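(* Let $n\ge 2$, let $\Omega\subset\mathbb{R}^n$ be an open set, let $0<K_1<+\infty$ and $0\le K_2<+\infty$, and let $f:\Omega\to\mathbb{R}^n$ be a $(K_1,K_2)$-quasiregular mapping. Assume that $$\int_\Omega |Df(x)|^n\,dx = M<+\infty .$$ Let $$\alpha=\begin{cases} 1/K_1, & \text{if } K_1>1,\\ \text{any (fixed) positive number less than } 1, & \text{if } K_1=1 \text{ and } K_2>0,\\ 1, & \text{if } K_1=1 \text{ and } K_2=0,\\ 1, & \text{if } K_1<1.\end{cases}$$ Then $f$ (identified with its continuous representative, i.e. after modification on a set of measure zero) satisfies a Hölder condition with exponent $\alpha$ on compact subsets of $\Omega$. Further, if $V$ is contained strictly inside $\Omega$, then for any $x,y\in V$ $$|f(x)-f(y)|\le L|x-y|^{\alpha},$$ where, for the fixed $\alpha$, the constant $L$ depends only on $V$, the constants $K_1$ and $K_2$, the dimension $n$, the distance from $V$ to the boundary of $\Omega$, and the constant $M$.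
   Context: For an $n\times n$ matrix $A$, $|A|=\sup_{|\xi|=1}|A\xi|$. $W^{1,n}(\Omega,\mathbb{R}^n)$ is the Sobolev space of mappings $f=(f^1,\dots,f^n):\Omega\to\mathbb{R}^n$ whose components and their first distributional derivatives belong to $L^n(\Omega)$. For such $f$, $Df(x)=(\partial f^i/\partial x_j)_{1\le i,j\le n}$ is the weak derivative matrix, defined for almost all $x\in\Omega$, and $\mathcal{J}(x,f)=\det Df(x)$ is the Jacobian. A function $u$ does not change sign in $\Omega$ if either $u\ge 0$ almost everywhere in $\Omega$ or $u\le 0$ almost everywhere in $\Omega$. A mapping $f:\Omega\to\mathbb{R}^n$ is $(K_1,K_2)$-quasiregular, with $0<K_1<+\infty$ and $0\le K_2<+\infty$, if (i) $f\in W^{1,n}(\Omega,\mathbb{R}^n)$; (ii) $\mathcal{J}(x,f)$ does not change sign in $\Omega$, and $|Df(x)|^n\le K_1|\mathcal{J}(x,f)|+K_2$ for almost all $x\in\Omega$. A mapping $f:\Omega\to\mathbb{R}^n$ satisfies a Hölder condition with exponent $\alpha$ ($0<\alpha\le 1$) on compact subsets of $\Omega$ if for every compact set $V\subset\Omega$ there is a number $M(V)$, $0\le M(V)<+\infty$, such that $|f(x_1)-f(x_2)|\le M(V)|x_1-x_2|^\alpha$ for all $x_1,x_2\in V$. A set $V$ is contained strictly inside $\Omega$ if its closure is a compact subset of $\Omega$.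
   Formalization: The uniform constant L is claimed only for x,y in one connected component of V or with |x-y| less than the distance from V to the boundary of Ω (for all x,y in V it fails: f may take different constants on two balls); other pairs in V get a finite constant that may depend on f and Ω. *)

(* Defs.v *)
From HB Require Import structures.
From mathcomp Require Import all_boot all_order all_algebra.
From mathcomp Require Import all_classical all_reals all_analysis.

Set Implicit Arguments.
Unset Strict Implicit.
Unset Printing Implicit Defensive.

Import Order.TTheory GRing.Theory Num.Theory.
Import numFieldNormedType.Exports.

Local Open Scope classical_set_scope.
Local Open Scope ring_scope.

(* Points of R^n are row vectors.  The library norm on 'rV[R]_n is the sup
   norm; it induces the usual topology, but all metric notions below use the
   Euclidean norm enorm. *)

Section lebesgue_outer_measure.
Context {R : realType} {n : nat}.
Local Open Scope ereal_scope.

(* [Some (a, b)] is the half-open box with corners a and b, empty unless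
   a < b coordinatewise.  [None] is an explicit empty box, without which the
   outer measure of set0 would not vanish when n = 0. *)
Let cell := option ('rV[R]_n * 'rV[R]_n).

Definition cell_set (c : cell) : set 'rV[R]_n :=
  if c is Some (a, b) then [set x | forall i, (a 0 i < x 0 i <= b 0 i)%R]
  else set0.

Definition cell_vol (c : cell) : \bar R :=
  if c is Some (a, b) then (\prod_i Num.max 0 (b 0 i - a 0 i))%R%:E else 0.

Definition cell_cover (A : set 'rV[R]_n) : set (nat -> cell) :=
  [set c | A `<=` \bigcup_k cell_set (c k)].

Definition leb (A : set 'rV[R]_n) : \bar R :=
  ereal_inf [set \sum_(k <oo) cell_vol (c k) | c in cell_cover A].

Let cell_vol_ge0 c : 0 <= cell_vol c.
Proof.
case: c => [[a b]|]//=; rewrite lee_fin; apply: prodr_ge0 => i _.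
by rewrite le_max lexx.
Qed.

Let leb_ge0 A : 0 <= leb A.
Proof.
by apply: le_ereal_inf_tmp => x [c _ <-{x}]; apply: nneseries_ge0.
Qed.

Let le_leb : {homo leb : A B / A `<=` B >-> A <= B}.
Proof.
move=> A B AB; apply/ereal_inf_le_tmp => x [c cB <-{x}].
by exists c => //; exact: subset_trans AB cB.
Qed.

Let leb0 : leb set0 = 0.
Proof.
apply/eqP; rewrite eq_le leb_ge0 andbT.
by apply: ereal_inf_lbound; exists (fun=> None) => //=; rewrite eseries0.
Qed.

Let leb_sigma_subadditive : sigma_subadditive leb.
Proof.
move=> A; have [[i ioo]|] := pselect (exists i, leb (A i) = +oo).
  rewrite (eseries_pinfty _ _ ioo) ?leey// => k _.
  by rewrite gt_eqF// (lt_le_trans _ (leb_ge0 _)).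
rewrite -forallNE => Aoo.
suff add2e (e : {posnum R}) :
    leb (\bigcup_k A k) <= \sum_(i <oo) leb (A i) + e%:num%:E.
  by apply/lee_addgt0Pr => _/posnumP[].
rewrite (le_trans _ (epsilon_trick _ _ _))//.
pose P k (c : nat -> cell) := cell_cover (A k) c /\
  \sum_(j <oo) cell_vol (c j) <= leb (A k) + (e%:num / (2 ^ k.+1)%:R)%:E.
have [G PG] : {G : nat -> nat -> cell & forall k, P k (G k)}.
  apply: (@choice _ _ P) => k; rewrite /P.
  have Sfin : leb (A k) \is a fin_num.
    by rewrite ge0_fin_numE// lt_neqAle leey andbT; apply/eqP.
  have en1 : (0 < e%:num / (2 ^ k.+1)%:R)%R by [].
  have [x [c cA <-] cx] := lb_ereal_inf_adherent en1 Sfin.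
  by exists c; split => //; exact/ltW.
have volG_ge0 x : 0 <= (cell_vol \o uncurry G) x by exact: cell_vol_ge0.
apply: (@le_trans _ _ (\esum_(i in setT) (cell_vol \o uncurry G) i)).
  apply: ereal_inf_lbound => /=.
  have /card_esym/ppcard_eqP[f] := card_nat2.
  exists (uncurry G \o f).
    move=> t [i _] /(PG i).1 [j _ Gijt].
    by exists (f^-1%FUN (i, j)) => //=; rewrite invK ?inE.
  rewrite -(esum_pred_image (cell_vol \o uncurry G) _ xpredT) ?[fun=> _]set_true//.
  by rewrite image_eq.
rewrite (_ : esum _ _ = \sum_(i <oo) \sum_(j <oo ) cell_vol (G i j)); last first.
  pose J : nat -> set (nat * nat) := fun i => [set (i, j) | j in setT].
  rewrite (_ : setT = \bigcup_k J k); last first.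
    by rewrite predeqE => -[a b]; split => // _; exists a => //; exists b.
  rewrite esum_bigcupT /=; last 2 first.
    - apply/trivIsetP => i j _ _ ij.
      rewrite predeqE => -[k m] /=; split => //= -[] [_] _ [<-{k} _].
      by move=> [m' _] [] /esym/eqP; rewrite (negbTE ij).
    - by move=> /= [k m]; exact: cell_vol_ge0.
  rewrite -(image_id [set: nat]) -fun_true esum_pred_image//; last first.
    by move=> k _; exact: esum_ge0.
  apply: eq_eseriesr => /= j _.
  rewrite -(esum_pred_image (cell_vol \o uncurry G) (pair j) predT)//=; last first.
    by move=> ? ? _ _; exact: (@can_inj _ _ _ snd).
  by congr esum; rewrite predeqE => -[a b]; split; move=> [i _ <-]; exists i.
apply: lee_lim.
- apply: is_cvg_nneseries => k *.
  by apply: nneseries_ge0 => m *; exact: (volG_ge0 (k, m)).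
- by apply: is_cvg_nneseries => k *; apply: adde_ge0.
- by near=> k; apply: lee_sum => i _; exact: (PG i).2.
Unshelve. all: by end_near. Qed.

HB.instance Definition _ :=
  isOuterMeasure.Build R _ leb leb0 leb_ge0 le_leb leb_sigma_subadditive.

End lebesgue_outer_measure.
Arguments leb {R} n A.

(* Lebesgue measure: the (complete) restriction of the outer measure leb to
   the Caratheodory (i.e. Lebesgue) measurable sets. *)
Notation Rmeas R n := (caratheodory_type (@leb R n)).
Definition lebm (R : realType) (n : nat) : set (Rmeas R n) -> \bar R := leb n.
Arguments lebm : clear implicits.

HB.instance Definition _ (R : realType) (n : nat) :=
  isMeasure.Build _ _ _ (lebm R n)
    (@caratheodory_measure0 _ _ (leb n))
    (@caratheodory_measure_ge0 _ _ (leb n))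
    (@caratheodory_measure_sigma_additive _ _ (leb n)).

Section euclidean.
Context {R : realType} {n : nat}.

Definition enorm (x : 'rV[R]_n) : R := Num.sqrt (\sum_i x 0 i ^+ 2).

(* |A| = sup_{|xi| = 1} |A xi|, with A acting on column vectors. *)
Definition opnorm (A : 'M[R]_n) : R :=
  sup [set enorm (A *m xi^T)^T | xi in [set xi : 'rV[R]_n | enorm xi = 1]].

(* The distance is +oo when one of the sets is empty (e.g. when E is the
   boundary of the whole space). *)
Definition dist_set (V E : set 'rV[R]_n) : \bar R :=
  ereal_inf [set z | exists x y, [/\ V x, E y & z = (enorm (x - y))%:E]].

Definition boundary (A : set 'rV[R]_n) := closure A `\` interior A.

Definition strictly_inside (V Omega : set 'rV[R]_n) :=
  compact (closure V) /\ closure V `<=` Omega.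

Definition holder_on (V : set 'rV[R]_n) (alpha : R)
    (f : 'rV[R]_n -> 'rV[R]_n) :=
  exists2 M : R, 0 <= M & forall x1 x2, V x1 -> V x2 ->
    enorm (f x1 - f x2) <= M * enorm (x1 - x2) `^ alpha.

Definition locally_holder (Omega : set 'rV[R]_n) (alpha : R)
    (f : 'rV[R]_n -> 'rV[R]_n) :=
  forall V, compact V -> V `<=` Omega -> holder_on V alpha f.

End euclidean.

Section sobolev.
Context {R : realType} {n : nat}.
Implicit Types (Omega : set 'rV[R]_n) (f : 'rV[R]_n -> 'rV[R]_n).

Definition ae_on Omega (P : 'rV[R]_n -> Prop) :=
  {ae lebm R n, forall x, Omega x -> P x}.

Definition partial (j : 'I_n) (phi : 'rV[R]_n -> R) : 'rV[R]_n -> R :=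
  'D_(delta_mx 0 j) phi.

Fixpoint Ck (k : nat) (phi : 'rV[R]_n -> R) : Prop :=
  continuous phi /\
  if k is k'.+1 then
    forall j, (forall x, derivable phi x (delta_mx 0 j)) /\ Ck k' (partial j phi)
  else True.

Definition test_function Omega (phi : 'rV[R]_n -> R) :=
  (forall k, Ck k phi) /\
  exists K, [/\ compact K, K `<=` Omega & forall x, ~ K x -> phi x = 0].

Definition loc_integrable Omega (u : 'rV[R]_n -> R) :=
  forall K, compact K -> K `<=` Omega ->
    (lebm R n).-integrable K (fun x : Rmeas R n => (u x)%:E).

Definition in_Lp (p : R) Omega (u : 'rV[R]_n -> R) :=
  measurable_fun (Omega : set (Rmeas R n)) (u : Rmeas R n -> R) /\
  (\int[lebm R n]_(x in Omega) (`|u x| `^ p)%:E < +oo)%E.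

Definition is_weak_partial Omega (j : 'I_n) (u v : 'rV[R]_n -> R) :=
  [/\ loc_integrable Omega u, loc_integrable Omega v &
      forall phi, test_function Omega phi ->
        (\int[lebm R n]_(x in Omega) (u x * partial j phi x)%:E =
         - \int[lebm R n]_(x in Omega) (v x * phi x)%:E)%E].

Definition is_weak_derivative Omega f (D : 'rV[R]_n -> 'M[R]_n) :=
  forall i j, is_weak_partial Omega j (fun x => f x 0 i) (fun x => D x i j).

(* W^{1,n}(Omega, R^n): the exponent is the dimension. *)
Definition W1n Omega f :=
  (forall i, in_Lp n%:R Omega (fun x => f x 0 i)) /\
  exists2 D, is_weak_derivative Omega f D &
    forall i j, in_Lp n%:R Omega (fun x => D x i j).

(* A weak derivative matrix is unique up to a null subset of Omega; weakD
   picks one. *)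
Definition weakD Omega f : 'rV[R]_n -> 'M[R]_n :=
  xget (fun=> 0) [set D | is_weak_derivative Omega f D].

Definition jac Omega f (x : 'rV[R]_n) : R := \det (weakD Omega f x).

Definition no_sign_change Omega (u : 'rV[R]_n -> R) :=
  ae_on Omega (fun x => 0 <= u x) \/ ae_on Omega (fun x => u x <= 0).

Definition quasiregular (K1 K2 : R) Omega f :=
  [/\ W1n Omega f, no_sign_change Omega (jac Omega f) &
      ae_on Omega (fun x =>
        opnorm (weakD Omega f x) ^+ n <= K1 * `|jac Omega f x| + K2)].

End sobolev.

Definition holder_exponent {R : realType} (K1 K2 alpha : R) :=
  [/\ 1 < K1 -> alpha = K1^-1,
      K1 = 1 -> 0 < K2 -> 0 < alpha < 1,
      K1 = 1 -> K2 = 0 -> alpha = 1 &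
      K1 < 1 -> alpha = 1].

(* Pairs of points of V for which |f x - f y| is controlled by V, delta (the
   distance from V to the boundary of Omega) and the integral of |Df|^n alone.
   This fails for other pairs: a locally constant f has Df = 0 and arbitrary
   values on the components of Omega, and a long thin corridor joining two
   pieces of V has the same effect when K2 > 0.  If V is connected, every pair
   of its points is linked. *)
Definition linked {R : realType} {n : nat} (V : set 'rV[R]_n) (delta : \bar R)
    (x y : 'rV[R]_n) :=
  connected_component V x y \/ ((enorm (x - y))%:E < delta)%E.

(* Main.v *)
Require Import Defs.
From HB Require Import structures.
From mathcomp Require Import all_boot all_order all_algebra.
From mathcomp Require Import fingroup perm.
From mathcomp Require Import all_classical all_reals all_analysis.
From mathcomp Require Import measurable_realfun zify ring lra.
Import Order.TTheory GRing.Theory Num.Theory.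
Import numFieldNormedType.Exports.
Set Implicit Arguments.
Unset Strict Implicit.
Unset Printing Implicit Defensive.
Local Open Scope classical_set_scope.
Local Open Scope ring_scope.

(** The proof follows the growth of the energy over balls.  For a map f of
    class W^{1,n} with Jacobian J of constant sign, write V(s) and P(s) for the
    integrals of |J| and |Df|^n over a ball of radius s.  The isoperimetric
    inequality for the image of the ball, in the form n V(s)^((n-1)/n) <=
    omega^(-1/n) int |Df|^(n-1) over the sphere, and Hoelder's inequality give
    n V(s) <= s P'(s).  The distortion inequality P <= K1 V + K2 omega s^n then
    makes P(s) + c s^n grow at least like s^(n alpha), so that P(r) decays like
    r^(n alpha) as r tends to 0.  (For K1 < 1 it bounds the energy density
    directly, since |J| <= |Df|^n.)  Energy decay at this rate implies a Hoelder
    condition with exponent alpha, as in Morrey's lemma.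

    Spheres are avoided: all estimates are made on shells s < |x - a| < t, and
    the differential inequality becomes a family of difference inequalities
    (ball_isoperimetric), which are multiplied over geometric sequences of radii
    (growth).

    The isoperimetric inequality for maps is proved by degree theory in analytic
    form.  For a smooth f and a cut-off phi, the push-forward of phi J is a
    function g on the target whose derivative only involves the derivative of
    phi, because the Jacobian is a null Lagrangian (null_lagrangian,
    push_derive).  The sharp Sobolev inequality (cheeger_inequality), applied to
    g, bounds the integral of phi J by the energy in the shell, with a constant
    given by the measure of the image; the area inequality (area_inequality)
    bounds this measure by V(t).  The Sobolev inequality comes from the
    Brunn-Minkowski inequality for finite unions of boxes
    (brunn_minkowski_boxes) and a discrete layer-cake formula.  Mollification
    extends the result to Sobolev maps (cutoff_isoperimetric).

    For the Hoelder condition, the energy decay bounds the derivative of the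
    mollification of f at scale r by a multiple of r^(alpha - 1)
    (moll_gradient).  Since mollifications commute, mollifications at scales r
    and r / 2 then differ by a multiple of r^alpha (mollim_estimates), and the
    continuous representative is the limit along dyadic scales (rep).  All
    constants depend on the data only through n, K1, K2, alpha, the radius of
    the ball and the total energy.  For distant points of V, connected_oscillation
    bounds the oscillation along a component of V or a segment by counting
    separated points, which gives the dependence of L on V and on its distance
    to the boundary (rep_quantitative). *)

(** * Lebesgue measure of boxes *)

Section cells.
Context {R : realType} {n : nat}.
Implicit Types (a b x y : 'rV[R]_n).
Local Notation cell := (option ('rV[R]_n * 'rV[R]_n)).

(** The sides of index below [j] count by their length, the others by their
    indicator function: this interpolates between the indicator function of a
    cell and its volume. *)
Definition mixed_vol (j : nat) x (c : cell) : R :=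
  if c is Some (a, b) then
    \prod_(i < n) (if (i < j)%N then Num.max 0 (b 0 i - a 0 i)
                   else (a 0 i < x 0 i <= b 0 i)%R%:R)
  else 0.

Lemma mixed_vol_ge0 j x c : 0 <= mixed_vol j x c.
Proof.
case: c => [[a b]|]//=; apply: prodr_ge0 => i _.
by case: ifP => _; rewrite ?le_max ?lexx// ler0n.
Qed.

Definition upd x (i : 'I_n) (t : R) : 'rV[R]_n :=
  \row_j (if j == i then t else x 0 j).

Lemma updE x i t j : upd x i t 0 j = if j == i then t else x 0 j.
Proof. by rewrite mxE. Qed.

Lemma upd_id x i t : upd x i t 0 i = t.
Proof. by rewrite updE eqxx. Qed.

Let mixed_rest (i : 'I_n) x (c : cell) : R :=
  if c is Some (a, b) then
    \prod_(k < n | k != i) (if (k < i)%N then Num.max 0 (b 0 k - a 0 k)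
                   else (a 0 k < x 0 k <= b 0 k)%R%:R)
  else 0.

Let mixed_itv (i : 'I_n) (c : cell) : set R :=
  if c is Some (a, b) then [set` `]a 0 i, b 0 i]] else set0.

Let mixed_rest_ge0 i x c : 0 <= mixed_rest i x c.
Proof.
case: c => [[a b]|]//=; apply: prodr_ge0 => k _.
by case: ifP => _; rewrite ?le_max ?lexx// ler0n.
Qed.

Let mixed_itv_m i c : measurable (mixed_itv i c : set (measurableTypeR R)).
Proof. by case: c => [[a b]|] /=; [exact: measurable_itv|exact: measurable0]. Qed.

Let mixed_volE (i : 'I_n) x t c :
  mixed_vol i (upd x i t) c = mixed_rest i x c * \1_(mixed_itv i c) t.
Proof.
case: c => [[a b]|] /=; last by rewrite mul0r.
rewrite (bigD1 i)//= ltnn upd_id mulrC; congr (_ * _).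
  by apply: eq_bigr => k /negbTE ki; rewrite updE ki.
rewrite indicE; congr (nat_of_bool _)%:R.
by apply/idP/idP; rewrite inE/= in_itv/=.
Qed.

Let mixed_volSE (i : 'I_n) x c :
  ((mixed_vol i.+1 x c)%:E =
   (mixed_rest i x c)%:E * lebesgue_measure (mixed_itv i c))%E.
Proof.
case: c => [[a b]|] /=; last by rewrite mul0e.
rewrite (bigD1 i)//= ltnSn mulrC EFinM; congr (_ * _)%E.
  congr EFin; apply: eq_bigr => k ki; rewrite ltnS leq_eqVlt.
  by rewrite -[(k == i :> nat)]/(k == i) (negbTE ki).
rewrite lebesgue_measure_itv/= lte_fin; case: ltP => h.
  by rewrite max_r// subr_ge0 ltW.
by rewrite max_l// subr_le0.
Qed.

Let mixed_vol_int (i : 'I_n) x c :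
  (\int[lebesgue_measure]_t (mixed_vol i (upd x i t) c)%:E =
   (mixed_vol i.+1 x c)%:E)%E.
Proof.
rewrite mixed_volSE; under eq_integral do rewrite mixed_volE EFinM.
rewrite ge0_integralZl_EFin//.
- by rewrite integral_indic// setIT.
- by apply/measurable_EFinP; exact: measurable_indic.
Qed.

Let mixed_vol_m (i : 'I_n) x c :
  measurable_fun setT (fun t : measurableTypeR R => (mixed_vol i (upd x i t) c)%:E).
Proof.
rewrite (_ : (fun t => _) =
  EFin \o (cst (mixed_rest i x c) \* \1_(mixed_itv i c))); last first.
  by apply/funext => t /=; rewrite mixed_volE.
apply/measurable_EFinP; apply: measurable_funM; first exact: measurable_cst.
exact: measurable_indic.
Qed.

(** Subadditivity of the volume of cells: integrating the inequality between
    indicator functions in one coordinate replaces, in each product, an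
    indicator by a side length. *)
Lemma mixed_vol_le (c0 : cell) (c : nat -> cell) (j : nat) : (j <= n)%N ->
  cell_set c0 `<=` \bigcup_k cell_set (c k) ->
  forall x, ((mixed_vol j x c0)%:E <= \sum_(k <oo) (mixed_vol j x (c k))%:E)%E.
Proof.
move=> jn c0c; elim: j jn => [_|j IH jn] x.
  have H c' : mixed_vol 0 x c' = \1_(cell_set c') x.
    case: c' => [[a b]|] /=; last by rewrite indic0.
    rewrite indicE; have [xab|xab] := boolP [forall i, a 0 i < x 0 i <= b 0 i].
      rewrite mem_set; last by move/forallP: xab => /=.
      by rewrite big1// => i _; rewrite (forallP xab).
    rewrite memNset; last by apply/forallP.
    move/forallPn : xab => [i /negbTE xi].
    by rewrite (bigD1 i)//= xi mul0r.
  rewrite H indicE; case: (boolP (x \in cell_set c0)); last first.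
    by move=> _; apply: nneseries_ge0 => k *; rewrite lee_fin mixed_vol_ge0.
  rewrite inE => /c0c[k _ xk].
  apply: (@le_trans _ _ (\sum_(i < k.+1) (mixed_vol 0 x (c i))%:E)%E).
    rewrite big_ord_recr/= H indicE mem_set//; apply: leeDr.
    by apply: sume_ge0 => i _; rewrite lee_fin mixed_vol_ge0.
  rewrite -(big_mkord xpredT (fun i => (mixed_vol 0 x (c i))%:E)).
  by apply: nneseries_lim_ge => i *; rewrite lee_fin mixed_vol_ge0.
have jn' := jn; pose i := Ordinal jn'.
rewrite -[j.+1]/(i.+1) -(mixed_vol_int i).
under eq_eseriesr do rewrite -(mixed_vol_int i).
rewrite -integral_nneseries//; last first.
  by move=> k t _; rewrite lee_fin mixed_vol_ge0.
apply: ge0_le_integral => //.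
- by move=> t _; rewrite lee_fin mixed_vol_ge0.
- apply: ge0_emeasurable_sum => k *; first by rewrite lee_fin mixed_vol_ge0.
  exact: mixed_vol_m.
- by move=> t _; exact: (IH (ltnW jn)).
Qed.

Lemma mixed_vol_last x (c : cell) : (mixed_vol n x c)%:E = cell_vol c.
Proof.
case: c => [[a b]|]//=; congr EFin.
by apply: eq_bigr => i _; rewrite ltn_ord.
Qed.

Lemma cell_vol_ge0 (c : cell) : (0 <= cell_vol c)%E.
Proof. by rewrite -(mixed_vol_last 0) lee_fin mixed_vol_ge0. Qed.

(** A cover of a cell by cells has at least its volume, by the last of the mixed
    inequalities; the cell covers itself. *)
Lemma leb_cell (c : cell) : leb n (cell_set c) = cell_vol c.
Proof.
apply/eqP; rewrite eq_le; apply/andP; split.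
  apply: ereal_inf_lbound; exists (fun k => if k == 0%N then c else None).
    by move=> x cx; exists 0%N.
  rewrite (nneseries_split 0 1)//=; last by move=> k _; exact: cell_vol_ge0.
  rewrite big_mkord big_ord_recl big_ord0 /= adde0.
  by rewrite eseries0 ?adde0// => -[].
apply: le_ereal_inf_tmp => _ [d cd <-].
rewrite -(mixed_vol_last 0); under eq_eseriesr do rewrite -(mixed_vol_last 0).
exact: mixed_vol_le.
Qed.
End cells.

(** * Measurable sets, translations and dyadic cubes *)

Lemma minmax_split (R : realType) (a b t : R) :
  Num.max 0 (Num.min b t - a) + Num.max 0 (b - Num.max a t) = Num.max 0 (b - a).
Proof.
by case: (leP b t) => ?; case: (leP a t) => ?; repeat case: leP => ?; lra.
Qed.

Section leb_outer.
Context {R : realType} {n : nat}.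
Implicit Types (a b x y u : 'rV[R]_n) (A E : set 'rV[R]_n).
Local Notation cell := (option ('rV[R]_n * 'rV[R]_n)).
Local Open Scope ereal_scope.

Lemma leb_ge0 A : 0 <= leb n A.
Proof. exact: outer_measure_ge0. Qed.

Lemma le_leb A E : A `<=` E -> leb n A <= leb n E.
Proof. exact: le_outer_measure. Qed.

Definition cellL (i : 'I_n) (t : R) (c : cell) : cell :=
  if c is Some (a, b) then Some (a, upd b i (Num.min (b 0 i) t)%R) else None.

Definition cellR (i : 'I_n) (t : R) (c : cell) : cell :=
  if c is Some (a, b) then Some (upd a i (Num.max (a 0 i) t)%R, b) else None.

Lemma cellL_set i t c :
  cell_set (cellL i t c) = cell_set c `&` [set x | (x 0 i <= t)%R].
Proof.
case: c => [[a b]|] /=; last by rewrite set0I.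
apply/seteqP; split=> [x H|x [/= H xt] k].
  split=> [k|] /=.
    have := H k; rewrite updE; case: eqP => // ->.
    by rewrite le_min => /and3P[-> ->].
  by have := H i; rewrite upd_id le_min => /and3P[].
rewrite updE; case: eqP => // ->.
by rewrite le_min xt andbT; exact: H.
Qed.

Lemma cellR_set i t c :
  cell_set (cellR i t c) = cell_set c `&` ~` [set x | (x 0 i <= t)%R].
Proof.
case: c => [[a b]|] /=; last by rewrite set0I.
apply/seteqP; split=> [x H|x [/= H /negP]].
  split=> [k|] /=.
    have := H k; rewrite updE; case: eqP => // ->.
    by rewrite gt_max => /andP[/andP[-> _] ->].
  apply/negP; rewrite -ltNge.
  by have := H i; rewrite upd_id gt_max => /andP[/andP[]].
rewrite -ltNge => xt k.
rewrite updE; case: eqP => // ->.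
by rewrite gt_max xt andbT; exact: H.
Qed.

Lemma cell_vol_split i t (c : cell) :
  cell_vol (cellL i t c) + cell_vol (cellR i t c) = cell_vol c.
Proof.
case: c => [[a b]|] /=; last by rewrite adde0.
rewrite -EFinD; congr EFin.
rewrite (bigD1 i)//= [X in (_ + X)%R](bigD1 i)//= [RHS](bigD1 i)//=.
rewrite !upd_id.
rewrite (eq_bigr (fun j => Num.max 0 (b 0 j - a 0 j))%R); last first.
  by move=> k /negbTE ki; rewrite updE ki.
rewrite [X in (_ + _ * X)%R](eq_bigr (fun j => Num.max 0 (b 0 j - a 0 j))%R); last first.
  by move=> k /negbTE ki; rewrite updE ki.
rewrite -mulrDl; congr (_ * _)%R.
exact: minmax_split.
Qed.

Lemma cover_le A (c : nat -> cell) : A `<=` \bigcup_k cell_set (c k) ->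
  leb n A <= \sum_(k <oo) cell_vol (c k).
Proof. by move=> h; apply: ereal_inf_lbound; exists c. Qed.

(** A coordinate hyperplane cuts each cell of a cover into two cells of the same
    total volume.  The measurability of all open sets rests on this fact. *)
Lemma halfspace_cara (i : 'I_n) (t : R) :
  (leb n).-caratheodory [set x : 'rV[R]_n | (x 0 i <= t)%R].
Proof.
apply: le_caratheodory_measurable => X.
apply: le_ereal_inf_tmp => _ [c cX <-].
have -> : \sum_(k <oo) cell_vol (c k) =
    \sum_(k <oo) cell_vol (cellL i t (c k)) + \sum_(k <oo) cell_vol (cellR i t (c k)).
  rewrite -nneseriesD => [|k _ _|k _ _]; rewrite ?cell_vol_ge0//.
  by apply: eq_eseriesr => k _; rewrite cell_vol_split.
apply: leeD; apply: cover_le => x [/cX[k _ ck] xt]; exists k => //.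
  by rewrite cellL_set; split.
by rewrite cellR_set; split.
Qed.

Lemma measurable_halfspace (i : 'I_n) (t : R) :
  measurable ([set x | (x 0 i <= t)%R] : set (Rmeas R n)).
Proof. exact: halfspace_cara. Qed.

(** A set map that does not enlarge cells by more than a factor [k] does not
    enlarge any outer measure by more than [k]. *)
Lemma leb_image_le (F : 'rV[R]_n -> 'rV[R]_n) (k : R) : (0 < k)%R ->
  (forall c : cell, leb n (F @` cell_set c) <= k%:E * cell_vol c) ->
  forall A, leb n (F @` A) <= k%:E * leb n A.
Proof.
move=> k0 H A; rewrite muleC -lee_pdivrMr// muleC.
apply: le_ereal_inf_tmp => _ [c cA <-].
rewrite muleC lee_pdivrMr// muleC -nneseriesZl => [|? _]; last exact: cell_vol_ge0.
apply: (@le_trans _ _ (\sum_(j <oo) leb n (F @` cell_set (c j)))).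
  apply: le_trans (outer_measure_sigma_subadditive (leb n) _).
  apply: le_leb => _ [x /cA [j _ xj] <-]; exists j => //.
by apply: lee_nneseries => *; [exact: leb_ge0|exact: H].
Qed.

Lemma leb_shift A (t : 'rV[R]_n) : leb n [set (x + t)%R | x in A] = leb n A.
Proof.
have H B u : leb n [set (x + u)%R | x in B] <= leb n B.
  rewrite -[leb n B]mul1e; apply: leb_image_le => // c.
  rewrite mul1e -leb_cell; case: c => [[a b]|] /=; last first.
    by rewrite image_set0.
  rewrite -/(cell_set (Some (a, b))) (_ : [set (x + u)%R | x in _] = cell_set (Some (a + u, b + u)%R)).
    rewrite !leb_cell /= lee_fin; apply: ler_prod => i _.
    rewrite !mxE le_max lexx/=.
    by rewrite (_ : b 0 i + u 0 i - (a 0 i + u 0 i) = b 0 i - a 0 i)%R//; ring.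
  apply/seteqP; split => [_ [x xab <-] i /=|x xab].
    by rewrite !mxE ltrD2r lerD2r.
  exists (x - u)%R; last by rewrite subrK.
  by move=> i; have := xab i; rewrite !mxE ltrBrDr lerBlDr.
apply/eqP; rewrite eq_le H/=.
rewrite (_ : leb n A = leb n [set (x - t)%R | x in [set (x + t)%R | x in A]]) ?H//.
congr (leb n _); rewrite image_comp; apply/seteqP; split => [x Ax|_ [x Ax <-]].
  by exists x => //=; rewrite addrK.
by rewrite /= addrK.
Qed.

End leb_outer.

Section measurability.
Context {R : realType} {n : nat}.
Implicit Types (a b x y u : 'rV[R]_n) (A E : set 'rV[R]_n).
Local Notation cell := (option ('rV[R]_n * 'rV[R]_n)).
Local Notation T := (Rmeas R n).

Lemma measurable_coord (i : 'I_n) : measurable_fun setT (fun x : T => x 0 i).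
Proof.
apply: (measurability _ (RGenOInfty.measurableE R)) => _ [_ [a ->] <-].
rewrite setTI (_ : _ @^-1` _ = ~` [set x : T | x 0 i <= a]).
  by apply: measurableC; exact: measurable_halfspace.
apply/seteqP; split => x /=; rewrite in_itv/= andbT ltNge.
  by move/negP.
by move=> ?; apply/negP.
Qed.

Lemma measurable_cell (c : cell) : measurable (cell_set c : set T).
Proof.
case: c => [[a b]|]; last exact: measurable0.
rewrite (_ : cell_set _ = \bigcap_(i in setT) ((fun x : T => x 0 i) @^-1` `]a 0 i, b 0 i])).
  apply: fin_bigcap_measurable => // i _.
  rewrite -[X in measurable X]setTI; apply: measurable_coord => //.
apply/seteqP; split => x /= xab i; first by move=> _; rewrite /= in_itv/=.
by have := xab i I; rewrite /= in_itv.
Qed.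

(** Half-open dyadic cubes of side 2^-k: each level tiles the space. *)
Definition dya (k : nat) (z : 'rV[int]_n) : cell :=
  Some (\row_i ((z 0 i)%:~R / 2 ^+ k), \row_i ((z 0 i + 1)%:~R / 2 ^+ k)).

Definition dya_of (k : nat) x : 'rV[int]_n := \row_i (Num.ceil (x 0 i * 2 ^+ k) - 1).

Lemma dyaP k z x : cell_set (dya k z) x <-> z = dya_of k x.
Proof.
have k0 : (0 : R) < 2 ^+ k by rewrite exprn_gt0.
split=> [/= H|-> i /=].
  apply/rowP => i; rewrite mxE; have := H i; rewrite !mxE.
  rewrite ltr_pdivrMr// ler_pdivlMr// => h.
  by rewrite (@ceil_def _ _ (z 0 i + 1)) ?addrK.
rewrite !mxE subrK ltr_pdivrMr// ler_pdivlMr//.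
exact: ceil_itv.
Qed.

Lemma rV_ballP x (e : R) y : ball x e y <-> 0 < e /\ forall i, `|x 0 i - y 0 i| < e.
Proof.
split=> [[e0 H]|[e0 H]]; split => //; first by move=> i; exact: (H 0 i).
by move=> i j; rewrite (ord1 i); exact: (H j).
Qed.

Lemma dya_close k x y : dya_of k x = dya_of k y -> forall i, `|x 0 i - y 0 i| < 2 ^- k.
Proof.
move=> xy i.
have k0 : (0 : R) < 2 ^+ k by rewrite exprn_gt0.
have /(_ i) := (dyaP k (dya_of k x) x).2 erefl.
have /(_ i) := (dyaP k (dya_of k x) y).2 xy.
move: (dya_of k x) => z; rewrite !mxE !intrD !mulrDl !mul1r ltr_norml => /andP[h1 h2] /andP[h3 h4].
apply/andP; split; lra.
Qed.

Lemma dya_ex (e : R) : 0 < e -> exists k0, forall k, (k0 <= k)%N -> 2 ^- k < e :> R.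
Proof.
move=> e0; have [k0 hk] : exists k, e^-1 < k%:R.
  by exists (Num.truncn e^-1).+1; exact: truncnS_gt.
exists k0 => k kk; rewrite -[e]invrK ltf_pV2 ?posrE ?invr_gt0 ?exprn_gt0//.
apply: (lt_le_trans hk); rewrite -natrX ler_nat (leq_trans kk)//.
exact/ltnW/ltn_expl.
Qed.

Lemma dya_sub_open U x : open U -> U x ->
  exists k0, forall k, (k0 <= k)%N -> cell_set (dya k (dya_of k x)) `<=` U.
Proof.
move=> oU Ux; have /nbhs_ballP[e /= e0 eU] : nbhs x U by exact: open_nbhs_nbhs.
have [k0 hk0] := dya_ex e0; exists k0 => k kk y /dyaP xy; apply: eU.
by apply/rV_ballP; split => // i; exact: lt_trans (dya_close xy _) (hk0 _ kk).
Qed.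

Lemma measurable_open U : open U -> measurable (U : set T).
Proof.
move=> oU.
pose F (p : nat * 'rV[int]_n) : set T :=
  if pselect (cell_set (dya p.1 p.2) `<=` U) then cell_set (dya p.1 p.2) else set0.
rewrite (_ : U = \bigcup_p F p).
  apply: countable_bigcupT_measurable; first exact: countableP.
  move=> p; rewrite /F; case: pselect => ?; [exact: measurable_cell|exact: measurable0].
apply/seteqP; split => [x Ux|x [p _]].
  have [k /(_ k (leqnn k)) hk] := dya_sub_open oU Ux.
  exists (k, dya_of k x) => //; rewrite /F; case: pselect => [h|//].
  by apply/dyaP.
by rewrite /F; case: pselect => [h /h|_ []].
Qed.

Lemma measurable_closed C : closed C -> measurable (C : set T).
Proof.
by move=> cC; rewrite -(setCK C); apply: measurableC; apply: measurable_open; exact: closed_openC.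
Qed.

Lemma measurable_compact C : compact C -> measurable (C : set T).
Proof. by move=> cC; apply: measurable_closed; apply: compact_closed => //; exact: norm_hausdorff. Qed.

Lemma continuous_meas (f : 'rV[R]_n -> R) : continuous f ->
  measurable_fun setT (f : T -> R).
Proof.
move=> /continuousP cf; apply: (measurability _ (RGenOpens.measurableE R)).
move=> _ [_ [a [b ->] <-]]; rewrite setTI; apply: measurable_open.
exact/cf/interval_open.
Qed.

Lemma leb_bounded_fin E (r : R) : (forall x, E x -> forall i, `|x 0 i| <= r) ->
  (leb n E < +oo)%E.
Proof.
move=> Er; apply: (@le_lt_trans _ _ (leb n (cell_set (Some (const_mx (- r - 1), const_mx r))))).
  apply: le_leb => x /Er xr i; have := xr i; rewrite !mxE ler_norml => /andP[h ->].
  by rewrite andbT; lra.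
by rewrite leb_cell /= ltry.
Qed.

Lemma sigma_finite_lebm : sigma_finite [set: T] (lebm R n).
Proof.
exists (fun k => cell_set (Some (const_mx (- k%:R), const_mx k%:R) : cell)); last first.
  by move=> k; split; [exact: measurable_cell|rewrite /lebm leb_cell ltry].
apply/esym/seteqP; split => // x _.
pose r : R := \sum_i `|x 0 i|.
exists (Num.truncn r).+1 => // i; rewrite !mxE.
have := truncnS_gt r; set m := (_.+1)%:R => rm.
have : `|x 0 i| <= r by rewrite /r (bigD1 i)//= lerDl sumr_ge0.
by rewrite ler_norml => /andP[? ?]; apply/andP; split; lra.
Qed.

HB.instance Definition _ := Measure_isSigmaFinite.Build _ _ _ (lebm R n) sigma_finite_lebm.

Lemma coord_norm x (i : 'I_n) : `|x 0 i| <= `|x|.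
Proof.
rewrite [leRHS]/Num.norm/= mx_normrE.
exact: (le_trans _ (le_bigmax _ _ (0, i))).
Qed.

Lemma norm_coord_le x (r : R) : 0 <= r -> (forall i, `|x 0 i| <= r) -> `|x| <= r.
Proof.
move=> r0 H; rewrite /Num.norm/= mx_normrE; apply: bigmax_le => //= -[i j] _ /=.
by rewrite (ord1 i).
Qed.

Lemma compact_fin (K : set 'rV[R]_n) : compact K -> (leb n K < +oo)%E.
Proof.
move=> /compact_bounded[M [Mr H]].
apply: (@leb_bounded_fin _ (M + 1)) => x Kx i.
apply: (le_trans (coord_norm _ _)).
by apply: H Kx; rewrite ltrDl.
Qed.

End measurability.

(** * Linear images *)

Section linear_images.
Context {R : realType}.

(** A polynomial error in [1/m] disappears in the limit. *)
Lemma poly_lim_le (p : {poly R}) (c : R) :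
  (forall m : nat, (0 < m)%N -> c <= p.[m%:R^-1]) -> c <= p.[0].
Proof.
move=> H; rewrite leNgt; apply/negP => p0c.
have := @continuous_horner R p 0 => /cvgrPdist_lt/(_ _ (_ : 0 < c - p.[0])).
rewrite subr_gt0 => /(_ p0c)/nbhs_ballP[e /= e0 he].
have [m me] : exists m : nat, e^-1 < m.+1%:R.
  by exists (Num.truncn e^-1); exact: truncnS_gt.
have m0 : (0 : R) < m.+1%:R^-1 by rewrite invr_gt0 ltr0n.
have /he : ball (0 : R) e (m.+1%:R^-1).
  rewrite /ball/= sub0r normrN gtr0_norm//.
  by rewrite -[e]invrK ltf_pV2 ?posrE ?invr_gt0 ?ltr0n.
have /= := H m.+1 isT; rewrite ltr_norml => h /andP[h1 _]; lra.
Qed.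

Lemma unit_step (N : nat) (t : R) : 0 < t <= N%:R ->
  exists2 k, (k < N)%N & k%:R < t <= k.+1%:R.
Proof.
elim: N => [|N IH] /andP[t0 tN]; first by have := lt_le_trans t0 tN; rewrite ltxx.
have [tN'|Nt] := leP t N%:R; last by exists N => //; rewrite Nt.
by have [|k kN kt] := IH; [rewrite t0|exists k => //; exact: ltnW].
Qed.

Context {n : nat}.
Implicit Types (a b x y u : 'rV[R]_n) (A E : set 'rV[R]_n).
Local Notation cell := (option ('rV[R]_n * 'rV[R]_n)).

Lemma leb_fin_cover (I : finType) (P : pred I) (F : I -> set 'rV[R]_n) E :
  (forall x, E x -> exists2 i, P i & F i x) ->
  (leb n E <= \sum_(i | P i) leb n (F i))%E.
Proof.
move=> EF.
have H (s : seq I) : (leb n [set x | exists2 i, i \in s & F i x] <=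
    \sum_(i <- s) leb n (F i))%E.
  elim: s => [|i s IH].
    rewrite big_nil (_ : [set x | _] = set0) ?outer_measure0//.
    by apply/seteqP; split => x // [].
  rewrite big_cons; apply: (@le_trans _ _ (leb n (F i `|` [set x | exists2 i, i \in s & F i x]))).
    apply: le_leb => x [j]; rewrite inE => /orP[/eqP ->|js Fj]; first by left.
    by right; exists j.
  by apply: (le_trans (outer_measureU2 _ _ _)); rewrite leeD2l.
rewrite -big_enum; apply: le_trans (H _); apply: le_leb => x /EF[i Pi Fi].
by exists i => //; rewrite mem_enum.
Qed.

(** Cutting side [i] of the cell into [m ^ rk i] pieces makes the
    off-diagonal part of a triangular matrix negligible: each piece is mapped
    into a cell whose sides are, up to a relative error of order [1/m], those
    of the image under the diagonal part. *)
Lemma leb_triangular_cell (M : 'M[R]_n) (rk : 'I_n -> nat) (c : cell) :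
  (forall i j, i != j -> M i j != 0 -> (rk j < rk i)%N) ->
  (leb n [set x *m M | x in cell_set c] <= (\prod_i `|M i i|)%:E * cell_vol c)%E.
Proof.
move=> Mrk; case: c => [[a b]|]; last first.
  by rewrite image_set0 outer_measure0 /= mule0.
have [/existsP[i0 abi]|/existsPn ab] := boolP [exists i, b 0 i <= a 0 i].
  rewrite (_ : [set _ | x in _] = set0).
    rewrite outer_measure0 mule_ge0 ?cell_vol_ge0// lee_fin.
    by apply: prodr_ge0.
  apply/seteqP; split => // y [x /(_ i0) /andP[h1 h2] _].
  by have := lt_le_trans h1 (le_trans h2 abi); rewrite ltxx.
pose l i := b 0 i - a 0 i.
have l0 i : 0 < l i by rewrite /l subr_gt0 ltNge ab.
pose D j := 1 + 2 * \sum_i (`|M i j| * l i / l j).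
have S0 j : 0 <= \sum_i (`|M i j| * l i / l j).
  by apply: sumr_ge0 => i _; rewrite !mulr_ge0// ?invr_ge0 ltW.
have key (m : nat) : (0 < m)%N ->
   (leb n [set x *m M | x in cell_set (Some (a, b))] <=
    (\prod_j (l j * (`|M j j| + D j * m%:R^-1)))%:E)%E.
  move=> m0; have m0' : (0 : R) < m%:R by rewrite ltr0n.
  pose N i := (m ^ rk i)%N.
  have N0 i : (0 < N i)%N by rewrite expn_gt0 m0.
  have N0' i : (0 : R) < (N i)%:R by rewrite ltr0n.
  pose K := (\max_i N i)%N.
  have NK i : (N i <= K)%N by exact: leq_bigmax.
  pose h i := l i / (N i)%:R.
  have h0 i : 0 < h i by rewrite divr_gt0.
  pose p (f : {ffun 'I_n -> 'I_K}) : 'rV[R]_n := \row_i (a 0 i + (f i)%:R * h i).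
  pose o j := \sum_(i | i != j) `|M i j| * h i.
  pose lo j := Num.min 0 (M j j * h j) - o j - h j / m%:R.
  pose hi j := Num.max 0 (M j j * h j) + o j.
  pose F (f : {ffun 'I_n -> 'I_K}) :=
    cell_set (Some (p f *m M + \row_j lo j, p f *m M + \row_j hi j)).
  have o_le j : 2 * o j + h j / m%:R <= h j * (D j * m%:R^-1).
    have : o j <= h j / m%:R * \sum_i (`|M i j| * l i / l j).
      rewrite mulr_sumr [leRHS](bigID (fun i => i == j))/= addrC.
      apply: ler_wpDr.
        by apply: sumr_ge0 => i _; rewrite !mulr_ge0// ?invr_ge0// ltW.
      apply: ler_sum => i ij; have [->|Mij] := eqVneq (M i j) 0.
        by rewrite normr0 !mul0r mulr0.
      rewrite [leRHS](_ : _ = `|M i j| * (l i / ((N j)%:R * m%:R))); last first.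
        by rewrite /h; field; rewrite !gt_eqF.
      apply: ler_wpM2l => //; rewrite /h; apply: ler_wpM2l; first exact: ltW.
      rewrite lef_pV2 ?posrE ?mulr_gt0//.
      by rewrite -natrM ler_nat /N -expnSr leq_pexp2l// Mrk.
    rewrite /D; set s := \sum_i _ => oj.
    rewrite [leRHS](_ : _ = h j / m%:R + 2 * (h j / m%:R * s)); last by ring.
    by lra.
  have o0 j : 0 <= o j by apply: sumr_ge0 => i _; rewrite mulr_ge0// ltW.
  have hm0 j : 0 < h j / m%:R by rewrite divr_gt0.
  have hilo j : hi j - lo j = `|M j j| * h j + (2 * o j + h j / m%:R).
    have -> : `|M j j| * h j = `|M j j * h j| by rewrite normrM [`|h j|]gtr0_norm.
    rewrite /hi /lo.
    have [M0|M0] := leP 0 (M j j * h j); first by rewrite ger0_norm//; ring.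
    by rewrite ltr0_norm//; ring.
  have hilo0 j : 0 <= hi j - lo j.
    by rewrite hilo !addr_ge0 ?mulr_ge0// ltW.
  have volF f : leb n (F f) = (\prod_j (hi j - lo j))%:E.
    rewrite leb_cell /=; congr EFin; apply: eq_bigr => j _.
    by rewrite !mxE opprD addrACA subrr add0r max_r.
  pose Q (i : 'I_n) := [pred k : 'I_K | (k < N i)%N].
  apply: (@le_trans _ _ (\sum_(f in family Q) leb n (F f))%E).
    apply: leb_fin_cover => _ [x xab <-].
    have Hx i : exists k : 'I_K, (k < N i)%N && (k%:R * h i < x 0 i - a 0 i <= k.+1%:R * h i).
      have [|k kN] := @unit_step (N i) ((x 0 i - a 0 i) / h i).
        have := xab i => /andP[h1 h2]; apply/andP; split.
          by rewrite divr_gt0// subr_gt0.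
        rewrite ler_pdivrMr// /h mulrCA divff ?mulr1 ?gt_eqF//.
        by rewrite /l lerB.
      rewrite ltr_pdivlMr// ler_pdivrMr// => kh.
      by exists (Ordinal (leq_trans kN (NK i))); rewrite /= kN.
    pose f : {ffun 'I_n -> 'I_K} := [ffun i => xchoose (Hx i)].
    have Hf i : (f i < N i)%N /\ ((f i)%:R * h i < x 0 i - a 0 i <= (f i).+1%:R * h i).
      by rewrite ffunE; have /andP[] := xchooseP (Hx i).
    exists f; first by apply/familyP => i; rewrite inE /=; case: (Hf i).
    move=> j; rewrite [(_ + \row__ lo _) 0 j]mxE [(_ + \row__ hi _) 0 j]mxE.
    rewrite [(\row__ lo _) 0 j]mxE [(\row__ hi _) 0 j]mxE.
    set d := x - p f.
    have dE i : 0 < d 0 i <= h i.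
      have [_ /andP[d1 d2]] := Hf i; rewrite /d !mxE; apply/andP; split; first lra.
      by move: d2; rewrite -natr1 mulrDl mul1r; lra.
    rewrite (_ : x = p f + d); last by rewrite addrC subrK.
    rewrite mulmxDl [(_ *m M + _ *m M) 0 j]mxE ltrD2l lerD2l.
    have -> : (d *m M) 0 j = d 0 j * M j j + \sum_(i | i != j) d 0 i * M i j.
      by rewrite mxE (bigD1 j).
    have : `|\sum_(i | i != j) d 0 i * M i j| <= o j.
      apply: (le_trans (ler_norm_sum _ _ _)); apply: ler_sum => i _.
      have /andP[d1 d2] := dE i.
      by rewrite normrM mulrC ler_wpM2l// gtr0_norm.
    rewrite ler_norml /lo /hi => /andP[s1 s2].
    have hm : 0 < h j / m%:R by rewrite divr_gt0.
    have /andP[d1 d2] := dE j.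
    have [M0|M0] := leP 0 (M j j).
      rewrite min_l ?max_r; [|by rewrite mulr_ge0// ltW..].
      have e1 : 0 <= d 0 j * M j j by rewrite mulr_ge0// ltW.
      have e2 : d 0 j * M j j <= M j j * h j by rewrite mulrC ler_wpM2l.
      by apply/andP; split; lra.
    rewrite min_r ?max_l; [|by rewrite nmulr_rle0 ?ltW..].
    have e1 : d 0 j * M j j <= 0 by rewrite mulrC nmulr_rle0 ?ltW.
    have e2 : M j j * h j <= d 0 j * M j j by rewrite mulrC ler_wnM2r// ltW.
    by apply/andP; split; lra.
  rewrite (eq_bigr (fun=> (\prod_j (hi j - lo j))%:E)); last by move=> f _; exact: volF.
  rewrite sumEFin lee_fin.
  rewrite -(bigA_distr_big_dep Q (fun j _ => hi j - lo j))/=.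
  apply: ler_prod => j _; rewrite sumr_ge0//=.
  rewrite -(big_ord_widen K (fun=> hi j - lo j))// sumr_const card_ord.
  rewrite -[_ *+ N j]mulr_natl (_ : l j = (N j)%:R * h j); last first.
    by rewrite /h mulrCA divff ?mulr1 ?gt_eqF.
  by rewrite -mulrA ler_pM2l// mulrDr hilo [h j * `|_|]mulrC lerD2l.
pose p : {poly R} := \prod_j ((l j)%:P * (`|M j j|%:P + (D j)%:P * 'X)).
have pE t : p.[t] = \prod_j (l j * (`|M j j| + D j * t)).
  rewrite /p horner_prod; apply: eq_bigr => j _.
  by rewrite !hornerE.
have fin : leb n [set x *m M | x in cell_set (Some (a, b))] \is a fin_num.
  rewrite ge0_fin_numE ?leb_ge0//.
  by apply: le_lt_trans (key 1%N isT) _; rewrite ltry.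
rewrite -(fineK fin) /= -EFinM lee_fin.
apply: (@le_trans _ _ p.[0]).
  apply: poly_lim_le => m m0; rewrite pE -lee_fin fineK//; exact: key.
rewrite pE -big_split /=; apply: ler_prod => j _.
have lj := ltW (l0 j); rewrite mulr0 addr0 (max_r lj) mulr_ge0//=.
by rewrite mulrC.
Qed.

Lemma leb_triangular (M : 'M[R]_n) (rk : 'I_n -> nat) (k : R) :
  (forall i j, i != j -> M i j != 0 -> (rk j < rk i)%N) ->
  0 < k -> \prod_i `|M i i| <= k ->
  forall E, (leb n [set x *m M | x in E] <= k%:E * leb n E)%E.
Proof.
move=> Mrk k0 Mk; apply: leb_image_le => // c.
apply: (le_trans (leb_triangular_cell c Mrk)).
by rewrite lee_wpmul2r ?cell_vol_ge0// lee_fin.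
Qed.

Lemma leb_perm (s : 'S_n) E : (leb n [set x *m perm_mx s | x in E] <= leb n E)%E.
Proof.
rewrite -[leb n E]mul1e; apply: leb_image_le => // c; rewrite mul1e.
case: c => [[a b]|]; last by rewrite image_set0 outer_measure0.
apply: (@le_trans _ _ (leb n (cell_set (Some (a *m perm_mx s, b *m perm_mx s))))).
  apply: le_leb => _ [x xab <-] i.
  have H y : (y *m perm_mx s) 0 i = y 0 (s^-1%g i).
    by rewrite -[s]invgK -col_permE mxE invgK.
  by rewrite !H.
rewrite leb_cell /= lee_fin [leRHS](reindex_inj (@perm_inj _ s^-1%g))/=.
apply: ler_prod => i _; have H y : (y *m perm_mx s) 0 i = y 0 (s^-1%g i).
  by rewrite -[s]invgK -col_permE mxE invgK.
by rewrite !H lexx le_max lexx.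
Qed.

End linear_images.

(** Gaussian elimination writes a matrix as a product of a permutation and two
    triangular matrices, which reduces the general case to the triangular one. *)
Lemma leb_linear_le (R : realType) (n : nat) (A : 'M[R]_n) (k : R) :
  0 < k -> `|\det A| <= k ->
  forall E, (leb n [set x *m A | x in E] <= k%:E * leb n E)%E.
Proof.
case: n A => [|n] A k0 Ak E.
  rewrite det_mx00 normr1 in Ak.
  apply: (@le_trans _ _ (leb 0 E)).
    by apply: le_leb => _ [x Ex <-]; rewrite thinmx0 -[0](thinmx0 x).
  by rewrite -[leLHS]mul1e lee_wpmul2r ?leb_ge0// lee_fin.
have := cormen_lup_correct A; have := @cormen_lup_lower _ _ A.
have := @cormen_lup_upper _ _ A; have := cormen_lup_perm A.
have := cormen_lup_detL A.
case: (cormen_lup A) => [[P L] U] /= detL /is_perm_mxP[s ->] Uup Llow PA.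
have AE : A = perm_mx s^-1%g *m L *m U.
  rewrite -mulmxA -[L *m U]/(L * U) -PA -[perm_mx s * A]/(perm_mx s *m A) mulmxA -perm_mxM.
  by rewrite mulVg perm_mx1 mul1mx.
have detA : `|\det A| = \prod_i `|U i i|.
  rewrite AE !det_mulmx detL mulr1 normrM det_perm normrX normrN1 expr1n mul1r.
  rewrite -det_tr det_trig ?normr_prod.
    by apply: eq_bigr => i _; rewrite mxE.
  by apply/is_trig_mxP => i j ij; rewrite mxE Uup.
rewrite (_ : [set _ | x in E] = [set x *m U | x in [set x *m L | x in
    [set x *m perm_mx s^-1%g | x in E]]]); last first.
  rewrite !image_comp; apply: eq_imagel => x _ /=.
  by rewrite AE !mulmxA.
apply: le_trans (@leb_triangular _ _ U (fun i => n - i)%N k _ k0 _ _) _.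
- move=> i j ij Uij; have {}ij : (i < j)%N.
    rewrite ltnNge; apply: contra Uij; rewrite leq_eqVlt => /orP[/eqP/val_inj ji|/Uup ->//].
    by rewrite ji eqxx in ij.
  by rewrite ltn_sub2l// (leq_trans ij)// -ltnS.
- by rewrite -detA.
apply: lee_wpmul2l; first by rewrite lee_fin ltW.
apply: le_trans (@leb_triangular _ _ L (fun i => i) 1 _ _ _ _) _ => //.
- move=> i j ij Lij; rewrite ltnNge; apply: contra Lij => /Llow ->.
  by rewrite (negbTE ij).
- by rewrite big1// => i _; rewrite Llow// eqxx normr1.
by rewrite mul1e; exact: leb_perm.
Qed.

Section invertible_images.
Context {R : realType} {n : nat}.
Implicit Types (E : set 'rV[R]_n).

Lemma leb_linear (A : 'M[R]_n) E : A \in unitmx ->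
  (leb n [set x *m A | x in E] = `|\det A|%:E * leb n E)%E.
Proof.
move=> uA; have d0 : 0 < `|\det A|.
  by rewrite normr_gt0 -unitfE -unitmxE.
apply/eqP; rewrite eq_le leb_linear_le//=.
have := @leb_linear_le _ _ (invmx A) `|\det A|^-1 _ _ [set x *m A | x in E].
rewrite det_inv normfV invr_gt0 d0 => /(_ isT (lexx _)).
rewrite (_ : [set x *m invmx A | x in _] = E).
  by rewrite lee_pdivlMl.
rewrite image_comp; apply/seteqP; split => [_ [x Ex <-]|x Ex].
  by rewrite /= mulmxK.
by exists x => //=; rewrite mulmxK.
Qed.

Lemma leb_scale (c : R) E : c != 0 ->
  (leb n [set c *: x | x in E] = (`|c| ^+ n)%:E * leb n E)%E.
Proof.
move=> c0; rewrite -normrX -det_scalar -leb_linear; last first.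
  by rewrite unitmxE det_scalar unitrX// unitfE.
by congr (leb n _); apply: eq_imagel => x _; rewrite mul_mx_scalar.
Qed.

End invertible_images.

(** * Euclidean norm and balls *)

Section utilities.
Context {R : realType}.

Lemma nth_rootP (n : nat) (x : R) : (0 < n)%N -> 0 <= x ->
  exists2 y, 0 <= y & y ^+ n = x.
Proof.
move=> n0 x0; exists (x `^ n%:R^-1); first exact: powR_ge0.
by rewrite -powR_mulrn ?powR_ge0// -powRrM mulVf ?pnatr_eq0 -?lt0n// powRr1.
Qed.

Lemma lip_continuous (V W : normedModType R) (f : V -> W) (C : R) :
  (forall x y, `|f x - f y| <= C * `|x - y|) -> continuous f.
Proof.
move=> fC x; apply/cvgrPdist_lt => e e0.
have C1 : 0 < `|C| + 1 by rewrite ltr_pwDr.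
apply/nbhs_ballP; exists (e / (`|C| + 1)); first by rewrite /= divr_gt0.
move=> y; rewrite -ball_normE /= => xy.
apply: (le_lt_trans (fC x y)); apply: (@le_lt_trans _ _ ((`|C| + 1) * `|x - y|)).
  by rewrite ler_wpM2r//; apply: (le_trans (ler_norm C)); rewrite lerDl.
by rewrite mulrC -ltr_pdivlMr.
Qed.

Lemma AGM_ord (n : nat) (F : 'I_n -> R) : (forall i, 0 <= F i) ->
  \prod_i F i <= ((\sum_i F i) / n%:R) ^+ n.
Proof.
move=> F0; have := @leif_AGM R _ 'I_n F (fun i _ => F0 i).
by rewrite card_ord => -[].
Qed.

Lemma bernoulli_pow (n : nat) (x : R) : 0 <= 1 + x -> 1 + n%:R * x <= (1 + x) ^+ n.
Proof.
move=> x1; elim: n => [|n IH]; first by rewrite mul0r addr0 expr0.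
rewrite exprS; apply: le_trans (ler_wpM2l x1 IH); rewrite -natr1.
have : 0 <= n%:R * x ^+ 2 by rewrite mulr_ge0// sqr_ge0.
lra.
Qed.

Lemma tangent_pow (n : nat) (a t : R) : 0 <= a -> 0 <= t ->
  a ^+ n.+1 + n.+1%:R * a ^+ n * (t - a) <= t ^+ n.+1.
Proof.
rewrite le_eqVlt => /orP[/eqP <- t0|a0 t0].
  rewrite subr0 exprS mul0r add0r; case: n => [|n].
    by rewrite !expr1 expr0 !mul1r.
  by rewrite exprS !(mul0r, mulr0) exprn_ge0.
have := @bernoulli_pow n.+1 (t / a - 1) _; rewrite subrKC divr_ge0//; last exact: ltW.
move=> /(_ isT) H; have := ler_wpM2r (ltW (exprn_gt0 n.+1 a0)) H.
rewrite exprMn exprVn divfK ?expf_neq0 ?gt_eqF//; apply: le_trans.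
rewrite le_eqVlt; apply/orP; left; apply/eqP.
rewrite exprS; field; exact: lt0r_neq0.
Qed.

End utilities.

Section euclidean_norm.
Context {R : realType} {n : nat}.
Implicit Types (x y z : 'rV[R]_n).

Definition dot x y : R := \sum_i x 0 i * y 0 i.

Lemma dotC x y : dot x y = dot y x.
Proof. by apply: eq_bigr => i _; rewrite mulrC. Qed.

Lemma dotDl x y z : dot (x + y) z = dot x z + dot y z.
Proof. by rewrite -big_split; apply: eq_bigr => i _; rewrite !mxE mulrDl. Qed.

Lemma dotZl c x y : dot (c *: x) y = c * dot x y.
Proof. by rewrite mulr_sumr; apply: eq_bigr => i _; rewrite !mxE mulrA. Qed.

Lemma dotNl x y : dot (- x) y = - dot x y.
Proof. by rewrite -scaleN1r dotZl mulN1r. Qed.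

Lemma dotBl x y z : dot (x - y) z = dot x z - dot y z.
Proof. by rewrite dotDl dotNl. Qed.

Lemma dotDr x y z : dot x (y + z) = dot x y + dot x z.
Proof. by rewrite !(dotC x) dotDl. Qed.

Lemma dotZr c x y : dot x (c *: y) = c * dot x y.
Proof. by rewrite !(dotC x) dotZl. Qed.

Lemma dotBr x y z : dot x (y - z) = dot x y - dot x z.
Proof. by rewrite !(dotC x) dotBl. Qed.

Lemma dotE x y : dot x y = (x *m y^T) 0 0.
Proof. by rewrite mxE; apply: eq_bigr => i _; rewrite !mxE. Qed.

Lemma dotxx_ge0 x : 0 <= dot x x.
Proof. by apply: sumr_ge0 => i _; rewrite -expr2 sqr_ge0. Qed.

Lemma enormE x : enorm x = Num.sqrt (dot x x).
Proof. by congr Num.sqrt; apply: eq_bigr => i _; rewrite expr2. Qed.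

Lemma enorm_sqr x : enorm x ^+ 2 = dot x x.
Proof. by rewrite enormE sqr_sqrtr// dotxx_ge0. Qed.

Lemma enorm_ge0 x : 0 <= enorm x.
Proof. exact: sqrtr_ge0. Qed.

Lemma coord_enorm x i : `|x 0 i| <= enorm x.
Proof.
rewrite -(@ler_pXn2r _ 2) ?nnegrE ?enorm_ge0// enorm_sqr real_normK ?num_real//.
rewrite /dot (bigD1 i)//= -expr2 lerDl sumr_ge0// => j _.
by rewrite -expr2 sqr_ge0.
Qed.

Lemma norm_le_enorm x : `|x| <= enorm x.
Proof. by apply: norm_coord_le; [exact: enorm_ge0|move=> i; exact: coord_enorm]. Qed.

Lemma enorm_le_norm x : enorm x <= n%:R * `|x|.
Proof.
rewrite -(@ler_pXn2r _ 2) ?nnegrE ?enorm_ge0 ?mulr_ge0// enorm_sqr.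
apply: (@le_trans _ _ (\sum_(i < n) `|x| ^+ 2)).
  apply: ler_sum => i _; rewrite -expr2 -[x 0 i ^+ 2]real_normK ?num_real//.
  by rewrite ler_pXn2r ?nnegrE// coord_norm.
rewrite sumr_const card_ord -(mulr_natl (`|x| ^+ 2)) exprMn ler_wpM2r ?sqr_ge0//.
by rewrite -natrX ler_nat; case: (n) => // m; rewrite -mulnn leq_pmulr.
Qed.

Lemma enorm0 : enorm (0 : 'rV[R]_n) = 0.
Proof. by rewrite enormE /dot big1 ?sqrtr0// => i _; rewrite mxE mul0r. Qed.

Lemma enorm_eq0 x : (enorm x == 0) = (x == 0).
Proof.
apply/eqP/eqP => [x0|->]; last exact: enorm0.
by apply/eqP; rewrite -normr_le0 -x0 norm_le_enorm.
Qed.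

Lemma enormZ c x : enorm (c *: x) = `|c| * enorm x.
Proof.
by rewrite !enormE dotZl dotZr mulrA -expr2 sqrtrM ?sqr_ge0// sqrtr_sqr.
Qed.

Lemma enormN x : enorm (- x) = enorm x.
Proof. by rewrite -scaleN1r enormZ normrN1 mul1r. Qed.

Lemma enormBC x y : enorm (x - y) = enorm (y - x).
Proof. by rewrite -enormN opprB. Qed.

Lemma cauchy_schwarz x y : dot x y <= enorm x * enorm y.
Proof.
have [->|y0] := eqVneq y 0.
  by rewrite enorm0 mulr0 /dot big1// => i _; rewrite mxE mulr0.
have ey : 0 < enorm y by rewrite lt_neqAle enorm_ge0 eq_sym enorm_eq0 y0.
have ey2 : 0 < dot y y by rewrite -enorm_sqr exprn_gt0.
have [xy|xy] := leP (dot x y) 0.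
  by apply: (le_trans xy); rewrite mulr_ge0 ?enorm_ge0.
rewrite -(@ler_pXn2r _ 2) ?nnegrE ?mulr_ge0 ?enorm_ge0//; last exact: ltW.
rewrite exprMn !enorm_sqr -ler_pdivrMr//.
have := dotxx_ge0 (x - (dot x y / dot y y) *: y).
rewrite dotBl !dotBr !dotZl !dotZr (dotC y x) => h.
rewrite -subr_ge0 [leRHS](_ : _ = dot x x - dot x y / dot y y * dot x y - (dot x y / dot y y * dot x y - dot x y / dot y y * (dot x y / dot y y * dot y y)))//.
by rewrite divfK ?gt_eqF//; ring.
Qed.

Lemma enormD x y : enorm (x + y) <= enorm x + enorm y.
Proof.
rewrite -(@ler_pXn2r _ 2) ?nnegrE ?addr_ge0 ?enorm_ge0//.
rewrite enorm_sqr dotDl !dotDr sqrrD !enorm_sqr (dotC y x).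
have := cauchy_schwarz x y; lra.
Qed.

Lemma enormB_le x y z : enorm (x - z) <= enorm (x - y) + enorm (y - z).
Proof. by apply: le_trans (enormD _ _); rewrite addrA subrK. Qed.

Lemma enorm_lip x y : `|enorm x - enorm y| <= n%:R * `|x - y|.
Proof.
apply: le_trans (enorm_le_norm _); rewrite ler_norml.
have h1 : enorm x <= enorm (x - y) + enorm y by apply: le_trans (enormD _ _); rewrite subrK.
have h2 : enorm y <= enorm (x - y) + enorm x.
  by rewrite enormBC; apply: le_trans (enormD _ _); rewrite subrK.
by apply/andP; split; lra.
Qed.

Lemma enorm_continuous : continuous (@enorm R n).
Proof. exact: lip_continuous enorm_lip. Qed.

Definition eball x (r : R) : set 'rV[R]_n := [set y | enorm (y - x) < r].

Lemma eball_open x r : open (eball x r).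
Proof.
rewrite (_ : eball x r = (fun y => enorm (y - x)) @^-1` [set t | t < r]); last by [].
apply: open_comp; last exact: open_lt.
move=> y _; apply: (@lip_continuous _ _ _ _ n%:R) => u v.
by apply: le_trans (enorm_lip _ _) _; rewrite opprB addrA subrK.
Qed.

Lemma eball_sub_bounded r y : eball 0 r y -> forall i, `|y 0 i| <= r.
Proof.
rewrite /eball/= subr0 => yr i; apply: le_trans (coord_enorm _ _) _; exact: ltW.
Qed.

Lemma eball_shift x r : eball x r = [set y + x | y in eball 0 r].
Proof.
apply/seteqP; split => [y yx|_ [y yx <-]]; last first.
  by move: yx; rewrite /eball/= addrK subr0.
by exists (y - x); rewrite ?subrK// /eball/= subr0.
Qed.

Definition omega : R := fine (leb n (eball 0 1)).

Lemma leb_eball01 : leb n (eball 0 1) = omega%:E.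
Proof.
rewrite /omega fineK// ge0_fin_numE ?leb_ge0//.
apply: (@leb_bounded_fin _ _ _ 1); exact: eball_sub_bounded.
Qed.

Lemma omega_gt0 : 0 < omega.
Proof.
rewrite -lte_fin -leb_eball01.
pose r : R := (n%:R + 1)^-1.
have r0 : 0 < r by rewrite invr_gt0 ltr_pwDr.
apply: (@lt_le_trans _ _ (leb n (cell_set (Some (0 : 'rV[R]_n, const_mx (r / 2)))))).
  rewrite leb_cell /= lte_fin prodr_gt0// => i _.
  by rewrite !mxE subr0 lt_max divr_gt0// orbT.
apply: le_leb => x xr; rewrite /eball/= subr0.
apply: le_lt_trans (enorm_le_norm _) _.
apply: (@le_lt_trans _ _ (n%:R * r)); last first.
  by rewrite /r ltr_pdivrMr ?mul1r ?ltrDl// ltr_pwDr.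
rewrite ler_wpM2l// norm_coord_le ?ltW// => i.
have := xr i; rewrite !mxE => /andP[h1 h2]; rewrite ger0_norm ?ltW//; lra.
Qed.

Lemma leb_eball x (r : R) : 0 <= r -> (0 < n)%N -> leb n (eball x r) = (omega * r ^+ n)%:E.
Proof.
rewrite le_eqVlt => /orP[/eqP <- n0|r0 _].
  rewrite (_ : eball x 0 = set0) ?outer_measure0 ?expr0n ?gtn_eqF ?mulr0//.
  by apply/seteqP; split => // y; rewrite /eball/= ltNge enorm_ge0.
rewrite eball_shift leb_shift (_ : eball 0 r = [set r *: y | y in eball 0 1]).
  rewrite leb_scale; last exact: lt0r_neq0.
  by rewrite gtr0_norm// leb_eball01 -EFinM mulrC.
apply/seteqP; split => [y|_ [y yx <-]]; last first.
  by move: yx; rewrite /eball/= !subr0 enormZ gtr0_norm// => y1; rewrite -[ltRHS]mulr1 ltr_pM2l.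
rewrite /eball/= subr0 => yr; exists (r^-1 *: y).
  by rewrite /= subr0 enormZ gtr0_norm ?invr_gt0// mulrC ltr_pdivrMr ?mul1r.
by rewrite scalerA divff ?scale1r// lt0r_neq0.
Qed.

End euclidean_norm.
Arguments omega : clear implicits.

(** * Brunn-Minkowski inequality for unions of boxes *)

Lemma clip_lip (R : realType) (a b c d : R) :
  `|Num.max 0 (Num.min b c - a) - Num.max 0 (Num.min b d - a)| <= `|c - d|.
Proof.
have Hmax (x y : R) : `|Num.max 0 x - Num.max 0 y| <= `|x - y|.
  have h1 := ler_norm (x - y); have h2 : y - x <= `|x - y| by rewrite distrC ler_norm.
  by case: (leP 0 x) => ?; case: (leP 0 y) => ?; rewrite ler_norml; apply/andP; split; lra.
have Hmin : `|Num.min b c - Num.min b d| <= `|c - d|.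
  have h1 := ler_norm (c - d); have h2 : d - c <= `|c - d| by rewrite distrC ler_norm.
  by case: (leP b c) => ?; case: (leP b d) => ?; rewrite ler_norml; apply/andP; split; lra.
apply: (le_trans (Hmax _ _)); apply: le_trans Hmin.
by rewrite opprB addrA subrK.
Qed.

Section brunn_minkowski.
Context {R : realType} {n : nat}.
Implicit Types (x y z : 'rV[R]_n) (A B E : set 'rV[R]_n) (rho : R).
Let box := ('rV[R]_n * 'rV[R]_n)%type.
Implicit Types (p q : box) (s t : seq box).

Definition msum A B : set 'rV[R]_n := [set z | exists x y, [/\ A x, B y & z = x + y]].

Lemma msumC A B : msum A B = msum B A.
Proof.
by apply/seteqP; split => z [x [y [? ? ->]]]; exists y, x; rewrite addrC.
Qed.

Lemma msumSS A B C D : A `<=` B -> C `<=` D -> msum A C `<=` msum B D.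
Proof. by move=> AB CD z [x [y [/AB ? /CD ? ->]]]; exists x, y. Qed.

Definition bset p : set 'rV[R]_n := cell_set (Some p).
Definition bvol p : R := \prod_i Num.max 0 (p.2 0 i - p.1 0 i).
Definition bfull p : bool := [forall i, p.1 0 i < p.2 0 i].
Definition bsep p q : bool := [exists i, (p.2 0 i <= q.1 0 i) || (q.2 0 i <= p.1 0 i)].
Definition bcup s : set 'rV[R]_n := [set x | exists2 p, p \in s & bset p x].
Definition bsum s : R := \sum_(p <- s) bvol p.

Let bvolE p : cell_vol (Some p) = (bvol p)%:E.
Proof. by case: p. Qed.

Let bvol_ge0 p : 0 <= bvol p.
Proof. by apply: prodr_ge0 => i _; rewrite le_max lexx. Qed.

Let bvol_gt0 p : bfull p -> 0 < bvol p.
Proof.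
by move=> /forallP H; apply: prodr_gt0 => i _; rewrite lt_max subr_gt0 H orbT.
Qed.

Let bvol0 p : ~~ bfull p -> bvol p = 0.
Proof.
move=> /forallPn[i]; rewrite -leNgt => h.
by rewrite /bvol (bigD1 i)//= max_l ?mul0r// subr_le0.
Qed.

Let bsum_ge0 s : 0 <= bsum s.
Proof. exact: sumr_ge0. Qed.

Let bsum_full s : bsum [seq p <- s | bfull p] = bsum s.
Proof.
rewrite /bsum big_filter [RHS](bigID bfull)/= [X in _ = _ + X]big1 ?addr0.
  by [].
by move=> p /bvol0.
Qed.

Let bsum_gt0 s : all bfull s -> s != [::] -> 0 < bsum s.
Proof.
case: s => // p s /= /andP[fp _] _; rewrite /bsum big_cons.
by rewrite ltr_wpDr ?bvol_gt0//; exact: sumr_ge0.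
Qed.

Let cutl i c p : box := (p.1, upd p.2 i (Num.min (p.2 0 i) c)).
Let cutr i c p : box := (upd p.1 i (Num.max (p.1 0 i) c), p.2).
Let cutL i c s := [seq p <- map (cutl i c) s | bfull p].
Let cutR i c s := [seq p <- map (cutr i c) s | bfull p].

Let bvol_cut i c p : bvol (cutl i c p) + bvol (cutr i c p) = bvol p.
Proof.
by case: p => a b; apply: EFin_inj; rewrite EFinD; exact: (cell_vol_split i c (Some (a, b))).
Qed.

Let bsum_cut i c s : bsum (cutL i c s) + bsum (cutR i c s) = bsum s.
Proof.
rewrite !bsum_full /bsum !big_map -big_split /=.
by apply: eq_bigr => p _; exact: bvol_cut.
Qed.

Let bcup_cutL i c s : bcup (cutL i c s) `<=` bcup s `&` [set x | x 0 i <= c].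
Proof.
move=> x [p]; rewrite mem_filter => /andP[_ /mapP[[a b] qs ->]].
rewrite /bset -[Some _]/(cellL i c (Some (a, b))) cellL_set => -[h1 h2].
by split => //; exists (a, b).
Qed.

Let bcup_cutR i c s : bcup (cutR i c s) `<=` bcup s `&` ~` [set x | x 0 i <= c].
Proof.
move=> x [p]; rewrite mem_filter => /andP[_ /mapP[[a b] qs ->]].
rewrite /bset -[Some _]/(cellR i c (Some (a, b))) cellR_set => -[h1 h2].
by split => //; exists (a, b).
Qed.

Let sep_cutL i c s : pairwise bsep s -> pairwise bsep (cutL i c s).
Proof.
move=> ss; apply: pairwise_filter; rewrite pairwise_map.
apply: sub_pairwise ss => -[a b] [a' b'] /existsP[j /= h]; apply/existsP; exists j => /=.
rewrite !updE; case: eqP h => // -> /orP[h|h]; apply/orP; [left|right];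
  by rewrite ge_min h.
Qed.

Let sep_cutR i c s : pairwise bsep s -> pairwise bsep (cutR i c s).
Proof.
move=> ss; apply: pairwise_filter; rewrite pairwise_map.
apply: sub_pairwise ss => -[a b] [a' b'] /existsP[j /= h]; apply/existsP; exists j => /=.
rewrite !updE; case: eqP h => // -> /orP[h|h]; apply/orP; [left|right];
  by rewrite le_max h.
Qed.

Let size_filter_lt s p : p \in s -> ~~ bfull p -> (size [seq q <- s | bfull q] < size s)%N.
Proof.
move=> ps np; rewrite size_filter ltn_neqAle count_size andbT -all_count.
by apply/negP => /allP/(_ _ ps); rewrite (negbTE np).
Qed.

(** The case of two boxes is the arithmetic-geometric mean inequality applied
    to the proportions of the sides of each box in the sides of the sum. *)
Let bm_boxes p q rho : (0 < n)%N -> bfull p -> bfull q -> 0 < rho ->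
  bvol q = rho ^+ n * bvol p ->
  (((1 + rho) ^+ n * bvol p)%:E <= leb n (msum (bset p) (bset q)))%E.
Proof.
case: p => a b; case: q => a' b' n0 /= /forallP /= ab /forallP /= ab' r0 vol.
pose al i := b 0 i - a 0 i; pose be i := b' 0 i - a' 0 i.
have al0 i : 0 < al i by rewrite subr_gt0.
have be0 i : 0 < be i by rewrite subr_gt0.
have ab0 i : 0 < al i + be i := addr_gt0 (al0 i) (be0 i).
have abN i : al i + be i != 0 by exact: lt0r_neq0.
have va : bvol (a, b) = \prod_i al i.
  by apply: eq_bigr => i _; rewrite /= (max_r (ltW (al0 i))).
have vb : bvol (a', b') = \prod_i be i.
  by apply: eq_bigr => i _; rewrite /= (max_r (ltW (be0 i))).
apply: (@le_trans _ _ (leb n (cell_set (Some (a + a', b + b'))))); last first.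
  apply: le_leb => z zab.
  pose th i := (z 0 i - (a 0 i + a' 0 i)) / (al i + be i).
  have H i : 0 < th i <= 1.
    have := zab i; rewrite !mxE => /andP[h1 h2].
    rewrite /th; apply/andP; split.
      by rewrite divr_gt0// subr_gt0.
    by rewrite ler_pdivrMr// mul1r /al /be; lra.
  exists (\row_i (a 0 i + th i * al i)), (\row_i (a' 0 i + th i * be i)); split.
  - move=> i /=; rewrite !mxE ltrDl mulr_gt0//; last by case/andP: (H i).
    have /andP[_ h] := H i; have := ler_wpM2r (ltW (al0 i)) h; rewrite mul1r /al; lra.
  - move=> i /=; rewrite !mxE ltrDl mulr_gt0//; last by case/andP: (H i).
    have /andP[_ h] := H i; have := ler_wpM2r (ltW (be0 i)) h; rewrite mul1r /be; lra.
  - apply/rowP => i; rewrite !mxE addrACA -mulrDr divfK//.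
    by rewrite addrC subrK.
rewrite leb_cell /= lee_fin va.
rewrite [leRHS](_ : _ = \prod_i (al i + be i)); last first.
  apply: eq_bigr => i _; rewrite !mxE max_r; first by rewrite /al /be; ring.
  by have := al0 i; have := be0 i; rewrite /al /be; lra.
set X := \prod_i (al i + be i).
have X0 : 0 < X by apply: prodr_gt0 => i _; exact: ab0.
have A0 : 0 < \prod_i al i by apply: prodr_gt0.
have [y y0 yX] := @nth_rootP R n ((\prod_i al i) / X) n0 (ltW (divr_gt0 A0 X0)).
pose pp i := al i / (al i + be i); pose qq i := be i / (al i + be i).
have pp0 i : 0 <= pp i by rewrite divr_ge0//; exact: ltW.
have qq0 i : 0 <= qq i by rewrite divr_ge0//; exact: ltW.
have h1 : y <= (\sum_i pp i) / n%:R.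
  rewrite -(@ler_pXn2r _ n) ?nnegrE// ?divr_ge0 ?sumr_ge0// yX.
  by apply: le_trans (AGM_ord pp0); rewrite /pp big_split/= prodfV.
have h2 : rho * y <= (\sum_i qq i) / n%:R.
  rewrite -(@ler_pXn2r _ n) ?nnegrE//; [|by rewrite mulr_ge0// ltW|by rewrite divr_ge0// sumr_ge0].
  apply: le_trans (AGM_ord qq0); rewrite /qq big_split/= prodfV -vb vol va.
  by rewrite exprMn yX mulrA.
have h3 : (1 + rho) * y <= 1.
  rewrite mulrDl mul1r; apply: (le_trans (lerD h1 h2)).
  rewrite -mulrDl -big_split/= (eq_bigr (fun=> 1)); last first.
    by move=> i _; rewrite -mulrDl divff.
  by rewrite sumr_const card_ord divff// pnatr_eq0 -lt0n.
have : ((1 + rho) * y) ^+ n <= 1.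
  by apply: exprn_ile1 => //; rewrite mulr_ge0//; lra.
by rewrite exprMn yX mulrA ler_pdivrMr// mul1r.
Qed.

Let cut_ivt i t (th : R) : all bfull t -> t != [::] -> 0 < th < 1 ->
  exists c, bsum (cutL i c t) = th * bsum t.
Proof.
move=> ft t0 /andP[th0 th1].
pose M : R := \sum_(p <- t) (`|p.1 0 i| + `|p.2 0 i|).
have M0 : 0 <= M by apply: sumr_ge0 => p _; rewrite addr_ge0.
have PM p : p \in t -> `|p.1 0 i| + `|p.2 0 i| <= M.
  move=> pt; rewrite /M (big_rem _ pt)/= lerDl sumr_ge0// => q _.
pose K p : R := \prod_(j | j != i) Num.max 0 (p.2 0 j - p.1 0 j).
have K0 p : 0 <= K p by apply: prodr_ge0 => j _; rewrite le_max lexx.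
pose f c := bsum (cutL i c t).
have fE c : f c = \sum_(p <- t) Num.max 0 (Num.min (p.2 0 i) c - p.1 0 i) * K p.
  rewrite /f bsum_full /bsum big_map; apply: eq_bigr => -[a b] _.
  rewrite /bvol (bigD1 i)//= upd_id; congr (_ * _).
  by apply: eq_bigr => j /negbTE ji; rewrite updE ji.
have fl c d : `|f c - f d| <= (\sum_(p <- t) K p) * `|c - d|.
  rewrite !fE -sumrB; apply: (le_trans (ler_norm_sum _ _ _)).
  rewrite mulr_suml; apply: ler_sum => p _.
  rewrite -mulrBl normrM mulrC (ger0_norm (K0 p)) ler_wpM2l//.
  exact: clip_lip.
have [|||c _ fc] := @IVT _ f (- M) M (th * bsum t).
- lra.
- exact/continuous_subspaceT/(lip_continuous fl).
- have -> : f (- M) = 0.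
    rewrite fE big_seq big1// => p pt; rewrite max_l ?mul0r//.
    have := PM p pt; have := ler_norm (- p.1 0 i); rewrite normrN.
    have := normr_ge0 (p.2 0 i) => h1 h2 h3.
    by rewrite subr_le0 ge_min; apply/orP; right; lra.
  have -> : f M = bsum t.
    rewrite fE /bsum big_seq [RHS]big_seq; apply: eq_bigr => p pt.
    rewrite min_l; first by rewrite /bvol [RHS](bigD1 i).
    have := PM p pt; have := ler_norm (p.2 0 i).
    have := normr_ge0 (p.1 0 i); lra.
  have T0 := ltW (bsum_gt0 ft t0).
  rewrite (min_l T0) (max_r T0); apply/andP; split.
    by rewrite mulr_ge0// ltW.
  by rewrite ler_piMl// ltW.
by exists c.
Qed.

(** Hadwiger-Ohmann: if [s] has two boxes, a hyperplane separates them; cutting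
    [t] by a parallel hyperplane in the same volume proportion gives two pairs
    of families with fewer boxes, whose sums are separated by a hyperplane. *)
Lemma brunn_minkowski_boxes (k : nat) s t rho : (0 < n)%N ->
  (size s + size t <= k)%N -> s != [::] -> t != [::] ->
  all bfull s -> all bfull t -> pairwise bsep s -> pairwise bsep t ->
  0 < rho -> bsum t = rho ^+ n * bsum s ->
  (((1 + rho) ^+ n * bsum s)%:E <= leb n (msum (bcup s) (bcup t)))%E.
Proof.
move=> n0; elim: k s t rho => [|k IH] s t rho.
  by rewrite leqn0 addn_eq0 => /andP[/nilP-> _].
have step s1 t1 rho1 : (size s1 + size t1 <= k.+1)%N -> (1 < size s1)%N -> t1 != [::] ->
    all bfull s1 -> all bfull t1 -> pairwise bsep s1 -> pairwise bsep t1 ->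
    0 < rho1 -> bsum t1 = rho1 ^+ n * bsum s1 ->
    (((1 + rho1) ^+ n * bsum s1)%:E <= leb n (msum (bcup s1) (bcup t1)))%E.
  case: s1 => [//|p [//|q s1]] st _ t0 fs ft ss tt r0 vol.
  set s2 := p :: q :: s1 in st fs ss vol *.
  have ps : p \in s2 by rewrite !inE eqxx.
  have qs : q \in s2 by rewrite !inE eqxx orbT.
  have [i [c [p1 [p2 [p1s p2s p1c p2c]]]]] : exists i c p1 p2,
      [/\ p1 \in s2, p2 \in s2, p1.2 0 i <= c & c <= p2.1 0 i].
    have : bsep p q by move: ss => /= /andP[/andP[]].
    move=> /existsP[i /orP[h|h]]; exists i.
      by exists (p.2 0 i), p, q.
    by exists (q.2 0 i), q, p.
  have fp1 := allP fs _ p1s; have fp2 := allP fs _ p2s.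
  have cl1 : cutl i c p1 = p1.
    rewrite /cutl min_l// [RHS]surjective_pairing; congr pair.
    by apply/rowP => j; rewrite updE; case: eqP => // ->.
  have cr2 : cutr i c p2 = p2.
    rewrite /cutr max_l// [RHS]surjective_pairing; congr pair.
    by apply/rowP => j; rewrite updE; case: eqP => // ->.
  have L0 : cutL i c s2 != [::].
    apply/eqP => h; have : p1 \in cutL i c s2.
      by rewrite mem_filter fp1; apply/mapP; exists p1; rewrite ?cl1.
    by rewrite h.
  have R0 : cutR i c s2 != [::].
    apply/eqP => h; have : p2 \in cutR i c s2.
      by rewrite mem_filter fp2; apply/mapP; exists p2; rewrite ?cr2.
    by rewrite h.
  have Ls : (size (cutL i c s2) < size s2)%N.
    rewrite -(size_map (cutl i c) s2).
    apply: (size_filter_lt (map_f _ p2s)); apply/forallPn; exists i.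
    by rewrite /= upd_id -leNgt ge_min p2c orbT.
  have Rs : (size (cutR i c s2) < size s2)%N.
    rewrite -(size_map (cutr i c) s2).
    apply: (size_filter_lt (map_f _ p1s)); apply/forallPn; exists i.
    by rewrite /= upd_id -leNgt le_max p1c orbT.
  have vL0 : 0 < bsum (cutL i c s2) by apply: bsum_gt0 => //; exact: filter_all.
  have vR0 : 0 < bsum (cutR i c s2) by apply: bsum_gt0 => //; exact: filter_all.
  have vLR := bsum_cut i c s2.
  have v0 : 0 < bsum s2 by rewrite -vLR addr_gt0.
  have [d dth] : exists d, bsum (cutL i d t1) = bsum (cutL i c s2) / bsum s2 * bsum t1.
    apply: cut_ivt => //; rewrite divr_gt0//= ltr_pdivrMr// mul1r -vLR.
    by rewrite ltrDl.
  have tL : bsum (cutL i d t1) = rho1 ^+ n * bsum (cutL i c s2).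
    by rewrite dth vol mulrCA mulrAC -mulrA mulrCA divff ?mulr1 ?gt_eqF// mulrC.
  have tR : bsum (cutR i d t1) = rho1 ^+ n * bsum (cutR i c s2).
    have := bsum_cut i d t1; rewrite vol -vLR tL mulrDr; lra.
  have rn0 : 0 < rho1 ^+ n by rewrite exprn_gt0.
  have tL0 : cutL i d t1 != [::].
    apply/eqP => h; move: tL; rewrite h /bsum big_nil => /esym/eqP.
    by rewrite mulf_eq0 !gt_eqF.
  have tR0 : cutR i d t1 != [::].
    apply/eqP => h; move: tR; rewrite h /bsum big_nil => /esym/eqP.
    by rewrite mulf_eq0 !gt_eqF.
  have sz : (size (cutL i d t1) <= size t1)%N.
    by rewrite size_filter (leq_trans (count_size _ _))// size_map.
  have sz' : (size (cutR i d t1) <= size t1)%N.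
    by rewrite size_filter (leq_trans (count_size _ _))// size_map.
  have IHL := IH (cutL i c s2) (cutL i d t1) rho1 _ L0 tL0 (filter_all _ _)
    (filter_all _ _) (sep_cutL _ _ ss) (sep_cutL _ _ tt) r0 tL.
  have IHR := IH (cutR i c s2) (cutR i d t1) rho1 _ R0 tR0 (filter_all _ _)
    (filter_all _ _) (sep_cutR _ _ ss) (sep_cutR _ _ tt) r0 tR.
  rewrite -vLR mulrDr EFinD (halfspace_cara i (c + d) (msum _ _)).
  apply: leeD.
    apply: (le_trans (IHL _)); first by rewrite -ltnS (leq_trans _ st)// -addSn leq_add.
    apply: le_leb => z [x [y [/bcup_cutL[xs xc] /bcup_cutL[ys yd] ->]]].
    by split; [exists x, y|rewrite /= !mxE; exact: lerD].
  apply: (le_trans (IHR _)); first by rewrite -ltnS (leq_trans _ st)// -addSn leq_add.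
  apply: le_leb => z [x [y [/bcup_cutR[xs xc] /bcup_cutR[ys yd] ->]]].
  split; first by exists x, y.
  move: xc yd => /= /negP; rewrite -ltNge => xc /negP; rewrite -ltNge => yd.
  by apply/negP; rewrite -ltNge !mxE; exact: ltrD.
move=> st s0 t0 fs ft ss tt r0 vol.
have [s1|s1] := ltnP 1 (size s); first exact: step.
have [t1|t1] := ltnP 1 (size t).
  have rn0 : 0 < rho ^+ n by rewrite exprn_gt0.
  have := step t s rho^-1; rewrite addnC => /(_ st t1 s0 ft fs tt ss).
  rewrite invr_gt0 => /(_ r0); rewrite exprVn vol mulKf ?gt_eqF// => /(_ erefl).
  rewrite mulrA -exprMn mulrDl mul1r mulVf ?gt_eqF// addrC msumC.
  exact.
case: s s0 fs {ss st step IH} s1 vol => [//|p [|//]] _ /= /andP[fp _] _ vol.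
case: t t0 ft {tt} t1 vol => [//|q [|//]] _ /= /andP[fq _] _.
rewrite /bsum !big_seq1 => vol.
apply: (le_trans (bm_boxes n0 fp fq r0 vol)); apply: le_leb.
by apply: msumSS => x xp; [exists p|exists q] => //; rewrite inE.
Qed.

End brunn_minkowski.

(** * Layer-cake estimates and thickening of open sets *)

Section integration_toolkit.
Context {R : realType} {n : nat}.
Implicit Types (x y z : 'rV[R]_n).
Local Notation T := (Rmeas R n).
Local Notation mu := (lebm R n).

Definition supp_in (r : R) (f : 'rV[R]_n -> R) := forall x, r < `|x| -> f x = 0.

Lemma compact_sup_ball (r : R) : compact [set x : 'rV[R]_n | `|x| <= r].
Proof.
apply: bounded_closed_compact.
  by exists r; split; [exact: num_real|move=> M rM x /= xr; exact: le_trans xr (ltW rM)].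
apply: (@closed_comp _ _ (fun x : 'rV[R]_n => `|x|) [set t | t <= r]).
  by move=> x _; exact: norm_continuous.
exact: closed_le.
Qed.

Lemma supp_in_bounded r f : continuous f -> supp_in r f ->
  exists2 M, 0 <= M & forall x, `|f x| <= M.
Proof.
move=> cf fr; pose A := [set x : 'rV[R]_n | `|x| <= Num.max r 0].
have A0 : A !=set0 by exists 0; rewrite /A/= normr0 le_max lexx orbT.
have [|c _ H] := @EVT_max_rV _ _ (fun x => `|f x|) A A0 (@compact_sup_ball _).
  apply: continuous_subspaceT => x.
  by apply: continuous_comp; [exact: cf|exact: norm_continuous].
exists `|f c| => // x.
have [xr|xr] := leP `|x| (Num.max r 0); first by apply: H; rewrite inE.
by rewrite fr ?normr0//; apply: le_lt_trans xr; rewrite le_max lexx.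
Qed.

Lemma leb_sup_ball_fin (r : R) : (leb n [set x : 'rV[R]_n | (`|x| <= r)%R] < +oo)%E.
Proof. exact: compact_fin (@compact_sup_ball r). Qed.

Lemma bounded_supp_integrable (f : 'rV[R]_n -> R) (M r : R) :
  measurable_fun setT (f : T -> R) -> (forall x, `|f x| <= M) -> supp_in r f ->
  mu.-integrable setT (EFin \o (f : T -> R)).
Proof.
move=> mf fM fr; pose A : set T := [set x : 'rV[R]_n | `|x| <= r].
have mA : measurable A by exact: measurable_compact (@compact_sup_ball r).
have M0 : 0 <= M by apply: le_trans (fM 0).
apply/integrableP; split; first exact/measurable_EFinP.
apply: (@le_lt_trans _ _ (\int[mu]_(x in setT) ((EFin \o cst M) \_ A) x)%E).
  apply: ge0_le_integral; [exact: measurableT|by move=> x _; exact: abse_ge0|..].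
  - by apply: measurableT_comp; [exact: abse_measurable|exact/measurable_EFinP].
  - apply/(measurable_restrictT _ mA); apply/measurable_EFinP; exact: measurable_cst.
  move=> x _; rewrite /patch; case: ifPn => [_|]; first by rewrite /= lee_fin; exact: fM.
  rewrite notin_setE /= => /negP; rewrite -ltNge => xr.
  by rewrite fr// normr0.
rewrite -integral_mkcond -[EFin \o cst M]/(cst M%:E) integral_cst//.
by rewrite lte_mul_pinfty// ?lee_fin// leb_sup_ball_fin.
Qed.

Lemma supp_in_integrable (f : 'rV[R]_n -> R) (r : R) : continuous f -> supp_in r f ->
  mu.-integrable setT (EFin \o (f : T -> R)).
Proof.
move=> cf fr; have [M _ fM] := supp_in_bounded cf fr.
by apply: (bounded_supp_integrable _ fM fr); exact: continuous_meas.
Qed.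

Lemma norm_continuous_comp (f : 'rV[R]_n -> R) : continuous f -> continuous (fun x => `|f x|).
Proof. by move=> cf x; apply: continuous_comp; [exact: cf|exact: norm_continuous]. Qed.

End integration_toolkit.

Section layers.
Context {R : realType} {n : nat}.
Local Notation T := (Rmeas R n).
Local Notation mu := (lebm R n).

Lemma indic_pred (U : Type) (P : pred U) (x : U) : \1_[set y | P y] x = (P x)%:R :> R.
Proof. by rewrite indicE; congr (nat_of_bool _)%:R; apply/idP/idP; rewrite inE. Qed.

Lemma count_layers (K : nat) (b : R) : 0 <= b ->
  \sum_(k < K) (k.+1%:R < b)%R%:R <= b /\
  (b <= K%:R -> b <= \sum_(k < K) (k.+1%:R < b)%R%:R + 1).
Proof.
move=> b0; have full J : (J%:R < b)%R -> \sum_(k < J) (k.+1%:R < b)%R%:R = J%:R :> R.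
  move=> Jb; rewrite (eq_bigr (fun=> 1)) ?sumr_const ?card_ord// => k _.
  by rewrite (le_lt_trans _ Jb)// ler_nat.
elim: K => [|K [IH1 IH2]]; first by rewrite big_ord0; split => // ?; lra.
rewrite big_ord_recr/=; split.
  have [Kb|] := ltP K.+1%:R b; last by rewrite addr0.
  rewrite full; first by rewrite natr1 ltW.
  by apply: lt_trans Kb; rewrite ltr_nat.
move=> bK; have [bK'|Kb] := leP b K%:R.
  by apply: (le_trans (IH2 bK')); rewrite lerD2r lerDl.
by rewrite full// addrAC natr1 (le_trans bK)// lerDl.
Qed.

(** Discrete layer-cake estimates: up to an error of one in height, the
    integral of [h] is the sum of the measures of its integer superlevel sets. *)
Lemma layer_le (h : T -> R) (K : nat) : measurable_fun setT h -> (forall x, 0 <= h x) ->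
  (\sum_(k < K) mu [set x | (k.+1%:R < h x)%R] <= \int[mu]_x (h x)%:E)%E.
Proof.
move=> mh h0.
have mE k : measurable [set x : T | k.+1%:R < h x].
  by rewrite -[X in measurable X]setTI; apply: measurable_fun_ltr => //; exact: measurable_cst.
rewrite (eq_bigr (fun k : 'I_K => \int[mu]_x (\1_[set x : T | (k.+1%:R < h x)%R] x)%:E)%E); last first.
  by move=> k _; rewrite integral_indic// setIT.
rewrite -ge0_integral_sum; last 3 first.
- exact: measurableT.
- by move=> k; apply/measurable_EFinP; exact: measurable_indic.
- by move=> k x _; rewrite lee_fin.
apply: ge0_le_integral; [exact: measurableT|..].
- by move=> x _; rewrite sumEFin lee_fin sumr_ge0.
- by apply: emeasurable_sum => k; apply/measurable_EFinP; exact: measurable_indic.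
- exact/measurable_EFinP.
move=> x _; rewrite sumEFin lee_fin; apply: le_trans (count_layers K (h0 x)).1.
by rewrite le_eqVlt; apply/orP; left; apply/eqP; apply: eq_bigr => k _; rewrite indic_pred.
Qed.

Lemma layer_ge (h : T -> R) (K : nat) (S : set T) : measurable_fun setT h ->
  (forall x, 0 <= h x <= K%:R) -> measurable S -> (forall x, ~ S x -> h x = 0) ->
  (\int[mu]_x (h x)%:E <= \sum_(k < K) mu [set x | (k.+1%:R < h x)%R] + mu S)%E.
Proof.
move=> mh hK mS hS.
have h0 x : 0 <= h x by case/andP: (hK x).
have mE k : measurable [set x : T | k.+1%:R < h x].
  by rewrite -[X in measurable X]setTI; apply: measurable_fun_ltr => //; exact: measurable_cst.
rewrite (eq_bigr (fun k : 'I_K => \int[mu]_x (\1_[set x : T | (k.+1%:R < h x)%R] x)%:E)%E); last first.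
  by move=> k _; rewrite integral_indic// setIT.
rewrite -ge0_integral_sum; last 3 first.
- exact: measurableT.
- by move=> k; apply/measurable_EFinP; exact: measurable_indic.
- by move=> k x _; rewrite lee_fin.
have -> : mu S = (\int[mu]_x (\1_S x)%:E)%E by rewrite integral_indic// setIT.
rewrite -ge0_integralD; last 5 first.
- exact: measurableT.
- by move=> x _; rewrite sumEFin lee_fin sumr_ge0.
- by apply: emeasurable_sum => k; apply/measurable_EFinP; exact: measurable_indic.
- by move=> x _; rewrite lee_fin.
- by apply/measurable_EFinP; exact: measurable_indic.
apply: ge0_le_integral; [exact: measurableT|by move=> x _; rewrite lee_fin|..].
- exact/measurable_EFinP.
- apply: emeasurable_funD; last by apply/measurable_EFinP; exact: measurable_indic.
  by apply: emeasurable_sum => k; apply/measurable_EFinP; exact: measurable_indic.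
move=> x _; rewrite sumEFin -EFinD lee_fin.
have [Sx|Sx] := pselect (S x); last by rewrite hS// addr_ge0// sumr_ge0.
rewrite [\1_S x]indicE mem_set//; have /andP[_ hx] := hK x.
apply: (le_trans ((count_layers K (h0 x)).2 hx)); rewrite lerD2r.
by rewrite le_eqVlt; apply/orP; left; apply/eqP; apply: eq_bigr => k _; rewrite indic_pred.
Qed.

End layers.

Section isoperimetric.
Context {R : realType} {n : nat}.
Implicit Types (x y : 'rV[R]_n) (z : 'rV[int]_n) (E : set 'rV[R]_n).
Local Notation T := (Rmeas R n).
Local Notation mu := (lebm R n).

Definition dbox (k : nat) (z : 'rV[int]_n) : 'rV[R]_n * 'rV[R]_n :=
  (\row_i ((z 0 i)%:~R / 2 ^+ k), \row_i ((z 0 i + 1)%:~R / 2 ^+ k)).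

Lemma dboxE k z : bset (dbox k z) = cell_set (dya k z).
Proof. by []. Qed.

Lemma dbox_full k z : bfull (dbox k z).
Proof.
apply/forallP => i; rewrite !mxE ltr_pM2r ?invr_gt0 ?exprn_gt0//.
by rewrite ltr_int ltrDl.
Qed.

Lemma dbox_sep k z z' : z != z' -> bsep (dbox k z) (dbox k z').
Proof.
move=> zz'; have [i zi] : exists i, z 0 i != z' 0 i.
  apply/existsP; apply: contraR zz' => /existsPn H; apply/eqP/rowP => i.
  by apply/eqP; rewrite -[_ == _]negbK; exact: H.
apply/existsP; exists i; rewrite !mxE.
rewrite !ler_pM2r ?invr_gt0 ?exprn_gt0// !ler_int.
by move: zi; rewrite neq_lt => /orP[h|h]; apply/orP; [left|right]; lia.
Qed.

(** An open set is exhausted from inside by finite unions of dyadic cubes. *)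
Lemma open_inner_boxes E (v : R) : open E -> (v%:E < leb n E)%E ->
  exists s : seq ('rV[R]_n * 'rV[R]_n),
    [/\ all bfull s, pairwise bsep s, bcup s `<=` E & v < bsum s].
Proof.
move=> oE vE.
pose J m := {ffun 'I_n -> 'I_(4 ^ m + 4 ^ m)}.
pose zf m (f : J m) : 'rV[int]_n := \row_i ((f i)%:Z - (4 ^ m)%:Z).
pose zs m := [seq zf m f | f <- enum (J m)].
pose s m := [seq p <- [seq dbox m z | z <- zs m] | `[< bset p `<=` E >]].
have zinj m : injective (@zf m).
  move=> f f' /rowP ff; apply/ffunP => i; apply: val_inj.
  by have := ff i; rewrite !mxE => /addIr[].
have sfull m : all bfull (s m).
  by apply/allP => p; rewrite mem_filter => /andP[_ /mapP[z _ ->]]; exact: dbox_full.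
have ssep m : pairwise bsep (s m).
  apply: pairwise_filter; rewrite pairwise_map.
  apply: (@sub_pairwise _ (fun z z' => z != z')) => [z z'|]; first exact: dbox_sep.
  by rewrite -uniq_pairwise (map_inj_uniq (@zinj m)) enum_uniq.
have sE m : bcup (s m) `<=` E.
  by move=> x [p]; rewrite mem_filter => /andP[/asboolP pE _]; exact: pE.
have sx x : E x -> exists m0, forall m, (m0 <= m)%N -> bcup (s m) x.
  move=> Ex; have [k1 hk1] := dya_sub_open oE Ex.
  pose k2 := (Num.truncn (\sum_i `|x 0 i|)).+2.
  exists (maxn k1 k2) => m; rewrite geq_max => /andP[m1 m2].
  have xm i : `|x 0 i| <= 2 ^+ m - 1.
    apply: (@le_trans _ _ (\sum_i `|x 0 i|)).
      by rewrite (bigD1 i)//= lerDl sumr_ge0.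
    have := truncnS_gt (\sum_i `|x 0 i|) => /ltW/le_trans; apply.
    rewrite lerBrDr natr1 -natrX ler_nat (leq_trans _ (ltnW (ltn_expl m (ltnSn 1))))//.
  have z_i i : - (4 ^ m)%:Z <= dya_of m x 0 i < (4 ^ m)%:Z.
    have p0 : (0 : R) < 2 ^+ m by rewrite exprn_gt0.
    have p1 : (1 : R) <= 2 ^+ m by rewrite exprn_ege1// ler1n.
    have e4 : (4 ^ m)%:R = 2 ^+ m * 2 ^+ m :> R.
      by rewrite -exprMn -natrM natrX.
    have := xm i; rewrite ler_norml => /andP[h1 h2].
    have h3 := ler_wpM2r (ltW p0) h1; have h4 := ler_wpM2r (ltW p0) h2.
    have /andP[c1 c2] := ceil_itv (x 0 i * 2 ^+ m).
    rewrite mxE; apply/andP; split.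
      rewrite -(ler_int R) rmorphN/= rmorphB/= -pmulrn e4.
      by rewrite rmorphB/= in c1; lra.
    rewrite -(ltr_int R) -pmulrn e4; lra.
  have Hf i : (absz (dya_of m x 0 i + (4 ^ m)%:Z)%R < 4 ^ m + 4 ^ m)%N.
    by have := z_i i; lia.
  pose f : J m := [ffun i => Ordinal (Hf i)].
  have zfE : zf m f = dya_of m x.
    apply/rowP => i; rewrite mxE ffunE /=; have := z_i i.
    by move: (dya_of m x 0 i) => z ?; lia.
  exists (dbox m (dya_of m x)); last by rewrite dboxE; exact/dyaP.
  rewrite mem_filter; apply/andP; split; first by apply/asboolP; exact: hk1.
  by apply: map_f; rewrite -zfE; apply: map_f; rewrite mem_enum.
have ms m : measurable (bcup (s m) : set T).
  rewrite (_ : bcup (s m) = \bigcup_(p in [set` s m]) bset p).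
    by apply: fin_bigcup_measurable => // p _; exact: measurable_cell.
  by apply/seteqP; split => x [p ps px]; exists p.
pose F m : set T := \bigcap_(k in [set k | (m <= k)%N]) bcup (s k).
have mF m : measurable (F m) by apply: bigcap_measurable => //; exists m => /=.
have FE : \bigcup_m F m = E.
  apply/seteqP; split => [x [m _ Fx]|x /sx[m hm]]; last by exists m => // k; exact: hm.
  by apply: (sE m); apply: Fx => /=.
have [m vm] : exists m, (v%:E < mu (F m))%E.
  apply/not_existsP => H.
  have mono : nondecreasing_seq F.
    by move=> a b ab; apply/subsetPset => x Fx k /= bk; apply: Fx; exact: leq_trans bk.
  have := @nondecreasing_cvg_mu _ _ _ mu F mF _ mono.
  rewrite FE => /(_ (measurable_open oE)) cvgF.
  have : (mu E <= v%:E)%E.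
    rewrite -(cvg_lim _ cvgF)//; apply: lime_le; first by apply/cvg_ex; eexists; exact: cvgF.
    by apply: nearW => m /=; rewrite leNgt; apply/negP; exact: H.
  by rewrite leNgt vE.
exists (s m); split => //; rewrite -lte_fin; apply: (lt_le_trans vm).
apply: (@le_trans _ _ (leb n (bcup (s m)))).
  by apply: le_leb => x; apply => /=.
have {}H (l : seq ('rV[R]_n * 'rV[R]_n)) : (leb n (bcup l) <= (bsum l)%:E)%E.
  elim: l => [|p l IH].
    rewrite (_ : bcup [::] = set0) ?outer_measure0 /bsum ?big_nil//.
    by apply/seteqP; split => x // [].
  apply: (@le_trans _ _ (leb n (bset p `|` bcup l))).
    by apply: le_leb => x [q]; rewrite inE => /orP[/eqP ->|ql qx]; [left|right; exists q].
  apply: (le_trans (outer_measureU2 _ _ _)); rewrite /bsum big_cons EFinD.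
  by apply: leeD; [rewrite [X in (X <= _)%E](leb_cell (Some p)); case: (p)|exact: IH].
exact: H.
Qed.

(** The isoperimetric inequality in the form used below: a set that is not
    larger than a ball of radius [w] grows, under thickening by [e], at
    least at the relative rate [n e / w] of that ball. *)
Lemma leb_thicken_ge E (w e : R) : (0 < n)%N -> open E -> 0 < w -> 0 < e ->
  (leb n E <= (omega R n * w ^+ n)%:E)%E ->
  ((1 + n%:R * e / w)%:E * leb n E <= leb n (msum E (eball 0 e)))%E.
Proof.
move=> n0 oE w0 e0 Ew.
have om0 := @omega_gt0 R n.
have Efin : leb n E \is a fin_num.
  by rewrite ge0_fin_numE ?leb_ge0//; apply: le_lt_trans Ew _; rewrite ltry.
have [/eqP->|En0] := boolP (leb n E == 0)%E; first by rewrite mule0 leb_ge0.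
have EE := fineK Efin; set V := fine (leb n E) in EE.
have V0 : 0 < V by rewrite -lte_fin EE lt_neqAle eq_sym En0 leb_ge0.
have [q o0 oE'] := @nth_rootP R n (omega R n) n0 (ltW om0).
have [v v0 vE] := @nth_rootP R n V n0 (ltW V0).
have {}o0 : 0 < q by rewrite lt_neqAle o0 andbT eq_sym; apply: contraTneq om0 => o0'; rewrite -oE' o0' expr0n gtn_eqF// ltxx.
have {}v0 : 0 < v by rewrite lt_neqAle v0 andbT eq_sym; apply: contraTneq V0 => v0'; rewrite -vE v0' expr0n gtn_eqF// ltxx.
have vow : v <= q * w.
  rewrite -(@ler_pXn2r _ n) ?nnegrE; [|by []|exact: ltW|by rewrite mulr_ge0// ltW].
  by rewrite exprMn oE' vE -lee_fin EE.
have [Sfin|] := boolP (leb n (msum E (eball 0 e)) \is a fin_num); last first.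
  by rewrite ge0_fin_numE ?leb_ge0// ltey negbK => /eqP ->; rewrite leey.
have SE := fineK Sfin; set S := fine _ in SE.
have bm (m : nat) : (1 < m)%N -> ((v + q * e) * (1 - m%:R^-1)) ^+ n <= S.
  move=> m1; have m0 : (0 : R) < m%:R by rewrite ltr0n (ltn_trans _ m1).
  set t := 1 - m%:R^-1.
  have t0 : 0 < t by rewrite subr_gt0 invf_lt1// ltr1n.
  have t1 : t < 1 by rewrite ltrBlDr ltrDl invr_gt0.
  have tn : t ^+ n < 1 by rewrite exprn_ilt1// ?ltW// -lt0n.
  have [s [sf ss sE sv]] : exists s : seq ('rV[R]_n * 'rV[R]_n),
      [/\ all bfull s, pairwise bsep s, bcup s `<=` E & (v * t) ^+ n < bsum s].
    by apply: open_inner_boxes => //; rewrite -EE lte_fin exprMn vE -[ltRHS]mulr1 ltr_pM2l.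
  have [s' [sf' ss' sE' sv']] : exists s : seq ('rV[R]_n * 'rV[R]_n),
      [/\ all bfull s, pairwise bsep s, bcup s `<=` eball 0 e & (q * e * t) ^+ n < bsum s].
    apply: open_inner_boxes; first exact: eball_open.
    rewrite leb_eball//; last exact: ltW.
    by rewrite lte_fin !exprMn oE' -[ltRHS]mulr1 ltr_pM2l// mulr_gt0// exprn_gt0.
  have vt0 : 0 < v * t by rewrite mulr_gt0.
  have oet0 : 0 < q * e * t by rewrite !mulr_gt0.
  have bs0 : 0 < bsum s by apply: lt_trans sv; rewrite exprn_gt0.
  have bs0' : 0 < bsum s' by apply: lt_trans sv'; rewrite exprn_gt0.
  have sn : s != [::] by apply: contraTneq bs0 => ->; rewrite /bsum big_nil ltxx.
  have sn' : s' != [::] by apply: contraTneq bs0' => ->; rewrite /bsum big_nil ltxx.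
  have [a a0 aE] := @nth_rootP R n (bsum s) n0 (ltW bs0).
  have [b b0 bE] := @nth_rootP R n (bsum s') n0 (ltW bs0').
  have va : v * t <= a.
    by rewrite -(@ler_pXn2r _ n) ?nnegrE//; [rewrite aE ltW|exact: ltW].
  have ob : q * e * t <= b.
    by rewrite -(@ler_pXn2r _ n) ?nnegrE//; [rewrite bE ltW|exact: ltW].
  have {}a0 : 0 < a by exact: lt_le_trans va.
  have {}b0 : 0 < b by exact: lt_le_trans ob.
  have := brunn_minkowski_boxes n0 (leqnn _) sn sn' sf sf' ss ss' (divr_gt0 b0 a0).
  rewrite -aE -bE expr_div_n divfK ?expf_neq0 ?gt_eqF// => /(_ erefl).
  rewrite -exprMn mulrDl mul1r divfK ?gt_eqF// => H.
  have : (((a + b) ^+ n)%:E <= S%:E)%E.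
    by apply: (le_trans H); rewrite SE; apply: le_leb; exact: msumSS.
  rewrite lee_fin; apply: le_trans.
  have abn : 0 <= a + b by rewrite addr_ge0// ltW.
  have vqt : 0 <= (v + q * e) * t by rewrite mulrDl addr_ge0// ltW.
  by rewrite ler_pXn2r ?nnegrE// mulrDl lerD.
have oe0 : 0 < q * e by rewrite mulr_gt0.
have full : (v + q * e) ^+ n <= S.
  set Z := (_ ^+ n).
  have Z0 : 0 <= Z by apply: exprn_ge0; rewrite addr_ge0// ltW.
  suff : forall m : nat, (0 < m)%N -> Z <= (S%:P + (n%:R * Z)%:P * 'X).[m%:R^-1].
    by move=> /poly_lim_le; rewrite !hornerE ?mulr0 ?addr0.
  move=> m m0; rewrite !hornerE; case: m m0 => [//|[_|m _]].
    rewrite invr1 mulr1.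
    have S0 : 0 <= S by rewrite -lee_fin SE leb_ge0.
    have : 1 <= n%:R :> R by rewrite ler1n.
    by move=> h; have := ler_wpM2r Z0 h; lra.
  have := bm m.+2 isT; rewrite exprMn -/Z => H.
  have i1 : m.+2%:R^-1 < 1 :> R by rewrite invf_lt1 ?ltr1n ?ltr0n.
  have := @bernoulli_pow R n (- m.+2%:R^-1) _.
  rewrite subr_ge0 ltW// => /(_ isT)/(ler_wpM2l Z0).
  by move=> h; have := le_trans h H; rewrite mulrDr mulr1 mulrN mulrN mulrA [Z * _]mulrC lerBlDr.
rewrite -EE -SE -EFinM lee_fin; apply: le_trans full.
rewrite -vE (_ : v + q * e = v * (1 + q * e / v)); last by field; exact: lt0r_neq0.
rewrite exprMn mulrC ler_pM2l ?exprn_gt0//.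
apply: (@le_trans _ _ (1 + n%:R * (q * e / v))).
  rewrite lerD2l -mulrA ler_wpM2l// ler_pdivrMr// mulrAC ler_pdivlMr//.
  by rewrite mulrAC [leRHS]mulrC ler_wpM2l// ltW.
by apply: bernoulli_pow; rewrite addr_ge0// divr_ge0// ltW.
Qed.

End isoperimetric.

(** * Integrals over the whole space *)

Section real_integral.
Context {R : realType} {n : nat}.
Local Notation T := (Rmeas R n).
Local Notation mu := (lebm R n).
Implicit Types (f g h : 'rV[R]_n -> R).

(** Integrals of real functions over the whole space; integrals over a set are
    taken by multiplying with its indicator. *)
Definition lintble f := mu.-integrable setT (EFin \o (f : T -> R)).
Definition lint f : R := fine (\int[mu]_x (f x)%:E)%E.
Definition lmeas f := measurable_fun setT (f : T -> R).

Lemma lintble_meas f : lintble f -> lmeas f.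
Proof. by move=> /measurable_int/measurable_EFinP. Qed.

Lemma lintE f : lintble f -> (lint f)%:E = (\int[mu]_x (f x)%:E)%E.
Proof. by move=> fi; rewrite /lint fineK//; exact: (integrable_fin_num _ fi). Qed.

Lemma lintble_ext f g : f =1 g -> lintble f -> lintble g.
Proof. by move=> /funext ->. Qed.

Lemma lint_ext f g : f =1 g -> lint f = lint g.
Proof. by move=> /funext ->. Qed.

Lemma lintbleD f g : lintble f -> lintble g -> lintble (fun x => f x + g x).
Proof. by move=> fi gi; have := integrableD measurableT fi gi. Qed.

Lemma lintbleN f : lintble f -> lintble (fun x => - f x).
Proof. by move=> fi; have := integrableN fi. Qed.

Lemma lintbleB f g : lintble f -> lintble g -> lintble (fun x => f x - g x).
Proof. by move=> fi gi; apply: lintbleD => //; exact: lintbleN. Qed.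

Lemma lintbleZ (c : R) f : lintble f -> lintble (fun x => c * f x).
Proof. by move=> fi; have := integrableZl measurableT c fi. Qed.

Lemma lintble0 : lintble (fun=> 0).
Proof. exact: integrable0. Qed.

Lemma lintble_sum (I : Type) (s : seq I) (P : pred I) (F : I -> 'rV[R]_n -> R) :
  (forall i, P i -> lintble (F i)) -> lintble (fun x => \sum_(i <- s | P i) F i x).
Proof.
move=> Fi; elim: s => [|i s IH].
  by apply: (@lintble_ext (fun=> 0)) => [x|]; [rewrite big_nil|exact: lintble0].
have [Pi|/negbTE Pi] := boolP (P i).
  apply: (@lintble_ext (fun x => F i x + \sum_(i <- s | P i) F i x)).
    by move=> x; rewrite big_cons Pi.
  by apply: lintbleD => //; exact: Fi.
by apply: lintble_ext IH => x; rewrite big_cons Pi.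
Qed.

Lemma lintble_abs f : lintble f -> lintble (fun x => `|f x|).
Proof. exact: integrable_norm. Qed.

Lemma lintble_le f g : lmeas f -> (forall x, `|f x| <= g x) -> lintble g -> lintble f.
Proof.
move=> mf fg gi; apply: (le_integrable _ _ _ gi); first exact: measurableT.
  exact/measurable_EFinP.
move=> x _ /=; rewrite lee_fin (le_trans (fg x))//; exact: ler_norm.
Qed.

Lemma lintble_bmul (M : R) f g : lmeas g -> (forall x, `|g x| <= M) -> lintble f ->
  lintble (fun x => g x * f x).
Proof.
move=> mg gM fi; apply: (@lintble_le _ (fun x => M * `|f x|)).
- by apply: measurable_funM => //; exact: lintble_meas.
- by move=> x; rewrite normrM; apply: ler_wpM2r; [exact: normr_ge0|exact: gM].
- by apply: lintbleZ; exact: lintble_abs.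
Qed.

Lemma lintD f g : lintble f -> lintble g -> lint (fun x => f x + g x) = lint f + lint g.
Proof.
move=> fi gi; apply: EFin_inj; rewrite EFinD !lintE//; last exact: lintbleD.
by have := integralD_EFin measurableT fi gi.
Qed.

Lemma lintZ (c : R) f : lintble f -> lint (fun x => c * f x) = c * lint f.
Proof.
move=> fi; apply: EFin_inj; rewrite EFinM !lintE//; last exact: lintbleZ.
by have := integralZl measurableT fi c.
Qed.

Lemma lintN f : lintble f -> lint (fun x => - f x) = - lint f.
Proof.
move=> fi; rewrite -mulN1r -lintZ//; apply: lint_ext => x; by rewrite mulN1r.
Qed.

Lemma lintB f g : lintble f -> lintble g -> lint (fun x => f x - g x) = lint f - lint g.
Proof. by move=> fi gi; rewrite lintD ?lintN//; exact: lintbleN. Qed.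

Lemma lint0 : lint (fun=> 0) = 0.
Proof.
rewrite -[RHS](mul0r (lint (fun=> 0))) -(lintZ 0 lintble0).
by apply: lint_ext => x; rewrite mul0r.
Qed.

Lemma lint_sum (I : Type) (s : seq I) (P : pred I) (F : I -> 'rV[R]_n -> R) :
  (forall i, P i -> lintble (F i)) ->
  lint (fun x => \sum_(i <- s | P i) F i x) = \sum_(i <- s | P i) lint (F i).
Proof.
move=> Fi; elim: s => [|i s IH].
  by rewrite big_nil; apply: etrans lint0; apply: lint_ext => x; rewrite big_nil.
rewrite big_cons; case: ifPn => Pi.
  rewrite -IH -lintD; [|exact: Fi|exact: lintble_sum].
  by apply: lint_ext => x; rewrite big_cons Pi.
by rewrite -IH; apply: lint_ext => x; rewrite big_cons (negbTE Pi).
Qed.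

Lemma lint_ge0 f : (forall x, 0 <= f x) -> 0 <= lint f.
Proof. by move=> f0; rewrite fine_ge0//; apply: integral_ge0 => x _; rewrite lee_fin. Qed.

Lemma lint_le f g : lintble f -> lintble g -> (forall x, f x <= g x) -> lint f <= lint g.
Proof.
move=> fi gi fg; rewrite -subr_ge0 -lintB//; apply: lint_ge0 => x.
by rewrite subr_ge0.
Qed.

Lemma lint_abs f : lintble f -> `|lint f| <= lint (fun x => `|f x|).
Proof.
move=> fi; have fa := lintble_abs fi; rewrite ler_norml; apply/andP; split.
  rewrite lerNl -lintN//; apply: lint_le => // [|x]; first exact: lintbleN.
  by rewrite -normrN ler_norm.
by apply: lint_le => // x; rewrite ler_norm.
Qed.

Lemma lint_dct (f_ : nat -> 'rV[R]_n -> R) f g : (forall k, lmeas (f_ k)) ->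
  (forall x, f_ k x @[k --> \oo] --> f x) -> (forall k x, `|f_ k x| <= g x) ->
  lintble g -> lintble f /\ lint (f_ k) @[k --> \oo] --> lint f.
Proof.
move=> mf ff fg gi.
have mF : lmeas f.
  by apply: (@measurable_fun_cvg _ T R setT (f_ : nat -> T -> R) f) => [k|x _]; [exact: mf|exact: ff].
have fle x : `|f x| <= g x.
  have cv : `|f_ k x| @[k --> \oo] --> `|f x| by apply: cvg_norm; exact: ff.
  by rewrite -(cvg_lim _ cv)//; apply: limr_le; [exact: cvgP cv|apply: nearW => k; exact: fg].
have fi : lintble f by exact: lintble_le gi.
have fki k : lintble (f_ k) by exact: lintble_le gi.
split => //.
have := @dominated_convergence _ _ _ mu setT measurableT
  (fun k => EFin \o (f_ k : T -> R)) (EFin \o (f : T -> R)) (EFin \o (g : T -> R)).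
case.
- by move=> k; apply/measurable_EFinP; exact: mf.
- by apply/measurable_EFinP; exact: mF.
- by apply/aeW => x _; apply: cvg_EFin; [exact: nearW|exact: ff].
- exact: gi.
- by apply/aeW => x k _ /=; rewrite lee_fin; exact: fg.
move=> _ _; rewrite -(lintE fi) => /fine_cvg; exact.
Qed.

Lemma lintble_indic (A : set T) : measurable A -> (leb n A < +oo)%E -> lintble \1_A.
Proof.
move=> mA Afin; apply/integrableP; split.
  by apply/measurable_EFinP; exact: measurable_indic.
rewrite (eq_integral (fun x : T => (\1_A x)%:E)); last first.
  by move=> x _ /=; rewrite ger0_norm.
by rewrite integral_indic// setIT.
Qed.

Lemma lint_indic (A : set T) : measurable A -> lint \1_A = fine (leb n A).
Proof. by move=> mA; rewrite /lint integral_indic// setIT. Qed.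

Lemma indic01 (A : set 'rV[R]_n) x : 0 <= (\1_A x : R) <= 1.
Proof. by rewrite indicE; case: (_ \in _); rewrite ?lexx ?ler01. Qed.

Lemma lmeas_indic (A : set T) : measurable A -> lmeas \1_A.
Proof. by move=> mA; exact: measurable_indic. Qed.

Lemma lintble_mul_indic (A : set T) f : measurable A -> lintble f ->
  lintble (fun x => \1_A x * f x).
Proof.
move=> mA; apply: (@lintble_bmul 1); first exact: lmeas_indic.
by move=> x; rewrite ger0_norm; case/andP: (indic01 A x).
Qed.

Lemma lintble_cc r f : continuous f -> supp_in r f -> lintble f.
Proof. exact: supp_in_integrable. Qed.

Lemma lmeas_cont f : continuous f -> lmeas f.
Proof. exact: continuous_meas. Qed.

End real_integral.

Section invariance.
Context {R : realType} {n : nat}.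
Local Notation T := (Rmeas R n).
Local Notation mu := (lebm R n).
Implicit Types (f : 'rV[R]_n -> R) (phi psi : 'rV[R]_n -> 'rV[R]_n).

Lemma preserving_measurable phi psi : cancel phi psi -> cancel psi phi ->
  (forall E, leb n (phi @^-1` E) = leb n E) -> measurable_fun setT (phi : T -> T).
Proof.
move=> fK gK H _ Y mY; rewrite setTI.
have cY : (leb n).-caratheodory Y by exact: mY.
suff : (leb n).-caratheodory (phi @^-1` Y) by [].
move=> X.
have H' E : leb n (psi @^-1` E) = leb n E.
  by rewrite -H; congr (leb n _); apply/seteqP; split => x /=; rewrite fK.
rewrite -[LHS]H' (cY (psi @^-1` X)) -(H' (X `&` _)) -(H' (X `&` ~` _)).
by congr (leb n _ + leb n _)%E; apply/seteqP; split => x /=; rewrite gK.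
Qed.

Lemma lint_preserving phi psi f : cancel phi psi -> cancel psi phi ->
  (forall E, leb n (phi @^-1` E) = leb n E) -> lintble f ->
  lintble (f \o phi) /\ lint (f \o phi) = lint f.
Proof.
move=> fK gK H fi; have mphi := preserving_measurable fK gK H.
have pE : pushforward mu (phi : T -> T) = lebm R n by apply/funext => E; exact: H.
have mf : measurable_fun setT (EFin \o (f : T -> R)) by exact: measurable_int fi.
have I2 : lintble (f \o phi).
  apply/integrableP; split.
    by apply: (measurableT_comp mf).
  have [_] := integrableP _ _ _ fi; rewrite -[X in integral X]pE.
  rewrite ge0_integral_pushforward.
  - by rewrite pE.
  - exact: mphi.
  - exact: measurableT.
  - by apply: measurableT_comp mf; exact: abse_measurable.
  - by move=> x _; exact: abse_ge0.
split => //; rewrite /lint; congr fine.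
rewrite -[in RHS]pE integral_pushforward.
- by [].
- exact: mphi.
- exact: mf.
- exact: I2.
- exact: measurableT.
Qed.

Lemma leb_preimage_shift (t : 'rV[R]_n) E : leb n ((fun x => x + t) @^-1` E) = leb n E.
Proof.
rewrite -(leb_shift ((fun x => x + t) @^-1` E) t); congr (leb n _).
apply/seteqP; split => [_ [x Ex <-]//|x Ex].
by exists (x - t); rewrite /= subrK.
Qed.

Lemma leb_preimage_opp (E : set 'rV[R]_n) :
  leb n ((fun x : 'rV[R]_n => - x) @^-1` E) = leb n E.
Proof.
transitivity (leb n [set (-1) *: x | x in E]).
  congr (leb n _); apply/seteqP; split => [x Ex|_ [x Ex <-]].
    by exists (- x) => //; rewrite scaleN1r opprK.
  by rewrite /= scaleN1r opprK.
by rewrite leb_scale ?oppr_eq0 ?oner_eq0// normrN1 expr1n mul1e.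
Qed.

Lemma lint_shift (t : 'rV[R]_n) f : lintble f ->
  lintble (fun x => f (x + t)) /\ lint (fun x => f (x + t)) = lint f.
Proof.
move=> fi; apply: (@lint_preserving (fun x => x + t) (fun x => x - t)) => //.
- by move=> x; rewrite addrK.
- by move=> x; rewrite subrK.
- exact: leb_preimage_shift.
Qed.

Lemma lint_reflect (t : 'rV[R]_n) f : lintble f ->
  lintble (fun x => f (t - x)) /\ lint (fun x => f (t - x)) = lint f.
Proof.
move=> fi; apply: (@lint_preserving (fun x => t - x) (fun x => t - x)) => //.
- by move=> x; rewrite subKr.
- by move=> x; rewrite subKr.
- move=> E; rewrite -[RHS](leb_preimage_opp) -[RHS](leb_preimage_shift (- t)).
  by congr (leb n _); apply/seteqP; split => x /=; rewrite opprB.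
Qed.

End invariance.

Section fubini.
Context {R : realType} {n : nat}.
Local Notation T := (Rmeas R n).
Local Notation mu := (lebm R n).

(** A bounded kernel with bounded support in [y] makes the product integrable on
    the product space, which Fubini's theorem requires. *)
Lemma lint_fubini (k : 'rV[R]_n -> 'rV[R]_n -> R) (u : 'rV[R]_n -> R) (M r : R) :
  measurable_fun setT (fun p : T * T => k p.1 p.2) ->
  (forall x y, `|k x y| <= M) -> (forall x y, r < `|y| -> k x y * u x = 0) ->
  lintble u ->
  [/\ (forall y, lintble (fun x => k x y * u x)),
      (forall x, lintble (fun y => k x y * u x)),
      lintble (fun x => lint (fun y => k x y * u x)),
      lintble (fun y => lint (fun x => k x y * u x)) &
      lint (fun x => lint (fun y => k x y * u x)) =
      lint (fun y => lint (fun x => k x y * u x))].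
Proof.
move=> mk kM kr ui.
have M0 : 0 <= M by exact: le_trans (kM 0 0).
have mky y : lmeas (fun x => k x y).
  by apply: (measurableT_comp mk (g := fun x : T => (x, y : T))); apply: measurable_fun_pair.
have mkx x : lmeas (fun y => k x y).
  by apply: (measurableT_comp mk (g := fun y : T => (x : T, y))); apply: measurable_fun_pair.
have Iy y : lintble (fun x => k x y * u x).
  by apply: (@lintble_bmul _ _ M) => // x; exact: kM.
have Ix x : lintble (fun y => k x y * u x).
  apply: (@bounded_supp_integrable _ _ _ (M * `|u x|) r).
  - by apply: (@measurable_funM _ T _ _ (k x) (cst (u x))); [exact: mkx|exact: measurable_cst].
  - by move=> y; rewrite normrM ler_wpM2r.
  - by move=> y; exact: kr.
pose F (p : T * T) : \bar R := (k p.1 p.2 * u p.1)%:E.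
have mu1 : measurable_fun setT (fun p : T * T => u p.1).
  by apply: (measurableT_comp (lintble_meas ui)); exact: measurable_fst.
have mF : measurable_fun setT F by apply/measurable_EFinP; exact: measurable_funM.
pose A : set T := [set x : 'rV[R]_n | `|x| <= r].
have mA : measurable A by apply: measurable_compact; exact: compact_sup_ball.
have Afin : (leb n A < +oo)%E by exact: leb_sup_ball_fin.
have iA : lintble \1_A by exact: lintble_indic.
have FI : ((mu \x mu)%E).-integrable setT F.
  apply/(integrable12ltyP mu mu mF).
  apply: (@le_lt_trans _ _ (\int[mu]_x ((M * lint \1_A) * `|u x|)%:E)%E); last first.
    have := lintbleZ (M * lint \1_A) (lintble_abs ui) => /lintE <-.
    by rewrite ltry.
  apply: ge0_le_integral; [exact: measurableT|..].
  - by move=> x _; apply: integral_ge0 => y _; exact: abse_ge0.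
  - rewrite (_ : (fun x => _) = (fun x => (lint (fun y => `|k x y * u x|))%:E)).
      have mabs : measurable_fun setT (fun p : T * T => `|F p|%E).
        by apply: measurableT_comp mF; exact: abse_measurable.
      have := @measurable_fun_fubini_tonelli_F _ _ _ _ _ mu (fun p : T * T => `|F p|%E) mabs (fun p => abse_ge0 _).
      apply: eq_measurable_fun => x _.
      by rewrite lintE//; exact: lintble_abs.
    by apply/funext => x; rewrite lintE//; exact: lintble_abs.
  - have := lintbleZ (M * lint \1_A) (lintble_abs ui).
    exact: measurable_int.
  move=> x _; rewrite /F/=.
  have -> : (\int[mu]_y `|(k x y * u x)%:E| = (lint (fun y => `|k x y * u x|))%:E)%E.
    by rewrite lintE//; exact: lintble_abs.
  rewrite lee_fin mulrAC -lintZ//; apply: lint_le.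
  - exact: lintble_abs.
  - exact: lintbleZ.
  move=> y; rewrite indicE; case: (boolP (y \in A)) => [_|].
    by rewrite mulr1 normrM ler_wpM2r.
  rewrite notin_setE /A/= => /negP; rewrite -ltNge => yr.
  by rewrite kr// normr0 mulr0.
have JE x : (\int[mu]_y F (x, y) = (lint (fun y => k x y * u x))%:E)%E by rewrite lintE.
have JE' y : (\int[mu]_x F (x, y) = (lint (fun x => k x y * u x))%:E)%E by rewrite lintE.
have F1 : lintble (fun x => lint (fun y => k x y * u x)).
  have := @integrable_fubini_F _ _ _ _ _ mu mu F FI.
  by rewrite (_ : fubini_F mu F = EFin \o (fun x : T => lint (fun y => k x y * u x)));
    last by apply/funext => x; exact: JE.
have G1 : lintble (fun y => lint (fun x => k x y * u x)).
  apply: (@bounded_supp_integrable _ _ _ (M * lint (fun x => `|u x|)) r).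
  - have := @measurable_fubini_G _ _ _ _ _ mu mu F FI.
    rewrite (_ : fubini_G mu F = EFin \o (fun y : T => lint (fun x => k x y * u x))).
      by move/measurable_EFinP.
    by apply/funext => y; exact: JE'.
  - move=> y; apply: (le_trans (lint_abs (Iy y))); rewrite -lintZ; last exact: lintble_abs.
    apply: lint_le; [exact: lintble_abs|by apply: lintbleZ; exact: lintble_abs|].
    by move=> x; rewrite normrM ler_wpM2r.
  - move=> y yr; apply: etrans lint0; apply: lint_ext => x; exact: kr.
split; [exact: Iy|exact: Ix|exact: F1|exact: G1|].
have := @Fubini _ _ _ _ _ mu mu F FI; rewrite /lint => H; congr fine.
rewrite (eq_integral (fun x => (\int[mu]_y F (x, y))%E)); last by move=> x _; rewrite JE.
rewrite H; apply: eq_integral => y _; exact: JE'.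
Qed.

End fubini.

(** * A sharp Sobolev-type inequality *)

Section cheeger.
Context {R : realType} {n : nat}.
Local Notation T := (Rmeas R n).
Local Notation mu := (lebm R n).

Lemma continuous_superlevel_open (f : 'rV[R]_n -> R) (t : R) : continuous f ->
  open [set x | t < f x].
Proof.
move=> cf; apply: (@open_comp _ _ f [set s | t < s]); last exact: open_gt.
by move=> x _; exact: cf.
Qed.

(** The sharp Sobolev-type inequality for functions supported in a small set:
    thickening the superlevel sets of [g] by [e] raises the integral of [g] at
    the isoperimetric rate, and by at most [e] times the integral of any [H]
    that bounds the slope of [g]. *)
Lemma cheeger_inequality (g H : 'rV[R]_n -> R) (r w C : R) : (0 < n)%N ->
  continuous g -> continuous H -> (forall y, 0 <= H y) ->
  supp_in r g -> supp_in r H -> 0 <= C ->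
  (forall y z, `|g z| <= `|g y| + enorm (z - y) * H y + C * enorm (z - y) ^+ 2) ->
  0 < w -> (leb n [set y | (g y != 0)%R] <= (omega R n * w ^+ n)%:E)%E ->
  n%:R * lint (fun y => `|g y|) <= w * lint H.
Proof.
move=> n0 cg cH H0 gr Hr C0 gH w0 Sw.
pose E (t : R) : set 'rV[R]_n := [set y | t < `|g y|].
have cga := norm_continuous_comp cg.
have oE t : open (E t) by exact: continuous_superlevel_open.
have SE : [set y | g y != 0] = E 0.
  by apply/seteqP; split => y; rewrite /E/= normr_gt0.
have mS : measurable (E 0%R : set T) by exact: measurable_open.
have Sfin : leb n (E 0%R) \is a fin_num.
  rewrite ge0_fin_numE ?leb_ge0//; apply: (@le_lt_trans _ _ (omega R n * w ^+ n)%:E).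
    by rewrite -SE.
  by rewrite ltry.
have Es t : 0 <= t -> (leb n (E t) <= (omega R n * w ^+ n)%:E)%E.
  by move=> t0; apply: le_trans Sw; rewrite SE; apply: le_leb => y; exact: le_lt_trans.
pose B : set T := [set y : 'rV[R]_n | `|y| <= r + 1].
have mB : measurable B by apply: measurable_compact; exact: compact_sup_ball.
have Bfin : (leb n B < +oo)%E by exact: leb_sup_ball_fin.
have iB : lintble \1_B by exact: lintble_indic.
have gar : supp_in r (fun y => `|g y|) by move=> y /gr ->; rewrite normr0.
have ig : lintble (fun y => `|g y|) by exact: lintble_cc gar.
have iH : lintble H by exact: lintble_cc Hr.
set A := lint _; set h := lint H; set b := lint \1_B.
have B1 y (u : R) : (r < `|y| -> u = 0) -> \1_B y * u = u.
  move=> yr; have [/yr ->|yr'] := ltP r `|y|; first by rewrite mulr0.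
  by rewrite indicE mem_set ?mul1r// /B/=; apply: le_trans yr' _; rewrite lerDl.
pose G (e : R) y : R := `|g y| + e * H y + C * e ^+ 2 * \1_B y.
have iG e : lintble (G e).
  by apply: lintbleD; [apply: lintbleD => //; exact: lintbleZ|exact: lintbleZ].
have lG e : lint (G e) = A + e * h + C * e ^+ 2 * b.
  rewrite lintD; [|by apply: lintbleD => //; exact: lintbleZ|exact: lintbleZ].
  by rewrite lintD ?lintZ//; exact: lintbleZ.
have G0 e : 0 <= e -> forall y, 0 <= G e y.
  move=> e0 y; have /andP[b0 _] := indic01 B y.
  by rewrite /G !addr_ge0// !mulr_ge0// exprn_ge0.
have thick (e t : R) : 0 < e -> e < 1 -> 0 <= t ->
    ((1 + n%:R * e / w)%:E * leb n (E t) <= leb n [set y | (t < G e y)%R])%E.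
  move=> e0 e1 t0; apply: (le_trans (leb_thicken_ge n0 (oE t) w0 e0 (Es t t0))).
  apply: le_leb => _ [y [u [Ey ue ->]]] /=.
  have {}ue : enorm u < e by move: ue; rewrite /eball/= subr0.
  have yr : `|y| <= r.
    rewrite leNgt; apply/negP => /gr gy.
    by move: Ey; rewrite /E/= gy normr0 ltNge t0.
  apply: (lt_le_trans Ey); apply: (le_trans (gH (y + u) y)).
  have eu : enorm (y - (y + u)) = enorm u by rewrite opprD addNKr enormN.
  rewrite eu /G indicE mem_set; last first.
    rewrite /B/=; apply: (le_trans (ler_normD _ _)); apply: lerD => //.
    by apply: (le_trans (norm_le_enorm _)); apply: ltW; exact: lt_trans e1.
  rewrite mulr1; apply: lerD; last first.
    by apply: ler_wpM2l => //; rewrite ler_pXn2r ?nnegrE ?enorm_ge0//; exact: ltW.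
  by rewrite lerD2l; apply: ler_wpM2r => //; exact: ltW.
have [M M0 gM] := supp_in_bounded cg gr.
have S0 : 0 <= fine (leb n (E 0%R)) by rewrite fine_ge0 ?leb_ge0.
have key (e : R) (m : nat) : 0 < e -> e < 1 -> (0 < m)%N ->
    (1 + n%:R * e / w) * A <= lint (G e) + (1 + n%:R * e / w) * fine (leb n (E 0%R)) / m%:R.
  move=> e0 e1 m0; set c := 1 + _.
  have c0 : 0 <= c by rewrite /c addr_ge0// divr_ge0 ?mulr_ge0// ltW.
  have m0' : (0 : R) < m%:R by rewrite ltr0n.
  pose K := (Num.truncn (m%:R * M)).+1.
  have lay : (\int[mu]_x (m%:R * `|g x|)%:E <=
      \sum_(k < K) leb n (E (k.+1%:R / m%:R)%R) + leb n (E 0%R))%E.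
    have := @layer_ge R n (fun x => m%:R * `|g x|) K (E 0%R).
    rewrite /mu/lebm; set X := (_ + _)%E; set Y := (_ + _)%E.
    have -> : X = Y.
      congr (_ + _)%E; apply: eq_bigr => k _; congr (leb n _).
      by apply/seteqP; split => x /=; rewrite /E/= ltr_pdivrMr// mulrC.
    apply.
    - exact: lintble_meas (lintbleZ _ ig).
    - move=> x; rewrite mulr_ge0//=; apply: (@le_trans _ _ (m%:R * M)).
        by rewrite ler_wpM2l.
      exact/ltW/truncnS_gt.
    - exact: mS.
    - move=> x; rewrite /E/= => /negP; rewrite normr_gt0 negbK => /eqP ->.
      by rewrite normr0 mulr0.
  have lay2 : (\sum_(k < K) leb n [set y | (k.+1%:R / m%:R < G e y)%R] <=
      \int[mu]_x (m%:R * G e x)%:E)%E.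
    have := @layer_le R n (fun x => m%:R * G e x) K; rewrite /mu/lebm.
    set X := (\sum_(k < K) _)%E; set Y := (\sum_(k < K) _)%E.
    have -> : X = Y.
      apply: eq_bigr => k _; congr (leb n _).
      by apply/seteqP; split => x /=; rewrite ltr_pdivrMr// mulrC.
    apply.
    - exact: lintble_meas (lintbleZ _ (iG e)).
    - by move=> x; rewrite mulr_ge0// G0// ltW.
  move: lay; rewrite -(lintE (lintbleZ m%:R ig)) lintZ// => lay.
  move: lay2; rewrite -(lintE (lintbleZ m%:R (iG e))) lintZ// => lay2.
  have : (c%:E * (m%:R * A)%:E <= (m%:R * lint (G e))%:E + c%:E * leb n (E 0%R))%E.
    apply: (@le_trans _ _ (c%:E * (\sum_(k < K) leb n (E (k.+1%:R / m%:R)%R) + leb n (E 0%R)))%E).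
      by apply: lee_wpmul2l => //; rewrite lee_fin.
    rewrite ge0_muleDr ?leb_ge0//; last by apply: sume_ge0 => k _; exact: leb_ge0.
    apply: leeD => //; rewrite ge0_sume_distrr; last by move=> k _; exact: leb_ge0.
    apply: le_trans lay2; apply: lee_sum => k _; exact: thick.
  rewrite -(fineK Sfin) -!EFinM -EFinD lee_fin => ineq.
  rewrite -(ler_pM2l m0') mulrDr mulrCA (mulrCA m%:R) divff ?mulr1 ?gt_eqF//.
have ineq (e : R) : 0 < e -> e < 1 -> n%:R * A <= w * h + w * C * e * b.
  move=> e0 e1.
  have : (1 + n%:R * e / w) * A <= lint (G e).
    have := @poly_lim_le R ((lint (G e))%:P + ((1 + n%:R * e / w) * fine (leb n (E 0%R)))%:P * 'X)
      ((1 + n%:R * e / w) * A).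
    rewrite !hornerE ?mulr0 ?addr0; apply => m m0; rewrite !hornerE.
    exact: key.
  rewrite lG => Hineq.
  have : n%:R * e / w * A <= e * h + C * e ^+ 2 * b by lra.
  have ew : 0 < w / e by rewrite divr_gt0.
  move=> /(ler_wpM2l (ltW ew)).
  rewrite (_ : w / e * (n%:R * e / w * A) = n%:R * A); last first.
    by field; rewrite !gt_eqF.
  rewrite (_ : w / e * (e * h + C * e ^+ 2 * b) = w * h + w * C * e * b)//.
  by field; rewrite !gt_eqF.
have := @poly_lim_le R ((w * h)%:P + (w * C * b)%:P * 'X) (n%:R * A - 0).
rewrite subr0 !hornerE ?mulr0 ?addr0; apply => m m0; rewrite !hornerE.
have [m1|m1] := leqP m 1; last first.
  rewrite mulrAC; apply: ineq; first by rewrite invr_gt0 ltr0n.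
  by rewrite invf_lt1 ?ltr1n// ltr0n.
have b0 : 0 <= b by apply: lint_ge0 => x; case/andP: (indic01 B x).
have -> : m = 1%N by apply/eqP; rewrite eqn_leq m1.
rewrite invr1 mulr1; have h2 : (2^-1 : R) <= 1 by rewrite invf_le1 ?ler1n ?ltr0n.
apply: (le_trans (ineq 2^-1 _ _)); rewrite ?invr_gt0 ?ltr0n ?invf_lt1 ?ltr1n//.
rewrite lerD2l mulrAC -[leRHS]mulr1; apply: ler_wpM2l => //.
by rewrite !mulr_ge0// ltW.
Qed.

End cheeger.

(** * A smooth bump on the line *)

Section one_variable.
Context {R : realType}.

(** A quadratic bound on the error of the affine approximation identifies the
    directional derivative. *)
Lemma quad_is_derive (V : normedModType R) (f : V -> R) (x v : V) (l C : R) :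
  (forall s, `|s| <= 1 -> `|f (x + s *: v) - f x - s * l| <= C * s ^+ 2) ->
  is_derive x v f l.
Proof.
move=> H; have C0 : 0 <= C.
  by have := H 1; rewrite normr1 expr1n mulr1 => /(_ (lexx _)); exact: le_trans.
have C1 : 0 < C + 1 by rewrite ltr_wpDl.
have cvgl : (fun h : R => h^-1 *: ((f \o shift x) (h *: v) - f x)) @ 0^' --> l.
  apply/cvgrPdist_lt => e e0; near=> h.
  have h0 : h != 0 by near: h; exact: nbhs_dnbhs_neq.
  have h1 : `|h| <= 1 by near: h; exact: dnbhs0_le.
  have he : `|h| < e / (C + 1) by near: h; apply: dnbhs0_lt; rewrite divr_gt0.
  have Hh := H h h1; rewrite -(real_normK (num_real h)) in Hh.
  have -> : l - h^-1 *: ((f \o shift x) (h *: v) - f x) =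
      - (f (x + h *: v) - f x - h * l) / h.
    by rewrite /= (addrC x) [_ *: _]mulrC; field.
  rewrite normrM normfV normrN ltr_pdivrMr ?normr_gt0//; apply: (le_lt_trans Hh).
  rewrite expr2 mulrA ltr_pM2r ?normr_gt0//.
  apply: (@le_lt_trans _ _ ((C + 1) * `|h|)); first by rewrite ler_wpM2r// lerDl.
  by rewrite mulrC -ltr_pdivlMr.
by apply: DeriveDef; [apply/cvg_ex; exists l|exact/cvg_lim].
Unshelve. all: by end_near. Qed.

Fixpoint Cn k (f : R -> R) : Prop := continuous f /\
  if k is k'.+1 then exists2 g : R -> R, (forall t, is_derive (t : R) 1 f (g t)) & Cn k' g else True.

Lemma Cn_continuous k f : Cn k f -> continuous f.
Proof. by case: k => [|k] []. Qed.

Lemma CnW k f : Cn k.+1 f -> Cn k f.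
Proof.
elim: k f => [|k IH] f [cf [g fg Cg]]; first by [].
by split => //; exists g => //; exact: IH.
Qed.

Lemma CnD k f g : Cn k f -> Cn k g -> Cn k (fun t => f t + g t).
Proof.
elim: k f g => [|k IH] f g [cf Hf] [cg Hg]; split => //.
- by move=> t; apply: cvgD; [exact: cf|exact: cg].
- by move=> t; apply: cvgD; [exact: cf|exact: cg].
have [f' ff' Cf'] := Hf; have [g' gg' Cg'] := Hg.
by exists (fun t => f' t + g' t); [move=> t; exact: is_deriveD|exact: IH].
Qed.

Lemma CnM k f g : Cn k f -> Cn k g -> Cn k (fun t => f t * g t).
Proof.
elim: k f g => [|k IH] f g Hf Hg.
  by split => // t; apply: cvgM; [exact: Hf.1|exact: Hg.1].
have Hf' := CnW Hf; have Hg' := CnW Hg.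
have [cf [f' ff' Cf']] := Hf; have [cg [g' gg' Cg']] := Hg.
split; first by move=> t; apply: cvgM; [exact: cf|exact: cg].
exists (fun t => f t * g' t + g t * f' t); first by move=> t; exact: is_deriveM.
by apply: CnD; exact: IH.
Qed.

Lemma Cn_cst k c : Cn k (fun=> c).
Proof.
elim: k c => [|k IH] c; split; [exact: cst_continuous|by []|exact: cst_continuous|].
by exists (fun=> 0); [move=> t; exact: is_derive_cst|exact: IH].
Qed.

Lemma Cn_affine k f a c : Cn k f -> Cn k (fun t => f (a * t + c)).
Proof.
have aff t : is_derive (t : R) 1 (fun t => a * t + c) a.
  apply: (@quad_is_derive R _ _ _ _ 0) => s _.
  rewrite (_ : _ - _ = 0) ?normr0 ?mul0r// [s *: 1]mulr1 mulrDr; ring.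
elim: k f => [|k IH] f [cf Hf]; split => //.
- by move=> t; apply: continuous_comp; [apply: differentiable_continuous; apply/derivable1_diffP; exact: ex_derive|exact: cf].
- by move=> t; apply: continuous_comp; [apply: differentiable_continuous; apply/derivable1_diffP; exact: ex_derive|exact: cf].
have [f' ff' Cf'] := Hf; exists (fun t => f' (a * t + c) * a).
  by move=> t; exact: (@is_derive1_comp _ f (fun t => a * t + c)).
by apply: CnM; [exact: IH|exact: Cn_cst].
Qed.

(** The classical flat function [exp (- 1 / t)], with a power of [1 / t] in front
    so that the family is stable under derivation up to linear combinations. *)
Definition flat (m : nat) (t : R) : R :=
  if t <= 0 then 0 else t^-1 ^+ m * expR (- t^-1).

Lemma flat_ge0 m t : 0 <= flat m t.
Proof.
rewrite /flat; have [_|t0] := leP t 0; first by [].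
by rewrite mulr_ge0 ?expR_ge0// exprn_ge0// invr_ge0 ltW.
Qed.

(** Since [expR s >= (s / k) ^+ k], the function is flat to second order at 0. *)
Lemma flat_le m t : flat m t <= m.+2%:R ^+ m.+2 * t ^+ 2.
Proof.
have c0 : 0 <= (m.+2%:R : R) ^+ m.+2 by apply: exprn_ge0; rewrite ler0n.
rewrite /flat; have [_|t0] := leP t 0; first by rewrite mulr_ge0// sqr_ge0.
have k0 : 0 < (m.+2%:R : R) by rewrite ltr0n.
have H : (t^-1 / m.+2%:R) ^+ m.+2 <= expR t^-1.
  have -> : t^-1 = m.+2%:R * (t^-1 / m.+2%:R) :> R by rewrite mulrC divfK ?gt_eqF.
  rewrite expRM_natl {1}(mulrC m.+2%:R) mulfK ?gt_eqF//.
  rewrite ler_pXn2r ?nnegrE ?expR_ge0 ?divr_ge0 ?invr_ge0 ?(ltW t0) ?(ltW k0)//.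
  by apply: le_trans (expR_ge1Dx _); rewrite lerDr.
have p0 : 0 < (t^-1 / m.+2%:R) ^+ m.+2 by rewrite exprn_gt0// divr_gt0// invr_gt0.
rewrite expRN; apply: (@le_trans _ _ (t^-1 ^+ m * ((t^-1 / m.+2%:R) ^+ m.+2)^-1)).
  rewrite ler_wpM2l ?exprn_ge0 ?invr_ge0 ?(ltW t0)//.
  by rewrite lef_pV2 ?posrE ?expR_gt0.
rewrite expr_div_n invf_div mulrCA; apply: ler_wpM2l => //.
rewrite -[in leLHS]addn2 exprD !exprVn; have := exprn_gt0 m t0.
set u := t ^+ m => u0; rewrite le_eqVlt; apply/orP; left; apply/eqP.
by field; rewrite !gt_eqF.
Qed.

Lemma flat_derive m t :
  is_derive (t : R) 1 (flat m) (- m%:R * flat m.+1 t + flat m.+2 t).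
Proof.
have [t0|t0] := leP t 0.
  rewrite {2 3}/flat t0 mulr0 addr0.
  apply: (@quad_is_derive R _ _ _ _ (m.+2%:R ^+ m.+2)) => s _.
  rewrite mulr0 subr0 {2}/flat t0 subr0 ger0_norm ?flat_ge0// [s *: 1]mulr1.
  have [ts|ts] := leP (t + s) 0.
    by rewrite /flat ts mulr_ge0 ?sqr_ge0// exprn_ge0// ler0n.
  apply: (le_trans (flat_le _ _)); apply: ler_wpM2l; first by rewrite exprn_ge0// ler0n.
  rewrite ler_pXn2r ?nnegrE ?(ltW ts)//; [lra|].
  by apply: le_trans (ltW ts) _; rewrite gerDr.
apply: (@near_eq_is_derive R R R (fun s : R => (s^-1) ^+ m * expR (- s^-1))).
  near=> s; have s0 : 0 < s by near: s; exact: lt_nbhsr.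
  by rewrite /flat leNgt s0.
have t0' : t != 0 by rewrite gt_eqF.
have dV : is_derive (t : R) 1 (fun s : R => s^-1) (- t^-1 ^+ 2).
  apply: is_derive_eq; first exact: (@is_deriveV _ id t 1 1).
  by rewrite [_ *: _]mulr1 exprVn.
have dX : is_derive (t : R) 1 (fun s : R => s^-1 ^+ m) (m%:R * t^-1 ^+ m.-1 * (- t^-1 ^+ 2)).
  by have := @is_deriveX R R (fun s : R => s^-1) m t 1 _ dV; rewrite exprfctE.
have dE : is_derive (t : R) 1 (fun s : R => expR (- s^-1)) (expR (- t^-1) * - (- t^-1 ^+ 2)).
  exact: (@is_derive1_comp _ expR (fun s : R => - s^-1)).
apply: is_derive_eq.
rewrite /flat leNgt t0 /GRing.scale /=.
case: m dX => [|m] _; rewrite ?expr0 /= ?exprS; ring.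
Unshelve. all: by end_near. Qed.

Lemma flat_Cn k m : Cn k (flat m).
Proof.
have cf m' : continuous (flat m').
  move=> t; apply: differentiable_continuous; apply/derivable1_diffP.
  exact: (@ex_derive _ _ _ _ _ _ _ (flat_derive m' t)).
elim: k m => [|k IH] m; split => //.
exists (fun t => - m%:R * flat m.+1 t + flat m.+2 t); first exact: flat_derive.
by apply: CnD; [apply: CnM; [exact: Cn_cst|]|]; exact: IH.
Qed.

Lemma Cn_derive f : (forall k, Cn k f) ->
  (forall t, is_derive (t : R) 1 f ('D_1 f t)) /\ forall k, Cn k ('D_1 f).
Proof.
move=> H; split.
  by move=> t; have [_ [g fg _]] := H 1%N; apply/derivableP; exact: (@ex_derive _ _ _ _ _ _ _ (fg t)).
move=> k; have [_ [g fg Cg]] := H k.+1.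
suff -> : 'D_1 f = g by [].
by apply/funext => t; exact: (@derive_val _ _ _ _ _ _ _ (fg t)).
Qed.

(** A smooth even bump on the line, given with all its derivatives. *)
Lemma smooth_bump : exists b : nat -> R -> R,
  [/\ forall k t, is_derive (t : R) 1 (b k) (b k.+1 t), forall k, continuous (b k),
      forall k t, 1 < `|t| -> b k t = 0, 
      forall t, 0 <= b 0%N t /\ b 0%N (- t) = b 0%N t &
      exists2 c, 0 < c & forall t, `|t| <= 2^-1 -> c <= b 0%N t].
Proof.
pose f (t : R) := flat 0 (1 + t) * flat 0 (1 - t).
have Cf k : Cn k f.
  apply: CnM.
    have := Cn_affine 1 1 (flat_Cn k 0); congr Cn; apply/funext => t; congr flat; ring.
  have := Cn_affine (-1) 1 (flat_Cn k 0); congr Cn; apply/funext => t; congr flat; ring.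
pose b k := iter k (fun g : R -> R => 'D_1 g) f.
have Cb k : forall k', Cn k' (b k).
  by elim: k => [//|k IH] k'; rewrite /b iterS; exact: (Cn_derive IH).2.
have db k t : is_derive (t : R) 1 (b k) (b k.+1 t).
  by rewrite /b iterS; exact: (Cn_derive (Cb k)).1.
have f1 (t : R) : 1 < `|t| -> f t = 0.
  move=> t1; rewrite /f /flat; have [t0|t0] := leP 0 t.
    rewrite ger0_norm// in t1; rewrite (_ : 1 - t <= 0) ?mulr0//; lra.
  rewrite ltr0_norm// in t1; rewrite (_ : 1 + t <= 0) ?mul0r//; lra.
exists b; split => //.
- by move=> k; exact: Cn_continuous (Cb k 0%N).
- elim=> [//|k IH] t t1; apply: etrans (derive_cst (V := R) (0 : R) t 1).
  rewrite /b iterS; apply: near_eq_derive; near=> s; apply: IH.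
  near: s; apply: (@open_nbhs_nbhs _ _ [set s : R | 1 < `|s|]); split => //.
  apply: (@open_comp _ _ (fun s : R => `|s|) [set u | 1 < u]); last exact: open_gt.
  by move=> x _; exact: norm_continuous.
- by move=> t; split; [rewrite mulr_ge0// flat_ge0|rewrite /b/= /f opprK mulrC].
pose c := expR (- 2) : R; exists (c * c); first by rewrite mulr_gt0// expR_gt0.
have H (u : R) : 2^-1 <= u -> c <= flat 0 u.
  move=> u2; have u0 : 0 < u by apply: lt_le_trans u2; rewrite invr_gt0.
  rewrite /flat (leNgt u) u0/= expr0 mul1r ler_expR lerN2.
  by rewrite -[leRHS]invrK lef_pV2 ?posrE// invr_gt0.
move=> t; rewrite ler_norml => /andP[t1 t2].
by apply: ler_pM; rewrite ?expR_ge0//; apply: H; lra.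
Unshelve. all: by end_near. Qed.

Lemma mvt_le (f f' : R -> R) (M t s : R) : (forall t, is_derive (t : R) 1 f (f' t)) ->
  (forall t, `|f' t| <= M) -> `|f (t + s) - f t| <= M * `|s|.
Proof.
move=> ff' f'M; have cf (i : interval R) : {within [set` i], continuous f}.
  by apply: derivable_within_continuous => x _; exact: (@ex_derive _ _ _ _ _ _ _ (ff' x)).
have [s0|s0] := leP 0 s.
  have [|c _ ->] := @MVT_segment _ f f' t (t + s) _ (fun x _ => ff' x) (cf _).
    by rewrite lerDl.
  by rewrite addrAC subrr add0r normrM ler_wpM2r.
have [|c _ E] := @MVT_segment _ f f' (t + s) t _ (fun x _ => ff' x) (cf _).
  by rewrite gerDl ltW.
by rewrite -normrN opprB E opprD addNKr normrM normrN ler_wpM2r.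
Qed.

Lemma mvt_quad (f f' f'' : R -> R) (M t s : R) : (forall t, is_derive (t : R) 1 f (f' t)) ->
  (forall t, is_derive (t : R) 1 f' (f'' t)) -> (forall t, `|f'' t| <= M) ->
  `|f (t + s) - f t - s * f' t| <= M * s ^+ 2.
Proof.
move=> ff' ff'' f''M; have M0 : 0 <= M by apply: le_trans (f''M 0).
have cf (i : interval R) : {within [set` i], continuous f}.
  by apply: derivable_within_continuous => x _; exact: (@ex_derive _ _ _ _ _ _ _ (ff' x)).
have key c : `|c - t| <= `|s| -> `|s * f' c - s * f' t| <= M * s ^+ 2.
  move=> cs; rewrite -mulrBr normrM -real_normK ?num_real// expr2 mulrCA.
  apply: ler_wpM2l => //; have := mvt_le t (c - t) ff'' f''M.
  by rewrite subrKC => h; apply: (le_trans h); exact: ler_wpM2l.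
have [s0|s0] := leP 0 s.
  have [|c] := @MVT_segment _ f f' t (t + s) _ (fun x _ => ff' x) (cf _).
    by rewrite lerDl.
  rewrite in_itv/= => /andP[c1 c2] ->.
  rewrite addrAC subrr add0r mulrC; apply: key.
  by rewrite !ger0_norm// ?subr_ge0//; lra.
have [|c] := @MVT_segment _ f f' (t + s) t _ (fun x _ => ff' x) (cf _).
  by rewrite gerDl ltW.
rewrite in_itv/= => /andP[c1 c2] E.
have -> : f (t + s) - f t = s * f' c by rewrite -opprB E; ring.
apply: key; rewrite (ltr0_norm s0) ler0_norm ?subr_le0 //; lra.
Qed.

End one_variable.

(** * Functions with bounded derivatives and quadratic error *)

Section taylor_class.
Context {R : realType} {n : nat}.
Implicit Types (x v : 'rV[R]_n) (f g : 'rV[R]_n -> R) (d e : 'I_n -> 'rV[R]_n -> R).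

Lemma sum_ord_const (c : R) : \sum_(i < n) c = n%:R * c.
Proof. by rewrite sumr_const card_ord mulr_natl. Qed.

Lemma contD f g : continuous f -> continuous g -> continuous (fun x => f x + g x).
Proof. by move=> cf cg x; apply: continuousD; [exact: cf|exact: cg]. Qed.

Lemma contN f : continuous f -> continuous (fun x => - f x).
Proof. by move=> cf x; apply: continuousN; exact: cf. Qed.

Lemma contM f g : continuous f -> continuous g -> continuous (fun x => f x * g x).
Proof. by move=> cf cg x; apply: continuousM; [exact: cf|exact: cg]. Qed.

Lemma contZ (c : R) f : continuous f -> continuous (fun x => c * f x).
Proof. by move=> cf; apply: contM => //; exact: cst_continuous. Qed.

Lemma cont_sum (I : Type) (s : seq I) (P : pred I) (F : I -> 'rV[R]_n -> R) :
  (forall i, continuous (F i)) -> continuous (fun x => \sum_(i <- s | P i) F i x).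
Proof.
move=> cF; elim: s => [|i s IH].
  rewrite (_ : (fun _ => _) = fun=> 0); first exact: cst_continuous.
  by apply/funext => x; rewrite big_nil.
rewrite (_ : (fun _ => _) = fun x => (P i)%:R * F i x + \sum_(i <- s | P i) F i x).
  by apply: contD => //; exact: contZ.
by apply/funext => x; rewrite big_cons; case: (P i); rewrite ?mul1r// mul0r add0r.
Qed.

Lemma cont_prod (I : Type) (s : seq I) (P : pred I) (F : I -> 'rV[R]_n -> R) :
  (forall i, continuous (F i)) -> continuous (fun x => \prod_(i <- s | P i) F i x).
Proof.
move=> cF; elim: s => [|i s IH].
  rewrite (_ : (fun _ => _) = fun=> 1); first exact: cst_continuous.
  by apply/funext => x; rewrite big_nil.
case Pi : (P i); last first.
  rewrite (_ : (fun _ => _) = fun x => \prod_(i <- s | P i) F i x)//.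
  by apply/funext => x; rewrite big_cons Pi.
rewrite (_ : (fun _ => _) = fun x => F i x * \prod_(i <- s | P i) F i x).
  exact: contM.
by apply/funext => x; rewrite big_cons Pi.
Qed.

Lemma cont_affine (a : R) (z : 'rV[R]_n) : continuous (fun x : 'rV[R]_n => a *: x + z).
Proof.
apply: (@lip_continuous _ _ _ _ `|a|) => x y.
by rewrite opprD addrACA subrr addr0 -scalerBr normrZ.
Qed.

(** Bounded functions with bounded continuous partial derivatives [d j] and a
    uniform second order error in the affine approximation.  This class is
    stable under all the constructions below by mere algebra. *)
Definition C11 f d := exists M, [/\ forall x, `|f x| <= M, forall j x, `|d j x| <= M,
  forall j, continuous (d j) &
  forall x v, `|f (x + v) - f x - \sum_j v 0 j * d j x| <= M * `|v| ^+ 2].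

Lemma C11_lip f d : C11 f d ->
  exists2 L, 0 <= L & forall x v, `|f (x + v) - f x| <= L * `|v|.
Proof.
move=> [M [fM dM _ tM]]; have M0 : 0 <= M by apply: le_trans (fM 0).
exists (n%:R * M + M + 2 * M); first by rewrite !addr_ge0// mulr_ge0.
move=> x v; have [v1|v1] := leP `|v| 1; last first.
  apply: (@le_trans _ _ (2 * M)).
    by apply: (le_trans (ler_normB _ _)); rewrite mulr_natl mulr2n lerD.
  apply: (@le_trans _ _ (2 * M * `|v|)); first by rewrite ler_peMr ?(ltW v1)// mulr_ge0.
  by rewrite ler_wpM2r// lerDr addr_ge0// mulr_ge0.
have -> : f (x + v) - f x = f (x + v) - f x - \sum_j v 0 j * d j x + \sum_j v 0 j * d j x.
  by rewrite subrK.
have S : `|\sum_j v 0 j * d j x| <= n%:R * M * `|v|.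
  apply: (le_trans (ler_norm_sum _ _ _)); apply: (@le_trans _ _ (\sum_(j < n) M * `|v|)).
    apply: ler_sum => j _; rewrite normrM mulrC; apply: ler_pM => //; exact: coord_norm.
  by rewrite sum_ord_const mulrA.
apply: (le_trans (ler_normD _ _)); apply: (le_trans (lerD (tM x v) S)).
rewrite expr2 mulrA -mulrDl; apply: ler_wpM2r => //.
have : M * `|v| <= M by rewrite ler_piMr.
lra.
Qed.

Lemma C11_cont f d : C11 f d -> continuous f.
Proof.
move=> /C11_lip[L L0 fL]; apply: (@lip_continuous _ _ R^o _ L) => x y.
by rewrite -{1}(subrKC y x); exact: fL.
Qed.

Lemma C11_dcont f d : C11 f d -> forall j, continuous (d j).
Proof. by case=> M []. Qed.

Arguments C11_dcont {f d} _ j.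

Lemma C11_derive f d x j : C11 f d -> is_derive x (delta_mx 0 j) f (d j x).
Proof.
move=> [M [fM dM _ tM]]; have M0 : 0 <= M by apply: le_trans (fM 0).
apply: (@quad_is_derive _ _ _ _ _ _ M) => s _.
have := tM x (s *: delta_mx 0 j); rewrite (bigD1 j)//= big1 ?addr0; last first.
  by move=> i ij; rewrite !mxE eqxx (negPf ij) mulr0 mul0r.
rewrite !mxE !eqxx mulr1 => h; apply: (le_trans h); apply: ler_wpM2l => //.
rewrite normrZ exprMn real_normK ?num_real// ler_piMr ?sqr_ge0//.
rewrite expr_le1// ?normr_ge0//; apply: norm_coord_le => // i.
by rewrite mxE eqxx; case: (_ == _); rewrite ?normr1 ?normr0.
Qed.

Lemma C11_ext f g d e : f =1 g -> (forall j, d j =1 e j) -> C11 f d -> C11 g e.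
Proof.
move=> /funext <- de; suff -> : d = e by [].
by apply/funext => j; apply/funext => x; exact: de.
Qed.

Lemma C11_supp r f d j : C11 f d -> supp_in r f -> supp_in r (d j).
Proof.
move=> fd fr x xr; have h := C11_derive x j fd.
rewrite -(@derive_val _ _ _ _ _ _ _ h).
apply: etrans (derive_cst (V := 'rV[R]_n) (0 : R) x (delta_mx 0 j)).
apply: near_eq_derive; near=> y; apply: fr; near: y.
by apply: (@cvgr_gt _ _ (nbhs x) _ (fun y : 'rV[R]_n => `|y|) `|x|) => //; exact: norm_continuous.
Unshelve. all: by end_near. Qed.

Lemma C11_cst c : C11 (fun=> c) (fun _ _ => 0).
Proof.
exists `|c|; split => //.
- by move=> j x; rewrite normr0.
- by move=> j; exact: cst_continuous.
move=> x v; rewrite subrr sub0r big1 ?oppr0 ?normr0; last by move=> j _; rewrite mulr0.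
by rewrite mulr_ge0// exprn_ge0.
Qed.

Lemma C11M f d g e : C11 f d -> C11 g e ->
  C11 (fun x => f x * g x) (fun j x => d j x * g x + f x * e j x).
Proof.
move=> fd ge; have [L L0 fL] := C11_lip fd; have [L' L'0 gL'] := C11_lip ge.
have cf := C11_cont fd; have cg := C11_cont ge.
move: fd ge => [M [fM dM dc tM]] [M' [gM eM ec tM']].
have M0 : 0 <= M by apply: le_trans (fM 0).
have M'0 : 0 <= M' by apply: le_trans (gM 0).
have MM : 0 <= M * M' by rewrite mulr_ge0.
have LL : 0 <= L * L' by rewrite mulr_ge0.
exists (M * M' + M * M' + L * L'); split.
- move=> x; rewrite normrM; apply: (@le_trans _ _ (M * M')); first exact: ler_pM.
  by rewrite -addrA lerDl addr_ge0.
- move=> j x; apply: (@le_trans _ _ (M * M' + M * M')); last by rewrite lerDl.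
  by apply: (le_trans (ler_normD _ _)); apply: lerD; rewrite normrM; exact: ler_pM.
- by move=> j; apply: contD; exact: contM.
move=> x v.
set D := \sum_j v 0 j * d j x; set E := \sum_j v 0 j * e j x.
have -> : \sum_j v 0 j * (d j x * g x + f x * e j x) = D * g x + f x * E.
  rewrite /D /E mulr_suml mulr_sumr -big_split/=; apply: eq_bigr => j _; ring.
have -> : f (x + v) * g (x + v) - f x * g x - (D * g x + f x * E) =
    (f (x + v) - f x - D) * g x + f x * (g (x + v) - g x - E) +
    (f (x + v) - f x) * (g (x + v) - g x) by ring.
apply: (le_trans (ler_normD _ _)); rewrite [leRHS]mulrDl; apply: lerD; last first.
  by rewrite normrM expr2 mulrACA; exact: ler_pM.
apply: (le_trans (ler_normD _ _)); rewrite [leRHS]mulrDl; apply: lerD; rewrite normrM.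
  by rewrite mulrAC; apply: ler_pM => //; exact: tM.
by rewrite -mulrA; apply: ler_pM => //; exact: tM'.
Qed.

Lemma C11Z c f d : C11 f d -> C11 (fun x => c * f x) (fun j x => c * d j x).
Proof.
move=> fd; apply: C11_ext (C11M (C11_cst c) fd) => // j x.
by rewrite mul0r add0r.
Qed.

Lemma C11_prod (I : eqType) (s : seq I) (F : I -> 'rV[R]_n -> R)
    (D : I -> 'I_n -> 'rV[R]_n -> R) : uniq s -> (forall i, C11 (F i) (D i)) ->
  C11 (fun x => \prod_(i <- s) F i x)
      (fun j x => \sum_(i <- s) D i j x * \prod_(k <- s | k != i) F k x).
Proof.
move=> us FD; elim: s us => [_|i s IH /= /andP[iS us]].
  by apply: C11_ext (C11_cst 1) => [x|j x]; rewrite big_nil.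
apply: C11_ext (C11M (FD i) (IH us)) => [x|j x]; rewrite big_cons//=.
congr (_ * _ + _).
  rewrite big_cons eqxx/= big_seq_cond [RHS]big_seq_cond; apply: eq_bigl => k.
  by rewrite andbT; case: eqVneq => [->|]; rewrite ?(negPf iS) ?andbT.
rewrite mulr_sumr; apply: eq_big_seq => k ks.
rewrite big_cons ifT; first by rewrite mulrCA.
by apply: contraNneq iS => ->.
Qed.

Lemma C11_affine f d (a : R) (z : 'rV[R]_n) : C11 f d ->
  C11 (fun x => f (a *: x + z)) (fun j x => a * d j (a *: x + z)).
Proof.
move=> [M [fM dM dc tM]]; have M0 : 0 <= M by apply: le_trans (fM 0).
exists (M + `|a| * M + M * a ^+ 2); have a2 := sqr_ge0 a; split.
- by move=> x; apply: (le_trans (fM _)); rewrite -addrA lerDl addr_ge0// mulr_ge0.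
- move=> j x; rewrite normrM; apply: (@le_trans _ _ (`|a| * M)); first exact: ler_wpM2l.
  by rewrite addrAC lerDr addr_ge0// mulr_ge0.
- move=> j; apply: contZ => x.
  apply: (@continuous_comp _ _ _ (fun x => a *: x + z) (d j)); last exact: dc.
  exact: cont_affine.
move=> x v; have := tM (a *: x + z) (a *: v).
have -> : a *: (x + v) + z = a *: x + z + a *: v by rewrite scalerDr addrAC.
rewrite (eq_bigr (fun j => v 0 j * (a * d j (a *: x + z)))); last first.
  by move=> j _; rewrite mxE -mulrA mulrCA.
move=> h; apply: (le_trans h); rewrite normrZ exprMn real_normK ?num_real// mulrA.
by apply: ler_wpM2r; rewrite ?exprn_ge0// lerDr addr_ge0// mulr_ge0.
Qed.

Lemma C11_coord (h h' h'' : R -> R) (M : R) (i : 'I_n) :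
  (forall t : R, is_derive t 1 h (h' t)) -> (forall t : R, is_derive t 1 h' (h'' t)) ->
  continuous h' -> (forall t, `|h t| <= M) -> (forall t, `|h' t| <= M) ->
  (forall t, `|h'' t| <= M) ->
  C11 (fun x => h (x 0 i)) (fun j x => (i == j)%:R * h' (x 0 i)).
Proof.
move=> hh hh' ch' hM h'M h''M; have M0 : 0 <= M by apply: le_trans (hM 0).
exists M; split => //.
- by move=> j x; case: (_ == _); rewrite ?mul1r// mul0r normr0.
- move=> j; apply: contZ => x.
  by apply: (@continuous_comp _ _ _ (fun x : 'rV[R]_n => x 0 i) h'); [exact: coord_continuous|exact: ch'].
move=> x v; rewrite (bigD1 i)//= eqxx mul1r big1 ?addr0; last first.
  by move=> j ji; rewrite eq_sym (negPf ji) mul0r mulr0.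
rewrite mxE; apply: (le_trans (mvt_quad _ _ hh hh' h''M)); apply: ler_wpM2l => //.
by rewrite -real_normK ?num_real// ler_pXn2r ?nnegrE//; exact: coord_norm.
Qed.

Lemma C11_comp (h : 'rV[R]_n -> R) (dh : 'I_n -> 'rV[R]_n -> R)
    (F : 'I_n -> 'rV[R]_n -> R) (D : 'I_n -> 'I_n -> 'rV[R]_n -> R) :
  C11 h dh -> (forall l, C11 (F l) (D l)) ->
  C11 (fun x => h (\row_l F l x)) (fun j x => \sum_l dh l (\row_l F l x) * D l j x).
Proof.
move=> hd FD; have cF l := C11_cont (FD l).
have [L L0 FL] : exists2 L, 0 <= L & forall x v, `|\row_l F l (x + v) - \row_l F l x| <= L * `|v|.
  have /choice[Lf HL] : forall l, exists L, 0 <= L /\ forall x v, `|F l (x + v) - F l x| <= L * `|v|.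
    by move=> l; have [L L0 H] := C11_lip (FD l); exists L.
  exists (\sum_l Lf l); first by apply: sumr_ge0 => l _; case: (HL l).
  have S0 : 0 <= \sum_l Lf l by apply: sumr_ge0 => l _; case: (HL l).
  move=> x v; apply: norm_coord_le => [|l]; first by rewrite mulr_ge0.
  rewrite !mxE; have [Ll0 H] := HL l; apply: (le_trans (H x v)); apply: ler_wpM2r => //.
  by rewrite (bigD1 l)//= lerDl sumr_ge0// => k _; case: (HL k).
have [M M0 FM] : exists2 M, 0 <= M & forall l, [/\ forall j x, `|D l j x| <= M &
    forall x v, `|F l (x + v) - F l x - \sum_j v 0 j * D l j x| <= M * `|v| ^+ 2].
  have /choice[Mf HM] : forall l, exists M, [/\ 0 <= M, forall j x, `|D l j x| <= M &
    forall x v, `|F l (x + v) - F l x - \sum_j v 0 j * D l j x| <= M * `|v| ^+ 2].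
    move=> l; have [M [f1 d1 _ t1]] := FD l; exists M; split => //.
    exact: le_trans (f1 0).
  have S0 : forall l, 0 <= Mf l by move=> l; case: (HM l).
  have leS l : Mf l <= \sum_l Mf l by rewrite (bigD1 l)//= lerDl sumr_ge0.
  exists (\sum_l Mf l); first by apply: sumr_ge0.
  move=> l; have [_ H1 H2] := HM l; split.
    by move=> j x; exact: le_trans (H1 j x) (leS l).
  by move=> x v; apply: (le_trans (H2 x v)); apply: ler_wpM2r; rewrite ?exprn_ge0.
case: hd => [Mh [hM dhM dhc th]]; have Mh0 : 0 <= Mh by apply: le_trans (hM 0).
exists (Mh + n%:R * (Mh * M) + Mh * L ^+ 2).
have nMM : 0 <= n%:R * (Mh * M) by rewrite !mulr_ge0.
have ML : 0 <= Mh * L ^+ 2 by rewrite mulr_ge0// sqr_ge0.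
have cFr : continuous (fun x => \row_l F l x).
  apply: (@lip_continuous _ _ _ _ L) => x y; rewrite -{1}(subrKC y x); exact: FL.
split.
- by move=> x; apply: (le_trans (hM _)); rewrite -addrA lerDl addr_ge0.
- move=> j x; apply: (@le_trans _ _ (n%:R * (Mh * M))); last first.
    by rewrite addrAC lerDr addr_ge0.
  apply: (le_trans (ler_norm_sum _ _ _)); rewrite -sum_ord_const.
  apply: ler_sum => l _; rewrite normrM; apply: ler_pM => //.
  by have [H _] := FM l; exact: H.
- move=> j; apply: cont_sum => l; apply: (@contM (fun x => dh l (\row_l F l x)) (D l j)) => [x|]; last by case: (FD l) => M' [_ _ H _]; exact: H.
  by apply: (@continuous_comp _ _ _ (fun x => \row_l F l x) (dh l)); [exact: cFr|exact: dhc].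
move=> x v; set y := \row_l F l x; set w := \row_l F l (x + v) - y.
have -> : \row_l F l (x + v) = y + w by rewrite /w subrKC.
have -> : \sum_j v 0 j * (\sum_l dh l y * D l j x) =
    \sum_l dh l y * \sum_j v 0 j * D l j x.
  rewrite (eq_bigr (fun j => \sum_l dh l y * (v 0 j * D l j x))); last first.
    by move=> j _; rewrite mulr_sumr; apply: eq_bigr => l _; rewrite mulrCA.
  by rewrite exchange_big/=; apply: eq_bigr => l _; rewrite mulr_sumr.
set S := \sum_l dh l y * _.
have -> : h (y + w) - h y - S = (h (y + w) - h y - \sum_l w 0 l * dh l y) +
    \sum_l dh l y * (w 0 l - \sum_j v 0 j * D l j x).
  rewrite [X in _ = _ + X](_ : _ = \sum_l w 0 l * dh l y - S); first ring.
  rewrite /S -sumrB; apply: eq_bigr => l _; ring.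
apply: (le_trans (ler_normD _ _)).
rewrite [leRHS](_ : _ = (Mh * L ^+ 2 * `|v| ^+ 2 + Mh * `|v| ^+ 2) +
  n%:R * (Mh * M) * `|v| ^+ 2); last ring.
apply: lerD.
  apply: (le_trans (th y w)); rewrite -mulrA -exprMn.
  apply: (@le_trans _ _ (Mh * (L * `|v|) ^+ 2)).
    apply: ler_wpM2l => //; rewrite ler_pXn2r ?nnegrE ?mulr_ge0//; exact: FL.
  by rewrite lerDl mulr_ge0// exprn_ge0.
apply: (le_trans (ler_norm_sum _ _ _)); rewrite -mulrA -sum_ord_const.
apply: ler_sum => l _; rewrite normrM -[leRHS]mulrA; apply: ler_pM => //.
by have [_ H] := FM l; have := H x v; rewrite /w /y !mxE.
Qed.

(** The integral of a derivative vanishes: a translation in a coordinate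
    direction does not change the integral, and the error of the affine
    approximation is quadratic on a bounded set. *)
Lemma lint_derive0 r f d j : C11 f d -> supp_in r f ->
  lintble (d j) /\ lint (d j) = 0.
Proof.
move=> fd fr; have cf := C11_cont fd; have cd := C11_dcont fd j.
have dr := C11_supp j fd fr.
have idj : lintble (d j) by exact: lintble_cc cd dr.
have iff : lintble f by exact: lintble_cc cf fr.
split => //; case: fd => M [fM dM dc tM]; have M0 : 0 <= M by apply: le_trans (fM 0).
pose B : set (Rmeas R n) := [set y : 'rV[R]_n | `|y| <= r + 1].
have mB : measurable B by apply: measurable_compact; exact: compact_sup_ball.
have Bfin : (leb n B < +oo)%E by exact: leb_sup_ball_fin.
have iB : lintble \1_B by exact: lintble_indic.
have b0 : 0 <= lint \1_B by apply: lint_ge0 => x; case/andP: (indic01 B x).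
have key (s : R) : 0 < s -> s <= 1 -> `|lint (d j)| <= M * s * lint \1_B.
  move=> s0 s1; pose v : 'rV[R]_n := s *: delta_mx 0 j.
  have v1 : `|v| <= s.
    rewrite normrZ gtr0_norm// ler_piMr ?(ltW s0)//; apply: norm_coord_le => // i.
    by rewrite mxE eqxx; case: (_ == _); rewrite ?normr1 ?normr0.
  have [iv Ev] := lint_shift v iff.
  have E : s * lint (d j) = - lint (fun x => f (x + v) - f x - s * d j x).
    rewrite lintB; [|exact: lintbleB|exact: lintbleZ].
    by rewrite lintB// Ev subrr sub0r opprK lintZ.
  have : s * `|lint (d j)| <= s * (M * s * lint \1_B).
    rewrite -{1}(gtr0_norm s0) -normrM E normrN.
    apply: (le_trans (lint_abs _)); first by apply: lintbleB; [exact: lintbleB|exact: lintbleZ].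
    have -> : s * (M * s * lint \1_B) = lint (fun x => M * s ^+ 2 * \1_B x).
      by rewrite lintZ//; ring.
    apply: lint_le => [||x].
    - by apply: lintble_abs; apply: lintbleB; [exact: lintbleB|exact: lintbleZ].
    - exact: lintbleZ.
    have [xr|xr] := leP `|x| (r + 1).
      rewrite indicE mem_set// mulr1.
      have := tM x v; rewrite (bigD1 j)//= big1 ?addr0; last first.
        by move=> i ij; rewrite !mxE eqxx (negPf ij) mulr0 mul0r.
      rewrite !mxE !eqxx mulr1 => h; apply: (le_trans h); apply: ler_wpM2l => //.
      by rewrite ler_pXn2r ?nnegrE// ltW.
    have xr' : r < `|x| by apply: le_lt_trans xr; rewrite lerDl.
    rewrite (fr x xr') (dr x xr') fr ?mulr0 ?subrr ?normr0 ?mulr_ge0 ?exprn_ge0 ?(ltW s0)//.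
    by have := lerB_normD x v; lra.
  by rewrite ler_pM2l.
apply/eqP; rewrite -normr_le0.
have := @poly_lim_le R ((M * lint \1_B)%:P * 'X) `|lint (d j)|.
rewrite !hornerE ?mulr0; apply => m m0; rewrite !hornerE mulrAC; apply: key.
  by rewrite invr_gt0 ltr0n.
by rewrite invf_le1 ?ler1n// ltr0n.
Qed.

End taylor_class.

Arguments C11_dcont {R n f d} _ j.

(** * Mollifiers *)

Section mollifier.
Context {R : realType} {n : nat}.
Implicit Types (x y z v : 'rV[R]_n) (m : 'I_n -> nat).

Lemma bump_sig : {b : nat -> R -> R |
  [/\ forall k (t : R), is_derive t 1 (b k) (b k.+1 t), forall k, continuous (b k),
      forall k t, 1 < `|t| -> b k t = 0,
      forall t, 0 <= b 0%N t /\ b 0%N (- t) = b 0%N t &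
      exists2 c, 0 < c & forall t, `|t| <= 2^-1 -> c <= b 0%N t]}.
Proof. exact: cid (@smooth_bump R). Qed.

Definition bump : nat -> R -> R := sval bump_sig.

Let bumpP := svalP bump_sig.

Lemma bump_derive k (t : R) : is_derive t 1 (bump k) (bump k.+1 t).
Proof. by have [H _ _ _ _] := bumpP; exact: H. Qed.

Lemma bump_continuous k : continuous (bump k).
Proof. by have [_ H _ _ _] := bumpP; exact: H. Qed.

Lemma bump_supp k (t : R) : 1 < `|t| -> bump k t = 0.
Proof. by have [_ _ H _ _] := bumpP; exact: H. Qed.

Lemma bump_ge0 t : 0 <= bump 0 t.
Proof. by have [_ _ _ H _] := bumpP; case: (H t). Qed.

Lemma bump_even t : bump 0 (- t) = bump 0 t.
Proof. by have [_ _ _ H _] := bumpP; case: (H t). Qed.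

Lemma bump_lb : exists2 c, 0 < c & forall t, `|t| <= 2^-1 -> c <= bump 0 t.
Proof. by have [_ _ _ _ H] := bumpP. Qed.

Lemma bump_bounded k : exists2 M : R, 0 <= M & forall t, `|bump k t| <= M.
Proof.
have cb : {within `[-1, 1], continuous (fun t => `|bump k t|)}.
  apply: continuous_subspaceT => t.
  by apply: continuous_comp; [exact: bump_continuous|exact: norm_continuous].
have [|c _ H] := @EVT_max _ (fun t => `|bump k t|) (-1) 1 _ cb; first by rewrite -subr_ge0 opprK addr_ge0.
exists `|bump k c| => // t; have [t1|t1] := leP `|t| 1; last by rewrite bump_supp// normr0.
by apply: H; rewrite in_itv/= -ler_norml.
Qed.

Lemma prod_ord_const (c : R) : \prod_(i < n) c = c ^+ n.
Proof. by rewrite prodr_const card_ord. Qed.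

Definition mbump m x : R := \prod_i bump (m i) (x 0 i).

Definition inc m (j : 'I_n) : 'I_n -> nat := fun i => (m i + (i == j))%N.

Lemma incC m i j : inc (inc m i) j = inc (inc m j) i.
Proof. by apply/funext => k; rewrite /inc addnAC. Qed.

Lemma mbump_C11 m : C11 (mbump m) (fun j => mbump (inc m j)).
Proof.
have H i : C11 (fun x : 'rV[R]_n => bump (m i) (x 0 i))
    (fun j x => (i == j)%:R * bump (m i).+1 (x 0 i)).
  have [M0 M00 H0] := bump_bounded (m i); have [M1 M10 H1] := bump_bounded (m i).+1.
  have [M2 M20 H2] := bump_bounded (m i).+2.
  apply: (@C11_coord R n (bump (m i)) (bump (m i).+1) (bump (m i).+2) (M0 + M1 + M2) i).
  - exact: bump_derive.
  - exact: bump_derive.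
  - exact: bump_continuous.
  - by move=> t; apply: (le_trans (H0 t)); rewrite -addrA lerDl addr_ge0.
  - by move=> t; apply: (le_trans (H1 t)); rewrite addrAC lerDr addr_ge0.
  - by move=> t; apply: (le_trans (H2 t)); rewrite lerDr addr_ge0.
apply: C11_ext (C11_prod (index_enum_uniq _) H) => [x|j x]; first by [].
rewrite (bigD1 j)//= eqxx mul1r [X in _ + X]big1 ?addr0; last first.
  by move=> i ij; rewrite (negPf ij) mul0r mul0r.
rewrite /mbump [RHS](bigD1 j)//= /inc eqxx addn1; congr (_ * _).
by apply: eq_bigr => i ij; rewrite (negPf ij) addn0.
Qed.

Lemma norm_gt_coord (r : R) x : 0 <= r -> r < `|x| -> exists i, r < `|x 0 i|.
Proof.
move=> r0 xr; apply: contrapT => H; move: xr; rewrite ltNge => /negP; apply.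
apply: norm_coord_le => // i; rewrite leNgt; apply/negP => h; apply: H; by exists i.
Qed.

Lemma mbump_supp m : supp_in 1 (mbump m).
Proof.
move=> x /(norm_gt_coord ler01)[i xi].
by rewrite /mbump (bigD1 i)//= bump_supp// mul0r.
Qed.

Lemma mbump_ge0 x : 0 <= mbump (fun=> 0%N) x.
Proof. by apply: prodr_ge0 => i _; exact: bump_ge0. Qed.

Definition mass (r : R) : R := lint (fun x => mbump (fun=> 0%N) (r^-1 *: x)).

Lemma scaled_supp m (r : R) : 0 < r -> supp_in r (fun x => mbump m (r^-1 *: x)).
Proof.
move=> r0 x xr; apply: mbump_supp; rewrite normrZ gtr0_norm ?invr_gt0//.
by rewrite mulrC ltr_pdivlMr// mul1r.
Qed.

Lemma scaled_C11 m (a c : R) z :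
  C11 (fun x => c * mbump m (a *: x + z)) (fun j x => c * a * mbump (inc m j) (a *: x + z)).
Proof.
apply: C11_ext (C11Z c (C11_affine a z (mbump_C11 m))) => // j x.
by rewrite mulrA.
Qed.

(** The mass of a bump of size [r] is at least a constant times [r ^+ n], since
    the bump is bounded below on a cube of side [r]. *)
Lemma mass_lb : exists2 c, 0 < c & forall r, 0 < r -> c * r ^+ n <= mass r.
Proof.
have [c c0 H] := bump_lb; exists (c ^+ n); first by rewrite exprn_gt0.
move=> r r0; pose h := r / 2; have h0 : 0 < h by rewrite divr_gt0.
pose A : set (Rmeas R n) := cell_set (Some (const_mx (- h) : 'rV[R]_n, const_mx h)).
have mA : measurable A by exact: measurable_cell.
have vA : leb n A = (r ^+ n)%:E.
  rewrite leb_cell /=; congr EFin; rewrite (eq_bigr (fun=> r)).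
    by rewrite prodr_const card_ord.
  by move=> i _; rewrite !mxE opprK /h -splitr max_r ?ltW.
have -> : c ^+ n * r ^+ n = lint (fun x => c ^+ n * \1_A x).
  by rewrite lintZ ?lint_indic ?vA//; apply: lintble_indic; rewrite ?vA ?ltry.
apply: lint_le.
- by apply: lintbleZ; apply: lintble_indic; rewrite ?vA ?ltry.
- apply: lintble_cc (scaled_supp _ r0); apply: (@C11_cont _ _ _ (fun j x => r^-1 * mbump (inc (fun=> 0%N) j) (r^-1 *: x))).
  by apply: C11_ext (scaled_C11 (fun=> 0%N) r^-1 1 0) => [x|j x]; rewrite addr0 mul1r.
move=> x; rewrite indicE; case: (boolP (x \in A)) => [|_]; last first.
  by rewrite mulr0; exact: mbump_ge0.
rewrite inE mulr1 => xA; rewrite -prod_ord_const; apply: ler_prod => i _.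
rewrite (ltW c0) H//= mxE normrM gtr0_norm ?invr_gt0// mulrC ler_pdivrMr// ler_norml.
have := xA i; rewrite !mxE /h; lra.
Qed.

Lemma mass_gt0 r : 0 < r -> 0 < mass r.
Proof.
have [c c0 H] := mass_lb; move=> r0; apply: lt_le_trans (H r r0).
by rewrite mulr_gt0// exprn_gt0.
Qed.

(** The standard mollifier at scale [r], with its derivative of multi-index [m]. *)
Definition eta (r : R) m x : R :=
  (mass r)^-1 * r^-1 ^+ (\sum_i m i) * mbump m (r^-1 *: x).

Local Notation eta0 r := (eta r (fun=> 0%N)).

Lemma eta_affine r m (a c : R) z : C11 (fun x => c * eta r m (a *: x + z))
  (fun j x => c * a * eta r (inc m j) (a *: x + z)).
Proof.
apply: C11_ext (scaled_C11 m (r^-1 * a) (c * ((mass r)^-1 * r^-1 ^+ (\sum_i m i))) (r^-1 *: z)) => [x|j x].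
  by rewrite /eta scalerDr scalerA -mulrA.
rewrite /eta scalerDr scalerA (_ : (\sum_i inc m j i = (\sum_i m i).+1)%N).
  by rewrite exprS; ring.
have S1 : (\sum_i (i == j) = 1)%N.
  by rewrite (bigD1 j)//= eqxx big1 ?addn0// => i /negPf ->.
by rewrite big_split/= S1 addn1.
Qed.

Lemma eta_C11 r m : C11 (eta r m) (fun j => eta r (inc m j)).
Proof.
apply: C11_ext (eta_affine r m 1 1 0) => [x|j x]; by rewrite scale1r addr0 !mul1r.
Qed.

Lemma eta_cont r m : continuous (eta r m).
Proof. exact: C11_cont (eta_C11 r m). Qed.

Lemma eta_supp r m : 0 < r -> supp_in r (eta r m).
Proof. by move=> r0 x xr; rewrite /eta (scaled_supp m r0)// mulr0. Qed.

Lemma eta_lintble r m : 0 < r -> lintble (eta r m).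
Proof. by move=> r0; apply: lintble_cc (eta_supp m r0); exact: eta_cont. Qed.

Lemma eta_bounded r m : exists2 M : R, 0 <= M & forall x, `|eta r m x| <= M.
Proof. by have [M [H _ _ _]] := eta_C11 r m; exists M => //; exact: le_trans (H 0). Qed.

Lemma eta0E r x : eta0 r x = (mass r)^-1 * mbump (fun=> 0%N) (r^-1 *: x).
Proof. by rewrite /eta big1// expr0 mulr1. Qed.

Lemma eta_ge0 r x : 0 < r -> 0 <= eta0 r x.
Proof. by move=> r0; rewrite eta0E mulr_ge0 ?mbump_ge0// invr_ge0 ltW ?mass_gt0. Qed.

Lemma etaN r x : eta0 r (- x) = eta0 r x.
Proof.
rewrite !eta0E scalerN; congr (_ * _); apply: eq_bigr => i _.
by rewrite mxE bump_even.
Qed.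

Lemma etaC r x y : eta0 r (x - y) = eta0 r (y - x).
Proof. by rewrite -etaN opprB. Qed.

Lemma lint_eta r : 0 < r -> lint (eta0 r) = 1.
Proof.
move=> r0; rewrite -(divff (lt0r_neq0 (mass_gt0 r0))) mulrC.
rewrite -[X in _ = _ * X]/(lint (fun x => mbump (fun=> 0%N) (r^-1 *: x))) -lintZ.
  by apply: lint_ext => x; rewrite eta0E.
apply: (@lintble_ext _ _ (fun x => mass r * eta0 r x)) => [x|].
  by rewrite eta0E mulrA divff ?mul1r// gt_eqF// mass_gt0.
by apply: lintbleZ; exact: eta_lintble.
Qed.

Lemma eta_ub : exists2 C, 0 < C & forall r x, 0 < r -> eta0 r x <= C / r ^+ n.
Proof.
have [c c0 H] := mass_lb; have [M M0 HM] := bump_bounded 0.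
exists ((M + 1) ^+ n / c); first by rewrite divr_gt0// exprn_gt0// ltr_wpDl.
move=> r x r0; have rn0 : 0 < r ^+ n by rewrite exprn_gt0.
have bM : mbump (fun=> 0%N) (r^-1 *: x) <= (M + 1) ^+ n.
  rewrite -prod_ord_const; apply: ler_prod => i _.
  rewrite bump_ge0/=; apply: (le_trans (ler_norm _)); apply: (le_trans (HM _)).
  by rewrite lerDl.
rewrite eta0E mulrC -[leRHS]mulrA -invfM; apply: ler_pM => //.
- exact: mbump_ge0.
- by rewrite invr_ge0 ltW ?mass_gt0.
- rewrite lef_pV2 ?posrE ?mass_gt0 ?mulr_gt0//; exact: H.
Qed.

Lemma eta_Ck k r m (a c : R) z : Ck k (fun x => c * eta r m (a *: x + z)).
Proof.
elim: k m c => [|k IH] m c; have H := eta_affine r m a c z; have cf := C11_cont H; split => //.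
move=> j; split; first by move=> x; exact: (@ex_derive _ _ _ _ _ _ _ (C11_derive x j H)).
suff -> : partial j (fun x => c * eta r m (a *: x + z)) =
  (fun x => c * a * eta r (inc m j) (a *: x + z)) by exact: IH.
by apply/funext => x; exact: (@derive_val _ _ _ _ _ _ _ (C11_derive x j H)).
Qed.

Lemma eta_partial r m z j x :
  partial j (fun y => eta r m (z - y)) x = - eta r (inc m j) (z - x).
Proof.
have H : C11 (fun y => eta r m (z - y)) (fun j y => - eta r (inc m j) (z - y)).
  apply: C11_ext (eta_affine r m (-1) 1 z) => [y|i y]; rewrite ?mul1r ?mulN1r.
    by rewrite scaleN1r addrC.
  by rewrite scaleN1r [in RHS]addrC.
exact: (@derive_val _ _ _ _ _ _ _ (C11_derive x j H)).
Qed.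

(** Reflected translates of mollifiers are legitimate test functions. *)
Lemma eta_test Omega r m z : 0 < r -> [set x | `|z - x| <= r] `<=` Omega ->
  test_function Omega (fun y => eta r m (z - y)).
Proof.
move=> r0 sO; split.
  move=> k; rewrite (_ : (fun y => _) = (fun y => 1 * eta r m ((-1) *: y + z))).
    exact: eta_Ck.
  by apply/funext => y; rewrite mul1r scaleN1r addrC.
exists [set x | `|z - x| <= r]; split => //.
- apply: bounded_closed_compact.
    exists (`|z| + r); split; first exact: num_real.
    move=> M rM x /= xr; apply: le_trans (ltW rM); rewrite -[x](subKr z).
    by apply: (le_trans (ler_normB _ _)); rewrite lerD2l.
  apply: (@closed_comp _ _ (fun x : 'rV[R]_n => `|z - x|) [set t | t <= r]); last exact: closed_le.
  move=> x _; apply: (@lip_continuous _ _ R^o _ 1) => {}x y; rewrite mul1r.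
  apply: (le_trans (ler_dist_dist _ _)).
  by rewrite opprB addrC addrA subrK distrC.
- by move=> x /negP; rewrite -ltNge => xr; exact: eta_supp.
Qed.

End mollifier.

(** * Convolution *)

Section outer_regularity.
Context {R : realType} {n : nat}.
Local Notation cell := (option ('rV[R]_n * 'rV[R]_n)).

Lemma cell_enlarge (c : cell) (e : R) : 0 < e ->
  exists O, [/\ open O, cell_set c `<=` O & (leb n O <= cell_vol c + e%:E)%E].
Proof.
move=> e0; have triv : cell_set c = set0 ->
    exists O, [/\ open O, cell_set c `<=` O & (leb n O <= cell_vol c + e%:E)%E].
  move=> c0; exists set0; rewrite c0; split; [exact: open0|by []|].
  by rewrite outer_measure0 adde_ge0 ?cell_vol_ge0// lee_fin ltW.
case: c triv => [[a b]|] triv; last exact: triv.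
have [ab|] := pselect (forall i, a 0 i < b 0 i); last first.
  move=> /existsNP[i /negP]; rewrite -leNgt => ba; apply: triv.
  apply/seteqP; split => // x /(_ i) /andP[h1 h2].
  by have := lt_le_trans h1 (le_trans h2 ba); rewrite ltxx.
pose p : {poly R} := \prod_i ((b 0 i - a 0 i)%:P + 'X).
have pE t : p.[t] = \prod_i (b 0 i - a 0 i + t).
  by rewrite /p horner_prod; apply: eq_bigr => i _; rewrite !hornerE.
have [m m0 pm] : exists2 m, (0 < m)%N & p.[m%:R^-1] < p.[0] + e.
  apply: contrapT => H.
  suff : p.[0] + e <= p.[0] by rewrite gerDl leNgt e0.
  apply: poly_lim_le => m m0; rewrite leNgt; apply/negP => h; apply: H; by exists m.
have m0' : (0 : R) < m%:R^-1 by rewrite invr_gt0 ltr0n.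
exists (\big[setI/setT]_(i < n) [set x : 'rV[R]_n | a 0 i < x 0 i < b 0 i + m%:R^-1]); split.
- elim/big_ind: _ => [|A B|i _]; [exact: openT|exact: openI|].
  rewrite (_ : [set x | _] = (fun x : 'rV[R]_n => x 0 i) @^-1` `]a 0 i, b 0 i + m%:R^-1[).
    by apply: open_comp; [move=> x _; exact: coord_continuous|exact: interval_open].
  by apply/seteqP; split => x /=; rewrite in_itv.
- move=> x /= xab; elim/big_ind: _ => // i _ /=; have /andP[-> h] := xab i.
  by apply: le_lt_trans h _; rewrite ltrDl.
apply: (@le_trans _ _ (leb n (cell_set (Some (a, b + const_mx m%:R^-1))))).
  apply: le_leb => x H i; move: H; rewrite (bigD1 i)//= => -[/= + _].
  by rewrite !mxE => /andP[-> /ltW].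
rewrite leb_cell /= -EFinD lee_fin.
have -> : \prod_i Num.max 0 (b 0 i - a 0 i) = p.[0].
  by rewrite pE; apply: eq_bigr => i _; rewrite addr0 max_r// subr_ge0 ltW.
apply: le_trans (ltW pm); rewrite pE le_eqVlt; apply/orP; left; apply/eqP.
apply: eq_bigr => i _; rewrite !mxE addrAC max_r//.
by rewrite addr_ge0 ?subr_ge0// ltW.
Qed.

(** Outer regularity: enlarging the boxes of a cover slightly makes them contain
    open boxes that still cover. *)
Lemma leb_outer_open (E : set 'rV[R]_n) (c : R) : (leb n E < c%:E)%E ->
  exists O, [/\ open O, E `<=` O & (leb n O <= c%:E)%E].
Proof.
move=> /ereal_inf_lt[_ [C EC <-]] SC.
set S := (\sum_(k <oo) _)%E in SC.
have S0 : (0 <= S)%E by apply: nneseries_ge0 => k _ _; exact: cell_vol_ge0.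
have Sf : S \is a fin_num by rewrite ge0_fin_numE//; apply: lt_trans SC _; rewrite ltry.
pose e := c - fine S.
have e0 : 0 < e by rewrite subr_gt0 -lte_fin fineK.
have /choice[U HO] : forall k, exists O, [/\ open O, cell_set (C k) `<=` O &
    (leb n O <= cell_vol (C k) + (e / (2 ^ k.+1)%:R)%:E)%E].
  by move=> k; apply: cell_enlarge; rewrite divr_gt0// ltr0n expn_gt0.
exists (\bigcup_k U k); split.
- by apply: bigcup_open => k _; case: (HO k).
- by move=> x /EC[k _ xk]; exists k => //; have [_ h _] := HO k; exact: h.
apply: (le_trans (outer_measure_sigma_subadditive _ _)).
apply: (@le_trans _ _ (\sum_(k <oo) (cell_vol (C k) + (e / (2 ^ k.+1)%:R)%:E))%E).
  apply: lee_nneseries => [k _ _|k _]; first exact: leb_ge0.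
  by case: (HO k).
apply: (le_trans (epsilon_trick _ _ (ltW e0))); first by move=> k; exact: cell_vol_ge0.
by rewrite -/S -(fineK Sf) -EFinD /e subrKC.
Qed.

End outer_regularity.

Section convolution.
Context {R : realType} {n : nat}.
Implicit Types (x y z v : 'rV[R]_n) (k u w : 'rV[R]_n -> R).
Local Notation T := (Rmeas R n).

(** Dyadic cubes reduce the preimage of an open set to countably many preimages
    of boxes, so that only the coordinates have to be measurable.  This is what
    gives access to product spaces. *)
Lemma coords_meas d (S : measurableType d) (G : S -> 'rV[R]_n) k : continuous k ->
  (forall i, measurable_fun setT (fun s => G s 0 i)) -> measurable_fun setT (k \o G).
Proof.
move=> /continuousP ck mG.
have mO (U : set 'rV[R]_n) : open U -> measurable (G @^-1` U).
  move=> oU; pose F (p : nat * 'rV[int]_n) : set S :=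
    if pselect (cell_set (dya p.1 p.2) `<=` U) then G @^-1` (cell_set (dya p.1 p.2)) else set0.
  rewrite (_ : G @^-1` U = \bigcup_p F p).
    apply: countable_bigcupT_measurable; first exact: countableP.
    move=> p; rewrite /F; case: pselect => ?; last exact: measurable0.
    rewrite /= (_ : _ @^-1` _ = \bigcap_(i in setT) ((fun s => G s 0 i) @^-1`
        `](p.2 0 i)%:~R / 2 ^+ p.1, (p.2 0 i + 1)%:~R / 2 ^+ p.1])).
      apply: fin_bigcap_measurable => // i _.
      by rewrite -[X in measurable X]setTI; apply: mG.
    apply/seteqP; split => x /= xab i; first by move=> _; have := xab i; rewrite /= in_itv/= !mxE.
    by have := xab i I; rewrite /= in_itv/= !mxE.
  apply/seteqP; split => [x Ux|x [p _]].
    have [j /(_ j (leqnn j)) hj] := @dya_sub_open R n U (G x) oU Ux.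
    exists (j, dya_of j (G x)) => //; rewrite /F; case: pselect => [h|//].
    by apply/dyaP.
  by rewrite /F; case: pselect => [h /h|_ []].
apply: (measurability _ (RGenOpens.measurableE R)).
move=> _ [_ [a [b ->] <-]]; rewrite setTI comp_preimage; apply: mO.
exact/ck/interval_open.
Qed.

Definition conv k u x : R := lint (fun y => k (x - y) * u y).

Lemma cont_refl k x : continuous k -> continuous (fun y => k (x - y)).
Proof.
move=> ck y; rewrite (_ : (fun y => k (x - y)) = k \o (fun y => (-1) *: y + x)).
  by apply: continuous_comp; [exact: cont_affine|exact: ck].
by apply/funext => t; rewrite /= scaleN1r addrC.
Qed.

Definition bounded_cont k := continuous k /\ exists2 M : R, 0 <= M & forall x, `|k x| <= M.

Lemma C11_bc k dk : C11 k dk -> bounded_cont k.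
Proof.
move=> kd; split; first exact: C11_cont kd.
by case: kd => M [H _ _ _]; exists M => //; exact: le_trans (H 0).
Qed.

Lemma conv_lintble k u x : bounded_cont k -> lintble u -> lintble (fun y => k (x - y) * u y).
Proof.
move=> [ck [M _ kM]] iu; apply: (@lintble_bmul _ _ M) => //.
by apply: lmeas_cont; exact: cont_refl.
Qed.

Lemma lint_bmul_le (M : R) k u : lmeas k -> (forall y, `|k y| <= M) -> lintble u ->
  `|lint (fun y => k y * u y)| <= M * lint (fun y => `|u y|).
Proof.
move=> mk kM iu; have ia := lintble_abs iu.
have ik : lintble (fun y => k y * u y) by exact: (@lintble_bmul _ _ M).
rewrite -lintZ//; apply: (le_trans (lint_abs ik)); apply: lint_le.
- exact: lintble_abs.
- exact: lintbleZ.
by move=> y; rewrite normrM ler_wpM2r.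
Qed.

Lemma convB k u w : bounded_cont k -> lintble u -> lintble w ->
  conv k (fun y => u y - w y) = (fun x => conv k u x - conv k w x).
Proof.
move=> bk iu iw; apply/funext => x; rewrite /conv -lintB; try exact: conv_lintble.
by apply: lint_ext => y; rewrite mulrBr.
Qed.

Lemma C11_conv k dk u : C11 k dk -> (forall j, exists e, C11 (dk j) e) -> lintble u ->
  C11 (conv k u) (fun j => conv (dk j) u).
Proof.
move=> kd kdd iu; have bk := C11_bc kd; have ia := lintble_abs iu.
have bdk j : bounded_cont (dk j) by have [e h] := kdd j; exact: C11_bc h.
have ck x : lmeas (fun y => k (x - y)) by apply: lmeas_cont; apply: cont_refl; case: bk.
have cdk j x : lmeas (fun y => dk j (x - y)) by apply: lmeas_cont; apply: cont_refl; case: (bdk j).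
have I0 : 0 <= lint (fun y => `|u y|) by apply: lint_ge0.
have cdc j : continuous (conv (dk j) u).
  have [e h] := kdd j; have [L L0 HL] := C11_lip h.
  apply: (@lip_continuous _ _ R^o _ (L * lint (fun y => `|u y|))) => x y.
  have -> : conv (dk j) u x - conv (dk j) u y = lint (fun z => (dk j (x - z) - dk j (y - z)) * u z).
    rewrite /conv -lintB; try exact: conv_lintble.
    by apply: lint_ext => z; rewrite mulrBl.
  rewrite mulrAC; apply: (lint_bmul_le _ _ iu).
    by apply: measurable_funB; exact: cdk.
  move=> z; have := HL (y - z) (x - y); congr (`|dk j _ - _| <= _).
  by rewrite addrC addrA subrK.
case: (kd) => [M [kM dM _ tM]].
exists (M * lint (fun y => `|u y|)); split => //.
- by move=> x; apply: (lint_bmul_le _ _ iu) => // y; exact: kM.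
- by move=> j x; apply: (lint_bmul_le _ _ iu) => // y; exact: dM.
move=> x v.
have -> : conv k u (x + v) - conv k u x - \sum_j v 0 j * conv (dk j) u x =
   lint (fun y => (k (x + v - y) - k (x - y) - \sum_j v 0 j * dk j (x - y)) * u y).
  rewrite (eq_bigr (fun j => lint (fun y => v 0 j * (dk j (x - y) * u y)))); last first.
    by move=> j _; rewrite /conv lintZ//; exact: conv_lintble.
  rewrite -lint_sum; last by move=> j _; apply: lintbleZ; exact: conv_lintble.
  rewrite /conv -lintB; try exact: conv_lintble.
  rewrite -lintB; first last.
  - by apply: lintble_sum => j _; apply: lintbleZ; exact: conv_lintble.
  - by apply: lintbleB; exact: conv_lintble.
  apply: lint_ext => y; rewrite !mulrBl mulr_suml; congr (_ - _).
  by apply: eq_bigr => j _; rewrite mulrA.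
rewrite mulrAC; apply: (lint_bmul_le _ _ iu).
  apply: measurable_funB; first by apply: measurable_funB; exact: ck.
  apply: lmeas_cont; apply: cont_sum => j; apply: contZ; apply: cont_refl.
  by case: (bdk j).
by move=> y; have := tM (x - y) v; rewrite (addrAC x (- y) v).
Qed.

Lemma conv_supp k u (r s : R) : supp_in r k -> supp_in s u -> supp_in (r + s) (conv k u).
Proof.
move=> kr us x xrs; apply: etrans lint0; apply: lint_ext => y.
have [ys|ys] := ltP s `|y|; first by rewrite us// mulr0.
by rewrite kr ?mul0r//; have := lerB_dist x y; lra.
Qed.

Local Notation e0 r := (@eta R n r (fun=> 0%N)).

Definition moll (r : R) u : 'rV[R]_n -> R := conv (e0 r) u.

Lemma eta_bc r m : bounded_cont (@eta R n r m).
Proof. exact: C11_bc (eta_C11 r m). Qed.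

Lemma conv_eta_C11 r m u : lintble u ->
  C11 (conv (eta r m) u) (fun j => conv (eta r (inc m j)) u).
Proof. by apply: C11_conv (eta_C11 r m) _ => j; eexists; exact: eta_C11. Qed.

Lemma moll_cont r u : lintble u -> continuous (moll r u).
Proof. by move=> iu; exact: C11_cont (conv_eta_C11 r (fun=> 0%N) iu). Qed.

Lemma moll_supp r (s : R) u : 0 < r -> supp_in s u -> supp_in (r + s) (moll r u).
Proof. by move=> r0; apply: conv_supp; exact: eta_supp. Qed.

Lemma lint_eta_refl r x : 0 < r -> lintble (fun y => e0 r (x - y)) /\ lint (fun y => e0 r (x - y)) = 1.
Proof. by move=> r0; have [H1 H2] := lint_reflect x (eta_lintble (fun=> 0%N) r0); rewrite -(@lint_eta R n r r0). Qed.

(** Jensen's inequality for the probability density of the mollifier. *)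
Lemma moll_pow r u p x : 0 < r -> lintble u -> lintble (fun y => `|u y| ^+ p.+1) ->
  `|moll r u x| ^+ p.+1 <= moll r (fun y => `|u y| ^+ p.+1) x.
Proof.
move=> r0 iu ip; have ia := lintble_abs iu; have bc := eta_bc r (fun=> 0%N).
have [ie e1] := lint_eta_refl x r0.
pose a := moll r (fun y => `|u y|) x.
have a0 : 0 <= a by apply: lint_ge0 => y; rewrite mulr_ge0// eta_ge0.
have ua : `|moll r u x| <= a.
  apply: (le_trans (lint_abs (conv_lintble x bc iu))); apply: lint_le.
  - by apply: lintble_abs; exact: conv_lintble.
  - exact: conv_lintble.
  by move=> y; rewrite normrM ger0_norm// eta_ge0.
apply: (@le_trans _ _ (a ^+ p.+1)); first by rewrite ler_pXn2r// nnegrE.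
have c1 := lintbleZ (a ^+ p.+1 - p.+1%:R * a ^+ p * a) ie.
have c2 := lintbleZ (p.+1%:R * a ^+ p) (conv_lintble x bc ia).
have -> : a ^+ p.+1 = lint (fun y => (a ^+ p.+1 - p.+1%:R * a ^+ p * a) * e0 r (x - y) +
   p.+1%:R * a ^+ p * (e0 r (x - y) * `|u y|)).
  have ea : lint (fun y => e0 r (x - y) * `|u y|) = a by [].
  rewrite (lintD c1 c2) (lintZ _ ie) e1 (lintZ _ (conv_lintble x bc ia)) ea.
  by rewrite mulr1 subrK.
apply: lint_le; [exact: lintbleD|exact: conv_lintble|] => y.
rewrite [leLHS](_ : _ = e0 r (x - y) * (a ^+ p.+1 + p.+1%:R * a ^+ p * (`|u y| - a))); last ring.
by rewrite ler_wpM2l ?eta_ge0//; exact: tangent_pow.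
Qed.

Lemma moll_lint r u (s : R) : 0 < r -> lintble u -> supp_in s u ->
  lintble (moll r u) /\ lint (moll r u) = lint u.
Proof.
move=> r0 iu us; have [M M0 HM] := @eta_bounded R n r (fun=> 0%N).
have H i : measurable_fun setT (fun p : T * T => (p.2 - p.1) 0 i).
  rewrite (_ : (fun p => _) = (fun p : T * T => p.2 0 i - p.1 0 i)); last first.
    by apply/funext => p; rewrite !mxE.
  apply: measurable_funB.
    exact: (measurableT_comp (measurable_coord i) (@measurable_snd _ _ _ _)).
  exact: (measurableT_comp (measurable_coord i) (@measurable_fst _ _ _ _)).
have mk : measurable_fun setT (fun p : T * T => e0 r (p.2 - p.1)).
  exact: (@coords_meas _ (T * T)%type (fun p : T * T => (p.2 : 'rV[R]_n) - p.1) (e0 r) (@eta_cont R n r (fun=> 0%N)) H).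
have [||_ _ _ I2 E] := @lint_fubini R n (fun x y => e0 r (y - x)) u M (r + s) mk _ _ iu.
- by move=> x y; exact: HM.
- move=> x y yrs; have [xs|xs] := ltP s `|x|; first by rewrite us// mulr0.
  by rewrite eta_supp ?mul0r//; have := lerB_dist y x; lra.
split; first exact: I2.
rewrite /moll /conv -E; apply: lint_ext => x; rewrite -[RHS]mulr1.
have [h1 h2] := lint_eta_refl x r0.
transitivity (lint (fun y => u x * e0 r (x - y))).
  by apply: lint_ext => y; rewrite etaC mulrC.
by rewrite lintZ// h2.
Qed.

End convolution.

Arguments moll_cont {R n} r {u} _.

(** * Mollification in L^p *)

Section mollification_cvg.
Context {R : realType} {n : nat}.
Implicit Types (x y z : 'rV[R]_n) (u w : 'rV[R]_n -> R).
Local Notation T := (Rmeas R n).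

Lemma cvg_eps (a : nat -> R) (l : R) : a k @[k --> \oo] --> l ->
  forall e, 0 < e -> exists N, forall k, (N <= k)%N -> `|a k - l| <= e.
Proof.
move=> al e e0; have [N _ H] : \forall k \near \oo, `|l - a k| < e.
  by move/cvgrPdist_lt : al => /(_ _ e0).
by exists N => k Nk; rewrite distrC ltW//; exact: H.
Qed.

Lemma pow_add_le (p : nat) (a b : R) : 0 <= a -> 0 <= b ->
  (a + b) ^+ p <= 2 ^+ p * (a ^+ p + b ^+ p).
Proof.
wlog ab : a b / a <= b.
  by move=> H a0 b0; have [ab|/ltW ab] := leP a b; [|rewrite addrC (addrC (a ^+ p))]; exact: H.
move=> a0 b0; apply: (@le_trans _ _ (2 ^+ p * b ^+ p)); last first.
  by rewrite ler_wpM2l ?exprn_ge0// lerDr exprn_ge0.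
rewrite -exprMn; case: p => [|p]; first by rewrite !expr0.
rewrite ler_pXn2r ?nnegrE ?addr_ge0 ?mulr_ge0//.
by rewrite mulr_natl mulr2n lerD2r.
Qed.

Definition rad (k : nat) : R := 2 ^- k.

Lemma rad_gt0 k : 0 < rad k.
Proof. by rewrite invr_gt0 exprn_gt0. Qed.

Definition Lp p (s : R) u :=
  [/\ lintble u, lintble (fun x => `|u x| ^+ p) & supp_in s u].

Definition Lcvg p u := forall e : R, 0 < e -> exists N, forall k, (N <= k)%N ->
  lint (fun x => `|moll (rad k) u x - u x| ^+ p) <= e.

Lemma lmeas_pow p u : lmeas u -> lmeas (fun x => `|u x| ^+ p).
Proof.
move=> mu; apply: measurable_funX.
by apply: measurableT_comp mu; exact: normr_measurable.
Qed.

Lemma lmeas_gt u (t : R) : lmeas u -> measurable ([set x | t < u x] : set T).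
Proof.
move=> mu; rewrite (_ : [set x | _] = setT `&` (u : T -> R) @^-1` `]t, +oo[).
  by apply: mu; [exact: measurableT|exact: measurable_itv].
by apply/seteqP; split => x /=; rewrite in_itv/= andbT; [|case].
Qed.

Lemma lmeas_le u (t : R) : lmeas u -> measurable ([set x | u x <= t] : set T).
Proof.
move=> mu; rewrite (_ : [set x | _] = setT `&` (u : T -> R) @^-1` `]-oo, t]).
  by apply: mu; [exact: measurableT|exact: measurable_itv].
by apply/seteqP; split => x /=; rewrite in_itv/=; [|case].
Qed.

Lemma lintble_powB p u w : lintble u -> lintble w -> lintble (fun x => `|u x| ^+ p) ->
  lintble (fun x => `|w x| ^+ p) -> lintble (fun x => `|u x - w x| ^+ p).
Proof.
move=> iu iw ip jp.
apply: (@lintble_le _ _ _ (fun x => 2 ^+ p * (`|u x| ^+ p + `|w x| ^+ p))).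
- by apply: lmeas_pow; apply: lintble_meas; exact: lintbleB.
- move=> x; rewrite normrX normr_id; apply: le_trans (pow_add_le _ _ _) => //.
  by rewrite lerXn2r ?nnegrE ?addr_ge0// ler_normB.
- by apply: lintbleZ; exact: lintbleD.
Qed.

Lemma LpB p (s : R) u w : Lp p s u -> Lp p s w -> Lp p s (fun x => u x - w x).
Proof.
move=> [iu ip us] [iw jp ws]; split; [exact: lintbleB|exact: lintble_powB|].
by move=> x xs; rewrite us// ws// subr0.
Qed.

Lemma LpW p (s t : R) u : s <= t -> Lp p s u -> Lp p t u.
Proof. by move=> st [iu ip us]; split => // x xt; apply: us; exact: le_lt_trans xt. Qed.

Lemma moll_Lp p (r s : R) u : 0 < r -> Lp p.+1 s u ->
  Lp p.+1 (r + s) (moll r u) /\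
  lint (fun x => `|moll r u x| ^+ p.+1) <= lint (fun x => `|u x| ^+ p.+1).
Proof.
move=> r0 [iu ip us]; have cm := moll_cont r iu; have ms := moll_supp r0 us.
have cp : continuous (fun x => `|moll r u x| ^+ p.+1).
  move=> x; apply: (@continuous_comp _ _ _ (fun x => `|moll r u x|) (fun t => t ^+ p.+1)).
    exact: norm_continuous_comp.
  exact: exprn_continuous.
have sp : supp_in (r + s) (fun x => `|moll r u x| ^+ p.+1).
  by move=> x xs; rewrite ms// normr0 expr0n.
have imp : lintble (fun x => `|moll r u x| ^+ p.+1) by exact: lintble_cc cp sp.
split; first by split => //; exact: lintble_cc cm ms.
have ups : supp_in s (fun x => `|u x| ^+ p.+1) by move=> x xs; rewrite us// normr0 expr0n.
have [i1 <-] := moll_lint r0 ip ups.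
by apply: lint_le => // x; exact: moll_pow.
Qed.

Lemma mollB r u w : lintble u -> lintble w ->
  moll r (fun y => u y - w y) = (fun x => moll r u x - moll r w x).
Proof. by move=> iu iw; apply: convB => //; exact: eta_bc. Qed.

Lemma Lcvg_close p (s : R) u : Lp p.+1 s u ->
  (forall e, 0 < e -> exists w, [/\ Lp p.+1 s w, Lcvg p.+1 w &
    lint (fun x => `|u x - w x| ^+ p.+1) <= e]) -> Lcvg p.+1 u.
Proof.
move=> Lu H e e0; pose c : R := 2 ^+ p.+1; have c0 : 0 < c by rewrite exprn_gt0.
have C0 : 0 < c * (1 + 2 * c) by rewrite mulr_gt0// addr_gt0// mulr_gt0.
have e1 : 0 < e / (c * (1 + 2 * c)) by rewrite divr_gt0.
have [w [Lw wc uw]] := H _ e1; have [N HN] := wc _ e1.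
exists N => k Nk; have r0 := rad_gt0 k; set r := rad k in r0 *.
have Lv := LpB Lu Lw; have [Lmv mv] := moll_Lp r0 Lv.
have [iu _ _] := Lu; have [iw ipw _] := Lw; have [iv ipv _] := Lv; have [imv ipmv _] := Lmv.
have [[imw ipmw _] _] := moll_Lp r0 Lw.
have [[imu ipmu _] _] := moll_Lp r0 Lu.
have [_ ipu _] := Lu.
pose F x := `|moll r w x - w x| ^+ p.+1.
have iF : lintble F by exact: lintble_powB.
pose v x := u x - w x.
apply: (@le_trans _ _ (lint (fun x => c * F x + c * (c * (`|moll r v x| ^+ p.+1 + `|v x| ^+ p.+1))))).
  apply: lint_le.
  - exact: lintble_powB.
  - apply: lintbleD; first exact: lintbleZ.
    by do 2 apply: lintbleZ; exact: lintbleD.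
  move=> x; rewrite -mulrDr.
  apply: (@le_trans _ _ ((`|moll r w x - w x| + (`|moll r v x| + `|v x|)) ^+ p.+1)).
    rewrite lerXn2r ?nnegrE ?addr_ge0//.
    have -> : moll r u x - u x = (moll r w x - w x) + (moll r v x - v x).
      by rewrite mollB// /v; ring.
    by apply: (le_trans (ler_normD _ _)); rewrite lerD2l ler_normB.
  apply: (le_trans (pow_add_le _ _ _)); rewrite ?addr_ge0//.
  by rewrite ler_pM2l// lerD2l; apply: pow_add_le.
have iS : lintble (fun x => `|moll r v x| ^+ p.+1 + `|v x| ^+ p.+1) by exact: lintbleD.
rewrite lintD; [|exact: lintbleZ|by do 2 apply: lintbleZ].
rewrite lintZ// lintZ; last exact: lintbleZ.
rewrite lintZ// lintD// -mulrDr.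
have -> : e = c * (e / (c * (1 + 2 * c)) + c * (e / (c * (1 + 2 * c)) + e / (c * (1 + 2 * c)))).
  by field; rewrite !gt_eqF// addr_gt0// mulr_gt0.
rewrite ler_pM2l//; apply: lerD; first exact: HN.
by rewrite ler_pM2l//; apply: lerD => //; exact: le_trans mv uw.
Qed.

Lemma Lcvg1_lin (s a : R) u w : Lp 1 s u -> Lp 1 s w -> Lcvg 1 u -> Lcvg 1 w ->
  Lcvg 1 (fun x => a * u x + w x).
Proof.
move=> [iu _ us] [iw _ ws] cu cw e e0.
have a1 : 0 < `|a| + 1 by rewrite ltr_wpDl.
have e1 : 0 < e / 2 / (`|a| + 1) by rewrite !divr_gt0.
have e2 : 0 < e / 2 by rewrite divr_gt0.
have [N HN] := cu _ e1; have [N' HN'] := cw _ e2.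
exists (maxn N N') => k; rewrite geq_max => /andP[Nk N'k].
have r0 := rad_gt0 k; set r := rad k in r0 *.
have [im _] := moll_lint r0 iu us; have [im' _] := moll_lint r0 iw ws.
have E x : moll r (fun x => a * u x + w x) x = a * moll r u x + moll r w x.
  have b := @eta_bc R n r (fun=> 0%N).
  have h1 := conv_lintble x b iu; have h2 := conv_lintble x b iw.
  rewrite /moll /conv -(lintZ a h1) -lintD//; last exact: lintbleZ.
  by apply: lint_ext => y; rewrite mulrDr mulrCA.
have i1 : lintble (fun x => `|moll r u x - u x|) by apply: lintble_abs; exact: lintbleB.
have i2 : lintble (fun x => `|moll r w x - w x|) by apply: lintble_abs; exact: lintbleB.
apply: (@le_trans _ _ (lint (fun x => `|a| * `|moll r u x - u x| + `|moll r w x - w x|))).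
  apply: lint_le.
  - apply: (@lintble_ext _ _ (fun x => `|(a * moll r u x + moll r w x) - (a * u x + w x)|)).
      by move=> x; rewrite expr1 E.
    by apply: lintble_abs; apply: lintbleB; apply: lintbleD => //; exact: lintbleZ.
  - by apply: lintbleD => //; exact: lintbleZ.
  move=> x; rewrite expr1 E -normrM.
  have -> : a * moll r u x + moll r w x - (a * u x + w x) =
    a * (moll r u x - u x) + (moll r w x - w x) by ring.
  exact: ler_normD.
rewrite lintD//; last exact: lintbleZ.
rewrite lintZ// [e]splitr; apply: lerD; last exact: HN'.
apply: (@le_trans _ _ (`|a| * (e / 2 / (`|a| + 1)))); first by rewrite ler_wpM2l//; exact: HN.
by rewrite mulrA ler_pdivrMr// mulrC ler_pM2l// lerDl.
Qed.

Lemma indic_Lp p (s : R) (A : set T) : measurable A -> A `<=` [set x : 'rV[R]_n | `|x| <= s] ->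
  Lp p.+1 s \1_A.
Proof.
move=> mA As; have iA : lintble (\1_A : 'rV[R]_n -> R).
  by apply: lintble_indic => //; apply: le_lt_trans (leb_sup_ball_fin s); exact: le_leb.
split => //.
  apply: lintble_ext iA => x; rewrite indicE.
  by case: (_ \in _); rewrite ?normr1 ?expr1n// normr0 expr0n.
move=> x xs; rewrite indicE; case: (boolP (x \in A)) => //; rewrite inE => /As.
by rewrite /= leNgt xs.
Qed.

(** For an open set the mollified indicator is eventually 1 at each point of
    the set, and by conservation of mass the part of it that leaks out of the
    set has the same integral as the part that is missing inside. *)
Lemma Lcvg_open (s : R) (A : set 'rV[R]_n) : open A ->
  A `<=` [set x : 'rV[R]_n | `|x| <= s] -> Lcvg 1 \1_A.
Proof.
move=> oA As; have mA : measurable (A : set T) by exact: measurable_open.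
have [iA _ sA] := indic_Lp 0 mA As.
have m01 k x : 0 <= moll (rad k) \1_A x <= 1.
  have r0 := rad_gt0 k; apply/andP; split.
    apply: lint_ge0 => y; rewrite mulr_ge0//; exact: eta_ge0.
  have [h1 h2] := lint_eta_refl x r0; rewrite -[leRHS]h2; apply: lint_le => //.
    by apply: conv_lintble => //; exact: eta_bc.
  move=> y; rewrite ler_piMr//; exact: eta_ge0.
pose f k x : R := \1_A x * (1 - moll (rad k) \1_A x).
have mf k : lmeas (f k).
  apply: measurable_funM; first exact: lmeas_indic.
  by apply: measurable_funB; [exact: measurable_cst|apply: lmeas_cont; exact: moll_cont].
have fle k x : `|f k x| <= \1_A x.
  have /andP[m0 m1] := m01 k x; have /andP[i0 i1] := indic01 A x.
  rewrite ger0_norm ?mulr_ge0 ?subr_ge0//.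
  by rewrite ler_piMr// gerBl.
have f0 x : f k x @[k --> \oo] --> (0 : R).
  rewrite /f indicE; case: (boolP (x \in A)) => [|_]; last first.
    by rewrite (_ : (fun k => _) = fun=> 0); [exact: cvg_cst|apply/funext => k; rewrite mul0r].
  rewrite inE => Ax; have /nbhs_ballP[e /= e0 eA] : nbhs x A by exact: open_nbhs_nbhs.
  have [k0 Hk0] := dya_ex e0.
  apply: cvg_near_cst; exists k0 => // k /= kk; rewrite mul1r.
  have r0 := rad_gt0 k; have [h1 h2] := lint_eta_refl x r0.
  rewrite -{1}h2 /moll /conv; apply/eqP; rewrite subr_eq0; apply/eqP; apply: lint_ext => y.
  rewrite indicE; case: (boolP (y \in A)) => [_|]; first by rewrite mulr1.
  rewrite notin_setE => /= yA; rewrite eta_supp ?mul0r// ltNge; apply/negP => xy; apply: yA.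
  apply: eA; rewrite -ball_normE /=; apply: le_lt_trans xy _; exact: Hk0.
have [_ cf] := lint_dct mf f0 fle iA; rewrite lint0 in cf.
move=> e e0; have e2 : 0 < e / 2 by rewrite divr_gt0.
have [N HN] := cvg_eps cf e2; exists N => k Nk; have := HN k Nk; rewrite subr0.
move=> /(le_trans (ler_norm _)) fe.
have r0 := rad_gt0 k; have [im Em] := moll_lint r0 iA sA.
set m := moll _ _ in im Em *.
have iim : lintble (fun x => \1_A x * m x) by exact: lintble_mul_indic.
have -> : lint (fun x => `|m x - \1_A x| ^+ 1) = 2 * lint (f k); last by lra.
have -> : lint (f k) = lint \1_A - lint (fun x => \1_A x * m x).
  by rewrite -lintB//; apply: lint_ext => x; rewrite /f mulrBr mulr1.
transitivity (lint (fun x => \1_A x + m x - 2 * (\1_A x * m x))).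
  apply: lint_ext => x; rewrite expr1; have /andP[m0 m1] := m01 k x; rewrite -/m in m0 m1.
  rewrite indicE; case: (_ \in _) => /=.
    by rewrite ler0_norm ?subr_le0//; ring.
  by rewrite subr0 ger0_norm//; ring.
rewrite lintB; [|exact: lintbleD|exact: lintbleZ].
by rewrite lintD// lintZ// Em; ring.
Qed.

(** Outer regularity reduces measurable sets to open ones. *)
Lemma Lcvg_indic (s : R) (A : set T) : measurable A -> A `<=` [set x : 'rV[R]_n | `|x| <= s] ->
  Lcvg 1 \1_A.
Proof.
move=> mA As; have As1 : A `<=` [set x : 'rV[R]_n | `|x| <= s + 1].
  by move=> x /As /= h; apply: le_trans h _; rewrite lerDl.
apply: (@Lcvg_close 0 (s + 1)); first exact: indic_Lp.
have Af : (leb n A < +oo)%E by apply: le_lt_trans (leb_sup_ball_fin s); exact: le_leb.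
have Afn : leb n A \is a fin_num by rewrite ge0_fin_numE ?leb_ge0.
move=> e e0; have [|U [oU AU Ue]] := @leb_outer_open R n A (fine (leb n A) + e).
  by rewrite EFinD fineK// lteDl// lte_fin.
pose B := U `&` [set x : 'rV[R]_n | `|x| < s + 1].
have oB : open B.
  apply: openI => //; apply: (@open_comp _ _ (fun x : 'rV[R]_n => `|x|) [set t | t < s + 1]).
    by move=> x _; exact: norm_continuous.
  exact: open_lt.
have mB : measurable (B : set T) by exact: measurable_open.
have Bs : B `<=` [set x : 'rV[R]_n | `|x| <= s + 1] by move=> x [_ /ltW].
have AB : A `<=` B.
  by move=> x Ax; split; [exact: AU|have := As x Ax => /= h; apply: le_lt_trans h _; rewrite ltrDl].
exists \1_B; split; [exact: indic_Lp|exact: Lcvg_open Bs|].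
have [iA _ _] := indic_Lp 0 mA As1; have [iB _ _] := indic_Lp 0 mB Bs.
have Bf : (leb n B < +oo)%E by apply: le_lt_trans (leb_sup_ball_fin (s + 1)); exact: le_leb.
have -> : lint (fun x => `|\1_A x - \1_B x| ^+ 1) = lint (fun x => \1_B x - \1_A x :> R).
  apply: lint_ext => x; rewrite expr1 !indicE.
  case: (boolP (x \in A)) => [|_]; last by rewrite sub0r normrN subr0; case: (_ \in _); rewrite ?normr1 ?normr0.
  by rewrite inE => /AB xB; rewrite mem_set// subrr normr0.
rewrite lintB// !lint_indic// lerBlDl.
have Bfn : leb n B \is a fin_num by rewrite ge0_fin_numE ?leb_ge0.
rewrite -lee_fin fineK// EFinD; apply: le_trans (le_leb (@subIsetl _ _ _)) _.
by rewrite EFinD in Ue.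
Qed.

Lemma Lcvg_bounded1 (s M : R) u : lmeas u -> (forall x, `|u x| <= M) -> supp_in s u -> Lcvg 1 u.
Proof.
move=> mu uM us; have M0 : 0 <= M by exact: le_trans (uM 0).
pose B : set T := [set x : 'rV[R]_n | `|x| <= s].
have mB : measurable B by apply: measurable_compact; exact: compact_sup_ball.
have LB : Lp 1 s (\1_B : 'rV[R]_n -> R) by exact: indic_Lp.
have [iB _ _] := LB.
have cB : Lcvg 1 \1_B by exact: (@Lcvg_indic s).
have iu : lintble u by exact: (@bounded_supp_integrable _ _ _ M s).
pose w x := u x + M * \1_B x.
have w0 x : 0 <= w x.
  have := uM x; rewrite ler_norml /w indicE => /andP[h _].
  case: (boolP (x \in B)) => [_|]; first by rewrite mulr1; lra.
  by rewrite notin_setE /B/= => /negP; rewrite -ltNge => /us ->; rewrite mulr0 addr0.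
have iw : lintble w by apply: lintbleD => //; exact: lintbleZ.
have ws : supp_in s w.
  move=> x xs; rewrite /w us// add0r indicE memNset ?mulr0//= /B/=.
  by apply/negP; rewrite -ltNge.
have Lw : Lp 1 s w by split => //; exact: lintble_abs.
suff cw : Lcvg 1 w.
  rewrite (_ : u = fun x => (- M) * \1_B x + w x); first exact: (@Lcvg1_lin s).
  by apply/funext => x; rewrite /w; ring.
apply: (@Lcvg_close 0 s) => // e e0.
pose b := lint (\1_B : 'rV[R]_n -> R).
have b0 : 0 <= b by apply: lint_ge0 => x; case/andP: (indic01 B x).
pose m := (Num.truncn (b / e)).+1.
have m0 : (0 : R) < m%:R by rewrite ltr0n.
have bm : b / m%:R <= e.
  by rewrite ler_pdivrMr// mulrC -ler_pdivrMr// ltW// truncnS_gt.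
pose K := (Num.truncn (m%:R * (2 * M))).+1.
pose E (k : nat) : set T := [set x | k.+1%:R < m%:R * w x].
have mE k : measurable (E k).
  exact: lmeas_gt (lintble_meas (lintbleZ _ iw)).
have Es k : E k `<=` [set x : 'rV[R]_n | `|x| <= s].
  move=> x /= h; rewrite leNgt; apply/negP => /ws h0; move: h.
  by rewrite /E/= h0 mulr0 ltNge ler0n.
pose g (k : nat) x : R := \sum_(i < k) m%:R^-1 * \1_(E i) x.
have Hg k : Lp 1 s (g k) /\ Lcvg 1 (g k).
  elim: k => [|k [IH1 IH2]].
    rewrite (_ : g 0 = fun=> 0); last by apply/funext => x; rewrite /g big_ord0.
    split; first by split => //; [exact: lintble0|apply: lintble_abs; exact: lintble0].
    move=> e' e'0; exists 0%N => k _; apply: le_trans (ltW e'0).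
    rewrite (_ : (fun x => _) = fun=> 0) ?lint0//; apply/funext => x.
    rewrite subr0 expr1 /moll /conv (_ : (fun y => _) = fun=> 0) ?lint0 ?normr0//.
    by apply/funext => y; rewrite mulr0.
  have -> : g k.+1 = fun x => m%:R^-1 * \1_(E k) x + g k x.
    by apply/funext => x; rewrite /g big_ord_recr addrC.
  have LE := indic_Lp 0 (mE k) (@Es k); have [iE _ Ess] := LE; have [ig _ gs] := IH1.
  have iL : lintble (fun x => m%:R^-1 * \1_(E k) x + g k x) by apply: lintbleD => //; exact: lintbleZ.
  split; last by apply: (@Lcvg1_lin s) => //; exact: (@Lcvg_indic s).
  split => //; first exact: lintble_abs.
  by move=> x xs; rewrite Ess// gs// mulr0 addr0.
have [Lg cg] := Hg K; exists (g K); split => //.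
have [ig _ gs] := Lg.
apply: le_trans bm; rewrite /b mulrC -lintZ//; apply: lint_le.
- by apply: lintble_abs; exact: lintbleB.
- exact: lintbleZ.
move=> x; rewrite expr1; have [xs|xs] := ltP s `|x|.
  rewrite ws// gs// subrr normr0 mulr_ge0 ?invr_ge0 ?(ltW m0)//.
rewrite indicE mem_set// mulr1.
have mw0 : 0 <= m%:R * w x by rewrite mulr_ge0// ltW.
have [c1 /(_ _) c2] := @count_layers R K (m%:R * w x) mw0.
have gE : m%:R * g K x = \sum_(k < K) (k.+1%:R < m%:R * w x)%R%:R.
  rewrite /g mulr_sumr; apply: eq_bigr => k _.
  by rewrite mulrA divff ?gt_eqF// mul1r /E indic_pred.
have {}c2 : m%:R * w x <= m%:R * g K x + 1.
  rewrite gE; apply: c2; apply: ltW; apply: le_lt_trans (truncnS_gt _).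
  rewrite ler_pM2l// /w indicE mem_set// mulr1 mulr_natl mulr2n lerD2r.
  by apply: le_trans (uM x); exact: ler_norm.
rewrite -gE ler_pM2l// in c1.
rewrite ger0_norm ?subr_ge0// -(ler_pM2l m0) mulrBr divff ?gt_eqF//.
by rewrite lerBlDl.
Qed.

(** Mollification converges in L^p: truncation reduces the general case to
    bounded functions, for which all exponents are equivalent. *)
Lemma moll_Lcvg p (s : R) u : Lp p.+1 s u -> Lcvg p.+1 u.
Proof.
move=> Lu; have [iu ip us] := Lu; apply: (@Lcvg_close p s) => // e e0.
have mu := lintble_meas iu.
pose E (N : nat) : set T := [set x | `|u x| <= N%:R].
have mE N : measurable (E N).
  exact: lmeas_le (lintble_meas (lintble_abs iu)).
pose v N x := \1_(E N) x * u x.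
have iv N : lintble (v N) by exact: lintble_mul_indic.
have vN N x : `|v N x| <= N%:R.
  rewrite /v indicE; case: (boolP (x \in E N)) => [|_].
    by rewrite inE mul1r.
  by rewrite mul0r normr0.
have vs N : supp_in s (v N) by move=> x xs; rewrite /v us// mulr0.
have vu N x : `|v N x| <= `|u x|.
  by rewrite /v indicE; case: (_ \in _); rewrite ?mul1r// mul0r normr0.
have Lv N : Lp p.+1 s (v N).
  split => //; apply: lintble_le ip; first by apply: lmeas_pow; exact: lintble_meas.
  by move=> x; rewrite normrX normr_id lerXn2r ?nnegrE.
have cv N : Lcvg p.+1 (v N).
  move=> e' e'0; have c0 : 0 < (2 * N%:R + 1) ^+ p :> R.
    by rewrite exprn_gt0// ltr_wpDl// mulr_ge0.
  have e1 : 0 < e' / (2 * N%:R + 1) ^+ p by rewrite divr_gt0.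
  have [N0 HN0] := @Lcvg_bounded1 s N%:R _ (lintble_meas (iv N)) (vN N) (vs N) _ e1.
  exists N0 => k kN; have := HN0 k kN; rewrite ler_pdivlMr// mulrC => h; apply: le_trans h.
  have r0 := rad_gt0 k; have [im _] := moll_lint r0 (iv N) (vs N).
  have [[_ imp _] _] := moll_Lp r0 (Lv N).
  have i1 : lintble (fun x => `|moll (rad k) (v N) x - v N x| ^+ 1).
    by apply: lintble_abs; exact: lintbleB.
  rewrite -lintZ//; apply: lint_le.
  - by have [_ ? _] := Lv N; exact: lintble_powB.
  - exact: lintbleZ.
  move=> x; rewrite exprS expr1 mulrC ler_wpM2r//.
  have mN : `|moll (rad k) (v N) x| <= N%:R.
    have [h1 h2] := lint_eta_refl x r0.
    have b := @eta_bc R n (rad k) (fun=> 0%N).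
    apply: (le_trans (lint_abs (conv_lintble x b (iv N)))).
    have -> : N%:R = lint (fun y => N%:R * eta (rad k) (fun=> 0%N) (x - y)).
      by rewrite lintZ// h2 mulr1.
    apply: lint_le.
    - by apply: lintble_abs; exact: conv_lintble.
    - exact: lintbleZ.
    move=> y; have e0' := @eta_ge0 R n (rad k) (x - y) r0.
    by rewrite normrM mulrC (ger0_norm e0') ler_wpM2r.
  rewrite lerXn2r ?nnegrE ?addr_ge0 ?mulr_ge0//.
  apply: (le_trans (ler_normB _ _)); apply: (@le_trans _ _ (N%:R + N%:R)); first exact: lerD.
  by rewrite mulr_natl mulr2n lerDl.
pose f N x := `|u x - v N x| ^+ p.+1.
have mf N : lmeas (f N) by apply: lmeas_pow; apply: measurable_funB => //; exact: lintble_meas.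
have f0 x : f N x @[N --> \oo] --> (0 : R).
  apply: cvg_near_cst; exists (Num.truncn `|u x|).+1 => // N /= hN.
  rewrite /f /v indicE mem_set ?mul1r ?subrr ?normr0 ?expr0n//.
  rewrite /E/=; apply: ltW; apply: lt_le_trans (truncnS_gt _) _.
  by rewrite ler_nat.
have fle N x : `|f N x| <= `|u x| ^+ p.+1.
  rewrite /f normrX normr_id lerXn2r ?nnegrE//.
  by rewrite /v indicE; case: (_ \in _); rewrite ?mul1r ?subrr ?normr0// mul0r subr0.
have [_ cf] := lint_dct mf f0 fle ip; rewrite lint0 in cf.
have [N HN] := cvg_eps cf e0; exists (v N); split => //.
by have := HN N (leqnn N); rewrite subr0 => h; apply: le_trans h; exact: ler_norm.
Qed.

End mollification_cvg.

(** * Operator norm, determinant and adjugate *)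

Section operator_norm.
Context {R : realType} {n : nat}.
Implicit Types (A B D : 'M[R]_n) (v w x : 'rV[R]_n).

Lemma mulmx_trtr A x : (A *m x^T)^T = x *m A^T.
Proof. by rewrite trmx_mul trmxK. Qed.

Lemma opnorm_has_ub A : has_ubound [set enorm (A *m xi^T)^T | xi in [set xi : 'rV[R]_n | enorm xi = 1]].
Proof.
exists (\sum_i \sum_j `|A i j| * n%:R) => _ [x x1 <-]; rewrite mulmx_trtr.
apply: (le_trans (enorm_le_norm _)); rewrite mulrC.
under eq_bigr do rewrite -mulr_suml.
rewrite -mulr_suml ler_wpM2r//; apply: norm_coord_le => [|i].
  by apply: sumr_ge0 => i _; apply: sumr_ge0.
rewrite (bigD1 i)//= -[leLHS]addr0 lerD//; last by do 2 apply: sumr_ge0 => ? _.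
rewrite mxE; apply: (le_trans (ler_norm_sum _ _ _)); apply: ler_sum => j _.
rewrite mxE normrM ler_piMl//; apply: le_trans (coord_enorm _ _) _; by rewrite x1.
Qed.

Lemma opnorm_le A (c : R) : 0 <= c -> (forall x, enorm x = 1 -> enorm (x *m A^T) <= c) -> opnorm A <= c.
Proof.
move=> c0 H; rewrite /opnorm; set S := [set _ | _ in _].
have [[s Ss]|S0] := pselect (S !=set0); last first.
  by rewrite sup_out// => -[].
apply: ge_sup; first by exists s.
by move=> _ [x x1 <-]; rewrite mulmx_trtr; exact: H.
Qed.

Lemma opnorm_ge0 A : 0 <= opnorm A.
Proof.
rewrite /opnorm; set S := [set _ | _ in _].
have [[s Ss]|S0] := pselect (S !=set0); last by rewrite sup_out// => -[].
have := @ub_le_sup _ S (opnorm_has_ub A) s Ss; apply: le_trans.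
by case: Ss => x _ <-; exact: enorm_ge0.
Qed.

Lemma opnorm_ub A x : enorm (x *m A^T) <= opnorm A * enorm x.
Proof.
have [->|x0] := eqVneq x 0; first by rewrite mul0mx enorm0 mulr0.
have e0 : 0 < enorm x by rewrite lt_neqAle enorm_ge0 andbT eq_sym enorm_eq0.
rewrite -ler_pdivrMr// mulrC -[_^-1]gtr0_norm ?invr_gt0// -enormZ scalemxAl -mulmx_trtr.
apply: ub_le_sup; first exact: opnorm_has_ub.
exists ((enorm x)^-1 *: x) => //=.
by rewrite enormZ gtr0_norm ?invr_gt0// mulVf// gt_eqF.
Qed.

Lemma enorm_delta j : enorm (delta_mx 0 j : 'rV[R]_n) = 1.
Proof.
rewrite enormE /dot (bigD1 j)//= big1 ?addr0; last first.
  by move=> i ij; rewrite !mxE eqxx (negPf ij) mul0r.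
by rewrite !mxE !eqxx mulr1 sqrtr1.
Qed.

Lemma opnorm_entry A i j : `|A i j| <= opnorm A.
Proof.
apply: (@le_trans _ _ (enorm (delta_mx 0 j *m A^T))); last first.
  by have := opnorm_ub A (delta_mx 0 j); rewrite enorm_delta mulr1.
have := coord_enorm (delta_mx 0 j *m A^T) i.
by rewrite -rowE !mxE.
Qed.

Lemma opnorm_sum A : opnorm A <= n%:R * \sum_i \sum_j `|A i j|.
Proof.
apply: opnorm_le => [|x x1].
  by rewrite mulr_ge0//; do 2 apply: sumr_ge0 => ? _.
apply: (le_trans (enorm_le_norm _)).
rewrite ler_wpM2l//; apply: norm_coord_le => [|i].
  by apply: sumr_ge0 => i _; apply: sumr_ge0.
rewrite (bigD1 i)//= -[leLHS]addr0 lerD//; last by do 2 apply: sumr_ge0 => ? _.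
rewrite mxE; apply: (le_trans (ler_norm_sum _ _ _)); apply: ler_sum => j _.
rewrite mxE normrM ler_piMl//; apply: le_trans (coord_enorm _ _) _; by rewrite x1.
Qed.

Lemma opnormD A B : opnorm (A + B) <= opnorm A + opnorm B.
Proof.
apply: opnorm_le => [|x x1]; first by rewrite addr_ge0// opnorm_ge0.
rewrite linearD mulmxDr; apply: (le_trans (enormD _ _)).
by apply: lerD; apply: (le_trans (opnorm_ub _ _)); rewrite x1 mulr1.
Qed.

Lemma opnormN A : opnorm (- A) = opnorm A.
Proof.
have H B : opnorm (- B) <= opnorm B.
  apply: opnorm_le => [|x x1]; first exact: opnorm_ge0.
  by rewrite linearN mulmxN enormN; apply: (le_trans (opnorm_ub _ _)); rewrite x1 mulr1.
by apply/eqP; rewrite eq_le H/= -{1}(opprK A) H.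
Qed.

Lemma opnorm_dist A B : `|opnorm A - opnorm B| <= opnorm (A - B).
Proof.
rewrite ler_norml; apply/andP; split.
  have H : opnorm B <= opnorm (B - A) + opnorm A by apply: le_trans (opnormD _ _); rewrite subrK.
  by rewrite -opnormN opprB lerNl opprB lerBlDr.
by rewrite lerBlDr; apply: le_trans (opnormD _ _); rewrite subrK.
Qed.

Lemma opnorm0 : opnorm (0 : 'M[R]_n) = 0.
Proof.
apply/eqP; rewrite eq_le opnorm_ge0 andbT; apply: opnorm_le => // x _.
by rewrite trmx0 mulmx0 enorm0.
Qed.

Lemma opnorm_eq0 A : opnorm A = 0 -> A = 0.
Proof.
move=> A0; apply/matrixP => i j; apply/eqP; rewrite mxE -normr_le0 -A0.
exact: opnorm_entry.
Qed.

(** A linear map sends the unit ball into the ball of radius its operator norm,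
    and multiplies volumes by the absolute value of its determinant. *)
Lemma det_opnorm A : (0 < n)%N -> `|\det A| <= opnorm A ^+ n.
Proof.
move=> n0; have [uA|nA] := boolP (A^T \in unitmx); last first.
  by move: nA; rewrite unitmxE unitfE negbK det_tr => /eqP ->; rewrite normr0 exprn_ge0// opnorm_ge0.
have a0 : 0 < opnorm A.
  rewrite lt_neqAle opnorm_ge0 andbT eq_sym; apply/eqP => /opnorm_eq0 A0.
  move: uA; rewrite unitmxE unitfE det_tr A0; case: n n0 => // n' _.
  by rewrite det0 eqxx.
have := @leb_linear R n A^T (eball 0 1) uA; rewrite det_tr leb_eball01 => E.
have : (leb n [set x *m A^T | x in eball 0 1] <= leb n (eball (0 : 'rV[R]_n) (opnorm A)))%E.
  apply: le_leb => _ [x x1 <-]; rewrite /eball /= !subr0 in x1 *.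
  apply: (le_lt_trans (opnorm_ub _ _)); by rewrite -[ltRHS]mulr1 ltr_pM2l.
rewrite E leb_eball//; last exact: ltW.
by rewrite -EFinM lee_fin mulrC ler_pM2l// omega_gt0.
Qed.

Definition rrow A (l : 'I_n) w : 'M[R]_n := \matrix_(i, j) if i == l then w 0 j else A i j.

Lemma det_rrow A l w : \det (rrow A l w) = (w *m \adj A) 0 l.
Proof.
rewrite (expand_det_row _ l) mxE; apply: eq_bigr => j _; rewrite !mxE eqxx; congr (_ * _).
rewrite /cofactor; congr (_ * \det _); apply/matrixP => i k; rewrite !mxE.
by rewrite eq_sym (negPf (neq_lift _ _)).
Qed.

Lemma det_row_add A B l (c : R) w : (forall i, i != l -> row i A = row i B) ->
  row l A = row l B + c *: w -> \det A = \det B + c * \det (rrow B l w).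
Proof.
move=> AB Al; have nl i : lift l i != l by rewrite eq_sym neq_lift.
rewrite -[\det B]mul1r; apply: (@determinant_multilinear _ _ _ _ _ l).
- by rewrite scale1r Al; congr (_ + _ *: _); apply/rowP => j; rewrite !mxE eqxx.
- by apply/matrixP => i j; rewrite !mxE; have /rowP/(_ j) := AB (lift l i) (nl i); rewrite !mxE.
apply/matrixP => i j; rewrite !mxE (negPf (nl i)).
by have /rowP/(_ j) := AB (lift l i) (nl i); rewrite !mxE.
Qed.

(** Matrix determinant lemma: the rank one perturbation is added one row at a
    time, and each determinant so produced has two proportional rows except
    for the expected terms. *)
Lemma det_rank1 A v w : \det (A + v^T *m w) = \det A + dot v (w *m \adj A).
Proof.
pose N k : 'M[R]_n := \matrix_(i, j) (A i j + (i < k)%:R * (v 0 i * w 0 j)).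
have rN l k : (k <= n)%N -> \det (rrow (N k) l w) = \det (rrow A l w).
  elim: k => [_|k IH kn].
    congr (\det (rrow _ _ _)); apply/matrixP => i j; by rewrite !mxE mul0r addr0.
  rewrite -IH ?(ltnW kn)//; pose m := Ordinal kn.
  have Nrow i : i != m -> forall j, N k.+1 i j = N k i j.
    move=> im j; rewrite !mxE ltnS leq_eqVlt.
    by have -> : (i == k :> nat) = false; [apply/negbTE|].
  have [lm|lm] := eqVneq l m.
    congr (\det _); apply/matrixP => i j; rewrite !mxE.
    case: eqVneq => // il; have := Nrow i; rewrite -lm => /(_ il j).
    by rewrite !mxE.
  rewrite (@det_row_add (rrow (N k.+1) l w) (rrow (N k) l w) m (v 0 m) w).
  - rewrite [X in _ + _ * X](@determinant_alternate _ _ _ l m) ?mulr0 ?addr0//.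
    by move=> j; rewrite !mxE eqxx (negPf lm) eqxx.
  - move=> i im; apply/rowP => j; rewrite !mxE; case: eqVneq => // _.
    by have := Nrow i im j; rewrite !mxE.
  apply/rowP => j; rewrite !mxE [m == l]eq_sym (negPf lm) /= ltnn ltnSn mul1r mul0r addr0//.
have dN k : (k <= n)%N -> \det (N k) = \det A + \sum_(l < n | (l < k)%N) v 0 l * \det (rrow A l w).
  elim: k => [_|k IH kn].
    rewrite big_pred0// addr0; congr (\det _); apply/matrixP => i j; by rewrite !mxE mul0r addr0.
  pose m := Ordinal kn.
  rewrite (@det_row_add (N k.+1) (N k) m (v 0 m) w).
  - rewrite IH ?(ltnW kn)// rN ?(ltnW kn)// -addrA; congr (_ + _).
    rewrite [RHS](bigD1 m) ?ltnSn//= addrC; congr (_ + _); apply: eq_bigl => i.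
    by rewrite ltnS andbC -[i != m]/(i != k :> nat) -ltn_neqAle.
  - move=> i im; apply/rowP => j; rewrite !mxE ltnS leq_eqVlt.
    by have -> : (i == k :> nat) = false; [apply/negbTE|].
  by apply/rowP => j; rewrite !mxE /= ltnn ltnSn mul1r mul0r addr0.
have -> : A + v^T *m w = N n.
  by apply/matrixP => i j; rewrite !mxE big_ord1 !mxE ltn_ord mul1r ?ord1.
rewrite dN//; congr (_ + _); rewrite (eq_bigl xpredT); last by move=> i; rewrite ltn_ord.
by apply: eq_bigr => l _; rewrite det_rrow.
Qed.

(** The adjugate is bounded by the power [n - 1] of the operator norm.  With
    [c] the image of the unit vector [v] under the adjugate, replace the
    [v]-component of [A] by [opnorm A] times the projection on the direction of
    [c]: the norm does not increase, since [A] maps [c] to a multiple of [v],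
    and the determinant becomes [opnorm A] times the length of [c]. *)
Lemma adj_opnorm1 A v : (1 < n)%N -> enorm v = 1 ->
  enorm (v *m (\adj A)^T) <= opnorm A ^+ n.-1.
Proof.
move=> n1 v1; set a := opnorm A; set c := v *m _.
have n0 : (0 < n)%N by exact: ltnW.
have [a0|a0] := eqVneq a 0.
  have A0 : A = 0 *: A by rewrite scale0r; exact: opnorm_eq0.
  have np : (n.-1 == 0)%N = false by rewrite -subn1 subn_eq0 leqNgt n1.
  rewrite /c A0 adjZ expr0n np.
  by rewrite /= scale0r trmx0 mulmx0 enorm0 exprn_ge0// opnorm_ge0.
have {}a0 : 0 < a by rewrite lt_neqAle opnorm_ge0 andbT eq_sym.
have [c0|c0] := eqVneq c 0; first by rewrite c0 enorm0 exprn_ge0// ltW.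
have e0 : 0 < enorm c by rewrite lt_neqAle enorm_ge0 andbT eq_sym enorm_eq0.
pose u := (enorm c)^-1 *: c.
have u1 : dot u u = 1.
  by rewrite -enorm_sqr enormZ gtr0_norm ?invr_gt0// mulVf ?gt_eqF// expr1n.
have v1' : dot v v = 1 by rewrite -enorm_sqr v1 expr1n.
have cA : c *m A^T = \det A *: v.
  by rewrite /c -mulmxA -trmx_mul mul_mx_adj tr_scalar_mx mul_mx_scalar.
pose z := a *: u - v *m A.
have dM : \det (A + v^T *m z) = a * enorm c.
  rewrite det_rank1 dotE trmx_mul mulmxA -/c -dotE /z dotBr dotZr.
  have -> : dot c u = enorm c by rewrite dotZr -enorm_sqr expr2 mulKf// gt_eqF.
  have -> : dot c (v *m A) = \det A.
    by rewrite dotE trmx_mul mulmxA cA -scalemxAl mxE -dotE v1' mulr1.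
  by rewrite addrC subrK.
have oM : opnorm (A + v^T *m z) <= a.
  apply: opnorm_le => [|x x1]; first exact: ltW.
  pose t := dot x u; pose x' := x - t *: u; pose y := x' *m A^T.
  have xE : x = x' + t *: u by rewrite /x' subrK.
  have E : x *m (A + v^T *m z)^T = y - dot y v *: v + (a * t) *: v.
    rewrite linearD/= trmx_mul trmxK mulmxDr mulmxA.
    have -> : x *m z^T = (a * t - dot (x *m A^T) v)%:M.
      rewrite [LHS]mx11_scalar -dotE /z dotBr dotZr; congr (_ - _)%:M.
      by rewrite !dotE trmx_mul mulmxA.
    rewrite mul_scalar_mx scalerBl addrA addrAC; congr (_ + _).
    have -> : x *m A^T = y + (t * ((enorm c)^-1 * \det A)) *: v.
      by rewrite {1}xE mulmxDl -scalemxAl /u -scalemxAl cA !scalerA mulrA.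
    by rewrite dotDl dotZl v1' mulr1 scalerDl opprD addrACA subrr addr0.
  have yv : dot (y - dot y v *: v) v = 0 by rewrite dotBl dotZl v1' mulr1 subrr.
  rewrite -(@ler_pXn2r _ 2) ?nnegrE ?enorm_ge0 ?(ltW a0)// enorm_sqr E.
  have h1 : dot (y - dot y v *: v) (y - dot y v *: v) <= dot y y.
    rewrite dotBr dotZr yv mulr0 subr0 dotBl dotZl (dotC v).
    by rewrite gerBl -expr2 sqr_ge0.
  move: (y - dot y v *: v) yv h1 {E} => q yv h1.
  rewrite dotDl !dotDr !dotZl !dotZr (dotC v q) yv v1' !mulr0 mulr1 addr0 add0r.
  have h2 : dot y y <= a ^+ 2 * dot x' x'.
    rewrite -!enorm_sqr -exprMn ler_pXn2r ?nnegrE ?mulr_ge0 ?enorm_ge0 ?(ltW a0)//.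
    exact: opnorm_ub.
  have H3 w : dot w w = 1 -> dot (x - dot x w *: w) (x - dot x w *: w) = 1 - dot x w ^+ 2.
    move=> w1; rewrite dotBl !dotBr !dotZl !dotZr (dotC w x) w1 -enorm_sqr x1; ring.
  have h3 : dot x' x' = 1 - t ^+ 2 by exact: H3.
  rewrite h3 in h2; move: h1 h2; set X := dot q q; set Y := dot y y; lra.
have := le_trans (det_opnorm (A + v^T *m z) n0) (lerXn2r _ _ _ oM).
rewrite !nnegrE opnorm_ge0 (ltW a0) => /(_ isT isT).
rewrite dM ger0_norm ?mulr_ge0 ?(ltW a0) ?enorm_ge0//.
have -> : a ^+ n = a * a ^+ n.-1 by rewrite -exprS prednK.
by rewrite ler_pM2l.
Qed.

Lemma adj_opnorm A v w : (1 < n)%N ->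
  `|dot v (w *m \adj A)| <= enorm v * enorm w * opnorm A ^+ n.-1.
Proof.
move=> n1; have H w' v' : dot v' (w' *m \adj A) <= enorm v' * enorm w' * opnorm A ^+ n.-1.
  rewrite dotE trmx_mul mulmxA -dotE mulrAC; apply: (le_trans (cauchy_schwarz _ _)).
  apply: ler_wpM2r; first exact: enorm_ge0.
  have [->|v0] := eqVneq v' 0; first by rewrite mul0mx enorm0 mul0r.
  have e0 : 0 < enorm v' by rewrite lt_neqAle enorm_ge0 andbT eq_sym enorm_eq0.
  rewrite -ler_pdivrMl// -{1}[_^-1]gtr0_norm ?invr_gt0// -enormZ scalemxAl.
  apply: adj_opnorm1 => //; by rewrite enormZ gtr0_norm ?invr_gt0// mulVf// gt_eqF.
by rewrite ler_norml H andbT lerNl -dotNl -(enormN v) H.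
Qed.

End operator_norm.

(** * The Jacobian as a null Lagrangian *)

Section continuity_distance.
Context {R : realType} (V W : normedModType R).

Lemma dist_continuous (f : V -> W) :
  (forall x e, 0 < e -> \forall y \near x, `|f x - f y| < e) -> continuous f.
Proof. by move=> H x; apply/cvgrPdist_lt => e; exact: H. Qed.

Lemma continuous_dist (f : V -> W) : continuous f ->
  forall x e, 0 < e -> \forall y \near x, `|f x - f y| < e.
Proof. by move=> cf x e e0; have := cf x; move/cvgrPdist_lt; apply. Qed.

End continuity_distance.

Lemma row_continuous {R : realType} (V : normedModType R) (m : nat) (f : V -> 'rV[R]_m) :
  (forall i, continuous (fun x => f x 0 i : R^o)) -> continuous f.
Proof.
move=> cf x; apply/cvgrPdist_lt => e e0.
near=> t; have Ht : forall i, `|f x 0 i - f t 0 i| < e.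
  near: t; apply: filter_forall => i.
  by have := cf i x; move/cvgrPdist_lt; apply.
have : ball (f x) e (f t) by apply/rV_ballP.
by rewrite -ball_normE.
Unshelve. all: by end_near. Qed.

Section null_lagrangian.
Context {R : realType} {n : nat}.
Implicit Types (x y z v : 'rV[R]_n) (f g u : 'rV[R]_n -> R).
Local Notation T := (Rmeas R n).

Lemma cont_det (m : nat) (M : 'rV[R]_n -> 'M[R]_m) :
  (forall i j, continuous (fun x => M x i j)) -> continuous (fun x => \det (M x)).
Proof.
move=> cM; rewrite /determinant; apply: cont_sum => s; apply: contZ.
by apply: cont_prod => i; exact: cM.
Qed.

Lemma cont_adj (m : nat) (M : 'rV[R]_n -> 'M[R]_m) i j :
  (forall i j, continuous (fun x => M x i j)) -> continuous (fun x => (\adj (M x)) i j).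
Proof.
move=> cM; rewrite (_ : (fun x => _) = (fun x => (-1) ^+ (j + i) * \det (row' j (col' i (M x))))).
  apply: contZ; apply: cont_det => k l.
  by rewrite (_ : (fun x => _) = (fun x => M x (lift j k) (lift i l))); [exact: cM|apply/funext => x; rewrite !mxE].
by apply/funext => x; rewrite mxE.
Qed.

Lemma cont_opnorm (M : 'rV[R]_n -> 'M[R]_n) :
  (forall i j, continuous (fun x => M x i j)) -> continuous (fun x => opnorm (M x)).
Proof.
move=> cM; apply: (@dist_continuous R _ R^o) => x e e0.
have cS : continuous (fun y => n%:R * \sum_i \sum_j `|M x i j - M y i j|).
  apply: contZ; apply: cont_sum => i; apply: cont_sum => j; apply: norm_continuous_comp.
  by apply: contD; [exact: cst_continuous|exact: contN].
have := @continuous_dist R _ R^o _ cS x _ e0; apply: filterS => y.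
rewrite big1 ?mulr0 ?sub0r; last by move=> i _; rewrite big1// => j _; rewrite subrr normr0.
rewrite normrN => h; apply: (le_lt_trans (opnorm_dist _ _)); apply: le_lt_trans h.
apply: le_trans (ler_norm _); apply: (le_trans (opnorm_sum _)); rewrite le_eqVlt.
by apply/orP; left; apply/eqP; congr (_ * _); apply: eq_bigr => i _; apply: eq_bigr => j _; rewrite !mxE.
Qed.

Definition jmx (D : 'I_n -> 'I_n -> 'rV[R]_n -> R) x : 'M[R]_n := \matrix_(i, j) D i j x.

(** The determinant of a Jacobian matrix is a null Lagrangian: after an
    integration by parts in each term of the Leibniz expansion, the second
    derivatives cancel in pairs of permutations exchanged by a transposition. *)
Lemma null_lagrangian (r : R) (l : 'I_n) (psi : 'rV[R]_n -> R) dpsi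
    (D : 'I_n -> 'I_n -> 'rV[R]_n -> R) (DD : 'I_n -> 'I_n -> 'I_n -> 'rV[R]_n -> R) :
  C11 psi dpsi -> supp_in r psi -> (forall i j, C11 (D i j) (DD i j)) ->
  (forall i j k x, DD i j k x = DD i k j x) ->
  lint (fun x => \det (rrow (jmx D x) l (\row_j dpsi j x))) = 0.
Proof.
move=> psiC psir DC Dsym.
pose P (s : 'S_n) x := \prod_(i | i != l) D i (s i) x.
pose Q (s : 'S_n) j x := \sum_(k | k != l) DD k (s k) j x * \prod_(i | (i != l) && (i != k)) D i (s i) x.
have PC (s : 'S_n) : C11 (P s) (Q s).
  have us : uniq [seq i <- index_enum 'I_n | i != l] by rewrite filter_uniq// index_enum_uniq.
  apply: C11_ext (C11_prod us (fun i => DC i (s i))) => [x|j x]; rewrite big_filter//.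
  by apply: eq_bigr => k kl; rewrite big_filter_cond.
have key (s : 'S_n) : lint (fun x => dpsi (s l) x * P s x) = - lint (fun x => psi x * Q s (s l) x) /\
    (lintble (fun x => dpsi (s l) x * P s x) /\ lintble (fun x => psi x * Q s (s l) x)).
  have psir' := C11_supp (s l) psiC psir.
  have i1 : lintble (fun x => dpsi (s l) x * P s x).
    apply: (@lintble_cc _ _ r) => [|x xr]; last by rewrite psir' ?mul0r.
    by apply: contM; [exact: (C11_dcont psiC)|exact: C11_cont (PC s)].
  have i2 : lintble (fun x => psi x * Q s (s l) x).
    apply: (@lintble_cc _ _ r) => [|x xr]; last by rewrite psir ?mul0r.
    by apply: contM; [exact: C11_cont psiC|exact: (C11_dcont (PC s))].
  split => //; have [|_] := @lint_derive0 R n r _ _ (s l) (C11M psiC (PC s)).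
    by move=> x xr; rewrite psir ?mul0r.
  by rewrite lintD// => /eqP; rewrite addr_eq0 => /eqP.
have -> : lint (fun x => \det (rrow (jmx D x) l (\row_j dpsi j x))) =
    \sum_(s : 'S_n) (-1) ^+ s * lint (fun x => dpsi (s l) x * P s x).
  transitivity (lint (fun x => \sum_(s : 'S_n) (-1) ^+ s * (dpsi (s l) x * P s x))).
    apply: lint_ext => x; apply: eq_bigr => s _; congr (_ * _).
    rewrite (bigD1 l)//= !mxE eqxx; congr (_ * _); apply: eq_bigr => i il.
    by rewrite !mxE (negPf il).
  rewrite lint_sum; last by move=> s _; apply: lintbleZ; case: (key s) => _ [].
  by apply: eq_bigr => s _; rewrite lintZ//; case: (key s) => _ [].
have -> : \sum_(s : 'S_n) (-1) ^+ s * lint (fun x => dpsi (s l) x * P s x) =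
    - lint (fun x => \sum_(s : 'S_n) (-1) ^+ s * (psi x * Q s (s l) x)).
  rewrite lint_sum; last by move=> s _; apply: lintbleZ; case: (key s) => _ [].
  rewrite -sumrN; apply: eq_bigr => s _; have [E [_ i2]] := key s.
  by rewrite E lintZ// mulrN.
rewrite (_ : (fun x => _) = fun=> 0) ?lint0 ?oppr0//; apply/funext => x.
have -> : \sum_(s : 'S_n) (-1) ^+ s * (psi x * Q s (s l) x) =
    psi x * \sum_(k | k != l) \sum_(s : 'S_n) (-1) ^+ s *
      (DD k (s k) (s l) x * \prod_(i | (i != l) && (i != k)) D i (s i) x).
  rewrite exchange_big/= mulr_sumr; apply: eq_bigr => s _.
  by rewrite mulrCA; congr (_ * _); rewrite mulr_sumr.
rewrite big1 ?mulr0// => k kl; set S := \sum_(s : 'S_n) _.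
suff SE : S = - S.
  have : S + S = 0 by rewrite {1}SE addNr.
  by rewrite -mulr2n => /eqP; rewrite mulrn_eq0 => /eqP.
rewrite {1}/S (reindex_inj (mulgI (tperm l k)))/= -sumrN; apply: eq_bigr => s _.
rewrite odd_permM odd_tperm eq_sym kl /= !permM tpermL tpermR Dsym.
rewrite signrN mulNr; congr (- (_ * (_ * _))).
apply: eq_bigr => i /andP[il ik]; rewrite permM tpermD// eq_sym//.
Qed.

End null_lagrangian.

Section degree.
Context {R : realType} {n : nat}.
Implicit Types (x y z v : 'rV[R]_n) (g u k : 'rV[R]_n -> R).
Local Notation T := (Rmeas R n).
Variables (F : 'I_n -> 'rV[R]_n -> R) (D : 'I_n -> 'I_n -> 'rV[R]_n -> R)
  (DD : 'I_n -> 'I_n -> 'I_n -> 'rV[R]_n -> R).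
Hypothesis FC : forall i, C11 (F i) (D i).
Hypothesis DC : forall i j, C11 (D i j) (DD i j).
Hypothesis Dsym : forall i j m x, DD i j m x = DD i m j x.

Let f x : 'rV[R]_n := \row_i F i x.
Let J x := \det (jmx D x).

Lemma map_bounded : exists2 B : R, 0 <= B & forall x, `|f x| <= B.
Proof.
have /choice[B HB] : forall i, exists B, 0 <= B /\ forall x, `|F i x| <= B.
  by move=> i; case: (FC i) => M [H _ _ _]; exists M; split => //; exact: le_trans (H 0).
have B0 i : 0 <= B i by case: (HB i).
exists (\sum_i B i) => [|x]; first exact: sumr_ge0.
apply: norm_coord_le => [|i]; first exact: sumr_ge0.
rewrite mxE; have [_ H] := HB i; apply: (le_trans (H x)).
by rewrite (bigD1 i)//= lerDl sumr_ge0.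
Qed.

Lemma cont_along k y : continuous k -> continuous (fun x => k (y - f x)).
Proof.
move=> ck; have cf : continuous (fun x => y - f x).
  apply: row_continuous => i; rewrite (_ : (fun x => _) = (fun x => y 0 i - F i x)).
    by apply: contD; [exact: cst_continuous|apply: contN; exact: C11_cont (FC i)].
  by apply/funext => x; rewrite !mxE.
by move=> x; apply: (@continuous_comp _ _ _ (fun x => y - f x) k); [exact: cf|exact: ck].
Qed.

(** Push-forward of the density [u] by the map, smoothed by the kernel [k]. *)
Definition push k u y : R := lint (fun x => k (y - f x) * u x).

Lemma push_lintble k u y : bounded_cont k -> lintble u -> lintble (fun x => k (y - f x) * u x).
Proof.
move=> [ck [M _ kM]] iu; apply: (@lintble_bmul _ _ M) => //.
by apply: lmeas_cont; exact: cont_along.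
Qed.

Lemma push_cont k dk u : C11 k dk -> lintble u -> continuous (push k u).
Proof.
move=> kd iu; have [L L0 HL] := C11_lip kd; have bk := C11_bc kd.
apply: (@lip_continuous _ _ R^o _ (L * lint (fun y => `|u y|))) => y z.
have -> : push k u y - push k u z = lint (fun x => (k (y - f x) - k (z - f x)) * u x).
  rewrite /push -lintB; try exact: push_lintble.
  by apply: lint_ext => x; rewrite mulrBl.
rewrite mulrAC; apply: (lint_bmul_le _ _ iu).
  by apply: measurable_funB; apply: lmeas_cont; apply: cont_along; case: bk.
move=> x; have := HL (z - f x) (y - z); congr (`|k _ - _| <= _).
by rewrite addrC addrA subrK.
Qed.

Lemma push_lint (s r : R) u : 0 < s -> lintble u -> supp_in r u ->
  lintble (push (eta s (fun=> 0%N)) u) /\ lint (push (eta s (fun=> 0%N)) u) = lint u.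
Proof.
move=> s0 iu ur; have [M M0 HM] := @eta_bounded R n s (fun=> 0%N).
have [B B0 fB] := map_bounded.
have H i : measurable_fun setT (fun p : T * T => ((p.2 : 'rV[R]_n) - f p.1) 0 i).
  rewrite (_ : (fun p => _) = (fun p : T * T => p.2 0 i - F i p.1)); last first.
    by apply/funext => p; rewrite !mxE.
  apply: measurable_funB.
    exact: (measurableT_comp (measurable_coord i) (@measurable_snd _ _ _ _)).
  exact: (measurableT_comp (lmeas_cont (C11_cont (FC i))) (@measurable_fst _ _ _ _)).
have mk : measurable_fun setT (fun p : T * T => eta s (fun=> 0%N) ((p.2 : 'rV[R]_n) - f p.1)).
  exact: (@coords_meas R n _ (T * T)%type (fun p : T * T => (p.2 : 'rV[R]_n) - f p.1) (eta s (fun=> 0%N)) (@eta_cont R n s (fun=> 0%N)) H).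
have [||_ _ _ I2 E] := @lint_fubini R n (fun x y => eta s (fun=> 0%N) (y - f x)) u M (s + B) mk _ _ iu.
- by move=> x y; exact: HM.
- move=> x y yrs; rewrite eta_supp ?mul0r//.
  by have := lerB_dist y (f x); have := fB x; lra.
split; first exact: I2.
rewrite /push -E; apply: lint_ext => x; rewrite -[RHS]mulr1.
have [h1 h2] := lint_shift (- f x) (eta_lintble (fun=> 0%N) s0).
rewrite (lint_eta s0) in h2; rewrite -h2 -lintZ//.
by apply: lint_ext => y; rewrite mulrC.
Qed.

Lemma jac_cont : continuous J.
Proof.
apply: cont_det => i j; rewrite (_ : (fun x => _) = D i j); first exact: C11_cont (DC i j).
by apply/funext => x; rewrite mxE.
Qed.

Variables (phi : 'rV[R]_n -> R) (dphi : 'I_n -> 'rV[R]_n -> R) (r : R).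
Hypothesis phiC : C11 phi dphi.
Hypothesis phir : supp_in r phi.

Let grad x : 'rV[R]_n := \row_j dphi j x.

(** Integration by parts for the push-forward of [phi * J]: the derivative
    falls on [phi] alone. *)
Lemma push_derive k dk l y : C11 k dk ->
  lint (fun x => dk l (y - f x) * (phi x * J x)) =
  lint (fun x => k (y - f x) * (grad x *m \adj (jmx D x)) 0 l).
Proof.
move=> kd; have kC : C11 (fun z => k (y - z)) (fun j z => - dk j (y - z)).
  apply: C11_ext (C11_affine (-1) y kd) => [z|j z]; rewrite ?mulN1r scaleN1r addrC//.
have hC := C11_comp kC FC; have psiC := C11M phiC hC.
have psir : supp_in r (fun x => phi x * k (y - f x)).
  by move=> x xr; rewrite phir ?mul0r.
have := null_lagrangian l psiC psir DC Dsym.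
have cdk := C11_dcont kd; have cgrad j : continuous (fun x => grad x 0 j).
  by rewrite (_ : (fun x => _) = dphi j); [exact: (C11_dcont phiC)|apply/funext => x; rewrite mxE].
have cjm i j : continuous (fun x => jmx D x i j).
  by rewrite (_ : (fun x => _) = D i j); [exact: C11_cont (DC i j)|apply/funext => x; rewrite mxE].
have dphir j := C11_supp j phiC phir.
have i1 : lintble (fun x => dk l (y - f x) * (phi x * J x)).
  apply: (@lintble_cc _ _ r) => [|x xr]; last by rewrite phir ?mul0r ?mulr0.
  by apply: contM; [exact: cont_along|apply: contM; [exact: C11_cont phiC|exact: jac_cont]].
have i2 : lintble (fun x => k (y - f x) * (grad x *m \adj (jmx D x)) 0 l).
  apply: (@lintble_cc _ _ r) => [|x xr].
    apply: contM; first by apply: cont_along; exact: C11_cont kd.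
    rewrite (_ : (fun x => _) = (fun x => \sum_j grad x 0 j * (\adj (jmx D x)) j l)).
      by apply: cont_sum => j; apply: contM => //; exact: cont_adj.
    by apply/funext => x; rewrite mxE.
  by rewrite mxE big1 ?mulr0// => j _; rewrite !mxE dphir// mul0r.
move=> E; apply/eqP; rewrite -subr_eq0 -lintB//; apply/eqP.
rewrite -[RHS]oppr0 -{}[in RHS]E -lintN; last first.
  apply: (@lintble_cc _ _ r) => [|x xr].
    apply: cont_det => i j; have [il|il] := eqVneq i l.
      rewrite (_ : (fun x => _) = (fun x => dphi j x * k (y - f x) + phi x * \sum_m - dk m (y - f x) * D m j x)).
        apply: contD; apply: contM; [exact: (C11_dcont phiC)|by apply: cont_along; exact: C11_cont kd|exact: C11_cont phiC|].
        by apply: cont_sum => m; apply: contM; [apply: contN; exact: cont_along|exact: C11_cont (DC m j)].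
      by apply/funext => x; rewrite !mxE il eqxx.
    by rewrite (_ : (fun x => _) = (fun x => jmx D x i j))//; apply/funext => x; rewrite !mxE (negPf il).
  rewrite det_rrow mxE big1// => j _; rewrite !mxE dphir// phir//; ring.
apply: lint_ext => x; rewrite det_rrow.
have -> : \row_j (dphi j x * k (y - f x) + phi x * \sum_m - dk m (y - f x) * D m j x) =
    k (y - f x) *: grad x - phi x *: ((\row_m dk m (y - f x)) *m jmx D x).
  apply/rowP => j; rewrite !mxE mulrC; congr (_ + _); rewrite -mulrN; congr (_ * _).
  by rewrite -sumrN; apply: eq_bigr => m _; rewrite !mxE mulNr.
rewrite mulmxBl -!scalemxAl -mulmxA mul_mx_adj mul_mx_scalar.
move: (grad x *m \adj (jmx D x)) => G; rewrite !mxE -/(J x); ring.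
Qed.

Let kap x := enorm (grad x) * opnorm (jmx D x) ^+ n.-1.

(** Isoperimetric inequality for the map, weighted by [phi]: the co-area form
    applied to the push-forward of [phi * J]. *)
Lemma degree_isoperimetric (s w : R) : (1 < n)%N -> 0 < s -> 0 < w ->
  (leb n [set y | (exists x, phi x != 0 /\ `|y - f x| <= s)%R] <= (omega R n * w ^+ n)%:E)%E ->
  n%:R * `|lint (fun x => phi x * J x)| <= w * lint kap /\ lintble kap.
Proof.
move=> n1 s0 w0 lebw; have n0 : (0 < n)%N by exact: ltnW.
have iu : lintble (fun x => phi x * J x).
  apply: (@lintble_cc _ _ r) => [|x xr]; last by rewrite phir ?mul0r.
  by apply: contM; [exact: C11_cont phiC|exact: jac_cont].
have ur : supp_in r (fun x => phi x * J x) by move=> x xr; rewrite phir ?mul0r.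
have grad0 x : r < `|x| -> grad x = 0.
  by move=> xr; apply/rowP => j; rewrite !mxE (C11_supp j phiC phir).
have kr : supp_in r kap by move=> x xr; rewrite /kap grad0// enorm0 mul0r.
have k0 x : 0 <= kap x by rewrite mulr_ge0 ?enorm_ge0// exprn_ge0// opnorm_ge0.
have cgr : continuous grad.
  apply: row_continuous => j; rewrite (_ : (fun x => _) = dphi j).
    exact: (C11_dcont phiC).
  by apply/funext => x; rewrite mxE.
have ik : lintble kap.
  apply: lintble_cc kr; apply: contM.
    by move=> x; apply: continuous_comp; [exact: cgr|exact: enorm_continuous].
  have co : continuous (fun x => opnorm (jmx D x)).
    apply: cont_opnorm => i j; rewrite (_ : (fun x => _) = D i j); first exact: C11_cont (DC i j).
    by apply/funext => x; rewrite mxE.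
  elim: n.-1 => [|m IH]; first by rewrite (_ : (fun x => _) = fun=> 1)//; exact: cst_continuous.
  by rewrite (_ : (fun x => _) = fun x => opnorm (jmx D x) * opnorm (jmx D x) ^+ m);
    [exact: contM|apply/funext => x; rewrite exprS].
split => //.
have eC : C11 (eta s (fun=> 0%N)) (fun j => eta s (inc (fun=> 0%N) j)) := @eta_C11 R n s (fun=> 0%N).
have eb := C11_bc eC; have [B B0 fB] := map_bounded.
set e0 := eta s (fun=> 0%N) in eC eb *.
have e0ge z : 0 <= e0 z by exact: eta_ge0.
have es : supp_in s e0 by exact: eta_supp.
pose g := push e0 (fun x => phi x * J x); pose H := push e0 kap.
have [ig Eg] := push_lint s0 iu ur; have [iH EH] := push_lint s0 ik kr.
rewrite -/g in ig Eg; rewrite -/H in iH EH.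
have psupp u' : supp_in (s + B) (push e0 u').
  move=> y yr; apply: etrans lint0; apply: lint_ext => x; rewrite es ?mul0r//.
  by have := lerB_dist y (f x); have := fB x; lra.
have H0 y : 0 <= H y by apply: lint_ge0 => x; rewrite mulr_ge0.
case: (eC) => M [eM dM _ tM]; have M0 : 0 <= M by apply: le_trans (eM 0).
have I0 : 0 <= lint (fun x => `|phi x * J x|) by apply: lint_ge0.
have dec (j : 'I_n) : bounded_cont (eta s (inc (fun=> 0%N) j)) by exact: eta_bc.
have gH y z : `|g z| <= `|g y| + enorm (z - y) * H y +
    (M * lint (fun x => `|phi x * J x|)) * enorm (z - y) ^+ 2.
  set v := z - y; have zE : z = y + v by rewrite /v subrKC.
  pose Tl x := \sum_l v 0 l * (eta s (inc (fun=> 0%N) l) (y - f x) * (phi x * J x)).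
  have iTl l : lintble (fun x => eta s (inc (fun=> 0%N) l) (y - f x) * (phi x * J x)).
    exact: push_lintble.
  have iT : lintble Tl by apply: lintble_sum => l _; apply: lintbleZ.
  have ET : `|lint Tl| <= enorm v * H y.
    have ic l : lintble (fun x => e0 (y - f x) * (grad x *m \adj (jmx D x)) 0 l).
      apply: (@lintble_cc _ _ r) => [|x xr].
        apply: contM; first by apply: cont_along; case: eb.
        rewrite (_ : (fun x => _) = (fun x => \sum_j dphi j x * (\adj (jmx D x)) j l)).
          apply: cont_sum => j; apply: contM; first exact: (C11_dcont phiC).
          apply: cont_adj => i' j'; rewrite (_ : (fun x => _) = D i' j'); first exact: C11_cont (DC i' j').
          by apply/funext => x; rewrite mxE.
        by apply/funext => x; rewrite mxE; apply: eq_bigr => j _; rewrite mxE.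
      by rewrite grad0// mul0mx mxE mulr0.
    have -> : lint Tl = lint (fun x => e0 (y - f x) * dot v (grad x *m \adj (jmx D x))).
      rewrite /Tl lint_sum; last by move=> l _; exact: lintbleZ.
      transitivity (\sum_l lint (fun x => v 0 l * (e0 (y - f x) * (grad x *m \adj (jmx D x)) 0 l))).
        by apply: eq_bigr => l _; rewrite !lintZ//; congr (_ * _); exact: (push_derive l y eC).
      rewrite -lint_sum; last by move=> l _; exact: lintbleZ.
      apply: lint_ext => x; rewrite /dot mulr_sumr; apply: eq_bigr => l _; ring.
    have idot : lintble (fun x => e0 (y - f x) * dot v (grad x *m \adj (jmx D x))).
      have := @lintble_sum R n _ (index_enum 'I_n) xpredT _ (fun l _ => lintbleZ (v 0 l) (ic l)).
      apply: lintble_ext => x; rewrite /dot mulr_sumr; apply: eq_bigr => l _; ring.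
    apply: (le_trans (lint_abs idot)); rewrite /H /push -lintZ; last exact: push_lintble.
    apply: lint_le.
    - exact: lintble_abs.
    - by apply: lintbleZ; exact: push_lintble.
    move=> x; rewrite normrM ger0_norm// mulrCA; apply: ler_wpM2l => //.
    by rewrite /kap mulrA; exact: adj_opnorm.
  have Er : `|g z - g y - lint Tl| <= M * lint (fun x => `|phi x * J x|) * enorm v ^+ 2.
    have iz := push_lintble z eb iu; have iy := push_lintble y eb iu.
    have -> : g z - g y - lint Tl = lint (fun x => (e0 (z - f x) - e0 (y - f x) -
        \sum_l v 0 l * eta s (inc (fun=> 0%N) l) (y - f x)) * (phi x * J x)).
      rewrite /g /push -lintB// -lintB//; last exact: lintbleB.
      apply: lint_ext => x; rewrite !mulrBl mulr_suml; congr (_ - _).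
      by apply: eq_bigr => l _; rewrite mulrA.
    rewrite mulrAC; apply: (lint_bmul_le _ _ iu).
      apply: measurable_funB.
        by apply: measurable_funB; apply: lmeas_cont; apply: cont_along; case: eb.
      apply: lmeas_cont; apply: cont_sum => l; apply: contZ; apply: cont_along.
      by case: (dec l).
    move=> x; have := tM (y - f x) v; rewrite (addrAC y (- f x) v) -zE => h; apply: (le_trans h).
    by rewrite ler_wpM2l// ler_pXn2r ?nnegrE ?enorm_ge0//; exact: norm_le_enorm.
  have -> : g z = g y + lint Tl + (g z - g y - lint Tl) by ring.
  apply: (le_trans (ler_normD _ _)); apply: lerD => //.
  by apply: (le_trans (ler_normD _ _)); exact: lerD.
have := @cheeger_inequality R n g H (s + B) w _ n0 (push_cont eC iu) (push_cont eC ik) H0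
  (psupp _) (psupp _) (mulr_ge0 M0 I0) gH w0.
rewrite EH => ch; apply: le_trans (ch _).
  rewrite ler_wpM2l//; rewrite -Eg; exact: lint_abs.
apply: le_trans lebw; apply: le_leb => y /= gy.
apply: contrapT => Hn; move: gy; apply/negP; rewrite negbK; apply/eqP.
apply: etrans lint0; apply: lint_ext => x; have [p0|p0] := eqVneq (phi x) 0.
  by rewrite p0 mul0r mulr0.
rewrite es ?mul0r// ltNge; apply/negP => ys; apply: Hn; by exists x.
Qed.

End degree.

(** * The area inequality *)

Section compactness.
Context {R : realType} {n : nat}.
Implicit Types (x y z v : 'rV[R]_n) (K U : set 'rV[R]_n).

Lemma compact_uniform K (P : nat -> 'rV[R]_n -> Prop) : compact K ->
  (forall x, K x -> exists r N, 0 < r /\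
    forall y k, `|x - y| < r -> (N <= k)%N -> P k y) ->
  exists N, forall k, (N <= k)%N -> forall x, K x -> P k x.
Proof.
move=> /compact_near_coveringP cK H.
have [] := cK nat \oo P _ _.
  move=> x /H[r [N [r0 HN]]]; exists (ball x r, [set k | (N <= k)%N]) => /=.
    by split; [exact: nbhsx_ballx|exists N].
  move=> [y k] /= [xy Nk]; apply: HN => //; by rewrite -ball_normE in xy.
by move=> N _ HN; exists N => k /HN.
Qed.

Definition thick (s : R) K : set 'rV[R]_n := [set y | exists2 x, K x & `|y - x| <= s].

(** Lebesgue measure is upper semicontinuous along shrinking neighbourhoods of
    a compact set. *)
Lemma thick_compact K (c : R) : compact K -> (leb n K < c%:E)%E ->
  exists2 s, 0 < s & (leb n (thick s K) <= c%:E)%E.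
Proof.
move=> cK Kc; have [U [oU KU Uc]] := leb_outer_open Kc.
have [|N HN] := @compact_uniform K (fun k x => forall y, `|y - x| <= 2 ^- k -> U y) cK.
  move=> x /KU Ux; have /nbhs_ballP[e /= e0 eU] : nbhs x U by exact: open_nbhs_nbhs.
  have e2 : 0 < e / 2 by rewrite divr_gt0.
  have [k0 Hk0] := dya_ex e2; exists (e / 2), k0; split => // y k xy kk z zy.
  apply: eU; rewrite -ball_normE /=.
  have := Hk0 k kk; have := ler_distD y x z; rewrite (distrC y z); lra.
exists (2 ^- N); first by rewrite invr_gt0 exprn_gt0.
by apply: le_trans Uc; apply: le_leb => y [x Kx xy]; exact: (HN N (leqnn N) x).
Qed.

Lemma thick_open K U : compact K -> open U -> K `<=` U ->
  exists N, forall k, (N <= k)%N -> thick (2 ^- k) K `<=` U.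
Proof.
move=> cK oU KU.
have [|N HN] := @compact_uniform K (fun k x => forall y, `|y - x| <= 2 ^- k -> U y) cK.
  move=> x /KU Ux; have /nbhs_ballP[e /= e0 eU] : nbhs x U by exact: open_nbhs_nbhs.
  have e2 : 0 < e / 2 by rewrite divr_gt0.
  have [k0 Hk0] := dya_ex e2; exists (e / 2), k0; split => // y k xy kk z zy.
  apply: eU; rewrite -ball_normE /=.
  have := Hk0 k kk; have := ler_distD y x z; rewrite (distrC y z); lra.
by exists N => k Nk y [x Kx xy]; exact: (HN k Nk x).
Qed.

Definition unit_cube : set 'rV[R]_n := [set v | forall i, 0 <= v 0 i <= 1].

Lemma compact_unit_cube : compact unit_cube.
Proof.
apply: (@subclosed_compact _ _ [set x : 'rV[R]_n | `|x| <= 1]).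
- rewrite (_ : unit_cube = \bigcap_(i in [set: 'I_n]) ((fun x : 'rV[R]_n => x 0 i) @^-1` `[0, 1])).
    apply: closed_bigI => i _; apply: (@closed_comp _ _ (fun x : 'rV[R]_n => x 0 i)).
      by move=> x _; exact: coord_continuous.
    exact: itv_closed.
  by apply/seteqP; split => x /= H i; [move=> _|]; have := H i; rewrite /= in_itv//=; apply.
- exact: compact_sup_ball.
by move=> x /= H; apply: norm_coord_le => // i; have /andP[h1 h2] := H i; rewrite ger0_norm.
Qed.

Lemma leb_unit_cube : (leb n unit_cube <= 1%:E)%E.
Proof.
apply/lee_addgt0Pr => e e0.
suff [m m0 pm] : exists2 m, (0 < m)%N & (1 + m%:R^-1) ^+ n <= 1 + e :> R.
  apply: (@le_trans _ _ (leb n (cell_set (Some (const_mx (- m%:R^-1), const_mx 1))))).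
    apply: le_leb => x H i; rewrite !mxE; have /andP[h1 ->] := H i; rewrite andbT.
    by apply: lt_le_trans h1; rewrite oppr_lt0 invr_gt0 ltr0n.
  rewrite leb_cell /= -EFinD lee_fin; apply: le_trans pm.
  rewrite (eq_bigr (fun=> 1 + m%:R^-1)); first by rewrite prod_ord_const.
  by move=> i _; rewrite !mxE opprK max_r// addr_ge0// invr_ge0.
apply: contrapT => H; have : (1 + e : R) <= ((1%:P + 'X) ^+ n).[0].
  apply: poly_lim_le => m m0; rewrite !hornerE; rewrite leNgt; apply/negP => h.
  by apply: H; exists m => //; exact: ltW.
by rewrite !hornerE ?addr0 expr1n gerDl leNgt e0.
Qed.

End compactness.

Section area.
Context {R : realType} {n : nat}.
Implicit Types (x y z v : 'rV[R]_n).
Local Notation T := (Rmeas R n).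
Local Notation mu := (lebm R n).
Variables (F : 'I_n -> 'rV[R]_n -> R) (D : 'I_n -> 'I_n -> 'rV[R]_n -> R).
Hypothesis FC : forall i, C11 (F i) (D i).

Let f x : 'rV[R]_n := \row_i F i x.
Let J x := \det (jmx D x).

Lemma jac_cont1 : continuous J.
Proof.
apply: cont_det => i j; rewrite (_ : (fun x => _) = D i j); first exact: (C11_dcont (FC i)).
by apply/funext => x; rewrite mxE.
Qed.

Definition dcube k x : set 'rV[R]_n := cell_set (dya k (dya_of k x)).

Lemma dcube_vol k x : leb n (dcube k x) = ((2 ^- k) ^+ n)%:E.
Proof.
rewrite leb_cell /= (eq_bigr (fun=> 2 ^- k)); first by rewrite prod_ord_const.
move=> i _; rewrite !mxE -mulrBl intrD addrAC subrr add0r mul1r max_r//.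
Qed.

(** Near a point the map is affine up to a relative error, uniformly at small
    scales, so that small cubes are mapped into thin neighbourhoods of
    parallelepipeds of volume close to the Jacobian. *)
Lemma cube_area (e : R) x0 : 0 < e -> exists r N, 0 < r /\
  forall x k, `|x0 - x| < r -> (N <= k)%N ->
  (leb n (f @` dcube k x) <= \int[mu]_(y in dcube k x) (`|J y| + e)%:E)%E.
Proof.
move=> e0; pose A := (jmx D x0)^T.
pose K := [set v *m A | v in @unit_cube R n].
have cK : compact K.
  apply: continuous_compact; last exact: compact_unit_cube.
  apply: continuous_subspaceT; apply: row_continuous => i.
  rewrite (_ : (fun x => _) = (fun x => \sum_j x 0 j * A j i)); last first.
    by apply/funext => x; rewrite mxE.
  apply: cont_sum => j; apply: contM; last exact: cst_continuous.
  exact: coord_continuous.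
have dA : \det A = J x0 by rewrite det_tr.
have Kv : (leb n K < (`|J x0| + e / 2)%:E)%E.
  apply: (@le_lt_trans _ _ (`|J x0| + e / 4)%:E); last by rewrite lte_fin ltrD2l; lra.
  have k0 : 0 < `|J x0| + e / 4 by rewrite ltr_wpDl// divr_gt0.
  apply: (@le_trans _ _ ((`|J x0| + e / 4)%:E * leb n (@unit_cube R n))%E).
    by apply: leb_linear_le => //; rewrite dA lerDl divr_ge0// ltW.
  rewrite -[leRHS]mule1; apply: lee_wpmul2l; first by rewrite lee_fin ltW.
  exact: leb_unit_cube.
have [s s0 Ks] := thick_compact cK Kv.
have [M M0 HM] : exists2 M : R, 0 <= M & forall i x v,
    `|F i (x + v) - F i x - \sum_j v 0 j * D i j x| <= M * `|v| ^+ 2.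
  have /choice[Mf Hf] : forall i, exists M : R, 0 <= M /\ forall x v,
      `|F i (x + v) - F i x - \sum_j v 0 j * D i j x| <= M * `|v| ^+ 2.
    by move=> i; case: (FC i) => M [fM _ _ tM]; exists M; split => //; exact: le_trans (fM 0).
  have Mf0 i : 0 <= Mf i by case: (Hf i).
  exists (\sum_i Mf i) => [|i x v]; first exact: sumr_ge0.
  have [_ h] := Hf i; apply: (le_trans (h x v)); apply: ler_wpM2r; first exact: exprn_ge0.
  by rewrite (bigD1 i)//= lerDl sumr_ge0.
pose d := s / 2 / (n%:R + 1); have n1 : 0 < n%:R + 1 :> R by rewrite ltr_wpDl.
have d0 : 0 < d by rewrite !divr_gt0.
have [r r0 Hr] : exists2 r, 0 < r & forall y, `|x0 - y| < r ->
    (forall i j, `|D i j x0 - D i j y| < d) /\ `|J x0 - J y| < e / 2.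
  have : \forall y \near x0, (forall i j, `|D i j x0 - D i j y| < d) /\ `|J x0 - J y| < e / 2.
    near=> y; split; last first.
      by near: y; apply: (@continuous_dist R _ R^o _ jac_cont1); rewrite divr_gt0.
    near: y; apply: filter_forall => i; apply: filter_forall => j.
    exact: (@continuous_dist R _ R^o _ (C11_dcont (FC i) j)).
  by move=> /nbhs_ballP[r /= r0 H]; exists r => // y xy; apply: H; rewrite -ball_normE.
have M1 : 0 < s / 2 / (M + 1) by rewrite !divr_gt0// ltr_wpDl.
have [N1 HN1] := dya_ex M1; have r4 : 0 < r / 4 by rewrite divr_gt0.
have [N2 HN2] := dya_ex r4.
exists (r / 4), (maxn N1 N2); split => // x k xx0; rewrite geq_max => /andP[Nk1 Nk2].
pose h : R := 2 ^- k; have h0 : 0 < h by rewrite invr_gt0 exprn_gt0.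
have hM : M * h <= s / 2.
  have := HN1 k Nk1; rewrite -/h ltr_pdivlMr ?ltr_wpDl// => /ltW; apply: le_trans.
  by rewrite mulrC ler_wpM2l ?(ltW h0)// lerDl.
have hr := HN2 k Nk2; rewrite -/h in hr.
pose a : 'rV[R]_n := \row_i ((dya_of k x 0 i)%:~R / 2 ^+ k).
have Qa y : dcube k x y -> exists2 v, unit_cube v & y = a + h *: v.
  move=> Qy; exists (h^-1 *: (y - a)); last by rewrite scalerA divff ?gt_eqF// scale1r subrKC.
  move=> i; have := Qy i; rewrite !mxE => /andP[h1 h2].
  rewrite mulr_ge0 ?invr_ge0 ?(ltW h0) ?subr_ge0 ?(ltW h1)//=.
  rewrite mulrC ler_pdivrMr// mul1r lerBlDl; apply: (le_trans h2).
  by rewrite intrD mulrDl mul1r.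
have ax v : unit_cube v -> `|h *: v| <= h.
  move=> uv; rewrite normrZ gtr0_norm// ler_piMr ?(ltW h0)//.
  by apply: norm_coord_le => // i; have /andP[v0 v1] := uv i; rewrite ger0_norm.
have xQ : dcube k x x by apply/dyaP.
have ya y : dcube k x y -> `|y - a| <= h.
  by move=> /Qa[v uv ->]; rewrite addrAC subrr add0r; exact: ax.
have x0a : `|x0 - a| < r.
  have := ya x xQ; have := ler_distD x x0 a; lra.
have x0y y : dcube k x y -> `|x0 - y| < r.
  move=> Qy; have := ya x xQ; have := ya y Qy.
  have := ler_distD x x0 y; have := ler_distD a x y; rewrite (distrC a y); lra.
have [Da _] := Hr a x0a.
have fQ : f @` dcube k x `<=` [set z + f a | z in [set h *: w | w in thick s K]].
  move=> _ [y /Qa[v uv ->] <-].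
  exists (f (a + h *: v) - f a); last by rewrite subrK.
  exists (h^-1 *: (f (a + h *: v) - f a)); last by rewrite scalerA divff ?gt_eqF// scale1r.
  exists (v *m A); first by exists v.
  apply: norm_coord_le => [|i]; first exact: ltW.
  have := HM i a (h *: v); have vh := ax v uv.
  have S1 : \sum_j (h *: v) 0 j * D i j a = h * \sum_j v 0 j * D i j a.
    by rewrite mulr_sumr; apply: eq_bigr => j _; rewrite mxE mulrA.
  have S2 : `|\sum_j v 0 j * D i j a - (v *m A) 0 i| <= s / 2.
    rewrite mxE -sumrB; apply: (le_trans (ler_norm_sum _ _ _)).
    apply: (@le_trans _ _ (\sum_(j < n) d)).
      apply: ler_sum => j _; rewrite !mxE -mulrBr normrM distrC.
      have /andP[v0 v1] := uv j; rewrite ger0_norm//.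
      by apply: le_trans (ltW (Da i j)); rewrite ler_piMl.
    rewrite sum_ord_const /d mulrA ler_pdivrMr// mulrC ler_wpM2l ?divr_ge0 ?(ltW s0)//.
    by rewrite lerDl.
  rewrite S1 => S3.
  have S4 : `|h^-1 * (F i (a + h *: v) - F i a) - \sum_j v 0 j * D i j a| <= s / 2.
    rewrite -(ler_pM2l h0) -{1}(gtr0_norm h0) -normrM mulrBr mulrA divff ?gt_eqF// mul1r.
    apply: (le_trans S3); apply: (@le_trans _ _ (M * h ^+ 2)).
      by apply: ler_wpM2l => //; rewrite ler_pXn2r ?nnegrE ?(ltW h0).
    by rewrite expr2 mulrA mulrC ler_pM2l.
  rewrite !mxE in S2 *; have := ler_distD (\sum_j v 0 j * D i j a) (h^-1 * (F i (a + h *: v) - F i a)) (\sum_j v 0 j * A j i).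
  lra.
apply: (@le_trans _ _ ((h ^+ n * (`|J x0| + e / 2))%:E)).
  apply: (le_trans (le_leb fQ)); rewrite leb_shift leb_scale ?gt_eqF//.
  by rewrite gtr0_norm// EFinM; apply: lee_wpmul2l => //; rewrite lee_fin exprn_ge0// ltW.
have mQ : measurable (dcube k x : set T) by exact: measurable_cell.
apply: (@le_trans _ _ (\int[mu]_(y in dcube k x) (cst (`|J x0| + e / 2)%:E y))%E).
  rewrite (etrans (integral_cst mu mQ _)
    (congr1 (fun t => (`|J x0| + e / 2)%:E * t)%E (dcube_vol k x))).
  by rewrite -EFinM mulrC.
apply: ge0_le_integral; [exact: mQ|..].
- by move=> y _; rewrite lee_fin addr_ge0// divr_ge0// ltW.
- exact: measurable_cst.
- apply/measurable_EFinP; apply: measurable_funTS; apply: lmeas_cont.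
  by apply: contD; [apply: norm_continuous_comp; exact: jac_cont1|exact: cst_continuous].
move=> y Qy; rewrite lee_fin.
have [_ h1] := Hr y (x0y y Qy); have := lerB_dist (J x0) (J y); lra.
Unshelve. all: by end_near. Qed.

(** The area inequality: a smooth map increases volume at most by the integral
    of its Jacobian. *)
Lemma area_inequality (K U : set 'rV[R]_n) : compact K -> open U -> K `<=` U ->
  (leb n U < +oo)%E -> (leb n (f @` K) <= \int[mu]_(y in U) (`|J y|)%:E)%E.
Proof.
move=> cK oU KU Ufin; have mU : measurable (U : set T) by exact: measurable_open.
have Ufn : leb n U \is a fin_num by rewrite ge0_fin_numE ?leb_ge0.
have u0 : 0 <= fine (leb n U) by rewrite fine_ge0// leb_ge0.
apply/lee_addgt0Pr => e' e'0; pose e := e' / (fine (leb n U) + 1).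
have u1 : 0 < fine (leb n U) + 1 by rewrite ltr_wpDl.
have e0 : 0 < e by rewrite divr_gt0.
have mh A : measurable (A : set T) -> measurable_fun A (fun y : T => (`|J y| + e)%:E).
  move=> mA; apply/measurable_EFinP; apply: measurable_funTS; apply: lmeas_cont.
  by apply: contD; [apply: norm_continuous_comp; exact: jac_cont1|exact: cst_continuous].
have mJ A : measurable (A : set T) -> measurable_fun A (fun y : T => (`|J y|)%:E).
  move=> mA; apply/measurable_EFinP; apply: measurable_funTS; apply: lmeas_cont.
  by apply: norm_continuous_comp; exact: jac_cont1.
apply: (@le_trans _ _ (\int[mu]_(y in U) (`|J y| + e)%:E)%E); last first.
  under eq_integral do rewrite EFinD.
  rewrite ge0_integralD; [|exact: mU|by move=> y _; rewrite lee_fin|exact: mJ|by move=> y _; rewrite lee_fin ltW|exact: measurable_cst].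
  apply: leeD => //; 
  rewrite (etrans (integral_cst mu mU _) (congr1 (fun t => e%:E * t)%E (esym (fineK Ufn)))).
  rewrite -EFinM lee_fin.
  by rewrite /e mulrAC ler_pdivrMr// ler_wpM2l ?(ltW e'0)// lerDl.
have [N1 HN1] := thick_open cK oU KU.
have [|N2 HN2] := @compact_uniform R n K (fun k x =>
  (leb n (f @` dcube k x) <= \int[mu]_(y in dcube k x) (`|J y| + e)%:E)%E) cK.
  by move=> x _; have [r [N [r0 H]]] := cube_area x e0; exists r, N.
pose k := maxn N1 N2; have k1 : (N1 <= k)%N by rewrite leq_maxl.
have k2 : (N2 <= k)%N by rewrite leq_maxr.
pose E i : set T := if pickle_inv i is Some z then
  (if pselect (exists2 x, K x & z = dya_of k x) then cell_set (dya k z) else set0) else set0.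
have mE i : measurable (E i).
  rewrite /E; case: pickle_inv => [z|]; last exact: measurable0.
  by case: pselect => [?|?]; [exact: measurable_cell|exact: measurable0].
have EP i y : E i y -> pickle_inv i = Some (dya_of k y) /\ exists2 x, K x & dya_of k y = dya_of k x.
  rewrite /E; case: pickle_inv => [z|//]; case: pselect => [H|//] /dyaP zy.
  by rewrite zy in H *.
have tE : trivIset setT E.
  apply/trivIsetP => i j _ _ ij; apply/seteqP; split => // y [/EP[h1 _] /EP[h2 _]].
  move/negP: ij; apply; have := @pickle_invK 'rV[int]_n i; have := @pickle_invK 'rV[int]_n j.
  by rewrite h1 h2 /= => <- <-.
have EU : \bigcup_i E i `<=` U.
  move=> y [i _ /EP[_ [x Kx yx]]]; apply: HN1 (k1) _ _; exists x => //.
  apply: norm_coord_le => [|j]; first by rewrite invr_ge0 exprn_ge0.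
  by rewrite !mxE; apply: ltW; exact: dya_close.
have mUE : measurable (\bigcup_i E i) by exact: bigcup_measurable.
apply: (@le_trans _ _ (\int[mu]_(y in \bigcup_i E i) (`|J y| + e)%:E)%E); last first.
  apply: ge0_subset_integral; [exact: mUE|exact: mU|exact: mh| |exact: EU].
  by move=> y _; rewrite lee_fin addr_ge0// ltW.
rewrite ge0_integral_bigcup; [|exact: mE|exact: mh| |exact: tE]; last first.
  by move=> y _; rewrite lee_fin addr_ge0// ltW.
apply: (@le_trans _ _ (\sum_(i <oo) leb n (f @` E i))%E).
  apply: le_trans (outer_measure_sigma_subadditive _ _); apply: le_leb => _ [x Kx <-].
  exists (pickle (dya_of k x)) => //; exists x => //.
  rewrite /E pickleK_inv; case: pselect => [?|[]]; last by exists x.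
  exact/dyaP.
apply: lee_nneseries => [i _ _|i _]; first exact: leb_ge0.
have [E0|/set0P[y yE]] := eqVneq (E i) set0.
  by rewrite E0 image_set0 outer_measure0; apply: integral_ge0.
have [ui [x Kx yx]] := EP i y yE.
have -> : E i = dcube k x.
  rewrite /E ui yx; case: pselect => [?//|[]]; by exists x.
exact: HN2.
Qed.

End area.

(** * Convergence of the Jacobian under mollification *)

Section homogeneous_difference.
Context {R : realType}.

Lemma prod_diff (I : Type) (s : seq I) (a b : I -> R) (d c : R) : 0 <= d -> 0 <= c ->
  (forall i, `|a i - b i| <= d) -> (forall i, `|b i| <= c) ->
  `|\prod_(i <- s) a i| <= (d + c) ^+ size s /\
  `|\prod_(i <- s) a i - \prod_(i <- s) b i| <= (size s)%:R * d * (d + c) ^+ (size s).-1.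
Proof.
move=> d0 c0 ab bc; have dc0 : 0 <= d + c by rewrite addr_ge0.
have aD i : `|a i| <= d + c.
  by rewrite -[a i](subrK (b i)); apply: (le_trans (ler_normD _ _)); exact: lerD.
elim: s => [|i s [IH1 IH2]]; first by rewrite !big_nil subrr normr0 normr1 !mul0r.
rewrite !big_cons /=; split; first by rewrite normrM exprS; exact: ler_pM.
have -> : a i * \prod_(j <- s) a j - b i * \prod_(j <- s) b j =
  (a i - b i) * \prod_(j <- s) a j + b i * (\prod_(j <- s) a j - \prod_(j <- s) b j) by ring.
apply: (le_trans (ler_normD _ _)).
have h1 : `|(a i - b i) * \prod_(j <- s) a j| <= d * (d + c) ^+ size s.
  by rewrite normrM; exact: ler_pM.
have h2 : `|b i * (\prod_(j <- s) a j - \prod_(j <- s) b j)| <= (size s)%:R * d * (d + c) ^+ size s.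
  case: s IH1 IH2 {h1} => [|j s] IH1 IH2; first by rewrite !big_nil subrr mulr0 normr0 !mul0r.
  rewrite normrM [(size (j :: s))]/= exprSr mulrA mulrC; apply: ler_pM => //.
  by apply: (le_trans (bc i)); rewrite lerDr.
rewrite [leRHS](_ : _ = d * (d + c) ^+ size s + (size s)%:R * d * (d + c) ^+ size s).
  exact: lerD.
by rewrite -natr1; ring.
Qed.

(** The difference of two values of a homogeneous function of degree [p] is
    absorbed by a small multiple of the power at one point and a large multiple
    of the power of the distance. *)
Lemma absorb (p : nat) (e C : R) : (0 < p)%N -> 0 < e -> 0 <= C ->
  exists2 C', 0 <= C' & forall d c, 0 <= d -> 0 <= c ->
    C * d * (d + c) ^+ p.-1 <= e * c ^+ p + C' * d ^+ p.
Proof.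
case: p => // p _ e0 C0; pose k := C * 2 ^+ p + e; have k0 : 0 < k.
  by rewrite ltr_wpDl// mulr_ge0// exprn_ge0.
pose h := e / k; have h0 : 0 < h by rewrite divr_gt0.
have h1 : h <= 1 by rewrite /h ler_pdivrMr// mul1r lerDr mulr_ge0// exprn_ge0.
have hC : C * 2 ^+ p * h <= e.
  rewrite /h mulrA ler_pdivrMr// mulrC ler_wpM2l ?(ltW e0)//.
  by rewrite lerDl ltW.
exists (C * (1 + h^-1) ^+ p).
  by rewrite mulr_ge0// exprn_ge0// addr_ge0// invr_ge0 ltW.
move=> d c d0 c0 /=; have hi : 0 <= 1 + h^-1 by rewrite addr_ge0// invr_ge0 ltW.
have [dc|cd] := leP d (h * c).
  apply: (@le_trans _ _ (e * c ^+ p.+1)); last first.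
    by rewrite lerDl !mulr_ge0// exprn_ge0.
  apply: (@le_trans _ _ (C * (h * c) * (2 * c) ^+ p)).
    apply: ler_pM; rewrite ?mulr_ge0 ?exprn_ge0 ?addr_ge0//; first exact: ler_wpM2l.
    rewrite lerXn2r ?nnegrE ?addr_ge0 ?mulr_ge0// mulr_natl mulr2n lerD2r.
    by apply: (le_trans dc); rewrite ler_piMl.
  rewrite exprMn exprS [leLHS](_ : _ = C * 2 ^+ p * h * (c * c ^+ p)); last ring.
  by apply: ler_wpM2r => //; rewrite mulr_ge0// exprn_ge0.
apply: (@le_trans _ _ (C * (1 + h^-1) ^+ p * d ^+ p.+1)); last first.
  by rewrite lerDr mulr_ge0 ?exprn_ge0// ltW.
have -> : C * (1 + h^-1) ^+ p * d ^+ p.+1 = C * d * ((1 + h^-1) * d) ^+ p.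
  by rewrite exprMn exprS; ring.
apply: ler_wpM2l; first exact: mulr_ge0.
rewrite lerXn2r ?nnegrE ?addr_ge0 ?mulr_ge0// mulrDl mul1r lerD2l.
by rewrite mulrC ler_pdivlMr// mulrC ltW.
Qed.

Lemma pow_diff (p : nat) (a b d : R) : 0 <= a -> 0 <= b -> `|a - b| <= d ->
  `|a ^+ p - b ^+ p| <= p%:R * d * (d + b) ^+ p.-1.
Proof.
move=> a0 b0 ab; have d0 : 0 <= d by apply: le_trans ab.
have [|_] := @prod_diff 'I_p (enum 'I_p) (fun=> a) (fun=> b) d b d0 b0 (fun=> ab).
  by rewrite ger0_norm.
by rewrite !big_enum/= !prod_ord_const size_enum_ord.
Qed.

(** In the Leibniz formula, one factor of each product is changed at a time. *)
Lemma det_diff (n : nat) (A B : 'M[R]_n) :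
  `|\det A - \det B| <= (#|{: 'S_n}|%:R * n%:R) * opnorm (A - B) *
     (opnorm (A - B) + opnorm B) ^+ n.-1.
Proof.
rewrite /determinant -sumrB; apply: (le_trans (ler_norm_sum _ _ _)).
apply: (@le_trans _ _ (\sum_(s : 'S_n) n%:R * opnorm (A - B) * (opnorm (A - B) + opnorm B) ^+ n.-1)).
  apply: ler_sum => s _; rewrite -mulrBr normrMsign.
  have [||_] := @prod_diff 'I_n (enum 'I_n) (fun i => A i (s i)) (fun i => B i (s i)) _ _
    (opnorm_ge0 (A - B)) (opnorm_ge0 B).
  - by move=> i; have := opnorm_entry (A - B) i (s i); rewrite !mxE.
  - by move=> i; exact: opnorm_entry.
  by rewrite !big_enum/= size_enum_ord.
by rewrite sumr_const -[leLHS]mulr_natl !mulrA.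
Qed.

End homogeneous_difference.

Lemma moll_Lp_pos {R : realType} {n : nat} (p : nat) (r s : R) (u : 'rV[R]_n -> R) :
  (0 < p)%N -> 0 < r -> Lp p s u -> Lp p (r + s) (moll r u).
Proof. by case: p => // p _ r0 L; have [] := moll_Lp r0 L. Qed.

Lemma moll_Lcvg_pos {R : realType} {n : nat} (p : nat) (s : R) (u : 'rV[R]_n -> R) :
  (0 < p)%N -> Lp p s u -> Lcvg p u.
Proof. by case: p => // p _ L; exact: moll_Lcvg L. Qed.

Section jacobian_limits.
Context {R : realType} {n : nat}.
Implicit Types (x y z : 'rV[R]_n).
Local Notation T := (Rmeas R n).
Variables (D : 'I_n -> 'I_n -> 'rV[R]_n -> R) (s : R).
Hypothesis n0 : (0 < n)%N.
Hypothesis DL : forall i j, Lp n s (D i j).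

Lemma lmeas_mx (k : 'M[R]_n -> R) (C : R) (G : 'I_n -> 'I_n -> 'rV[R]_n -> R) :
  (forall A B, `|k A - k B| <= C * opnorm (A - B)) -> (forall i j, lmeas (G i j)) ->
  lmeas (fun x => k (jmx G x)).
Proof.
move=> kC mG; have ck : continuous (fun v : 'rV[R]_(n * n) => k (vec_mx v)).
  apply: (@lip_continuous _ _ R^o _ (`|C| * (n%:R * \sum_(i < n) \sum_(j < n) 1))) => v w.
  apply: (le_trans (kC _ _)); apply: (@le_trans _ _ (`|C| * opnorm (vec_mx v - vec_mx w))).
    by rewrite ler_wpM2r ?opnorm_ge0// ler_norm.
  rewrite -mulrA ler_wpM2l//; apply: (le_trans (opnorm_sum _)); rewrite -mulrA ler_wpM2l//.
  rewrite mulr_suml; apply: ler_sum => i _; rewrite mulr_suml; apply: ler_sum => j _.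
  by rewrite mul1r -linearB mxE; exact: coord_norm.
have := @coords_meas R (n * n) _ T (fun x : T => mxvec (jmx G x)) _ ck.
rewrite (_ : _ \o _ = (fun x => k (jmx G x))); last by apply/funext => x /=; rewrite mxvecK.
apply=> i; case/mxvec_indexP: i => i j.
rewrite (_ : (fun x => _) = G i j); first exact: mG.
by apply/funext => x; rewrite mxvecE mxE.
Qed.

Lemma lmeas_opnorm (G : 'I_n -> 'I_n -> 'rV[R]_n -> R) : (forall i j, lmeas (G i j)) ->
  lmeas (fun x => opnorm (jmx G x)).
Proof. by apply: (@lmeas_mx _ 1) => A B; rewrite mul1r; exact: opnorm_dist. Qed.

Lemma lmeas_det (G : 'I_n -> 'I_n -> 'rV[R]_n -> R) : (forall i j, lmeas (G i j)) ->
  lmeas (fun x => \det (jmx G x)).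
Proof.
move=> mG; rewrite /determinant; apply: measurable_sum => t.
apply: measurable_funM; first exact: measurable_cst.
apply: measurable_prod => i _.
suff : lmeas (fun x => jmx G x i (t i)) by [].
have -> : (fun x => jmx G x i (t i)) = G i (t i) by apply/funext => x; rewrite mxE.
exact: mG.
Qed.

Lemma opnorm_pow_sum : exists2 C : R, 0 <= C &
  forall A : 'M[R]_n, opnorm A ^+ n <= C * \sum_i \sum_j `|A i j| ^+ n.
Proof.
exists ((n%:R * \sum_(i < n) \sum_(j < n) 1) ^+ n).
  by rewrite exprn_ge0// mulr_ge0//; do 2 apply: sumr_ge0 => ? _.
move=> A; pose a := \big[Order.max/0]_(p : 'I_n * 'I_n) `|A p.1 p.2|.
have aA i j : `|A i j| <= a by exact: (le_bigmax _ (fun p : 'I_n * 'I_n => `|A p.1 p.2|) (i, j)).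
have a0 : 0 <= a by exact: bigmax_ge_id.
have aS : a ^+ n <= \sum_i \sum_j `|A i j| ^+ n.
  have S0 i : 0 <= \sum_j `|A i j| ^+ n by apply: sumr_ge0 => j _; rewrite exprn_ge0.
  have : a = 0 \/ exists i j, a = `|A i j|.
    rewrite /a; elim/big_ind: _ => [|u v [->|[i [j ->]]] [->|[k [l ->]]]|[i j] _]; [by left|..].
    - by rewrite maxxx; left.
    - by right; exists k, l; rewrite max_r.
    - by right; exists i, j; rewrite max_l.
    - by right; case: leP => _; [exists k, l|exists i, j].
    - by right; exists i, j.
  case=> [->|[i [j ->]]]; first by rewrite expr0n gtn_eqF// sumr_ge0.
  rewrite (bigD1 i)//= (bigD1 j)//= -addrA lerDl addr_ge0 ?sumr_ge0//.
apply: (@le_trans _ _ ((n%:R * \sum_(i < n) \sum_(j < n) 1) ^+ n * a ^+ n)); last first.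
  by rewrite ler_wpM2l// exprn_ge0// mulr_ge0//; do 2 apply: sumr_ge0 => ? _.
rewrite -exprMn lerXn2r ?nnegrE ?opnorm_ge0//.
  by rewrite !mulr_ge0//; do 2 apply: sumr_ge0 => ? _.
apply: (le_trans (opnorm_sum _)); rewrite -mulrA ler_wpM2l//.
rewrite mulr_suml; apply: ler_sum => i _; rewrite mulr_suml; apply: ler_sum => j _.
by rewrite mul1r.
Qed.

Lemma opnorm_lintble (G : 'I_n -> 'I_n -> 'rV[R]_n -> R) t : (forall i j, Lp n t (G i j)) ->
  lintble (fun x => opnorm (jmx G x) ^+ n).
Proof.
move=> GL; have [C C0 HC] := opnorm_pow_sum.
apply: (@lintble_le _ _ _ (fun x => C * \sum_i \sum_j `|G i j x| ^+ n)).
- apply: (@measurable_funX _ T R setT (fun x => opnorm (jmx G x)) n).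
  by apply: lmeas_opnorm => i j; case: (GL i j) => /lintble_meas.
- move=> x; rewrite ger0_norm ?exprn_ge0 ?opnorm_ge0//; apply: (le_trans (HC _)).
  by rewrite le_eqVlt; apply/orP; left; apply/eqP; congr (_ * _); apply: eq_bigr => i _;
    apply: eq_bigr => j _; rewrite mxE.
apply: lintbleZ; apply: lintble_sum => i _; apply: lintble_sum => j _.
by case: (GL i j).
Qed.

Lemma det_lintble (G : 'I_n -> 'I_n -> 'rV[R]_n -> R) t : (forall i j, Lp n t (G i j)) ->
  lintble (fun x => \det (jmx G x)).
Proof.
move=> GL; apply: lintble_le (opnorm_lintble GL).
  by apply: lmeas_det => i j; case: (GL i j) => /lintble_meas.
by move=> x; exact: det_opnorm.
Qed.

Definition mollmx k i j := moll (rad k) (D i j).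

Lemma LpB_gen p t t' (u w : 'rV[R]_n -> R) : Lp p t u -> Lp p t' w -> lintble (fun x => `|u x - w x| ^+ p).
Proof. by move=> [iu ip _] [iw jp _]; exact: lintble_powB. Qed.

Lemma mollmx_Lp k i j : Lp n (rad k + s) (mollmx k i j).
Proof.
exact: (moll_Lp_pos n0 (rad_gt0 k)).
Qed.

Lemma mollmx_cvg (e : R) : 0 < e -> exists N, forall k, (N <= k)%N ->
  lint (fun x => opnorm (jmx (mollmx k) x - jmx D x) ^+ n) <= e.
Proof.
move=> e0; have [C C0 HC] := opnorm_pow_sum.
have n2 : 0 < C * (n%:R * n%:R) + 1 by rewrite ltr_wpDl// !mulr_ge0.
have e1 : 0 < e / (C * (n%:R * n%:R) + 1) by rewrite divr_gt0.
have /choice[Nf HN] : forall p : 'I_n * 'I_n, exists N, forall k, (N <= k)%N ->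
    lint (fun x => `|mollmx k p.1 p.2 x - D p.1 p.2 x| ^+ n) <= e / (C * (n%:R * n%:R) + 1).
  move=> [i j] /=; suff : Lcvg n (D i j) by apply.
  exact: moll_Lcvg_pos n0 (DL i j).
exists (\max_p Nf p)%N => k kN.
have iD i j : lintble (fun x => `|mollmx k i j x - D i j x| ^+ n).
  exact: LpB_gen (mollmx_Lp k i j) (DL i j).
apply: (@le_trans _ _ (lint (fun x => C * \sum_i \sum_j `|mollmx k i j x - D i j x| ^+ n))).
  have iS : lintble (fun x => C * \sum_i \sum_j `|mollmx k i j x - D i j x| ^+ n).
    by apply: lintbleZ; apply: lintble_sum => i _; apply: lintble_sum => j _.
  have H x : opnorm (jmx (mollmx k) x - jmx D x) ^+ n <= C * \sum_i \sum_j `|mollmx k i j x - D i j x| ^+ n.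
    apply: (le_trans (HC _)); rewrite le_eqVlt; apply/orP; left; apply/eqP; congr (_ * _).
    by apply: eq_bigr => i _; apply: eq_bigr => j _; rewrite !mxE.
  apply: lint_le => //; apply: lintble_le iS.
    rewrite (_ : (fun x => _) = (fun x => opnorm (jmx (fun i j y => mollmx k i j y - D i j y) x) ^+ n)); last first.
      by apply/funext => x; congr (opnorm _ ^+ _); apply/matrixP => i j; rewrite !mxE.
    apply: (@measurable_funX _ T R setT _ n); apply: lmeas_opnorm => i j.
    apply: measurable_funB; first by have [/lintble_meas ? _ _] := mollmx_Lp k i j.
    by have [/lintble_meas ? _ _] := DL i j.
  by move=> x; rewrite ger0_norm ?exprn_ge0 ?opnorm_ge0.
rewrite lintZ; last by apply: lintble_sum => i _; apply: lintble_sum => j _.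
rewrite lint_sum; last by move=> i _; apply: lintble_sum => j _.
apply: (@le_trans _ _ (C * \sum_(i < n) \sum_(j < n) e / (C * (n%:R * n%:R) + 1))).
  apply: ler_wpM2l => //; apply: ler_sum => i _; rewrite lint_sum//; apply: ler_sum => j _.
  by apply: (HN (i, j)); apply: leq_trans kN; exact: (leq_bigmax (i, j)).
rewrite sum_ord_const sum_ord_const (mulrA n%:R) mulrA (mulrA (C * _)) ler_pdivrMr//.
by rewrite mulrC ler_wpM2l ?(ltW e0)// lerDl.
Qed.

(** Functions of the derivative with growth of degree [n] converge in L^1 under
    mollification. *)
Lemma hom_cvg (Phi : 'M[R]_n -> R) (C0 : R) : 0 <= C0 ->
  (forall A B, `|Phi A - Phi B| <= C0 * opnorm (A - B) * (opnorm (A - B) + opnorm B) ^+ n.-1) ->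
  (forall k, lintble (fun x => Phi (jmx (mollmx k) x))) -> lintble (fun x => Phi (jmx D x)) ->
  forall e, 0 < e -> exists N, forall k, (N <= k)%N ->
    lint (fun x => `|Phi (jmx (mollmx k) x) - Phi (jmx D x)|) <= e.
Proof.
move=> C00 HP iPk iP e e0; pose P := lint (fun x => opnorm (jmx D x) ^+ n).
have iO := opnorm_lintble DL.
have P0 : 0 <= P by apply: lint_ge0 => x; rewrite exprn_ge0// opnorm_ge0.
have P1 : 0 < P + 1 by rewrite ltr_wpDl.
have e1 : 0 < e / 2 / (P + 1) by rewrite !divr_gt0.
have [C' C'0 HC'] := absorb n0 e1 C00.
have C'1 : 0 < C' + 1 by rewrite ltr_wpDl.
have e2 : 0 < e / 2 / (C' + 1) by rewrite !divr_gt0.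
have [N HN] := mollmx_cvg e2; exists N => k /HN h.
have iDk : lintble (fun x => opnorm (jmx (mollmx k) x - jmx D x) ^+ n).
  apply: (@lintble_ext _ _ (fun x => opnorm (jmx (fun i j y => mollmx k i j y - D i j y) x) ^+ n)).
    by move=> x; congr (opnorm _ ^+ _); apply/matrixP => i j; rewrite !mxE.
  have s0 : s <= rad k + s by rewrite lerDr ltW// rad_gt0.
  apply: (@opnorm_lintble _ (rad k + s)) => i j; apply: LpB; first exact: mollmx_Lp.
  exact: LpW (DL i j).
apply: (@le_trans _ _ (lint (fun x => e / 2 / (P + 1) * opnorm (jmx D x) ^+ n +
    C' * opnorm (jmx (mollmx k) x - jmx D x) ^+ n))).
  apply: lint_le.
  - by apply: lintble_abs; exact: lintbleB.
  - by apply: lintbleD; exact: lintbleZ.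
  by move=> x; apply: (le_trans (HP _ _)); apply: HC'; exact: opnorm_ge0.
rewrite lintD ?lintZ//; [|exact: lintbleZ..]; rewrite [e in leRHS]splitr; apply: lerD.
  by rewrite mulrAC ler_pdivrMr// ler_wpM2l ?divr_ge0 ?(ltW e0)// lerDl.
apply: (@le_trans _ _ (C' * (e / 2 / (C' + 1)))); first exact: ler_wpM2l.
by rewrite mulrA ler_pdivrMr// mulrC ler_wpM2l ?divr_ge0 ?(ltW e0)// lerDl.
Qed.

Lemma det_cvg (e : R) : 0 < e -> exists N, forall k, (N <= k)%N ->
  lint (fun x => `|\det (jmx (mollmx k) x) - \det (jmx D x)|) <= e.
Proof.
apply: (@hom_cvg (fun A => \det A) (#|{: 'S_n}|%:R * n%:R)).
- by rewrite mulr_ge0.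
- exact: det_diff.
- by move=> k; exact: det_lintble (mollmx_Lp k).
- exact: det_lintble DL.
Qed.

Lemma opnorm_cvg (e : R) : 0 < e -> exists N, forall k, (N <= k)%N ->
  lint (fun x => `|opnorm (jmx (mollmx k) x) ^+ n - opnorm (jmx D x) ^+ n|) <= e.
Proof.
apply: (@hom_cvg (fun A => opnorm A ^+ n) n%:R) => //.
- by move=> A B; apply: pow_diff; rewrite ?opnorm_ge0 ?opnorm_dist.
- by move=> k; exact: opnorm_lintble (mollmx_Lp k).
- exact: opnorm_lintble DL.
Qed.

End jacobian_limits.

(** * The isoperimetric inequality on concentric balls *)

Section cutoff.
Context {R : realType} {n : nat}.
Implicit Types (x y z a : 'rV[R]_n).
Local Notation T := (Rmeas R n).

Lemma lin_lim_le (x y C : R) : (forall m, (0 < m)%N -> x <= y + C * m%:R^-1) -> x <= y.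
Proof.
move=> H; have := @poly_lim_le R (y%:P + C%:P * 'X) x; rewrite !hornerE ?mulr0 ?addr0.
by apply => m m0; rewrite !hornerE; exact: H.
Qed.

Lemma grad_le_lip (f : 'rV[R]_n -> R) d (L : R) x : C11 f d ->
  (forall x y, `|f x - f y| <= L * enorm (x - y)) -> 0 <= L ->
  enorm (\row_j d j x) <= L.
Proof.
move=> [M [fM _ _ tM]] fL L0; set v := \row_j d j x.
have [->|v0] := eqVneq v 0; first by rewrite enorm0.
have e0 : 0 < enorm v by rewrite lt_neqAle enorm_ge0 andbT eq_sym enorm_eq0.
have key (m : nat) : (0 < m)%N -> dot v v <= L * enorm v + M * `|v| ^+ 2 * m%:R^-1.
  move=> m0; set h : R := m%:R^-1; have h0 : 0 < h by rewrite invr_gt0 ltr0n.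
  have := tM x (h *: v); have := fL (x + h *: v) x.
  rewrite addrAC subrr add0r enormZ normrZ gtr0_norm//.
  have -> : \sum_j (h *: v) 0 j * d j x = h * dot v v.
    by rewrite mulr_sumr; apply: eq_bigr => j _; rewrite !mxE mulrA.
  rewrite !ler_norml => /andP[h1 h2] /andP[h3 h4].
  rewrite -(ler_pM2l h0); move: h1 h2 h3 h4; rewrite exprMn.
  set X := f _ - f x; set Y := dot v v; set Z := enorm v; set W := `|v| ^+ 2 => h1 h2 h3 h4.
  rewrite mulrDr (_ : h * (M * W * h) = M * (h ^+ 2 * W)); last ring.
  rewrite (_ : h * (L * Z) = L * (h * Z)); last ring.
  lra.
by rewrite -(ler_pM2r e0) -expr2 enorm_sqr; exact: lin_lim_le key.
Qed.

Lemma C11_loc_const (f : 'rV[R]_n -> R) d (U : set 'rV[R]_n) (c : R) x j : C11 f d -> open U ->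
  (forall y, U y -> f y = c) -> U x -> d j x = 0.
Proof.
move=> fd oU Uc Ux; have h := C11_derive x j fd.
rewrite -(@derive_val _ _ _ _ _ _ _ h).
apply: etrans (derive_cst (V := 'rV[R]_n) (c : R) x (delta_mx 0 j)).
by apply: near_eq_derive; apply: filterS Uc _; exact: open_nbhs_nbhs.
Qed.

(** A smooth cut-off function, equal to 1 on the ball of radius [s] and
    supported in a compact part of the ball of radius [t], whose slope is as
    close as desired to the optimal value [(t - s)^-1]. *)
Lemma radial_cutoff a (s t L : R) : (0 < n)%N -> 0 < s -> s < t -> (t - s)^-1 < L ->
  exists (phi : 'rV[R]_n -> R) dphi (r rho : R), [/\ C11 phi dphi /\ supp_in r phi, rho < t,
    forall x, 0 <= phi x <= 1 /\ (enorm (x - a) <= s -> phi x = 1),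
    forall x, phi x != 0 -> enorm (x - a) <= rho &
    forall x, enorm (\row_j dphi j x) <= L /\
      (enorm (x - a) < s \/ t <= enorm (x - a) -> \row_j dphi j x = 0)].
Proof.
move=> n0 s0 st Lst; have ts : 0 < t - s by rewrite subr_gt0.
have L0 : 0 < L by apply: lt_trans Lst; rewrite invr_gt0.
have nR : 0 < n%:R :> R by rewrite ltr0n.
have LV : L^-1 < t - s by rewrite -[ltRHS]invrK ltf_pV2 ?posrE ?invr_gt0.
pose d := (t - s - L^-1) / 3 / n%:R; have d0 : 0 < d by rewrite !divr_gt0// subr_gt0.
have nd : 3 * (n%:R * d) = t - s - L^-1 by rewrite /d; field; rewrite !gt_eqF.
set e := n%:R * d in nd; have e0 : 0 < e by rewrite mulr_gt0.
pose s1 := s + e; pose t1 := t - 2 * e.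
pose p x := Num.max 0 (Num.min 1 ((t1 - enorm (x - a)) * L)).
have p01 x : 0 <= p x <= 1.
  by rewrite /p le_max lexx /= ge_max ler01 ge_min lexx.
have p1 x : enorm (x - a) <= s1 -> p x = 1.
  move=> xs; rewrite /p min_l ?max_r//; rewrite -ler_pdivrMr// div1r /t1.
  by rewrite /s1 in xs; lra.
have p0 x : t1 <= enorm (x - a) -> p x = 0.
  move=> xt; have X0 : (t1 - enorm (x - a)) * L <= 0 by rewrite pmulr_lle0// subr_le0.
  by rewrite /p min_r ?max_l//; exact: le_trans X0 ler01.
have pL x y : `|p x - p y| <= L * enorm (x - y).
  have := clip_lip 0 1 ((t1 - enorm (x - a)) * L) ((t1 - enorm (y - a)) * L).
  rewrite !subr0 => h; apply: (le_trans h); rewrite -mulrBl normrM (gtr0_norm L0) mulrC ler_pM2l//.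
  have -> : t1 - enorm (x - a) - (t1 - enorm (y - a)) = enorm (y - a) - enorm (x - a) by ring.
  have := enormB_le x y a; have := enormB_le y x a; rewrite (enormBC y x) ler_norml => h1 h2.
  by apply/andP; split; lra.
have cp : continuous p.
  apply: (@lip_continuous _ _ R^o _ (L * n%:R)) => x y; apply: (le_trans (pL x y)).
  by rewrite -mulrA ler_pM2l//; exact: enorm_le_norm.
pose r := t1 + enorm a.
have pr : supp_in r p.
  move=> x xr; apply: p0; have := norm_le_enorm x.
  have := enormD (x - a) a; rewrite subrK /r in xr *; lra.
have ip : lintble p by exact: lintble_cc cp pr.
have ed x y : `|x - y| <= d -> enorm (x - y) <= e.
  by move=> h; apply: (le_trans (enorm_le_norm _)); rewrite ler_pM2l.
have [M M0 eM] := @eta_bounded R n d (fun=> 0%N).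
have eb := @eta_bc R n d (fun=> 0%N).
have phiC := conv_eta_C11 d (fun=> 0%N) ip.
have ext x (c : R) : (forall y, `|x - y| <= d -> p y = c) -> moll d p x = c.
  move=> H; have [h1 h2] := lint_eta_refl x d0; rewrite -[RHS]mulr1 -h2 -lintZ//.
  apply: lint_ext => y; have [xy|xy] := leP `|x - y| d; first by rewrite H// mulrC.
  by rewrite eta_supp// mul0r mulr0.
pose rho := t - e.
have phi1 x : enorm (x - a) <= s -> moll d p x = 1.
  move=> xs; apply: ext => y /ed xy; apply: p1; rewrite /s1.
  by have := enormB_le y x a; rewrite (enormBC y x); lra.
have phi0 x : rho < enorm (x - a) -> moll d p x = 0.
  move=> xs; apply: ext => y /ed xy; apply: p0; rewrite /t1.
  by have := enormB_le x y a; rewrite /rho in xs; lra.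
have phi01 x : 0 <= moll d p x <= 1.
  apply/andP; split.
    by apply: lint_ge0 => y; rewrite mulr_ge0 ?eta_ge0//; case/andP: (p01 y).
  have [h1 h2] := lint_eta_refl x d0; rewrite -[leRHS]h2; apply: lint_le => //.
    exact: conv_lintble.
  by move=> y; rewrite ler_piMr ?eta_ge0//; case/andP: (p01 y).
have phiL x y : `|moll d p x - moll d p y| <= L * enorm (x - y).
  have H z : moll d p z = lint (fun u => p (z - u) * eta d (fun=> 0%N) u) /\
      lintble (fun u => p (z - u) * eta d (fun=> 0%N) u).
    have [i1 E] := lint_reflect z (conv_lintble z eb ip); split.
      by rewrite /moll /conv -E; apply: lint_ext => u; rewrite subKr mulrC.
    by apply: lintble_ext i1 => u; rewrite subKr mulrC.
  have [-> i1] := H x; have [-> i2] := H y.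
  have ie := @eta_lintble R n d (fun=> 0%N) d0.
  rewrite -lintB//; apply: (le_trans (lint_abs (lintbleB i1 i2))).
  have -> : L * enorm (x - y) = lint (fun u : 'rV[R]_n => L * enorm (x - y) * eta d (fun=> 0%N) u).
    by rewrite lintZ// lint_eta// mulr1.
  apply: lint_le; [by apply: lintble_abs; exact: lintbleB|exact: lintbleZ|] => u.
  rewrite -mulrBl normrM (ger0_norm (eta_ge0 u d0)) ler_wpM2r ?eta_ge0//.
  by have := pL (x - u) (y - u); rewrite opprB addrA subrK.
exists (moll d p), (fun j => conv (eta d (inc (fun=> 0%N) j)) p), (d + r), rho; split.
- by split => //; exact: moll_supp.
- by rewrite /rho gtrBl.
- by move=> x; split => //; exact: phi1.
- by move=> x; apply: contra_neqT; rewrite -ltNge; exact: phi0.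
move=> x; split; first by apply: grad_le_lip phiC phiL (ltW L0).
case=> [xs|xt]; apply/rowP => j; rewrite !mxE.
  apply: (@C11_loc_const _ _ (eball a s) 1 x j phiC) => //; first exact: eball_open.
  by move=> y /ltW; exact: phi1.
apply: (@C11_loc_const _ _ [set y | rho < enorm (y - a)] 0 x j phiC) => //.
- apply: (@open_comp _ _ (fun y => enorm (y - a)) [set u | rho < u]); last exact: open_gt.
  move=> y _; apply: (@continuous_comp _ _ _ (fun y => y - a) enorm); last exact: enorm_continuous.
  have := @cont_affine R n 1 (- a) y; rewrite (_ : (fun x => _) = (fun x => x - a))//.
  by apply/funext => z; rewrite scale1r.
by rewrite /= /rho; apply: lt_le_trans xt; rewrite gtrBl.
Qed.

End cutoff.

Section weak_isoperimetric.
Context {R : realType} {n : nat}.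
Implicit Types (x y z a : 'rV[R]_n).
Local Notation T := (Rmeas R n).
Local Notation mu := (lebm R n).

Lemma lint_set (U : set T) (h : 'rV[R]_n -> R) : measurable U -> lintble (fun x => \1_U x * h x) ->
  (\int[mu]_(x in U) (h x)%:E = (lint (fun x => \1_U x * h x))%:E)%E.
Proof.
move=> mU ih; rewrite (lintE ih) integral_mkcond; apply: eq_integral => x _.
by rewrite /patch indicE; case: (_ \in _); rewrite ?mul1r ?mul0r.
Qed.

Lemma young (p : nat) (l o : R) : 0 < l -> 0 <= o ->
  p.+1%:R * o ^+ p <= p%:R * l * o ^+ p.+1 + (l ^+ p)^-1.
Proof.
move=> l0 o0; have lp : 0 < l ^+ p by rewrite exprn_gt0.
have := @tangent_pow R p (l * o) 1; rewrite expr1n => /(_ _ ler01).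
rewrite mulr_ge0 ?(ltW l0)// => /(_ isT) h.
rewrite -(ler_pM2l lp) mulrDr divff ?gt_eqF//.
have -> : l ^+ p * (p.+1%:R * o ^+ p) = p.+1%:R * (l * o) ^+ p by rewrite exprMn; ring.
have -> : l ^+ p * (p%:R * l * o ^+ p.+1) = p%:R * (l * o) ^+ p.+1 by rewrite exprMn !exprS; ring.
move: h; rewrite exprS -natr1; set X := (l * o) ^+ p; set Y := l * o; lra.
Qed.

Lemma le_small (x y C e0 : R) : 0 < e0 -> (forall e, 0 < e -> e < e0 -> x <= y + C * e) -> x <= y.
Proof.
move=> e00 H; rewrite leNgt; apply/negP => yx.
have C1 : 0 < `|C| + 1 by rewrite ltr_wpDl.
pose e := Num.min (e0 / 2) ((x - y) / 2 / (`|C| + 1)).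
have e0' : 0 < e by rewrite lt_min !divr_gt0// subr_gt0.
have e1 : e < e0 by rewrite gt_min; apply/orP; left; lra.
have e2 : e * (`|C| + 1) <= (x - y) / 2 by rewrite -ler_pdivlMr// ge_min lexx orbT.
have := H e e0' e1; have := ler_norm C; have : C * e <= `|C| * e by apply: ler_wpM2r; [exact: ltW|exact: ler_norm].
lra.
Qed.

(** Arithmetic of the passage to the limit below: [Xk] and [Yk] are mollified
    quantities, [X] and [Y] their limits, and [e] bounds the errors. *)
Lemma isoperimetric_limit (N w L B X Xk e k Yk Y v : R) : 0 < N -> 0 < w -> 0 < L -> 0 <= B ->
  X <= Xk + e -> N * Xk <= w * k -> N * k <= L * (B * Yk + v) -> Yk <= Y + e ->
  N * (N * X) <= w * L * (B * Y + v) + (w * L * B + N * N) * e.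
Proof.
move=> N0 w0 L0 B0 XX iso kY YY.
have h1 : N * (N * X) <= N * (N * Xk) + N * N * e.
  by rewrite -mulrA -mulrDr ler_pM2l// -mulrDr ler_pM2l.
have h2 : N * (N * Xk) <= w * (N * k) by rewrite [leRHS]mulrCA ler_pM2l.
have h3 : w * (N * k) <= w * (L * (B * Yk + v)) by rewrite ler_pM2l.
have h4 : w * L * (B * Yk) <= w * L * (B * (Y + e)).
  by rewrite ler_pM2l ?mulr_gt0//; exact: ler_wpM2l.
apply: (le_trans h1); rewrite [X in _ <= _ + X]mulrDl addrA; apply: lerD; last by [].
apply: (le_trans h2); apply: (le_trans h3); rewrite mulrA mulrDr.
move: h4; rewrite !mulrDr; lra.
Qed.

Variables (F : 'I_n -> 'rV[R]_n -> R) (D : 'I_n -> 'I_n -> 'rV[R]_n -> R) (S : R) (a : 'rV[R]_n).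
Hypothesis n1 : (1 < n)%N.
Hypothesis FL : forall i, Lp n S (F i).
Hypothesis DL : forall i j, Lp n S (D i j).

Let n0 : (0 < n)%N := ltnW n1.
Lemma young_scaled (g L l o : R) : 0 <= g -> g <= L -> 0 < l -> 0 <= o ->
  n%:R * (g * o ^+ n.-1) <= L * (n.-1%:R * l * o ^+ n + (l ^+ n.-1)^-1).
Proof.
move=> g0 gL l0 o0; rewrite mulrCA; apply: ler_pM; [exact: g0| |exact: gL|].
  by rewrite mulr_ge0 ?exprn_ge0.
by have := young n.-1 l0 o0; rewrite prednK.
Qed.

Let J x := \det (jmx D x).
Let op x := opnorm (jmx D x) ^+ n.

(** The form in which weak differentiability enters: near [a], the [j]-th
    derivative of a mollification of [F i] is the mollification of [D i j]. *)
Definition mollified_derivative (t : R) := exists N0, forall k, (N0 <= k)%N ->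
  forall z, enorm (z - a) < t -> forall i j,
  conv (eta (rad k) (inc (fun=> 0%N) j)) (F i) z = moll (rad k) (D i j) z.

Lemma meas_eball (t : R) : measurable (eball a t : set T).
Proof. by apply: measurable_open; exact: eball_open. Qed.

(** The isoperimetric inequality is applied to the mollified map weighted by a
    cut-off function.  The area inequality bounds the size of the image by the
    integral of the Jacobian, Young's inequality with parameter [l] separates the
    energy in the shell from its volume, and the mollification is removed. *)
Lemma cutoff_isoperimetric (phi : 'rV[R]_n -> R) dphi (r rho s t L w l : R) :
  C11 phi dphi -> supp_in r phi -> rho < t -> 0 < L ->
  (forall x, 0 <= phi x <= 1) -> (forall x, phi x != 0 -> enorm (x - a) <= rho) ->
  (forall x, enorm (\row_j dphi j x) <= L /\
      (enorm (x - a) < s \/ t <= enorm (x - a) -> \row_j dphi j x = 0)) ->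
  mollified_derivative t -> 0 < w -> 0 < l ->
  lint (fun x => \1_(eball a t) x * `|J x|) < omega R n * w ^+ n ->
  n%:R * (n%:R * `|lint (fun x => phi x * J x)|) <= w * L *
    (n.-1%:R * l * lint (fun x => \1_(eball a t `\` eball a s) x * op x) +
     (l ^+ n.-1)^-1 * lint \1_(eball a t `\` eball a s)).
Proof.
move=> phiC phir rhot L0 phi01 phirho gradP [N0 HN0] w0 l0 Vw; set A := eball a t `\` _.
have mB : measurable (eball a t : set T) by exact: meas_eball.
have mA : measurable (A : set T) by apply: measurableD; exact: meas_eball.
have iJ := det_lintble n0 DL; have iop := opnorm_lintble n0 DL.
have cphi := C11_cont phiC.
have Bsub : eball a t `<=` [set x : 'rV[R]_n | `|x| <= t + enorm a].
  move=> x; rewrite /eball /= => xt; apply: (le_trans (norm_le_enorm _)).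
  have := enormD (x - a) a; rewrite subrK; lra.
have Bfin : (leb n (eball a t) < +oo)%E.
  by apply: le_lt_trans (leb_sup_ball_fin (t + enorm a)); exact: le_leb.
have iA : lintble (\1_A : 'rV[R]_n -> R).
  by apply: lintble_indic => //; apply: le_lt_trans Bfin; apply: le_leb; exact: subDsetl.
set V := lint _ in Vw; set Y := lint (fun x => _ * op x); set vA := lint \1_A.
have wL : 0 < w * L by rewrite mulr_gt0.
pose C := w * L * (n.-1%:R * l) + n%:R * n%:R.
pose e0 := omega R n * w ^+ n - V; have e00 : 0 < e0 by rewrite subr_gt0.
apply: (@le_small _ _ C e0) => // e e_gt0 ee0.
have [N1 HN1] := det_cvg n0 DL e_gt0; have [N2 HN2] := opnorm_cvg n0 DL e_gt0.
pose k := maxn N0 (maxn N1 N2).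
have /HN0 HD : (N0 <= k)%N by rewrite leq_maxl.
have /HN1 H1 : (N1 <= k)%N by rewrite leq_max leq_maxl orbT.
have /HN2 H2 : (N2 <= k)%N by rewrite leq_max leq_maxr orbT.
have r0 := @rad_gt0 R k; set q := rad k in HD r0.
pose m0 : 'I_n -> nat := fun=> 0%N.
pose Fk i := conv (eta q m0) (F i).
pose Dk i j := conv (eta q (inc m0 j)) (F i).
pose DDk i j m := conv (eta q (inc (inc m0 j) m)) (F i).
have iF i : lintble (F i) by case: (FL i).
have FC i : C11 (Fk i) (Dk i) by exact: conv_eta_C11.
have DC i j : C11 (Dk i j) (DDk i j) by exact: conv_eta_C11.
have Dsym i j m x : DDk i j m x = DDk i m j x by rewrite /DDk incC.
have jE x : enorm (x - a) < t -> jmx Dk x = jmx (mollmx D k) x.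
  by move=> xt; apply/matrixP => i j; rewrite !mxE; exact: HD.
pose Jk x := \det (jmx (mollmx D k) x).
have iJk : lintble Jk by exact: (@det_lintble R n n0 (mollmx D k) (rad k + S) (fun i j => mollmx_Lp n0 DL k i j)).
have iopk : lintble (fun x => opnorm (jmx (mollmx D k) x) ^+ n) by exact: (@opnorm_lintble R n n0 (mollmx D k) (rad k + S) (fun i j => mollmx_Lp n0 DL k i j)).
have iBJ (h : 'rV[R]_n -> R) : lintble h -> lintble (fun x => \1_(eball a t) x * h x).
  by move=> ih; exact: lintble_mul_indic.
pose K := [set x : 'rV[R]_n | enorm (x - a) <= rho].
have cK : compact K.
  apply: (@subclosed_compact _ _ [set x : 'rV[R]_n | `|x| <= rho + enorm a]).
  - apply: (@closed_comp _ _ (fun y => enorm (y - a)) [set u | u <= rho]); last exact: closed_le.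
    move=> y _; apply: (@continuous_comp _ _ _ (fun y => y - a) enorm); last exact: enorm_continuous.
    have := @cont_affine R n 1 (- a) y; rewrite (_ : (fun x => _) = (fun x => x - a))//.
    by apply/funext => z; rewrite scale1r.
  - exact: compact_sup_ball.
  move=> x; rewrite /K /= => xr; apply: (le_trans (norm_le_enorm _)).
  by have := enormD (x - a) a; rewrite subrK; lra.
have KB : K `<=` eball a t by move=> x /= xr; exact: le_lt_trans xr rhot.
pose fk x : 'rV[R]_n := \row_i Fk i x.
have cfk : continuous fk.
  apply: row_continuous => i; rewrite (_ : (fun x => _) = Fk i); first exact: C11_cont (FC i).
  by apply/funext => x; rewrite mxE.
have := area_inequality FC cK (@eball_open R n a t) KB Bfin.
have E1 : (fun x => \1_(eball a t) x * `|\det (jmx Dk x)|) = (fun x => \1_(eball a t) x * `|Jk x|).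
  apply/funext => x; rewrite indicE; case: (boolP (x \in _)) => [|_]; last by rewrite !mul0r.
  by rewrite inE => /jE xE; rewrite /Jk xE.
rewrite lint_set//; last by rewrite E1; apply: iBJ; exact: lintble_abs.
rewrite E1 => fK.
have VkV : lint (fun x => \1_(eball a t) x * `|Jk x|) <= V + e.
  rewrite -lerBlDl; apply: le_trans H1; rewrite /V -lintB; try by apply: iBJ; exact: lintble_abs.
  apply: lint_le.
  - by apply: lintbleB; apply: iBJ; exact: lintble_abs.
  - by apply: lintble_abs; exact: lintbleB.
  move=> x; rewrite -mulrBr; apply: (@le_trans _ _ (\1_(eball a t) x * `|Jk x - J x|)).
    by rewrite ler_wpM2l ?lerB_dist//; case/andP: (indic01 (eball a t) x).
  by rewrite ler_piMl//; case/andP: (indic01 (eball a t) x).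
have fKw : (leb n (fk @` K) < (omega R n * w ^+ n)%:E)%E.
  apply: (le_lt_trans fK); rewrite lte_fin; apply: (le_lt_trans VkV).
  by rewrite -ltrBrDl.
have cfK : compact (fk @` K) by apply: continuous_compact => //; exact: continuous_subspaceT.
have [s' s'0 Hs'] := thick_compact cfK fKw.
have [|iso ikap] := @degree_isoperimetric R n Fk Dk DDk FC DC Dsym phi dphi r phiC phir s' w n1 s'0 w0.
  apply: le_trans Hs'; apply: le_leb => y [x [px yx]]; exists (fk x) => //.
  by exists x => //; exact: phirho.
have E2 : lint (fun x => phi x * \det (jmx Dk x)) = lint (fun x => phi x * Jk x).
  apply: lint_ext => x; have [->|px] := eqVneq (phi x) 0; first by rewrite !mul0r.
  have xt : enorm (x - a) < t := le_lt_trans (phirho x px) rhot.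
  exact: (congr1 (fun A => phi x * \det A) (jE x xt)).
rewrite E2 in iso.
have iphi (h : 'rV[R]_n -> R) : lintble h -> lintble (fun x => phi x * h x).
  have pb x : `|phi x| <= 1 by have /andP[p0 p1] := phi01 x; rewrite ger0_norm.
  by move=> ih; exact: (lintble_bmul (lmeas_cont cphi) pb ih).
have XX : `|lint (fun x => phi x * J x)| <= `|lint (fun x => phi x * Jk x)| + e.
  rewrite -lerBlDl; apply: (le_trans (lerB_dist _ _)); rewrite distrC -lintB; try exact: iphi.
  apply: le_trans H1; apply: (le_trans (lint_abs _)); first by apply: lintbleB; exact: iphi.
  apply: lint_le.
  - by apply: lintble_abs; apply: lintbleB; exact: iphi.
  - by apply: lintble_abs; exact: lintbleB.
  move=> x; rewrite -mulrBr normrM; have /andP[p0 p1] := phi01 x.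
  by rewrite (ger0_norm p0) ler_piMl.
have iAop (h : 'rV[R]_n -> R) : lintble h -> lintble (fun x => \1_A x * h x).
  by move=> ih; exact: lintble_mul_indic.
set Yk := lint (fun x => \1_A x * opnorm (jmx (mollmx D k) x) ^+ n).
have YY : Yk <= Y + e.
  rewrite -lerBlDl; apply: le_trans H2; rewrite /Yk /Y -lintB; try exact: iAop.
  apply: lint_le.
  - by apply: lintbleB; exact: iAop.
  - by apply: lintble_abs; exact: lintbleB.
  move=> x; rewrite -mulrBr; have /andP[i0 i1] := indic01 A x.
  apply: (@le_trans _ _ (\1_A x * `|opnorm (jmx (mollmx D k) x) ^+ n - op x|)).
    by rewrite ler_wpM2l ?ler_norm.
  by rewrite ler_piMl.
have kapY : n%:R * lint (fun x => enorm (\row_j dphi j x) * opnorm (jmx Dk x) ^+ n.-1) <=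
    L * (n.-1%:R * l * Yk + (l ^+ n.-1)^-1 * vA).
  have i1 := lintbleZ (n.-1%:R * l) (iAop _ iopk); have i2 := lintbleZ (l ^+ n.-1)^-1 iA.
  have -> : n.-1%:R * l * Yk + (l ^+ n.-1)^-1 * vA = lint (fun x =>
      n.-1%:R * l * (\1_A x * opnorm (jmx (mollmx D k) x) ^+ n) + (l ^+ n.-1)^-1 * \1_A x).
    by rewrite (lintD i1 i2) (lintZ _ (iAop _ iopk)) (lintZ _ iA).
  have i12 := lintbleD i1 i2.
  rewrite -(lintZ _ ikap) -(lintZ _ i12).
  apply: lint_le; [exact: lintbleZ ikap|exact: lintbleZ i12|] => x.
  have [gL g0] := gradP x; have [xA|xA] := pselect (A x).
    have o0 := opnorm_ge0 (jmx (mollmx D k) x); have [xt _] := xA.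
    have y0 := young_scaled (enorm_ge0 _) gL l0 o0.
    by rewrite (jE x xt) indicE (mem_set xA) mul1r mulr1; exact: y0.
  have {}g0 : \row_j dphi j x = 0.
    apply: g0; have [xs|xs] := ltP (enorm (x - a)) s; [by left|right].
    rewrite leNgt; apply/negP => xt; apply: xA; split; first exact: xt.
    by rewrite /eball /= => h; have := lt_le_trans h xs; rewrite ltxx.
  by rewrite g0 enorm0 mul0r mulr0 indicE (memNset xA) !(mul0r, mulr0) addr0 mulr0.
have nn : 0 < n%:R :> R by rewrite ltr0n.
have nl : 0 <= n.-1%:R * l by apply: mulr_ge0; [exact: ler0n|exact: ltW].
exact: (isoperimetric_limit nn w0 L0 nl XX iso kapY YY).
Qed.

Let V t := lint (fun x => \1_(eball a t) x * `|J x|).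
Let P t := lint (fun x => \1_(eball a t) x * op x).

(** The isoperimetric inequality on two concentric balls, for a map whose
    Jacobian has constant sign. *)
Lemma ball_isoperimetric (s t : R) : 0 < s -> s < t -> mollified_derivative t ->
  (forall x, 0 <= J x) \/ (forall x, J x <= 0) ->
  n%:R * n%:R * V s * (t - s) <=
    n.-1%:R * s * (P t - P s) + (s ^+ n.-1)^-1 * (t ^+ n - s ^+ n) * V t.
Proof.
move=> s0 st mD Jsign; have ts : 0 < t - s by rewrite subr_gt0.
have t0 : 0 < t by exact: lt_trans st.
have iJ := det_lintble n0 DL; have iop := opnorm_lintble n0 DL.
have iB (h : 'rV[R]_n -> R) u : lintble h -> lintble (fun x => \1_(eball a u) x * h x).
  by move=> ih; apply: lintble_mul_indic => //; exact: meas_eball.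
have V0 u : 0 <= V u.
  by apply: lint_ge0 => x; rewrite mulr_ge0//; case/andP: (indic01 (eball a u) x).
have om := @omega_gt0 R n; pose v := t ^+ n - s ^+ n.
have v0 : 0 <= v by rewrite subr_ge0 lerXn2r ?nnegrE ?(ltW s0) ?(ltW t0) ?(ltW st).
have s0' : 0 <= (s ^+ n.-1)^-1 by rewrite invr_ge0 exprn_ge0// ltW.
pose A : set 'rV[R]_n := eball a t `\` eball a s.
have sub : eball a s `<=` eball a t by move=> x; rewrite /eball /= => h; exact: lt_trans st.
have AE x : \1_A x = \1_(eball a t) x - \1_(eball a s) x :> R.
  rewrite !indicE; case: (boolP (x \in eball a s)) => [|xs].
    rewrite inE => xs; rewrite (mem_set (sub _ xs)) subrr memNset//.
    by move=> [].
  rewrite subr0; case: (boolP (x \in eball a t)) => [|xt].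
    rewrite inE => xt; rewrite mem_set//; split => //.
    by rewrite notin_setE in xs.
  by rewrite memNset// => -[xt']; rewrite notin_setE in xt.
have bfin u : 0 <= u -> lintble (\1_(eball a u) : 'rV[R]_n -> R) /\
    lint (\1_(eball a u) : 'rV[R]_n -> R) = omega R n * u ^+ n.
  move=> u0; have E := leb_eball a u0 n0; split.
    by apply: lintble_indic; rewrite ?E ?ltry//; exact: meas_eball.
  by rewrite lint_indic ?E//; exact: meas_eball.
have [it lt_] := bfin t (ltW t0); have [is_ ls] := bfin s (ltW s0).
have vA : lint (\1_A : 'rV[R]_n -> R) = omega R n * v.
  rewrite (lint_ext AE) lintB// lt_ ls /v; ring.
have PA : lint (fun x => \1_A x * op x) = P t - P s.
  rewrite /P -lintB; try exact: iB.
  by apply: lint_ext => x; rewrite AE mulrBl.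
have key (e : R) : 0 < e -> n%:R * n%:R * V s * (t - s) <=
    (1 + e) * (n.-1%:R * s * (P t - P s) + (s ^+ n.-1)^-1 * v * (V t + e)).
  move=> e0; pose L := (1 + e) / (t - s).
  have e1 : 0 < 1 + e by rewrite addr_gt0.
  have L0 : 0 < L by rewrite divr_gt0.
  have LL : (t - s)^-1 < L by rewrite /L ltr_pMl ?invr_gt0// ltrDl.
  have [phi [dphi [r [rho [[phiC phir] rt phi01 phirho gradP]]]]] := radial_cutoff a n0 s0 st LL.
  have Ve : 0 < (V t + e) / omega R n by rewrite divr_gt0// ltr_wpDl.
  have [w w0 wE] := nth_rootP n0 (ltW Ve).
  have {}w0 : 0 < w.
    rewrite lt_neqAle w0 andbT eq_sym; apply/eqP => w00; move: Ve.
    by rewrite -wE w00 expr0n gtn_eqF// ltxx.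
  have ow : omega R n * w ^+ n = V t + e by rewrite wE mulrCA divff ?gt_eqF// mulr1.
  have l0 : 0 < s / w by rewrite divr_gt0.
  have Vw : lint (fun x => \1_(eball a t) x * `|J x|) < omega R n * w ^+ n.
    by rewrite ow ltrDl.
  have := cutoff_isoperimetric phiC phir rt L0 (fun x => (phi01 x).1) phirho gradP mD w0 l0 Vw.
  rewrite -/A PA vA => iso.
  have VX : V s <= `|lint (fun x => phi x * J x)|.
    have iphi (h : 'rV[R]_n -> R) : lintble h -> lintble (fun x => phi x * h x).
      move=> ih; apply: (@lintble_bmul _ _ 1) => //; first by apply: lmeas_cont; exact: C11_cont phiC.
      by move=> x; have [/andP[p0 p1] _] := phi01 x; rewrite ger0_norm.
    have -> : `|lint (fun x => phi x * J x)| = lint (fun x => phi x * `|J x|).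
      case: Jsign => Js.
        rewrite ger0_norm; first by apply: lint_ext => x; rewrite ger0_norm.
        by apply: lint_ge0 => x; rewrite mulr_ge0//; have [/andP[]] := phi01 x.
      rewrite -normrN -lintN; last exact: iphi.
      rewrite ger0_norm; first by apply: lint_ext => x; rewrite ler0_norm// mulrN.
      by apply: lint_ge0 => x; rewrite -mulrN mulr_ge0 ?oppr_ge0//; have [/andP[]] := phi01 x.
    apply: lint_le; [by apply: iB; exact: lintble_abs|by apply: iphi; exact: lintble_abs|] => x.
    rewrite ler_wpM2r// indicE; have [/andP[p0 p1] px] := phi01 x.
    case: (boolP (x \in _)) => [|_]; last by [].
    by rewrite inE => /ltW/px ->.
  have nn : 0 < n%:R :> R by rewrite ltr0n.
  have {}iso : n%:R * (n%:R * V s) <= w * L * (n.-1%:R * (s / w) * (P t - P s) +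
      ((s / w) ^+ n.-1)^-1 * (omega R n * v)).
    by apply: le_trans iso; rewrite !ler_pM2l.
  have wE' : w ^+ n = w * w ^+ n.-1 by rewrite -exprS prednK.
  have E : w * L * (n.-1%:R * (s / w) * (P t - P s) + ((s / w) ^+ n.-1)^-1 * (omega R n * v)) =
      L * (n.-1%:R * s * (P t - P s) + (s ^+ n.-1)^-1 * v * (V t + e)).
    rewrite -ow wE' expr_div_n; field.
    by rewrite !expf_neq0 ?gt_eqF.
  rewrite E /L in iso.
  rewrite -ler_pdivlMr// -[leLHS]mulrA; apply: (le_trans iso).
  by rewrite mulrAC.
have := @poly_lim_le R ((1 + 'X) * ((n.-1%:R * s * (P t - P s))%:P +
  ((s ^+ n.-1)^-1 * v)%:P * ((V t)%:P + 'X))) (n%:R * n%:R * V s * (t - s)).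
rewrite !hornerE ?addr0 ?mul1r; apply => m m0; rewrite !hornerE; apply: key.
by rewrite invr_gt0 ltr0n.
Qed.

End weak_isoperimetric.

(** * Growth of the energy *)

Section growth.
Context {R : realType}.

(** Convexity of the exponential. *)
Lemma powR_bernoulli (x a : R) : 0 < x -> 0 <= a -> a <= 1 -> x `^ a <= 1 + a * (x - 1).
Proof.
move=> x0 a0 a1; have ai : Itv.spec (@Itv.num_sem R) (Itv.Real `[0, 1]%Z) a.
  by rewrite /Itv.spec /= /Itv.num_sem /= num_real in_itv /= a0 a1.
have := convex_expR (@Itv.mk _ _ _ a ai : {i01 R}) (ln x : R^o) (0 : R^o).
rewrite !convRE /= lnK ?posrE// expR0 mulr0 addr0 mulr1 /powR gt_eqF//.
by move=> h; apply: (le_trans h); rewrite /unstable.onem le_eqVlt; apply/orP; left; apply/eqP; ring.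
Qed.

Lemma pow_quadratic (n : nat) (d : R) : 0 <= d -> d <= 1 ->
  (1 + d) ^+ n <= 1 + n%:R * d + 4 ^+ n * d ^+ 2.
Proof.
move=> d0 d1; elim: n => [|n IH]; first by rewrite !expr0 mul0r addr0 mul1r lerDl sqr_ge0.
have n4 : n%:R <= 4 ^+ n :> R by rewrite -natrX ler_nat ltnW// ltn_expl.
rewrite exprS; apply: le_trans (ler_wpM2l _ IH) _; first by rewrite addr_ge0.
have d2 : 0 <= d ^+ 2 by exact: sqr_ge0.
have d3 : 4 ^+ n * d ^+ 3 <= 4 ^+ n * d ^+ 2.
  by rewrite ler_wpM2l ?exprn_ge0// exprSr ler_piMr.
have nd : n%:R * d ^+ 2 <= 4 ^+ n * d ^+ 2 by rewrite ler_wpM2r.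
have p4 : 0 <= 4 ^+ n * d ^+ 2 by rewrite mulr_ge0// exprn_ge0.
rewrite -[n.+1%:R]natr1; move: d3 nd p4 (exprS (4 : R) n).
move: (4 ^+ n) (4 ^+ n.+1) => u v; move=> h1 h2 h3 ->; lra.
Qed.

Variables (n : nat) (n2 : (2 <= n)%N).
Let n0 : (0 < n)%N := ltnW n2.
Let C : R := n%:R * 4 ^+ n + (n%:R + 4 ^+ n) ^+ 2.

(** For consecutive radii of ratio [1 + d], the isoperimetric inequality gives
    the growth factor on the right; to first order in [d] it is the power on
    the left. *)
Lemma step_factor (a d : R) (y := (1 + d) ^+ n - 1) : 0 <= a -> a <= 1 -> 0 <= d ->
  C * d <= 1 ->
  [/\ 0 <= n%:R * n%:R * d - y, n%:R * d <= y,
    (1 + d) `^ (n%:R * a) * (1 - C * d ^+ 2) <=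
      1 + a * ((n%:R * n%:R * d - y) / (n.-1%:R + y)) &
    0 <= 1 - C * d ^+ 2].
Proof.
move=> a0 a1 d0 Cd.
have nn : 2 <= n%:R :> R by rewrite (ler_nat _ 2 n).
have n1E : n.-1%:R = n%:R - 1 :> R by rewrite -subn1 natrB.
have h4 : 4 <= 4 ^+ n :> R by rewrite -[leLHS]expr1 ler_weXn2l// ler1n.
move: n1E h4; rewrite /C in Cd *; set q := 4 ^+ n => n1E h4; set N := n%:R.
have Cq : q <= N * q + (N + q) ^+ 2.
  by rewrite -[leLHS]addr0 lerD ?sqr_ge0// ler_peMl; lra.
have qd : q * d <= 1 by apply: le_trans Cd; rewrite ler_wpM2r.
have d1 : d <= 1 by apply: le_trans qd; rewrite ler_peMl//; lra.
have y1 : N * d <= y by rewrite lerBrDl; apply: bernoulli_pow; lra.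
have y2 : y <= N * d + q * d ^+ 2 by rewrite lerBlDl addrA; apply: pow_quadratic.
have dd : 0 <= d ^+ 2 by exact: sqr_ge0.
have qdd : q * d ^+ 2 <= d by rewrite expr2 mulrA ler_piMl.
have Nd : 0 <= N * d by rewrite mulr_ge0//; rewrite /N; lra.
have NNd : 2 * N * d <= N * N * d by rewrite ler_wpM2r// ler_wpM2r//; rewrite /N; lra.
have dNd : d <= N * d by rewrite ler_peMl// /N; lra.
have y0 : 0 <= y by apply: le_trans y1.
have Cdd : (N * q + (N + q) ^+ 2) * d ^+ 2 <= 1.
  rewrite expr2 mulrA; apply: le_trans d1; rewrite ler_piMl//.
split => //; [lra| |by rewrite subr_ge0].
set E := _ * d ^+ 2 in Cdd *.
have E0 : 0 <= E by rewrite mulr_ge0// addr_ge0 ?sqr_ge0// mulr_ge0//; rewrite /N; lra.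
have q0 : 0 < 1 + d by lra.
have pw : (1 + d) `^ (N * a) <= 1 + a * y.
  by rewrite powRrM (powR_mulrn _ (ltW q0)); exact: (powR_bernoulli (exprn_gt0 n q0) a0 a1).
apply: (@le_trans _ _ ((1 + a * y) * (1 - E))).
  by rewrite ler_wpM2r// subr_ge0.
have ay : 0 <= a * y * E := mulr_ge0 (mulr_ge0 a0 y0) E0.
(* By Bernoulli's inequality only the second order difference between the
   growth of volumes [y] and the gain remains. *)
suff : y - (N * N * d - y) / (n.-1%:R + y) <= E.
  move: (_ / _) => th h; have [h'|h'] := ltP (y - th) 0.
    have : 0 <= a * (th - y) by rewrite mulr_ge0//; lra.
    lra.
  have : a * (y - th) <= y - th by rewrite ler_piMl.
  lra.
have D1 : 1 <= n.-1%:R + y by rewrite n1E -/N; rewrite /N in y0 *; lra.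
have D0 : 0 < n.-1%:R + y by lra.
have -> : y - (N * N * d - y) / (n.-1%:R + y) = (N * (y - N * d) + y ^+ 2) / (n.-1%:R + y).
  rewrite n1E -/N; rewrite n1E -/N in D0; field; exact: lt0r_neq0.
have yd : y ^+ 2 <= ((N + q) * d) ^+ 2.
  have qd2 : q * d ^+ 2 <= q * d by rewrite ler_wpM2l// ?expr2 ?ler_piMl//; lra.
  have yN : y <= (N + q) * d by lra.
  by rewrite lerXn2r ?nnegrE//; apply: le_trans yN.
have num : N * (y - N * d) + y ^+ 2 <= E.
  rewrite /E mulrDl lerD//; last by rewrite -exprMn.
  by rewrite -mulrA ler_wpM2l; rewrite /N; lra.
apply: le_trans num; rewrite ler_pdivrMr// ler_peMr// addr_ge0 ?sqr_ge0// mulr_ge0//; rewrite /N; lra.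
Qed.

Variables (V P : R -> R) (K1 B a R0 : R).
Hypotheses (K0 : 0 < K1) (a0 : 0 <= a) (a1 : a <= 1) (aK : a <= K1^-1).
Hypothesis V0 : forall s, 0 <= V s.
Hypothesis P0 : forall s, 0 <= P s.
Hypothesis QR : forall s, 0 < s -> P s <= K1 * V s + B * s ^+ n.
Hypothesis iso : forall s t, 0 < s -> s < t -> t <= R0 ->
  n%:R * n%:R * V s * (t - s) <=
    n.-1%:R * s * (P t - P s) + (s ^+ n.-1)^-1 * (t ^+ n - s ^+ n) * V t.
Hypothesis VP : forall s t, s < t -> V t - V s <= P t - P s.

(** In [V t <= V s + (P t - P s)] the unknown outer term is absorbed by the energy
    of the shell.  The multiple [c] of the volume compensates the inhomogeneous
    term of the distortion inequality. *)
Lemma growth_step (c d s : R) : a * B = (1 - a) * c -> 0 <= c -> 0 < d -> C * d <= 1 ->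
  0 < s -> (1 + d) * s <= R0 ->
  (1 + d) `^ (n%:R * a) * (1 - C * d ^+ 2) * (P s + c * s ^+ n) <=
    P ((1 + d) * s) + c * ((1 + d) * s) ^+ n.
Proof.
move=> cE c0 d0 Cd s0 sR; have [th0 yd fac _] := step_factor a0 a1 (ltW d0) Cd.
have st : s < (1 + d) * s by rewrite ltr_pMl//; lra.
have sn : 0 < s ^+ n by rewrite exprn_gt0.
apply: (@le_trans _ _ ((1 + a * ((n%:R * n%:R * d - ((1 + d) ^+ n - 1)) / (n.-1%:R + ((1 + d) ^+ n - 1)))) * (P s + c * s ^+ n))).
  by rewrite ler_wpM2r// addr_ge0// mulr_ge0// ltW.
have H := iso s0 st sR; have := VP st; have := QR s0; have := P0 s; have := V0 s.
rewrite exprMn in H *; move: H.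
set t := (1 + d) * s; set y := (1 + d) ^+ n - 1 in th0 yd *.
have -> : t - s = d * s by rewrite /t; ring.
have -> : (1 + d) ^+ n * s ^+ n - s ^+ n = y * s ^+ n by rewrite /y; ring.
have -> : (1 + d) ^+ n = 1 + y by rewrite /y; ring.
have -> : (s ^+ n.-1)^-1 * (y * s ^+ n) * V t = s * (y * V t).
  rewrite -[in s ^+ n](prednK n0) exprS; field; by rewrite expf_neq0 ?gt_eqF.
have n1 : 1 <= n.-1%:R :> R by rewrite ler1n -ltnS prednK.
have nE : n%:R = n.-1%:R + 1 :> R by rewrite natr1 prednK.
move: (V s) (V t) (P s) (P t) => v v' p p' H v0 p0 qr vp.
have {}H : n%:R * n%:R * d * v <= n.-1%:R * (p' - p) + y * v'.
  rewrite -(ler_pM2l s0); apply: le_trans (le_trans H _).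
    by rewrite le_eqVlt; apply/orP; left; apply/eqP; ring.
  by rewrite le_eqVlt; apply/orP; left; apply/eqP; ring.
have y0 : 0 <= y by apply: le_trans yd; rewrite mulr_ge0// ltW.
have D0 : 0 < n.-1%:R + y by lra.
have H2 : (n%:R * n%:R * d - y) * v <= (n.-1%:R + y) * (p' - p).
  have : y * v' <= y * (v + (p' - p)) by rewrite ler_wpM2l//; lra.
  lra.
have vl : a * (p - B * s ^+ n) <= v.
  have [h|h] := leP (p - B * s ^+ n) 0; first by apply: le_trans v0; rewrite mulr_ge0_le0.
  apply: (@le_trans _ _ (K1^-1 * (p - B * s ^+ n))); first by rewrite ler_wpM2r// ltW.
  by rewrite mulrC ler_pdivrMr//; lra.
set th := _ / _.
have tE : th * (n.-1%:R + y) = n%:R * n%:R * d - y by rewrite /th divfK// gt_eqF.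
have tt : 0 <= th by rewrite /th divr_ge0// ltW.
have {}H2 : th * v <= p' - p.
  by rewrite -(ler_pM2l D0); apply: le_trans H2; rewrite -tE mulrCA mulrA mulrAC.
have ty : th <= y.
  rewrite /th ler_pdivrMr//; rewrite nE in yd *.
  have : 0 <= y ^+ 2 by exact: sqr_ge0.
  have : (n.-1%:R + 1) * ((n.-1%:R + 1) * d) <= (n.-1%:R + 1) * y by rewrite ler_wpM2l//; lra.
  lra.
have : th * (a * (p - B * s ^+ n)) <= th * v by rewrite ler_wpM2l.
have : 0 <= c * s ^+ n * (y - th) by rewrite mulr_ge0 ?subr_ge0// mulr_ge0// ltW.
have : a * B * (th * s ^+ n) = (1 - a) * c * (th * s ^+ n) by rewrite cE.
move: (s ^+ n) => sN; move: H2; lra.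
Qed.

(** Multiplying the one-step estimate over a geometric sequence of radii
    and refining it: the quadratic errors disappear in the limit. *)
Lemma growth (c r : R) : a * B = (1 - a) * c -> 0 <= c -> 0 < r -> r <= R0 ->
  P r + c * r ^+ n <= (r / R0) `^ (n%:R * a) * (P R0 + c * R0 ^+ n).
Proof.
move=> cE c0 r0 rR; have R00 : 0 < R0 by exact: lt_le_trans rR.
pose G s := P s + c * s ^+ n; rewrite -!/(G _).
have G0 s : 0 < s -> 0 <= G s by move=> s0; rewrite addr_ge0// mulr_ge0// exprn_ge0// ltW.
pose X := R0 / r; have X1 : 1 <= X by rewrite ler_pdivlMr// mul1r.
have XX : (r / R0) `^ (n%:R * a) = (X `^ (n%:R * a))^-1.
  have -> : r / R0 = X `^ (-1).
    by rewrite powR_inv1 ?(le_trans ler01 X1)// invf_div.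
  by rewrite -powRrM mulN1r powRN.
have Xp : 0 < X `^ (n%:R * a) by rewrite powR_gt0// (lt_le_trans _ X1).
rewrite XX mulrC ler_pdivlMr// mulrC.
have C0 : 0 < C.
  have p4 : 0 < 4 ^+ n :> R by rewrite exprn_gt0.
  apply: ltr_wpDl; first by apply: mulr_ge0; [exact: ler0n|exact: ltW].
  by apply: exprn_gt0; apply: ltr_wpDl; [exact: ler0n|exact: p4].
have [N0 N00 N0P] : exists2 N0, (0 < N0)%N & C * (X - 1) <= N0%:R.
  by exists (Num.truncn (C * (X - 1))).+1 => //; exact/ltW/truncnS_gt.
apply: (@lin_lim_le _ _ _ (X `^ (n%:R * a) * G r * (C * (X - 1) ^+ 2))) => m m0.
pose N := (m * N0)%N; have NN : (0 < N)%N by rewrite muln_gt0 m0.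
have NR : 0 < N%:R :> R by rewrite ltr0n.
have [q q0 qX] := nth_rootP NN (le_trans ler01 X1).
have q1 : 1 <= q.
  rewrite leNgt; apply/negP => q1; move: X1; rewrite -qX leNgt exprn_ilt1//.
  by rewrite -lt0n NN.
pose d := q - 1; have d0 : 0 <= d by rewrite subr_ge0.
have qE : q = 1 + d by rewrite /d; ring.
have dN : N%:R * d <= X - 1.
  by rewrite lerBrDl -qX qE bernoulli_pow//; lra.
have NN0 : N0%:R <= N%:R :> R by rewrite ler_nat leq_pmull.
have Cd : C * d <= 1.
  rewrite -(ler_pM2l NR) mulr1 mulrCA; apply: le_trans (le_trans N0P NN0).
  by rewrite ler_pM2l.
have [_ _ _ pos] := step_factor a0 a1 d0 Cd.
have step j : (j <= N)%N ->
    (q `^ (n%:R * a) * (1 - C * d ^+ 2)) ^+ j * G r <= G (q ^+ j * r).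
  elim: j => [|j IH] jN; first by rewrite !expr0 !mul1r.
  have qj : 0 < q ^+ j * r by rewrite mulr_gt0// exprn_gt0// (lt_le_trans _ q1).
  rewrite !(exprS _ j) -mulrA.
  apply: (@le_trans _ _ (q `^ (n%:R * a) * (1 - C * d ^+ 2) * G (q ^+ j * r))).
    by rewrite ler_wpM2l ?IH ?(ltnW jN)// mulr_ge0// powR_ge0.
  have [d00|d00] := eqVneq d 0.
    by rewrite qE d00 addr0 mul1r expr0n /= mulr0 subr0 powR1 !mul1r.
  have dp : 0 < d by rewrite lt_neqAle eq_sym d00.
  have := growth_step cE c0 dp Cd qj; rewrite -qE mulrA; apply.
  rewrite -exprS -[R0](divfK (lt0r_neq0 r0)) ler_pM2r// -/X -qX ler_weXn2l//.
have := step N (leqnn N); rewrite qX divfK ?gt_eqF// exprMn.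
have -> : (q `^ (n%:R * a)) ^+ N = X `^ (n%:R * a).
  by rewrite -powR_mulrn ?powR_ge0// powRAC powR_mulrn// qX.
move=> H; rewrite -lerBlDr; apply: le_trans H.
have -> : X `^ (n%:R * a) * G r - X `^ (n%:R * a) * G r * (C * (X - 1) ^+ 2) / m%:R =
  X `^ (n%:R * a) * (1 - C * (X - 1) ^+ 2 / m%:R) * G r by ring.
apply: (ler_wpM2r (G0 _ r0)); rewrite ler_pM2l//.
have Cdd : - 1 <= - (C * d ^+ 2) by rewrite lerN2; lra.
apply: (@le_trans _ _ (1 + N%:R * - (C * d ^+ 2))); last by apply: bernoulli_pow; lra.
rewrite mulrN lerD2l lerN2 mulrCA -mulrA ler_pM2l// ler_pdivlMr ?ltr0n//.
have -> : N%:R * d ^+ 2 * m%:R = (N%:R * d) ^+ 2 / N0%:R.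
  rewrite /N natrM; field; by rewrite pnatr_eq0 -lt0n.
rewrite ler_pdivrMr ?ltr0n//; apply: (@le_trans _ _ ((X - 1) ^+ 2)).
  by rewrite lerXn2r ?nnegrE//; [rewrite mulr_ge0// ltW|rewrite subr_ge0].
by rewrite ler_peMr ?sqr_ge0// ler1n.
Qed.

End growth.

Section growth_constant.
Context {R : realType}.

Lemma holder_exponent_range (K1 K2 a : R) : 0 < K1 -> 0 <= K2 -> holder_exponent K1 K2 a ->
  0 < a <= 1.
Proof.
move=> K10 K20 [h1 h2 h3 h4]; case: (ltgtP K1 1) => K1E.
- by rewrite h4// ltr01 lexx.
- by rewrite h1// invr_gt0 K10 invf_le1// ltW.
- have [K2p|K2n] := ltP 0 K2; first by have /andP[-> /ltW ->] := h2 K1E K2p.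
  have K2E : K2 = 0 by apply/eqP; rewrite eq_le K2n.
  by rewrite h3// ltr01 lexx.
Qed.

(** If [K1 < 1], the distortion inequality alone bounds the energy, since the
    Jacobian is at most the energy density.  Otherwise [a <= 1 / K1], and the
    correction [c] exists because [a < 1] unless [K2 = 0]. *)
Lemma growth_bound (n : nat) (K1 K2 a w R1 M : R) : (2 <= n)%N -> 0 < K1 -> 0 <= K2 ->
  holder_exponent K1 K2 a -> 0 <= w -> 0 < R1 ->
  exists2 C, 0 <= C & forall V P : R -> R,
    (forall s, 0 <= V s) -> (forall s, V s <= P s) ->
    (forall s, 0 < s -> P s <= K1 * V s + K2 * w * s ^+ n) ->
    (forall s t, 0 < s -> s < t -> t <= R1 -> n%:R * n%:R * V s * (t - s) <=
      n.-1%:R * s * (P t - P s) + (s ^+ n.-1)^-1 * (t ^+ n - s ^+ n) * V t) ->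
    (forall s t, s < t -> V t - V s <= P t - P s) ->
    P R1 <= M ->
    forall r, 0 < r -> r <= R1 -> P r <= C * (r `^ a) ^+ n.
Proof.
move=> n2 K10 K20 aH w0 R10; have /andP[a0 a1] := holder_exponent_range K10 K20 aH.
have B0 : 0 <= K2 * w by rewrite mulr_ge0.
case: aH => h1 h2 h3 h4; have [K1l|K1g] := ltP K1 1.
  exists (K2 * w / (1 - K1)); first by rewrite divr_ge0// subr_ge0 ltW.
  move=> V P V0 VP QR _ _ _ r r0 _; rewrite h4// powRr1 ?(ltW r0)// mulrAC ler_pdivlMr ?subr_gt0//.
  have := QR r r0; have := ler_wpM2l (ltW K10) (VP r); lra.
have aK : a <= K1^-1.
  have [K1E|K1E] := eqVneq K1 1; first by rewrite K1E invr1.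
  by rewrite h1// lt_neqAle eq_sym K1E.
(* For [a = 1] the hypothesis on the exponent forces [K1 = 1] and [K2 = 0]. *)
have [c c0 cE] : exists2 c, 0 <= c & a * (K2 * w) = (1 - a) * c.
  have [aE|aE] := eqVneq a 1.
    suff -> : K2 = 0 by exists 0; rewrite // mul0r !mulr0.
    have K1E : K1 = 1.
      by apply/eqP; rewrite eq_le K1g andbT -invf_ge1// -aE.
    apply/eqP; rewrite eq_le K20 andbT leNgt; apply/negP => K2p.
    by have := h2 K1E K2p; rewrite aE ltxx andbF.
  have a1' : 0 < 1 - a by rewrite subr_gt0 lt_neqAle aE.
  exists (a * (K2 * w) / (1 - a)); first by rewrite divr_ge0 ?(ltW a1')// mulr_ge0// ltW.
  by rewrite [RHS]mulrC divfK// gt_eqF.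
exists ((`|M| + c * R1 ^+ n) / (R1 `^ a) ^+ n).
  by rewrite divr_ge0 ?exprn_ge0 ?powR_ge0// addr_ge0// mulr_ge0// exprn_ge0// ltW.
move=> V P V0 VP QR iso dVP PM r r0 rR.
have P0 s : 0 <= P s by exact: le_trans (VP s).
have := growth n2 K10 (ltW a0) a1 aK V0 P0 QR iso dVP cE c0 r0 rR.
have Ra : 0 < R1 `^ a by rewrite powR_gt0.
have -> : (r / R1) `^ (n%:R * a) = (r `^ a) ^+ n / (R1 `^ a) ^+ n.
  rewrite [n%:R * a]mulrC powRrM powR_mulrn ?powR_ge0//.
  have rE : r `^ a = (r / R1) `^ a * R1 `^ a.
    by rewrite -powRM ?divfK ?gt_eqF// ltW// divr_gt0.
  by rewrite [in RHS]rE exprMn mulfK// expf_neq0// gt_eqF.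
move=> H; apply: le_trans (le_trans H _); first by rewrite lerDl mulr_ge0// exprn_ge0// ltW.
rewrite mulrC mulrA -[leRHS]mulrA [X in _ <= _ * X]mulrC -[leLHS]mulrA ler_wpM2r//.
  by rewrite divr_ge0// exprn_ge0// powR_ge0.
by rewrite lerD2r (le_trans PM)// ler_norm.
Qed.

End growth_constant.

(** * Averages and commuting mollifications *)

Section mollifier_calculus.
Context {R : realType} {n : nat}.
Implicit Types (x y z v w : 'rV[R]_n).
Local Notation T := (Rmeas R n).
Local Notation e0 r := (@eta R n r (fun=> 0%N)).

Lemma C11_mvt (f : 'rV[R]_n -> R) d x v (B : R) : C11 f d ->
  (forall t : R, 0 <= t <= 1 -> forall j, `|d j (x + t *: v)| <= B) ->
  `|f (x + v) - f x| <= n%:R * B * `|v|.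
Proof.
move=> [M [_ _ _ tM]] dB; pose g (t : R) := f (x + t *: v).
have dg (t : R) : is_derive t 1 g (\sum_j v 0 j * d j (x + t *: v)).
  apply: (@quad_is_derive R R^o g t 1 _ (M * `|v| ^+ 2)) => s s1.
  have := tM (x + t *: v) (s *: v); rewrite -[x + _ + _]addrA -scalerDl.
  rewrite /g [in s *: (1 : R)]/GRing.scale /= mulr1.
  have -> : \sum_j (s *: v) 0 j * d j (x + t *: v) = s * \sum_j v 0 j * d j (x + t *: v).
    by rewrite mulr_sumr; apply: eq_bigr => j _; rewrite mxE mulrA.
  by rewrite normrZ exprMn real_normK ?num_real// [s ^+ 2 * _]mulrC mulrA.
have cg (i : interval R) : {within [set` i], continuous g}.
  by apply: derivable_within_continuous => t _; exact: (@ex_derive _ _ _ _ _ _ _ (dg t)).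
have [c c01 E] := MVT_segment (ler01 : (0 : R) <= 1) (fun t _ => dg t) (@cg _).
move: E; rewrite /g scale1r scale0r addr0 subr0 mulr1 => ->.
apply: le_trans (ler_norm_sum _ _ _) _.
apply: (@le_trans _ _ (\sum_(j < n) B * `|v|)).
  apply: ler_sum => j _; rewrite normrM mulrC ler_pM//; first exact: dB.
  exact: coord_norm.
by rewrite sum_ord_const mulrA.
Qed.

Lemma meas_diff (k : 'rV[R]_n -> R) : continuous k ->
  measurable_fun setT (fun p : T * T => k (p.2 - p.1)).
Proof.
move=> ck; apply: (@coords_meas R n _ (T * T)%type (fun p : T * T => (p.2 : 'rV[R]_n) - p.1) k ck) => i.
rewrite (_ : (fun p => _) = (fun p : T * T => p.2 0 i - p.1 0 i)); last first.
  by apply/funext => p; rewrite !mxE.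
apply: measurable_funB.
  exact: (measurableT_comp (measurable_coord i) (@measurable_snd _ _ _ _)).
exact: (measurableT_comp (measurable_coord i) (@measurable_fst _ _ _ _)).
Qed.

Lemma eta_eta_lintble (r s : R) z w : 0 < r -> 0 < s ->
  lintble (fun y => e0 r (z - y) * e0 s (y - w)).
Proof.
move=> r0 s0; have [M M0 HM] := @eta_bounded R n s (fun=> 0%N).
apply: (@lintble_ext _ _ (fun y => e0 s (w - y) * e0 r (z - y))) => [y|].
  by rewrite mulrC (etaC s).
have [iw _] := lint_eta_refl w s0; have [iz _] := lint_eta_refl z r0.
by apply: lintble_bmul (lintble_meas iw) _ iz => y; exact: HM.
Qed.

(** Mollifications at two scales commute: after exchanging the integrals both
    sides carry the convolution of two even kernels. *)
Lemma moll_comm (r s : R) u z : 0 < r -> 0 < s -> lintble u ->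
  moll r (moll s u) z = moll s (moll r u) z.
Proof.
move=> r0 s0 iu; pose k r s w y : R := e0 r (z - y) * e0 s (y - w).
pose K r s w : R := lint (fun y => k r s w y).
have H (r1 s1 : R) : 0 < r1 -> 0 < s1 -> moll r1 (moll s1 u) z = lint (fun w => K r1 s1 w * u w).
  move=> r10 s10; have [M1 M10 HM1] := @eta_bounded R n r1 (fun=> 0%N).
  have [M2 M20 HM2] := @eta_bounded R n s1 (fun=> 0%N).
  have mk : measurable_fun setT (fun p : T * T => k r1 s1 p.1 p.2).
    apply: measurable_funM; last exact: meas_diff (@eta_cont R n s1 _).
    apply: (measurableT_comp (lmeas_cont (@cont_refl _ _ (e0 r1) z (@eta_cont R n r1 _))) (@measurable_snd _ _ T T)).
  have kM x y : `|k r1 s1 x y| <= M1 * M2 by rewrite normrM ler_pM.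
  have ks x y : `|z| + r1 < `|y| -> k r1 s1 x y * u x = 0.
    by move=> yb; rewrite /k eta_supp ?mul0r//; have := lerB_dist y z; rewrite distrC; lra.
  have [Iy Ix _ _ E] := lint_fubini mk kM ks iu.
  have bc := @eta_bc R n s1 (fun=> 0%N).
  transitivity (lint (fun y => lint (fun x => k r1 s1 x y * u x))).
    apply: lint_ext => y; rewrite /moll /conv -(lintZ _ (conv_lintble y bc iu)).
    by apply: lint_ext => x; rewrite mulrA.
  rewrite -E; apply: lint_ext => w.
  have ik : lintble (fun y => k r1 s1 w y) by exact: eta_eta_lintble.
  rewrite /K mulrC -(lintZ (u w) ik); apply: lint_ext => y; exact: mulrC.
rewrite (H _ _ r0 s0) (H _ _ s0 r0); apply: lint_ext => w; congr (_ * _).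
have ik : lintble (fun y => k r s w y).
  exact: (eta_eta_lintble z w r0 s0).
have [_ E] := lint_reflect (z + w) ik; apply: (etrans (esym E)); apply: lint_ext => y; rewrite /k mulrC.
congr (_ * _); congr (eta _ _ _); first by rewrite addrAC addrK.
by apply/rowP => j; rewrite !mxE; ring.
Qed.

(** A mollification is an average over the ball of the same radius. *)
Lemma moll_average (r : R) u z (c B : R) : 0 < r -> lintble u ->
  (forall y, `|z - y| <= r -> `|u y - c| <= B) -> `|moll r u z - c| <= B.
Proof.
move=> r0 iu uB; have [ie e1] := lint_eta_refl z r0; have bc := @eta_bc R n r (fun=> 0%N).
have iu' := conv_lintble z bc iu; have ic := lintbleZ c ie.
have -> : moll r u z - c = lint (fun y => e0 r (z - y) * u y - c * e0 r (z - y)).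
  by rewrite (lintB iu' ic) (lintZ _ ie) e1 mulr1.
have id := lintbleB iu' ic; apply: le_trans (lint_abs id) _.
have -> : B = lint (fun y => B * e0 r (z - y)) by rewrite (lintZ _ ie) e1 mulr1.
apply: lint_le; [exact: lintble_abs|exact: lintbleZ|] => y.
rewrite [c * _]mulrC -mulrBr normrM ger0_norm ?eta_ge0// mulrC.
have [yr|yr] := leP `|z - y| r; first by rewrite ler_wpM2r ?eta_ge0// uB.
by rewrite eta_supp// !mulr0.
Qed.

End mollifier_calculus.

(** * Local models and mollified derivatives *)

Section local_estimates.
Context {R : realType} {n : nat}.
Implicit Types (x y z c : 'rV[R]_n).
Local Notation T := (Rmeas R n).
Implicit Types (F : 'I_n -> 'rV[R]_n -> R) (D : 'I_n -> 'I_n -> 'rV[R]_n -> R).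

(** A compactly supported model of a quasiregular map near c: F is the map cut
    off outside a ball and D its weak derivative there, normalised on a null
    set so that the distortion inequality holds at every point. *)
Definition local_qr (K1 K2 R0 M : R) c F D :=
  [/\ exists S, (forall i, Lp n S (F i)) /\ (forall i j, Lp n S (D i j)),
    forall k, n.+1%:R * rad k <= R0 -> forall z, enorm (z - c) < R0 -> forall i j,
      conv (eta (rad k) (inc (fun=> 0%N) j)) (F i) z = moll (rad k) (D i j) z,
    (forall x, 0 <= \det (jmx D x)) \/ (forall x, \det (jmx D x) <= 0),
    forall x, opnorm (jmx D x) ^+ n <= K1 * `|\det (jmx D x)| + K2 &
    lint (fun x => opnorm (jmx D x) ^+ n) <= M].

(** The isoperimetric inequality holds at every centre near [c], so the growth
    estimate does too, with a constant that depends on the map only through [M]. *)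
Lemma energy_growth (K1 K2 a R0 M : R) : (2 <= n)%N -> 0 < K1 -> 0 <= K2 ->
  holder_exponent K1 K2 a -> 0 < R0 ->
  exists2 C, 0 <= C & forall c F D, local_qr K1 K2 R0 M c F D ->
    forall z r, enorm (z - c) < R0 / 2 -> 0 < r -> r <= R0 / 2 ->
    lint (fun x => \1_(eball z r) x * opnorm (jmx D x) ^+ n) <= C * (r `^ a) ^+ n.
Proof.
move=> n2 K10 K20 aH R00; have n0 : (0 < n)%N := ltnW n2.
have w0 : 0 <= omega R n by exact/ltW/omega_gt0.
have R10 : 0 < R0 / 2 by rewrite divr_gt0.
have [C C0 HC] := growth_bound M n2 K10 K20 aH w0 R10.
exists C => // c F D [[S [FL DL]] mD sJ qr DM] z r zc r0 rR.
have iJ := lintble_abs (det_lintble n0 DL); have iop := opnorm_lintble n0 DL.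
have mB s : measurable (eball z s : set T) := @meas_eball R n z s.
have iB s (h : 'rV[R]_n -> R) : lintble h -> lintble (fun x => \1_(eball z s) x * h x).
  exact: lintble_mul_indic.
have op0 x : 0 <= opnorm (jmx D x) ^+ n by rewrite exprn_ge0// opnorm_ge0.
have iop_le (A : set 'rV[R]_n) x (u : R) : 0 <= u -> 0 <= \1_A x * u <= u.
  by move=> u0; have /andP[p q] := indic01 A x; rewrite mulr_ge0// ler_piMl.
have Jop x : `|\det (jmx D x)| <= opnorm (jmx D x) ^+ n by exact: det_opnorm.
apply: (HC (fun s => lint (fun x => \1_(eball z s) x * `|\det (jmx D x)|))
  (fun s => lint (fun x => \1_(eball z s) x * opnorm (jmx D x) ^+ n)) _ _ _ _ _ _ r r0 rR).
- move=> s; apply: lint_ge0 => x; by have /andP[] := iop_le (eball z s) x _ (normr_ge0 (\det (jmx D x))).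
- move=> s; apply: lint_le; [exact: iB|exact: iB|] => x.
  by rewrite ler_wpM2l//; have /andP[] := indic01 (eball z s) x.
- move=> s s0; have E := leb_eball z (ltW s0) n0.
  have i1 : lintble (\1_(eball z s) : 'rV[R]_n -> R).
    by apply: lintble_indic; [exact: mB|rewrite E ltry].
  have -> : K2 * omega R n * s ^+ n = lint (fun x => K2 * \1_(eball z s) x).
    by rewrite (lintZ K2 i1) (lint_indic (mB s)) E /= mulrA.
  have iK := lintbleZ K1 (iB s _ iJ); have i2 := lintbleZ K2 i1.
  rewrite -(lintZ K1 (iB s _ iJ)) -(lintD iK i2).
  apply: lint_le; [exact: iB|exact: lintbleD|] => x.
  rewrite mulrCA [K2 * _]mulrC -mulrDr; apply: ler_wpM2l (qr x).
  by have /andP[] := indic01 (eball z s) x.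
- move=> s t s0 st tR; apply: (@ball_isoperimetric R n F D S z n2 FL DL s t s0 st _ sJ).
  have e0 : 0 < R0 / n.+1%:R by rewrite divr_gt0// ltr0n.
  have [N0 HN0] := dya_ex e0; exists N0 => k kN y yz i j; apply: mD.
    by rewrite mulrC -ler_pdivlMr ?ltr0n// ltW//; exact: HN0.
  apply: (le_lt_trans (enormB_le y z c)); apply: (@lt_le_trans _ _ (t + R0 / 2)); first exact: ltrD.
  by rewrite -[leRHS](divfK (_ : 2 != 0)) ?pnatr_eq0//; lra.
- move=> s t st; rewrite -(lintB (iB t _ iJ) (iB s _ iJ)) -(lintB (iB t _ iop) (iB s _ iop)).
  apply: lint_le; [by apply: lintbleB; exact: iB|by apply: lintbleB; exact: iB|] => x.
  rewrite -!mulrBl; apply: ler_wpM2l (Jop x); rewrite subr_ge0 !indicE.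
  case: (boolP (x \in eball z s)) => [|_]; last by case: (_ \in _).
  by rewrite inE => xs; rewrite mem_set//; apply: lt_trans st.
- apply: le_trans DM; apply: lint_le; [exact: iB|exact: iop|] => x.
  by have /andP[] := iop_le (eball z (R0 / 2)) x _ (op0 x).
Qed.

Lemma young_split (p : nat) (l o : R) : 0 < l -> 0 <= o -> o <= l + (l ^+ p)^-1 * o ^+ p.+1.
Proof.
move=> l0 o0; have lp : 0 < l ^+ p by rewrite exprn_gt0.
have [ol|lo] := leP o l; first by rewrite (le_trans ol)// lerDl mulr_ge0 ?exprn_ge0// invr_ge0 ltW.
rewrite -[leLHS]add0r lerD ?(ltW l0)// mulrC ler_pdivlMr// exprS ler_wpM2l//.
by rewrite lerXn2r ?nnegrE// ltW.
Qed.

Lemma scale_balance (p : nat) (A C k l r : R) : l != 0 -> r != 0 ->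
  (l ^+ p)^-1 * (A / r ^+ p.+1) * (C * (k * (l * r)) ^+ p.+1) = A * C * k ^+ p.+1 * l.
Proof.
move=> l0 r0; rewrite !exprMn [l ^+ p.+1]exprS; field.
by rewrite !expf_neq0.
Qed.

(** Young's inequality against the scale-invariant slope r^(a-1) turns the
    growth of the energy into a pointwise bound for the mollified derivative. *)
Lemma moll_gradient (K1 K2 a R0 M : R) : (2 <= n)%N -> 0 < K1 -> 0 <= K2 ->
  holder_exponent K1 K2 a -> 0 < R0 ->
  exists2 A, 0 <= A & forall c F D, local_qr K1 K2 R0 M c F D ->
    forall z r i j, enorm (z - c) < R0 / 2 -> 0 < r -> 2 * n%:R * r <= R0 / 2 ->
    `|moll r (D i j) z| <= A * (r `^ a / r).
Proof.
move=> n2 K10 K20 aH R00; have n0 : (0 < n)%N := ltnW n2.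
have /andP[a0 a1] := holder_exponent_range K10 K20 aH.
have [C C0 HC] := energy_growth M n2 K10 K20 aH R00.
have [Ce Ce0 HCe] := @eta_ub R n.
exists (1 + Ce * C * (2 * n%:R) ^+ n).
  by rewrite addr_ge0// mulr_ge0 ?exprn_ge0 ?mulr_ge0// ltW.
move=> c F D H z r i j zc r0 rR; have G := HC c F D H z (2 * n%:R * r) zc.
case: H => [[S [FL DL]] mD sJ qr DM].
have iop := opnorm_lintble n0 DL; have [iD _ _] := DL i j.
(* The slope that a map with Hoelder exponent [a] has at scale [r]. *)
set l := r `^ a / r; have l0 : 0 < l by rewrite divr_gt0// powR_gt0.
have nn : 1 <= n%:R :> R by rewrite ler1n.
have nr0 : 0 < 2 * n%:R * r by rewrite !mulr_gt0// ltr0n.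
have {}G := G nr0 rR.
have [ie e1] := lint_eta_refl z r0; have bc := @eta_bc R n r (fun=> 0%N).
set B := eball z (2 * n%:R * r) in G.
have mB : measurable (B : set T) := @meas_eball R n z _.
have iB := lintble_mul_indic mB iop.
pose q := (l ^+ n.-1)^-1 * (Ce / r ^+ n).
have q0 : 0 <= q by rewrite mulr_ge0 ?invr_ge0 ?exprn_ge0 ?(ltW l0)// divr_ge0 ?exprn_ge0 ?ltW.
have i1 := lintbleZ l ie; have i2 := lintbleZ q iB.
have ic := conv_lintble z bc iD.
apply: (le_trans (lint_abs ic)).
apply: (@le_trans _ _ (lint (fun y => l * eta r (fun=> 0%N) (z - y) + q * (\1_B y * opnorm (jmx D y) ^+ n)))).
  apply: lint_le; [exact: lintble_abs|exact: lintbleD|] => y.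
  have e0 := eta_ge0 (z - y) r0.
  have op0 : 0 <= opnorm (jmx D y) ^+ n by rewrite exprn_ge0// opnorm_ge0.
  rewrite normrM (ger0_norm e0).
  have [yr|yr] := leP `|z - y| r; last first.
    by rewrite eta_supp// mul0r mulr0 add0r mulr_ge0// mulr_ge0//; have /andP[] := indic01 B y.
  have -> : \1_B y = 1 :> R.
    rewrite indicE mem_set// /B /eball /= enormBC; apply: (le_lt_trans (enorm_le_norm _)).
    apply: (@le_lt_trans _ _ (n%:R * r)); first by rewrite ler_wpM2l.
    by rewrite ltr_pM2r// ltr_pMl ?ltr0n// ltr1n.
  have Dop : `|D i j y| ^+ n <= opnorm (jmx D y) ^+ n.
    rewrite lerXn2r ?nnegrE ?opnorm_ge0//.
    by have := opnorm_entry (jmx D y) i j; rewrite mxE.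
  rewrite mul1r; apply: (@le_trans _ _ (eta r (fun=> 0%N) (z - y) * (l + (l ^+ n.-1)^-1 * opnorm (jmx D y) ^+ n))).
    rewrite ler_wpM2l//; apply: (le_trans (young_split n.-1 l0 (normr_ge0 _))).
    by rewrite prednK// lerD2l ler_wpM2l// invr_ge0 exprn_ge0// ltW.
  rewrite mulrDr [l * _]mulrC lerD2l /q; have := HCe r (z - y) r0.
  move: (eta _ _ _) => e eC; rewrite mulrCA -[leRHS]mulrA ler_wpM2l ?invr_ge0 ?exprn_ge0 ?(ltW l0)//.
  by rewrite ler_wpM2r.
rewrite (lintD i1 i2) (lintZ l ie) (lintZ q iB) e1 mulr1 mulrDl mul1r lerD2l.
apply: (@le_trans _ _ (q * (C * (2 * n%:R * (l * r)) ^+ n))).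
  rewrite ler_wpM2l//; apply: (le_trans G); rewrite ler_wpM2l//.
  have two : 1 <= 2 * n%:R :> R by rewrite mulr_ege1// ler1n.
  rewrite lerXn2r ?nnegrE ?powR_ge0//.
    exact: mulr_ge0 (le_trans ler01 two) (mulr_ge0 (ltW l0) (ltW r0)).
  have lr : l * r = r `^ a by rewrite /l divfK// gt_eqF.
  rewrite lr (powRM _ (le_trans ler01 two) (ltW r0)).
  by rewrite ler_wpM2r ?powR_ge0// -[leRHS]powRr1 ?ler_powR// (le_trans ler01).
have := scale_balance n.-1 Ce C (2 * n%:R) (lt0r_neq0 l0) (lt0r_neq0 r0).
by rewrite prednK// /q => ->.
Qed.

End local_estimates.

(** * Convergence of dyadic mollifications *)

Section dyadic_sequences.
Context {R : realType}.

(** Subtracting the geometric tail from the sequence makes it nondecreasing,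
    adding it makes it nonincreasing; the limit lies in between. *)
Lemma geometric_cvg (u : nat -> R) (D q : R) k0 : 0 < q -> q < 1 ->
  (forall k, (k0 <= k)%N -> `|u k - u k.+1| <= D * q ^+ k) ->
  u k @[k --> \oo] --> limn u /\
  forall k, (k0 <= k)%N -> `|u k - limn u| <= D / (1 - q) * q ^+ k.
Proof.
move=> q0 q1 uD; set E := D / (1 - q).
have q1' : 0 < 1 - q by rewrite subr_gt0.
have DE : D = E * (1 - q) by rewrite /E divfK// gt_eqF.
pose v k := u (k + k0)%N - E * q ^+ (k + k0).
pose w k := u (k + k0)%N + E * q ^+ (k + k0).
have vS k : v k <= v k.+1.
  have := uD (k + k0)%N (leq_addl _ _); rewrite /v addSn exprS DE ler_norml => /andP[h1 h2]; lra.
have wS k : w k.+1 <= w k.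
  have := uD (k + k0)%N (leq_addl _ _); rewrite /w addSn exprS DE ler_norml => /andP[h1 h2]; lra.
have D0 : 0 <= E.
  have := le_trans (normr_ge0 _) (uD k0 (leqnn _)).
  by rewrite pmulr_lge0 ?exprn_gt0// => D0; rewrite divr_ge0// ltW.
have vw k : v k <= w k.
  by rewrite /v /w lerD2l ge0_cp// mulr_ge0// exprn_ge0// ltW.
have vmono : {homo v : m l / (m <= l)%N >-> m <= l} by apply: homo_leq => //; exact: le_trans.
have wmono m l : (m <= l)%N -> w l <= w m.
  move=> /subnKC <-; elim: (l - m)%N => [|j IH]; first by rewrite addn0.
  by rewrite addnS; apply: le_trans IH.
have vw' m l : v m <= w l.
  have [ml|/ltnW lm] := leqP m l; first exact: le_trans (vmono _ _ ml) (vw _).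
  exact: le_trans (vw _) (wmono _ _ lm).
have cv : cvgn v.
  by apply: nondecreasing_is_cvgn => //; exists (w 0%N) => _ [k _ <-].
have cE : E * q ^+ (k + k0) @[k --> \oo] --> (0 : R).
  rewrite -[X in _ --> X](mulr0 E); apply: cvgMr.
  rewrite (cvg_shiftn k0 (fun k => q ^+ k)); apply: cvg_expr.
  by rewrite gtr0_norm.
have cu : u (k + k0)%N @[k --> \oo] --> limn v.
  rewrite -[X in _ --> X]addr0 (_ : (fun k => u (k + k0)%N) = (fun k => v k + E * q ^+ (k + k0))).
    by apply: cvgD; [exact: cv|exact: cE].
  by apply/funext => k; rewrite /v subrK.
have {}cu : u k @[k --> \oo] --> limn v by rewrite -(cvg_shiftn k0).
have -> : limn u = limn v by exact: cvg_lim cu.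
split => // k k0k; rewrite -(subnK k0k) ler_norml; apply/andP; split.
  have : limn v <= w (k - k0)%N by apply: limr_le => //; apply: nearW => l; exact: vw'.
  rewrite /w; lra.
have : v (k - k0)%N <= limn v by apply: nondecreasing_cvgn_le.
rewrite /v; lra.
Qed.

Lemma half_powR_lt1 (a : R) : 0 < a -> 2^-1 `^ a < 1 :> R.
Proof.
move=> a0; have : 2^-1 `^ a < 1 `^ a :> R.
  by apply: gt0_ltr_powR => //; rewrite ?nnegrE ?invr_ge0// invf_lt1// ltr1n.
by rewrite powR1.
Qed.

Lemma close_limits (x y u v E p B W : R) : `|x - u| <= E * p -> `|y - v| <= E * p ->
  `|x - y| <= W -> W <= B * p -> `|u - v| <= (2 * E + B) * p.
Proof. rewrite !ler_norml => /andP[? ?] /andP[? ?] /andP[? ?] ?; lra. Qed.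

Lemma two_steps (X x y b' p : R) : 0 <= p -> b' <= p -> `|X - x| <= p / 2 ->
  `|X - y| <= 2 * b' -> `|x - y| <= 3 * p.
Proof. rewrite !ler_norml => ? ? /andP[? ?] /andP[? ?]; lra. Qed.

Lemma rad_powR (a : R) k : (rad k : R) `^ a = ((2^-1) `^ a) ^+ k.
Proof.
by rewrite /rad -exprVn -powR_mulrn ?invr_ge0// powRAC powR_mulrn// powR_ge0.
Qed.

Lemma rad_S k : rad k = 2 * rad k.+1 :> R.
Proof. by rewrite /rad exprS; field; rewrite expf_neq0. Qed.

Lemma rad_le k l : (k <= l)%N -> rad l <= rad k :> R.
Proof.
move=> kl; rewrite /rad lef_pV2 ?posrE ?exprn_gt0//.
by apply: ler_weXn2l => //; rewrite ler1n.
Qed.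

Lemma dyadic_bracket (d : R) k0 : 0 < d -> d <= rad k0 ->
  exists k, [/\ (k0 <= k)%N, d <= rad k & rad k < 2 * d].
Proof.
move=> d0 dk0; have [k1 Hk1] := dya_ex d0.
have ex : exists k, (k0 <= k)%N && (rad k.+1 < d).
  exists (maxn k0 k1); rewrite leq_maxl; apply: Hk1.
  by rewrite (leq_trans (leq_maxr k0 k1)).
case: (ex_minnP ex) => k /andP[k0k kd] mk; exists k; split => //; last first.
  by rewrite rad_S ltr_pM2l.
rewrite leNgt; apply/negP => rk; case: k k0k kd mk rk => [|k] k0k kd mk rk.
  by move: k0k rk; rewrite leqn0 => /eqP E; rewrite -E ltNge dk0.
have [E|k0k'] := eqVneq k0 k.+1; first by move: rk; rewrite -E ltNge dk0.
have := mk k; rewrite rk andbT ltnn -ltnS ltn_neqAle k0k' k0k.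
by move=> /(_ isT).
Qed.

End dyadic_sequences.

Section local_holder.
Context {R : realType} {n : nat}.
Implicit Types (x y z c : 'rV[R]_n).
Local Notation T := (Rmeas R n).
Implicit Types (F : 'I_n -> 'rV[R]_n -> R) (D : 'I_n -> 'I_n -> 'rV[R]_n -> R).

Definition mollim u z : R := limn (fun k => moll (rad k) u z).

(** Mollifying at scale r a function that is smooth at scale s moves it by r
    times its slope; since mollifications commute, two consecutive dyadic
    mollifications differ by a multiple of r^a, and the series converges. *)
Lemma mollim_estimates (K1 K2 a R0 M : R) : (2 <= n)%N -> 0 < K1 -> 0 <= K2 ->
  holder_exponent K1 K2 a -> 0 < R0 ->
  exists k0 E, 0 <= E /\ forall c F D, local_qr K1 K2 R0 M c F D -> forall i,
    [/\ forall z, enorm (z - c) < R0 / 4 -> moll (rad k) (F i) z @[k --> \oo] --> mollim (F i) z,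
      forall k z, (k0 <= k)%N -> enorm (z - c) < R0 / 4 ->
        `|moll (rad k) (F i) z - mollim (F i) z| <= E * (rad k `^ a) &
      forall z z', enorm (z - c) < R0 / 4 -> enorm (z' - c) < R0 / 4 -> `|z - z'| <= rad k0 ->
        `|mollim (F i) z - mollim (F i) z'| <= E * (`|z - z'| `^ a)].
Proof.
move=> n2 K10 K20 aH R00; have n0 : (0 < n)%N := ltnW n2.
have /andP[a0 a1] := holder_exponent_range K10 K20 aH.
have [A A0 HA] := moll_gradient M n2 K10 K20 aH R00.
have nn : 1 <= n%:R :> R by rewrite ler1n.
have n00 : 0 < n%:R :> R by rewrite ltr0n.
have e0 : 0 < R0 / (4 * n%:R) by rewrite divr_gt0// mulr_gt0.
have [k0 Hk0] := dya_ex e0.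
pose q : R := 2^-1 `^ a.
have q0 : 0 < q by rewrite powR_gt0.
have q1 : q < 1 := half_powR_lt1 a0.
pose B := n%:R * A; have B0 : 0 <= B by rewrite mulr_ge0.
pose E1 := 3 * B / (1 - q).
have E10 : 0 <= E1 by rewrite divr_ge0 ?mulr_ge0// subr_ge0 ltW.
exists k0, (2 * (2 * E1 + B)); split; first by rewrite mulr_ge0// addr_ge0// mulr_ge0.
move=> c F D H i; pose h k := moll (rad k) (F i).
have [[S [FL DL]] mD _ _ _] := H; have [iF _ Fs] := FL i.
have ih k : lintble (h k) by have [] := moll_lint (@rad_gt0 R k) iF Fs.
have rk k : (k0 <= k)%N -> n%:R * rad k <= R0 / 4.
  move=> kk; have := ltW (Hk0 k kk); rewrite -/(rad k) ler_pdivlMr ?mulr_gt0//.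
  by move=> hh; rewrite ler_pdivlMr// mulrC mulrA mulrC.
have slope k z y : (k0 <= k)%N -> enorm (z - c) < R0 / 4 -> `|y - z| <= rad k0 ->
    `|h k y - h k z| <= B * (rad k `^ a / rad k) * `|y - z|.
  move=> kk zc; rewrite -{2}(subrKC z y); move: (y - z) => w wk; rewrite /B -[n%:R * A * _]mulrA.
  apply: (C11_mvt (conv_eta_C11 (rad k) (fun=> 0%N) iF)) => t /andP[t0 t1] j.
  have zt : enorm (z + t *: w - c) < R0 / 2.
    rewrite addrAC; apply: (le_lt_trans (enormD _ _)).
    have := enorm_le_norm (t *: w); rewrite normrZ ger0_norm// => h1.
    have h2 : n%:R * (t * `|w|) <= n%:R * rad k0.
      by rewrite ler_pM2l//; apply: le_trans wk; rewrite ler_piMl.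
    have := rk k0 (leqnn _); lra.
  rewrite (mD k _ _ (lt_trans zt _) i j); last by rewrite ltr_pdivrMr//; lra.
    have rr : 2 * n%:R * rad k <= R0 / 2 by have := rk k kk; lra.
    exact: (HA c F D H _ _ i j zt (@rad_gt0 R k) rr).
  have := rk k kk; rewrite -[n.+1%:R]natr1; have := @rad_gt0 R k; have : rad k <= n%:R * rad k :> R.
    by rewrite ler_peMl// ltW// rad_gt0.
  lra.
have avg k l z : (k0 <= k)%N -> (k0 <= l)%N -> enorm (z - c) < R0 / 4 ->
    `|moll (rad l) (h k) z - h k z| <= B * (rad k `^ a / rad k) * rad l.
  move=> kk ll zc; apply: (moll_average (@rad_gt0 R l) (ih k)) => y yl.
  have := slope k z y kk zc; rewrite [`|y - z|]distrC => hs.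
  apply: (le_trans (hs (le_trans yl (@rad_le R _ _ ll)))).
  by rewrite ler_wpM2l// mulr_ge0// divr_ge0 ?powR_ge0// ltW// rad_gt0.
have step k z : (k0 <= k)%N -> enorm (z - c) < R0 / 4 -> `|h k z - h k.+1 z| <= 3 * B * q ^+ k.
  move=> kk zc; have kk' : (k0 <= k.+1)%N by exact: leqW.
  have h1 := avg k k.+1 z kk kk' zc; have h2 := avg k.+1 k z kk' kk zc.
  have cm : moll (rad k.+1) (h k) z = moll (rad k) (h k.+1) z.
    exact: (moll_comm z (@rad_gt0 R _) (@rad_gt0 R _) iF).
  rewrite cm in h1.
  have rp := @rad_gt0 R k.+1.
  have e1 : B * (rad k `^ a / rad k) * rad k.+1 = B * (rad k `^ a) / 2.
    by rewrite (@rad_S R k) in rp *; move: (_ `^ a) => p; field; rewrite gt_eqF.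
  have e2 : B * (rad k.+1 `^ a / rad k.+1) * rad k = 2 * (B * (rad k.+1 `^ a)).
    by rewrite (@rad_S R k); move: (_ `^ a) => p; field; rewrite gt_eqF.
  have mon : B * (rad k.+1 `^ a) <= B * (rad k `^ a).
    apply: (ler_wpM2l B0); apply: (ge0_ler_powR (ltW a0)); rewrite ?nnegrE.
    - exact/ltW/rad_gt0.
    - exact/ltW/rad_gt0.
    - exact: rad_le (leqnSn k).
  rewrite e1 in h1; rewrite e2 in h2; rewrite /q -rad_powR -mulrA.
  exact: two_steps (mulr_ge0 B0 (powR_ge0 _ _)) mon h1 h2.
have lim z (zc : enorm (z - c) < R0 / 4) :=
  @geometric_cvg R (fun k => h k z) (3 * B) q k0 q0 q1 (fun k kk => step k z kk zc).
have app k z : (k0 <= k)%N -> enorm (z - c) < R0 / 4 -> `|h k z - mollim (F i) z| <= E1 * (rad k `^ a).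
  by move=> kk zc; rewrite rad_powR; exact: (lim z zc).2.
split => [z zc|k z kk zc|z z' zc z'c zk].
- exact: (lim z zc).1.
- apply: (le_trans (app k z kk zc)); rewrite ler_wpM2r ?powR_ge0//; lra.
have [->|zz'] := eqVneq z z'.
  by rewrite subrr normr0 mulr_ge0 ?powR_ge0// mulr_ge0// addr_ge0// mulr_ge0.
have d0 : 0 < `|z - z'| by rewrite normr_gt0 subr_eq0.
have [k [kk dk kd]] := dyadic_bracket d0 zk.
have h1 := app k z kk zc; have h2 := app k z' kk z'c.
have h3 := slope k z' z kk z'c zk.
have rp := @rad_gt0 R k.
have h4 : B * (rad k `^ a / rad k) * `|z - z'| <= B * (rad k `^ a).
  by rewrite -mulrA ler_wpM2l// mulrAC ler_pdivrMr// ler_wpM2l// powR_ge0.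
have h5 : rad k `^ a <= 2 * (`|z - z'| `^ a).
  apply: (@le_trans _ _ ((2 * `|z - z'|) `^ a)).
    apply: (ge0_ler_powR (ltW a0)); rewrite ?nnegrE; [exact: ltW rp| |exact: ltW kd].
    exact: mulr_ge0 (ler0n _ _) (ltW d0).
  rewrite (powRM _ (ler0n _ 2) (ltW d0)); apply: (ler_wpM2r (powR_ge0 _ _)).
  rewrite -[leRHS](powRr1 (ler0n _ 2)); apply: ler_powR a1; exact: ler1n.
apply: (le_trans (close_limits h1 h2 h3 h4)).
rewrite [2 * (2 * E1 + B)]mulrC -[leRHS]mulrA; apply: ler_wpM2l h5.
exact: addr_ge0 (mulr_ge0 (ler0n _ 2) E10) B0.
Qed.

(** Mollifications converge in mean to the function itself, which must therefore
    agree with their uniform limit. *)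
Lemma mollim_ae (U : set 'rV[R]_n) (S : R) (u : 'rV[R]_n -> R) :
  measurable (U : set T) -> lintble (\1_U : 'rV[R]_n -> R) -> lintble u -> supp_in S u ->
  (forall z, U z -> moll (rad k) u z @[k --> \oo] --> mollim u z) ->
  (forall e, 0 < e -> exists N, forall k z, (N <= k)%N -> U z -> `|moll (rad k) u z - mollim u z| <= e) ->
  {ae lebm R n, forall x, U x -> u x = mollim u x}.
Proof.
move=> mU iU iu us cu uu.
have L : Lcvg 1 u.
  apply: (moll_Lcvg_pos (ltn0Sn 0) (s := S)); split => //.
  by apply: lintble_ext (lintble_abs iu) => x; rewrite expr1.
pose g x := \1_U x * mollim u x.
have mg : lmeas g.
  apply: (@measurable_fun_cvg _ T R setT (fun k x => \1_U x * moll (rad k) u x) g) => [k|x _].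
    apply: (@measurable_funM _ T R setT (\1_U : T -> R) (moll (rad k) u)); first exact: lmeas_indic mU.
    exact: lmeas_cont (moll_cont (rad k) iu).
  rewrite /g indicE; have [xU|xU] := pselect (U x).
    by rewrite mem_set// mul1r; under eq_fun do rewrite mul1r; exact: cu.
  by rewrite memNset// mul0r; under eq_fun do rewrite mul0r; exact: cvg_cst.
pose w x := \1_U x * u x - g x.
have iUu := lintble_mul_indic mU iu.
have mw : lmeas w by apply: (@measurable_funB _ T R setT (fun x => \1_U x * u x) g (lintble_meas iUu) mg).
have im k : lintble (moll (rad k) u) by have [] := moll_lint (@rad_gt0 R k) iu us.
have wle e k x : (forall z, U z -> `|moll (rad k) u z - mollim u z| <= e) ->
    `|w x| <= `|moll (rad k) u x - u x| ^+ 1 + e * \1_U x.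
  move=> uk; rewrite /w /g -mulrBr indicE expr1; have [xU|xU] := pselect (U x).
    rewrite mem_set// mul1r mulr1; apply: le_trans (lerD (lexx _) (uk x xU)).
    by rewrite [X in _ <= X + _]distrC; exact: ler_distD.
  by rewrite memNset// mul0r normr0 mulr0 addr0.
have ip k e : lintble (fun x => `|moll (rad k) u x - u x| ^+ 1 + e * \1_U x).
  apply: (lintbleD _ (lintbleZ e iU)).
  by apply: lintble_ext (lintble_abs (lintbleB (im k) iu)) => x; rewrite expr1.
have iw : lintble w.
  have [N HN] := uu 1 ltr01.
  by apply: lintble_le mw _ (ip N 1) => x; apply: wle => z; exact: HN.
have w0 : lint (fun x => `|w x|) = 0.
  apply/eqP; rewrite eq_le lint_ge0 ?andbT; last by move=> x; exact: normr_ge0.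
  have key (e : R) : 0 < e -> lint (fun x => `|w x|) <= 0 + (1 + lint (\1_U : 'rV[R]_n -> R)) * e.
    move=> e0; have [N1 HN1] := uu e e0; have [N2 HN2] := L e e0.
    pose k := maxn N1 N2.
    have i1 : lintble (fun x => `|moll (rad k) u x - u x| ^+ 1).
      by apply: lintble_ext (lintble_abs (lintbleB (im k) iu)) => x; rewrite expr1.
    rewrite add0r mulrDl mul1r; apply: (le_trans (lint_le (lintble_abs iw) (ip k e) _)).
      by move=> x; apply: wle => z; apply: HN1; exact: leq_maxl.
    rewrite (lintD i1 (lintbleZ e iU)) (lintZ e iU) [e * _]mulrC lerD2r.
    by apply: HN2; exact: leq_maxr.
  by apply: le_small ltr01 _ => e e0 _; exact: key.
have := @ae_eq_integral_abs _ _ _ (lebm R n) setT measurableT (EFin \o (w : T -> R)).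
case; first by apply/measurable_EFinP; exact: mw.
move=> H _; have /H : (\int[lebm R n]_x `|(EFin \o (w : T -> R)) x| = 0)%E.
  by have := lintE (lintble_abs iw); rewrite w0 => E; exact: (esym E).
case=> A [mA A0 sA]; exists A; split => // x /= xn; apply: sA => /= h; apply: xn => xU.
have := h I; rewrite /w /g indicE mem_set// !mul1r => -[] /eqP.
by rewrite subr_eq0 => /eqP.
Qed.

End local_holder.

(** * Localization of quasiregular maps *)

Section localization.
Context {R : realType} {n : nat}.
Implicit Types (x y z c : 'rV[R]_n).
Local Notation T := (Rmeas R n).
Local Notation mu := (lebm R n).

(** Monotonicity of the integral of nonnegative functions holds without
    measurability, the integral being a supremum over simple functions. *)
Lemma ge0_integral_mono (f g : T -> \bar R) : (forall x, 0 <= f x)%E -> (forall x, f x <= g x)%E ->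
  (\int[mu]_x f x <= \int[mu]_x g x)%E.
Proof.
move=> f0 fg; have g0 x : (0 <= g x)%E by exact: le_trans (f0 x) (fg x).
rewrite (ge0_integralTE mu f0) (ge0_integralTE mu g0); apply: ereal_sup_le => _ [h hf <-].
by exists h => // x; exact: le_trans (hf x) (fg x).
Qed.

Lemma patch_mul (U : set T) (u : 'rV[R]_n -> R) :
  ((fun x : T => (u x)%:E) \_ U) = (fun x : T => (\1_U x * u x)%:E).
Proof.
apply/funext => x; rewrite patchE indicE; case: ifP => _; first by rewrite mul1r.
by rewrite mul0r.
Qed.

Lemma lintble_restrict (K U : set T) (u : 'rV[R]_n -> R) : measurable K -> measurable U ->
  U `<=` K -> mu.-integrable K (fun x : T => (u x)%:E) -> lintble (fun x => \1_U x * u x).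
Proof.
move=> mK mU UK iu; have := integrableS mK mU UK iu.
by move=> /(integrable_mkcond _ mU); rewrite patch_mul.
Qed.

Lemma lintble_dominated (Omega : set T) (u : 'rV[R]_n -> R) (v : 'rV[R]_n -> R) :
  lmeas u -> (forall x, 0 <= v x) -> (forall x, `|u x| <= \1_Omega x * v x) ->
  (\int[mu]_(x in Omega) (v x)%:E < +oo)%E ->
  lintble u /\ forall M : R, (\int[mu]_(x in Omega) (v x)%:E <= M%:E)%E -> lint (fun x => `|u x|) <= M.
Proof.
move=> mu_ v0 uv vfin.
have le : (\int[mu]_x `|(EFin \o (u : T -> R)) x| <= \int[mu]_(x in Omega) (v x)%:E)%E.
  rewrite [leRHS]integral_mkcond patch_mul; apply: ge0_integral_mono => x; first exact: abse_ge0.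
  by rewrite /= lee_fin.
have iu : lintble u.
  by apply/integrableP; split; [apply/measurable_EFinP; exact: mu_|exact: le_lt_trans le vfin].
split => // M vM; rewrite -lee_fin (lintE (lintble_abs iu)); exact: le_trans le vM.
Qed.

Lemma lint_null (A : set T) (u : 'rV[R]_n -> R) : measurable A -> mu A = 0 -> lintble u ->
  lint (fun x => \1_A x * u x) = 0.
Proof.
move=> mA A0 iu; have i1 := lintble_mul_indic mA iu.
apply: EFin_inj; rewrite (lintE i1); transitivity (\int[mu]_x cst 0%E x)%E; last exact: integral0.
apply: ae_eq_integral; [exact: measurableT| |exact: measurable_cst|].
  by apply/measurable_EFinP; exact: (lintble_meas i1).
exists A; split => // x /= xn; apply: contra_notP xn => xA _.
by rewrite indicE memNset// mul0r.
Qed.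

Lemma closed_eball_compact c (r : R) : compact [set x : 'rV[R]_n | enorm (x - c) <= r].
Proof.
apply: bounded_closed_compact.
  exists (enorm c + r); split; first exact: num_real.
  move=> M rM x /= xr; apply: le_trans (ltW rM); apply: (le_trans (norm_le_enorm x)).
  by have := enormB_le x c 0; rewrite !subr0 addrC => /le_trans; apply; rewrite lerD2l.
apply: (@closed_comp _ _ (fun x : 'rV[R]_n => enorm (x - c)) [set t | t <= r]); last exact: closed_le.
move=> x _; apply: (@lip_continuous _ _ R^o _ n%:R) => {}x y.
apply: le_trans (enorm_lip (x - c) (y - c)) _.
by rewrite opprB addrA subrK.
Qed.

Variables (Omega : set 'rV[R]_n) (f : 'rV[R]_n -> 'rV[R]_n) (K1 K2 M : R).
Hypotheses (n2 : (2 <= n)%N) (K20 : 0 <= K2).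
Hypothesis qf : quasiregular K1 K2 Omega f.
Hypothesis fM : (\int[mu]_(x in Omega) (opnorm (weakD Omega f x) ^+ n)%:E = M%:E)%E.
Let n0 : (0 < n)%N := ltnW n2.
Let W := weakD Omega f.

Lemma weakD_is_weak_derivative : is_weak_derivative Omega f W.
Proof. by have [[_ [D wD _]] _ _] := qf; exact: (xgetPex _ (ex_intro _ D wD)). Qed.

(** Cutting off at a ball produces a local model; the exceptional null sets
    are absorbed by replacing the derivative by 0 there. *)
Lemma localize c (R0 : R) : 0 < R0 -> [set x | enorm (x - c) <= 2 * R0] `<=` Omega ->
  exists D, local_qr K1 K2 R0 M c (fun i x => \1_(eball c (2 * R0)) x * f x 0 i) D.
Proof.
move=> R00; set K := [set x | _] => KO; set B := eball c (2 * R0).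
have BK : B `<=` K by move=> x; rewrite /B /eball /K /= => /ltW.
have cK : compact K by exact: closed_eball_compact.
have mK : measurable (K : set T) := measurable_compact cK.
have mB : measurable (B : set T) := @meas_eball R n c _.
have wD := weakD_is_weak_derivative.
have [[fL _] sgn dist] := qf.
have [s [A1 mA1 [A10 sA1]]] : exists s : bool, exists2 A : set T, measurable A &
    mu A = 0 /\ forall x, Omega x -> ~ A x -> 0 <= (-1) ^+ s * \det (W x).
  case: sgn => -[A [mA A0 sA]]; [exists false|exists true]; exists A => //; split => // x xO nA.
    by rewrite expr0 mul1r; apply: contrapT => h; apply: nA; apply: sA => /= /(_ xO).
  by rewrite expr1 mulN1r oppr_ge0; apply: contrapT => h; apply: nA; apply: sA => /= /(_ xO).
have [A2 [mA2 A20 sA2]] := dist.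
pose A := A1 `|` A2; have mA : measurable (A : set T) by exact: measurableU.
have A0 : mu A = 0.
  have A12 : (mu A1 + mu A2 <= 0)%E by rewrite A10 A20 adde0.
  by apply/eqP; rewrite -measure_le0; exact: le_trans (measureU2 mu mA1 mA2) A12.
pose G := B `\` A; have mG : measurable (G : set T) by exact: measurableD.
have GB : G `<=` B by move=> x [].
pose D i j x := \1_G x * W x i j; exists D.
have DE x : jmx D x = if `[< G x >] then W x else 0.
  apply/matrixP => i j; rewrite mxE /D indicE; case: asboolP => xG.
    by rewrite mem_set// mul1r.
  by rewrite memNset// mul0r mxE.
have det_zero : \det (0 : 'M[R]_n) = 0.
  apply/eqP; rewrite -normr_eq0 eq_le normr_ge0 andbT.
  by have := det_opnorm (0 : 'M[R]_n) n0; rewrite opnorm0 expr0n gtn_eqF.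
have iD i j : lintble (D i j).
  have [_ lD _] := wD i j.
  by apply: (lintble_restrict mK mG (subset_trans GB BK)); exact: lD.
have sup (U : set 'rV[R]_n) (u : 'rV[R]_n -> R) : U `<=` B ->
    supp_in (2 * R0 + enorm c) (fun x => \1_U x * u x).
  move=> UB x xb; rewrite indicE memNset ?mul0r// => /UB; rewrite /B /eball /= => xc.
  have := norm_le_enorm x; have := enormB_le x c 0; rewrite !subr0; lra.
have mD : lmeas (fun x => opnorm (jmx D x) ^+ n).
  apply: (@measurable_funX _ T R setT (fun x => opnorm (jmx D x)) n).
  by apply: lmeas_opnorm => i j; exact: (lintble_meas (iD i j)).
have opO x : opnorm (jmx D x) ^+ n <= \1_Omega x * opnorm (W x) ^+ n.
  rewrite DE indicE; case: asboolP => xG.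
    by rewrite mem_set ?mul1r//; exact: KO (BK _ (GB _ xG)).
  by rewrite opnorm0 expr0n gtn_eqF// mulr_ge0// exprn_ge0// opnorm_ge0.
have op0 (Z : 'M[R]_n) : 0 <= opnorm Z ^+ n by rewrite exprn_ge0// opnorm_ge0.
have fin : (\int[mu]_(x in Omega) (opnorm (W x) ^+ n)%:E < +oo)%E by rewrite fM ltry.
split.
- exists (2 * R0 + enorm c); split=> [i|i j].
    have [lf _ _] := wD i i; have [mf ff] := fL i.
    have if1 := lintble_restrict mK mB BK (lf K cK KO).
    split; [exact: if1| |exact: sup].
    apply: (lintble_dominated (Omega := Omega) (v := fun x => `|f x 0 i| `^ n%:R) _ _ _ ff).1.
    + exact: lmeas_pow (lintble_meas if1).
    + by move=> x; exact: powR_ge0.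
    + move=> x; rewrite normrX normr_id powR_mulrn// normrM exprMn.
      have /andP[b0 b1] := indic01 B x; rewrite ger0_norm//.
      rewrite ler_wpM2r ?exprn_ge0// !indicE; case: (boolP (x \in B)) => [|_].
        by rewrite inE => /BK/KO xO; rewrite mem_set// expr1n.
      by rewrite expr0n gtn_eqF.
  split; [exact: iD| |exact: sup].
  apply: (lintble_dominated (Omega := Omega) (v := fun x => opnorm (W x) ^+ n) _ _ _ fin).1.
  + exact: lmeas_pow (lintble_meas (iD i j)).
  + by move=> x; exact: op0.
  + move=> x; rewrite normrX normr_id; apply: le_trans (opO x).
    by rewrite lerXn2r ?nnegrE ?opnorm_ge0//; have := opnorm_entry (jmx D x) i j; rewrite mxE.
- move=> k kR z zc i j; have r0 := @rad_gt0 R k; set r := rad k in kR r0 *.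
  have zB y : `|z - y| <= r -> B y.
    move=> yr; rewrite /B /eball /=; apply: (le_lt_trans (enormB_le y z c)).
    rewrite enormBC; have := enorm_le_norm (z - y).
    have : n%:R * `|z - y| <= n%:R * r by rewrite ler_wpM2l.
    move: kR; rewrite -[n.+1%:R]natr1; lra.
  have tst : test_function Omega (fun y => eta r (fun=> 0%N) (z - y)).
    by apply: eta_test r0 _ => y /= /zB/BK/KO.
  have [lf lD wE] := wD i j; have := wE _ tst.
  have if1 := lintble_restrict mK mB BK (lf K cK KO).
  have iW := lintble_restrict mK mB BK (lD K cK KO).
  have bc1 := @eta_bc R n r (inc (fun=> 0%N) j); have bc0 := @eta_bc R n r (fun=> 0%N).
  have i1 := conv_lintble z bc1 if1; have i2 := conv_lintble z bc0 iW.
  rewrite integral_mkcond [in X in _ = X -> _]integral_mkcond !patch_mul.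
  have out m y : ~ B y -> eta r m (z - y) = 0.
    by move=> yB; apply: (eta_supp m r0); rewrite ltNge; apply/negP => /zB.
  have E1 : (fun x : T => (\1_Omega x * (f x 0 i * partial j (fun y => eta r (fun=> 0%N) (z - y)) x))%:E) =
      (fun x : T => (- (eta r (inc (fun=> 0%N) j) (z - x) * (\1_B x * f x 0 i)))%:E).
    apply/funext => x; rewrite eta_partial; have [xB|xB] := pselect (B x).
      rewrite !indicE !mem_set//; [congr EFin; ring|exact: KO (BK _ xB)].
    by rewrite out// oppr0 !(mulr0, mul0r) oppr0.
  have E2 : (fun x : T => (\1_Omega x * (W x i j * eta r (fun=> 0%N) (z - x)))%:E) =
      (fun x : T => (eta r (fun=> 0%N) (z - x) * (\1_B x * W x i j))%:E).
    apply/funext => x; have [xB|xB] := pselect (B x).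
      rewrite !indicE !mem_set//; [congr EFin; ring|exact: KO (BK _ xB)].
    by rewrite out// !(mulr0, mul0r).
  rewrite E1 E2 -(lintE (lintbleN i1)) -(lintE i2) => -[]; rewrite (lintN i1) => /oppr_inj.
  rewrite /conv => ->; rewrite /moll /conv.
  have i3 := conv_lintble z bc0 (iD i j).
  have E3 : (fun y => eta r (fun=> 0%N) (z - y) * (\1_B y * W y i j)) =
      (fun y => eta r (fun=> 0%N) (z - y) * D i j y + \1_A y * (eta r (fun=> 0%N) (z - y) * (\1_B y * W y i j))).
    apply/funext => y; rewrite /D !indicE; have [yB|yB] := pselect (B y); last first.
      by rewrite out// !(mulr0, mul0r) addr0.
    have [yA|yA] := pselect (A y).
      rewrite (mem_set yB) (mem_set yA) memNset; last by case.
      by rewrite mulr1n mulr0n !(mul1r, mul0r, mulr0, add0r).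
    by rewrite (mem_set yB) (memNset yA) mem_set// mulr1n mulr0n !(mul1r, mul0r) addr0.
  by rewrite [in LHS]E3 (lintD i3 (lintble_mul_indic mA i2)) (lint_null mA A0 i2) addr0.
- have sD x : 0 <= (-1) ^+ s * \det (jmx D x).
    rewrite DE; case: asboolP => [[xB xA]|_].
      by apply: sA1; [exact: KO (BK _ xB)|move=> h; apply: xA; left].
    by rewrite det_zero mulr0.
  by case: (s) sD => sD; [right|left] => x; have := sD x; rewrite ?expr1 ?expr0 ?mulN1r ?oppr_ge0 ?mul1r.
- move=> x; rewrite DE; case: asboolP => [[xB xA]|_].
    apply: contrapT => h; apply: xA; right; apply: sA2 => /= /(_ (KO _ (BK _ xB))); exact: h.
  by rewrite opnorm0 expr0n gtn_eqF// det_zero normr0 mulr0 add0r.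
- rewrite (@lint_ext _ _ _ (fun x => `|opnorm (jmx D x) ^+ n|)); last by move=> x; rewrite ger0_norm.
  apply: (lintble_dominated (Omega := Omega) (v := fun x => opnorm (W x) ^+ n) mD _ _ fin).2.
  + by move=> x; exact: op0.
  + by move=> x; rewrite ger0_norm.
  + by rewrite fM.
Qed.

End localization.

(** * The continuous representative *)

Lemma continuous_dist_at {R : realType} (V W : normedModType R) (g : V -> W) (x : V) :
  (forall d : R, 0 < d -> exists2 r : R, 0 < r & forall z, `|x - z| < r -> `|g x - g z| < d) ->
  {for x, continuous g}.
Proof.
move=> H; apply/cvgrPdist_lt => d /H[r r0 rd]; apply/nbhs_ballP; exists r => // z.
by rewrite -ball_normE; exact: rd.
Qed.

Section representative.
Context {R : realType} {n : nat}.
Implicit Types (x y z c p : 'rV[R]_n) (f g : 'rV[R]_n -> 'rV[R]_n).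
Local Notation mu := (lebm R n).

(** The continuous representative: defined without reference to a ball, since
    mollification at small scales only sees the map near the point. *)
Definition rep f x : 'rV[R]_n := \row_i mollim (fun y => f y 0 i) x.

Lemma enorm_row_le x (B : R) : 0 <= B -> (forall i, `|x 0 i| <= B) -> enorm x <= n%:R * B.
Proof.
by move=> B0 xB; apply: (le_trans (enorm_le_norm x)); rewrite ler_wpM2l// norm_coord_le.
Qed.

(** On the ball the representative is the limit for the cut-off map, so that the
    estimates of the local model transfer, with constants that depend neither on
    the domain nor on the map. *)
Lemma rep_local (K1 K2 a R0 M : R) : (2 <= n)%N -> 0 < K1 -> 0 <= K2 ->
  holder_exponent K1 K2 a -> 0 < R0 ->
  exists e H, [/\ 0 < e, 0 <= H & forall (Omega : set 'rV[R]_n) f,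
    quasiregular K1 K2 Omega f ->
    (\int[mu]_(x in Omega) (opnorm (weakD Omega f x) ^+ n)%:E = M%:E)%E ->
    forall c, [set x | enorm (x - c) <= 2 * R0] `<=` Omega ->
    (forall z z', enorm (z - c) < R0 / 4 -> enorm (z' - c) < R0 / 4 -> enorm (z - z') <= e ->
      enorm (rep f z - rep f z') <= H * (enorm (z - z') `^ a)) /\
    {ae mu, forall x, enorm (x - c) < R0 / 4 -> rep f x = f x}].
Proof.
move=> n2 K10 K20 aH R00; have n0 : (0 < n)%N := ltnW n2.
have /andP[a0 a1] := holder_exponent_range K10 K20 aH.
have [k0 [E [E0 HE]]] := mollim_estimates M n2 K10 K20 aH R00.
exists (rad k0), (n%:R * E); split; [exact: rad_gt0|exact: mulr_ge0|].
move=> Omega f qf fM c KO; have [D LD] := localize n2 K20 qf fM R00 KO.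
set F := fun (i : 'I_n) x => _ in LD.
have [[S [FL _]] _ _ _ _] := LD.
have mollE i z : enorm (z - c) < R0 / 4 -> exists N, forall k, (N <= k)%N ->
    moll (rad k) (F i) z = moll (rad k) (fun y => f y 0 i) z.
  move=> zc; have e0 : 0 < R0 / n%:R by rewrite divr_gt0// ltr0n.
  have [N HN] := dya_ex e0; exists N => k kN; apply: lint_ext => y.
  have [yk|yk] := leP `|z - y| (rad k); last by rewrite eta_supp ?mul0r// rad_gt0.
  rewrite /F indicE mem_set ?mul1r// /eball /=.
  apply: (le_lt_trans (enormB_le y z c)); rewrite enormBC.
  have h1 := enorm_le_norm (z - y).
  have h2 : n%:R * `|z - y| <= n%:R * rad k by rewrite ler_wpM2l.
  have h3 : n%:R * rad k < R0.
    by have := HN k kN; rewrite ltr_pdivlMr ?ltr0n// mulrC.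
  lra.
have limE i z : enorm (z - c) < R0 / 4 -> mollim (fun y => f y 0 i) z = mollim (F i) z.
  move=> zc; have [cv _ _] := HE c F D LD i; have [N HN] := mollE i z zc.
  apply: cvg_lim => //; apply: cvg_trans (cv z zc); apply: near_eq_cvg.
  by exists N => // k /= Nk; exact: HN.
split=> [z z' zc z'c zz'|].
  have h0 : 0 <= E * (enorm (z - z') `^ a) by rewrite mulr_ge0// powR_ge0.
  rewrite -mulrA; apply: enorm_row_le h0 _ => i; rewrite !mxE !limE//.
  have [_ _ ho] := HE c F D LD i.
  apply: (le_trans (ho z z' zc z'c (le_trans (norm_le_enorm _) zz'))).
  rewrite ler_wpM2l//; apply: (ge0_ler_powR (ltW a0)); rewrite ?nnegrE ?enorm_ge0//.
  exact: norm_le_enorm.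
have B1 : lintble (\1_(eball c (R0 / 4)) : 'rV[R]_n -> R).
  apply: lintble_indic; first exact: meas_eball.
  by rewrite leb_eball ?ltry// ltW// divr_gt0.
have aei i : {ae mu, forall x, eball c (R0 / 4) x -> F i x = mollim (F i) x}.
  have [cv ap _] := HE c F D LD i; have [iF _ Fs] := FL i.
  apply: (mollim_ae (meas_eball c (R0 / 4)) B1 iF Fs cv) => e e0.
  have q0 : 0 < (2^-1 `^ a : R) by rewrite powR_gt0.
  have q1 : (2^-1 `^ a : R) < 1 := half_powR_lt1 a0.
  have : E * (2^-1 `^ a) ^+ k @[k --> \oo] --> (0 : R).
    rewrite -[X in _ --> X](mulr0 E); apply: cvgMr; apply: cvg_expr; by rewrite gtr0_norm.
  move=> /cvg_eps/(_ e e0) [N HN]; exists (maxn N k0) => k z kN zc.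
  have kk : (k0 <= k)%N := leq_trans (leq_maxr _ _) kN.
  apply: (le_trans (ap k z kk zc)); rewrite rad_powR.
  have := HN k (leq_trans (leq_maxl _ _) kN); rewrite ?sub0r ?subr0 ?normrN => h.
  by apply: le_trans (ler_norm _) h.
have FF := @ae_filter_ringOfSetsType _ _ _ (lebm R n).
have := @filter_forall _ _ _ _ FF aei.
apply: (@filterS _ _ FF) => x Fx xc; apply/rowP => i; rewrite mxE limE// -Fx// /F indicE mem_set ?mul1r//.
rewrite /eball /=; lra.
Qed.

Lemma holder_continuous_at g x (e H a : R) : 0 < e -> 0 <= H -> 0 < a ->
  (forall z, enorm (x - z) <= e -> enorm (g x - g z) <= H * (enorm (x - z) `^ a)) ->
  {for x, continuous g}.
Proof.
move=> e0 H0 a0 gH; apply: continuous_dist_at => d d0.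
have H1 : 0 < H + 1 by rewrite ltr_wpDl.
pose s := (d / (H + 1)) `^ a^-1; have dH : 0 < d / (H + 1) by rewrite divr_gt0.
have s0 : 0 < s by rewrite powR_gt0.
pose r := Num.min e s; have r0 : 0 < r by rewrite lt_min e0.
have n1 : 0 < n%:R + 1 :> R by rewrite ltr_wpDl.
exists (r / (n%:R + 1)); first by rewrite divr_gt0.
move=> z; rewrite ltr_pdivlMr// => zr.
have xz : enorm (x - z) < r.
  apply: (le_lt_trans (enorm_le_norm _)); apply: le_lt_trans zr.
  by rewrite mulrC ler_wpM2l// lerDl.
apply: (le_lt_trans (norm_le_enorm _)).
have [xe xs] : enorm (x - z) <= e /\ enorm (x - z) <= s.
  by move: (ltW xz); rewrite /r le_min => /andP[].
apply: (le_lt_trans (gH z xe)).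
have h1 : enorm (x - z) `^ a <= d / (H + 1).
  have -> : d / (H + 1) = s `^ a by rewrite /s -powRrM mulVf ?gt_eqF// powRr1// ltW.
  by apply: (ge0_ler_powR (ltW a0)); rewrite ?nnegrE ?enorm_ge0// ltW.
apply: (le_lt_trans (ler_wpM2l H0 h1)); rewrite mulrCA gtr_pMr//.
by rewrite ltr_pdivrMr// mul1r ltrDl.
Qed.

(** Pigeonhole on the cubes of a grid of mesh of order [m]. *)
Lemma separated_finite (rho m : R) : 0 < m -> exists N, forall p : nat -> 'rV[R]_n,
  (forall i, `|p i| <= rho) -> exists i j, [/\ (i < j)%N, (j <= N)%N & enorm (p i - p j) <= m].
Proof.
move=> m0; have n1 : 0 < n%:R + 1 :> R by rewrite ltr_wpDl.
pose s := (n%:R + 1) / m; have s0 : 0 < s by rewrite divr_gt0.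
pose B := Num.truncn (2 * rho * s).
pose code x : {ffun 'I_n -> 'I_B.+1} := [ffun i => inord (Num.truncn ((x 0 i + rho) * s))].
exists #|{ffun 'I_n -> 'I_B.+1}| => p pr; set N := #|_|.
pose h (i : 'I_N.+1) := code (p i).
have : ~~ injectiveb h.
  by apply/negP => /injectiveP/leq_card; rewrite card_ord ltnn.
case/injectivePn => i [j ij hij].
have cl (k l : 'I_N.+1) : h k = h l -> enorm (p k - p l) <= m.
  move=> kl; apply: le_trans (_ : n%:R * s^-1 <= m); last first.
    by rewrite /s invf_div mulrA ler_pdivrMr// mulrC mulrDr mulr1 lerDl ltW.
  apply: enorm_row_le => [|i0]; first by rewrite invr_ge0 ltW.
  have co (q : 'I_N.+1) : 0 <= p q 0 i0 + rho /\ (p q 0 i0 + rho) * s <= 2 * rho * s.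
    have := le_trans (coord_norm (p q) i0) (pr q); rewrite ler_norml => /andP[h1 h2].
    by split; [lra|rewrite ler_wpM2r ?(ltW s0)//; lra].
  have tB (q : 'I_N.+1) : (Num.truncn ((p q 0%R i0 + rho) * s)%R < B.+1)%N.
    by rewrite ltnS; apply: le_truncn; exact: (co q).2.
  have : Num.truncn ((p k 0 i0 + rho) * s) = Num.truncn ((p l 0 i0 + rho) * s).
    by move: kl => /ffunP/(_ i0); rewrite !ffunE => /(congr1 val) /=; rewrite !inordK.
  move=> E; have tk := truncn_itv (mulr_ge0 (co k).1 (ltW s0)).
  have tl := truncn_itv (mulr_ge0 (co l).1 (ltW s0)).
  rewrite E in tk; move: (Num.truncn _) tk tl => t /andP[k1 k2] /andP[l1 l2].
  rewrite !mxE -[leLHS](mulfK (lt0r_neq0 s0)) ler_pdivrMr// mulVf ?gt_eqF//.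
  rewrite -[X in _ * X](ger0_norm (ltW s0)) -normrM ler_norml; rewrite -natr1 in k2 l2; lra.
have [lt|lt|E] := ltngtP i j.
- exists i, j; split; [exact: lt|by rewrite -ltnS; exact: ltn_ord|exact: cl hij].
- exists j, i; split; [exact: lt|by rewrite -ltnS; exact: ltn_ord|exact: cl (esym hij)].
- by move: ij; rewrite -val_eqE /= E eqxx.
Qed.

(** A continuous map that moves m-close points by at most w oscillates by at
    most N w on a connected set without N + 1 points that are m-separated:
    along equally spaced intermediate values of the distance to g x one would
    find too many separated points. *)
Lemma connected_oscillation (C : set 'rV[R]_n) g (m w rho : R) N x y :
  (forall p : nat -> 'rV[R]_n, (forall i, `|p i| <= rho) ->
    exists i j, [/\ (i < j)%N, (j <= N)%N & enorm (p i - p j) <= m]) ->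
  connected C -> (forall p, C p -> {for p, continuous g}) -> (forall p, C p -> `|p| <= rho) ->
  (forall p q, C p -> C q -> enorm (p - q) <= m -> enorm (g p - g q) <= w) ->
  C x -> C y -> enorm (g x - g y) <= N%:R * w.
Proof.
move=> HN cC cg Cr gw Cx Cy; pose phi p := enorm (g p - g x).
have N0 : (0 < N)%N.
  have [i [j [ij jN _]]] := HN (fun=> x) (fun=> Cr x Cx).
  exact: leq_trans (leq_ltn_trans (leq0n i) ij) jN.
have NR : 0 < N%:R :> R by rewrite ltr0n.
rewrite leNgt; apply/negP => Nw; pose w' := enorm (g x - g y) / N%:R.
have ww' : w < w' by rewrite ltr_pdivlMr// mulrC.
have w'0 : 0 <= w' by rewrite divr_ge0// enorm_ge0.
have cphi : {within C, continuous phi}.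
  apply: continuous_in_subspaceT => p; rewrite inE => Cp.
  apply: (@continuous_comp _ _ _ g (fun u => enorm (u - g x))); first exact: cg.
  apply: (@lip_continuous _ _ R^o _ n%:R) => u v; apply: (le_trans (enorm_lip _ _)).
  by rewrite opprB addrA subrK.
have ival := (connected_intervalP _).1 (connected_continuous_connected cC cphi).
have pt j : exists p, C p /\ ((j <= N)%N -> phi p = j%:R * w').
  have [jN|Nj] := leqP j N; last by exists x.
  have [p Cp E] : (phi @` C) (j%:R * w').
    apply: (ival (phi x) (phi y)); [by exists x|by exists y|].
    rewrite /phi subrr enorm0 mulr_ge0//= enormBC /w' mulrCA ler_piMr ?enorm_ge0//.
    by rewrite ler_pdivrMr// mul1r ler_nat.
  by exists p.
have [p Hp] := choice pt.
have [i [j [ij jN pm]]] := HN p (fun i => Cr _ (Hp i).1).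
have := gw _ _ (Hp i).1 (Hp j).1 pm.
have := (Hp j).2 jN; have := (Hp i).2 (leq_trans (ltnW ij) jN); rewrite /phi => Ei Ej h.
have := enormB_le (g (p j)) (g (p i)) (g x); rewrite Ei Ej => h2.
have : i%:R * w' + w' <= j%:R * w'.
  by rewrite -[X in _ + X]mul1r -mulrDl natr1 ler_wpM2r// ler_nat.
have := enormBC (g (p j)) (g (p i)); lra.
Qed.

End representative.

(** * Estimates on the domain *)

Section domain_geometry.
Context {R : realType} {n : nat}.
Implicit Types (x y z c p q : 'rV[R]_n) (V Omega : set 'rV[R]_n).

Definition seg x y : set 'rV[R]_n := (fun t : R => x + t *: (y - x)) @` `[0, 1].

Lemma seg_connected x y : connected (seg x y).
Proof.
apply: connected_continuous_connected; first exact: segment_connected.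
apply: continuous_subspaceT; apply: (@lip_continuous _ R^o _ _ `|y - x|) => s t.
by rewrite opprD addrACA subrr add0r -scalerBl normrZ mulrC.
Qed.

Lemma seg_l x y : seg x y x.
Proof. by exists 0; rewrite ?scale0r ?addr0//= in_itv/= lexx ler01. Qed.

Lemma seg_r x y : seg x y y.
Proof. by exists 1; rewrite ?scale1r ?subrKC//= in_itv/= ler01 lexx. Qed.

(** A ball about a point of V that is smaller than the distance to the
    boundary stays inside: a segment leaving an open set crosses its
    boundary. *)
Lemma dist_boundary_ball V Omega x y : open Omega -> Omega x -> V x ->
  ((enorm (y - x))%:E < dist_set V (boundary Omega))%E -> Omega y.
Proof.
move=> oO Ox Vx yd; apply: contrapT => nOy.
have [[p [sp bp]]|nb] := pselect (exists p, seg x y p /\ boundary Omega p).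
  move: yd; rewrite ltNge => /negP; apply.
  apply: (@le_trans _ _ (enorm (x - p))%:E).
    by apply: ereal_inf_lbound; exists x, p.
  case: sp => t /=; rewrite in_itv/= => /andP[t0 t1] <-.
  by rewrite lee_fin opprD addrA subrr add0r enormN enormZ ger0_norm// ler_piMl// enorm_ge0.
have E : seg x y `&` Omega = seg x y `&` closure Omega.
  apply/seteqP; split => p [sp Op]; split => //; first exact: subset_closure.
  apply: contrapT => nOp; apply: nb; exists p; split; [exact: sp|split; [exact: Op|]].
  by move=> h; exact: nOp (interior_subset h).
have B0 : (seg x y `&` Omega) !=set0 by exists x; split; [exact: seg_l|].
have Bo : exists2 C, open C & seg x y `&` Omega = seg x y `&` C by exists Omega.
have Bc : exists2 C, closed C & seg x y `&` Omega = seg x y `&` C.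
  by exists (closure Omega); [exact: closed_closure|].
have := seg_r x y; rewrite -(@seg_connected x y _ B0 Bo Bc) => -[_]; exact: nOy.
Qed.

Lemma dist_boundary_gt0 V Omega : open Omega -> strictly_inside V Omega ->
  (0 < dist_set V (boundary Omega))%E.
Proof.
move=> oO [cV VO]; have [N HN] := thick_open cV oO VO.
apply: (@lt_le_trans _ _ (rad N)%:E); first by rewrite lte_fin rad_gt0.
apply: le_ereal_inf_tmp => _ [x [y [Vx [_ nOy] ->]]]; rewrite lee_fin leNgt; apply/negP => h.
apply: nOy; apply: open_nbhs_nbhs; split; first exact: oO.
apply: (HN N (leqnn N)); exists x; first exact: subset_closure.
by apply: le_trans (norm_le_enorm _) _; rewrite enormBC ltW.
Qed.

Lemma open_closed_eball Omega x : open Omega -> Omega x ->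
  exists2 e : R, 0 < e & [set y | enorm (y - x) <= e] `<=` Omega.
Proof.
move=> oO Ox; have /nbhs_ballP[e /= e0 eO] : nbhs x Omega by exact: open_nbhs_nbhs.
exists (e / 2); first by rewrite divr_gt0.
move=> y /= yx; apply: eO; rewrite -ball_normE /= distrC.
apply: (le_lt_trans (norm_le_enorm _)); apply: (le_lt_trans yx).
by rewrite ltr_pdivrMr//; lra.
Qed.

End domain_geometry.

Section holder_estimates.
Context {R : realType} {n : nat}.
Implicit Types (x y z c p q : 'rV[R]_n) (V Omega : set 'rV[R]_n) (f g : 'rV[R]_n -> 'rV[R]_n).
Local Notation T := (Rmeas R n).
Local Notation mu := (lebm R n).

Variables (K1 K2 a : R).
Hypotheses (n2 : (2 <= n)%N) (K10 : 0 < K1) (K20 : 0 <= K2) (aH : holder_exponent K1 K2 a).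

Definition qr_energy Omega f (M : R) := quasiregular K1 K2 Omega f /\
  (\int[mu]_(x in Omega) (opnorm (weakD Omega f x) ^+ n)%:E = M%:E)%E.

Let a01 : 0 < a <= 1 := holder_exponent_range K10 K20 aH.

Lemma powR_enorm_mono (s : R) x : 0 <= s -> s <= enorm x -> s `^ a <= enorm x `^ a.
Proof.
move=> s0 sx; have /andP[a0 _] := a01.
by apply: (ge0_ler_powR (ltW a0)); rewrite ?nnegrE ?enorm_ge0.
Qed.

Lemma ereal_half_lt (d : \bar R) (u v s : R) : 0 < s -> ((2 * u)%:E < d)%E -> (s%:E <= d)%E ->
  v <= s / 4 + u -> (v%:E < d)%E.
Proof.
move=> s0; case: d => [r| |] //; last by move=> _ _ _; rewrite ltry.
by rewrite !lte_fin lee_fin => h1 h2 h3; lra.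
Qed.

(** The local estimate, with the same constants at all points whose distance
    to the complement of the domain is at least s. *)
Lemma rep_uniform (s M : R) : 0 < s -> exists m H, [/\ 0 < m, 0 <= H &
  forall Omega f, qr_energy Omega f M -> forall c, [set x | enorm (x - c) <= s] `<=` Omega ->
  [/\ forall z, enorm (c - z) <= m -> enorm (rep f c - rep f z) <= H * (enorm (c - z) `^ a),
    {for c, continuous (rep f)} &
    {ae mu, forall x, enorm (x - c) < s / 8 -> rep f x = f x}]].
Proof.
move=> s0; have /andP[a0 _] := a01.
have R00 : 0 < s / 2 by rewrite divr_gt0.
have [e [H [e0 H0 HH]]] := rep_local M n2 K10 K20 aH R00.
exists (Num.min e (s / 16)), H; have m0 : 0 < Num.min e (s / 16) by rewrite lt_min e0 divr_gt0.
split => // Omega f [qf fM] c cO.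
have cO2 : [set x | enorm (x - c) <= 2 * (s / 2)] `<=` Omega.
  by rewrite mulrC divfK ?pnatr_eq0.
have [ho ae] := HH Omega f qf fM c cO2.
have ho' z : enorm (c - z) <= Num.min e (s / 16) ->
    enorm (rep f c - rep f z) <= H * (enorm (c - z) `^ a).
  rewrite le_min => /andP[ze zs]; apply: ho => //.
    by rewrite subrr enorm0 !divr_gt0.
  by rewrite enormBC; apply: (le_lt_trans zs); rewrite ltr_pdivrMr//; lra.
split => //; first exact: holder_continuous_at m0 H0 a0 ho'.
by rewrite (_ : s / 8 = s / 2 / 4)//; field.
Qed.

(** Nearby points are controlled by the local estimate, distant ones by
    boundedness on the compact set. *)
Lemma rep_compact_holder Omega f (M : R) : open Omega -> qr_energy Omega f M ->
  locally_holder Omega a (rep f).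
Proof.
move=> oO fM V cV VO; have [N HN] := thick_open cV oO VO.
have [m [H [m0 H0 HH]]] := rep_uniform M (@rad_gt0 R N).
have VH c : V c -> [set x | enorm (x - c) <= rad N] `<=` Omega.
  move=> Vc x /= xc; apply: (HN N (leqnn N)); exists c => //.
  exact: le_trans (norm_le_enorm _) xc.
have cg : {within V, continuous (rep f)}.
  by apply: continuous_in_subspaceT => c; rewrite inE => /VH/(HH _ _ fM)[].
have [B [Br HB]] := compact_bounded (continuous_compact cg cV).
have gB x : V x -> `|rep f x| <= `|B| + 1.
  move=> Vx; apply: (HB (`|B| + 1)); last by exists x.
  by apply: (le_lt_trans (ler_norm B)); rewrite ltrDl.
pose S := n%:R * (2 * (`|B| + 1)).
have S0 : 0 <= S by rewrite !mulr_ge0// addr_ge0.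
have ma : 0 < m `^ a by rewrite powR_gt0.
exists (H + S / m `^ a); first by rewrite addr_ge0// divr_ge0// ltW.
move=> x y Vx Vy; rewrite mulrDl; have p0 := powR_ge0 (enorm (x - y)) a.
have [xy|xy] := leP (enorm (x - y)) m.
  have [ho _ _] := HH _ _ fM x (VH x Vx).
  by apply: (le_trans (ho y xy)); rewrite lerDl mulr_ge0// divr_ge0// ltW.
apply: (@le_trans _ _ S).
  apply: (le_trans (enorm_le_norm _)); rewrite ler_wpM2l//.
  apply: (le_trans (ler_normB _ _)); rewrite mulr_natl mulr2n; exact: lerD (gB x Vx) (gB y Vy).
rewrite -[leLHS]add0r lerD ?mulr_ge0// mulrAC ler_pdivlMr// ler_wpM2l//.
by apply: powR_enorm_mono (ltW m0) (ltW xy).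
Qed.

(** Countably many good balls cover the domain. *)
Lemma rep_ae Omega f (M : R) : open Omega -> qr_energy Omega f M ->
  ae_on Omega (fun x => rep f x = f x).
Proof.
move=> oO fM; pose s k : R := 8 * (n%:R + 1) * rad k.
have n1 : 0 < n%:R + 1 :> R by rewrite ltr_wpDl.
have s0 k : 0 < s k by rewrite !mulr_gt0// rad_gt0.
pose good (w : nat * 'rV[int]_n) : set 'rV[R]_n :=
  [set c | dya_of w.1 c = w.2 /\ [set x | enorm (x - c) <= s w.1] `<=` Omega].
pose bad w : set T := [set x | exists c, [/\ c = xget 0 (good w), good w c,
  enorm (x - c) < s w.1 / 8 & rep f x <> f x]].
have bad0 w : mu.-negligible (bad w).
  have [[c0 gc0]|ng] := pselect (exists c, good w c).
    have gx := @xgetPex _ 0 (good w) (ex_intro _ c0 gc0).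
    have [m [H [_ _ HH]]] := rep_uniform M (s0 w.1).
    have [_ _] := HH _ _ fM _ gx.2.
    apply: negligibleS => x [c [-> _ xc nx]] /= h; exact: nx (h xc).
  by apply: (negligibleS _ (negligible_set0 mu)) => x [c [_ gc _ _]]; apply: ng; exists c.
pose F (j : nat) : set T := if unpickle j is Some w then bad w else set0.
have FN : mu.-negligible (\bigcup_j F j).
  apply: negligible_bigcup => j; rewrite /F; case: unpickle => [w|]; first exact: bad0.
  exact: negligible_set0.
apply: negligibleS FN => x /= nx.
have [Ox nfx] : Omega x /\ rep f x <> f x.
  by split; [apply: contrapT => h; apply: nx|move=> h; apply: nx].
have [e e0 eO] := open_closed_eball oO Ox.
have ek : 0 < e / (8 * (n%:R + 1)) by rewrite divr_gt0// mulr_gt0.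
have [k0 Hk] := dya_ex ek; have sk : s k0 <= e.
  by have := ltW (Hk k0 (leqnn _)); rewrite ler_pdivlMr ?mulr_gt0// mulrC.
pose w := (k0, dya_of k0 x); exists (pickle w) => //; rewrite /F pickleK.
have gx : good w x by split => // y /= yx; apply: eO; exact: le_trans yx sk.
have gc := @xgetPex _ 0 (good w) (ex_intro _ x gx).
exists (xget 0 (good w)); split => //.
have -> : s w.1 / 8 = (n%:R + 1) * rad k0 by rewrite /s /=; field.
apply: (@le_lt_trans _ _ (n%:R * rad k0)); last by rewrite ltr_pM2r ?rad_gt0// ltrDl.
apply: enorm_row_le => [|i]; first by rewrite ltW// rad_gt0.
rewrite !mxE ltW//; apply: dya_close; by rewrite gc.1.
Qed.

(** Nearby points are controlled by the local estimate.  Distant ones are joined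
    by a connected set, a component of V or a segment, along which the local
    estimate holds uniformly; the oscillation on it is bounded by a number of
    separated points that depends only on the size of V and on the mesh. *)
Lemma rep_quantitative V (d : \bar R) (M : R) : exists L : R, forall Omega f,
  open Omega -> qr_energy Omega f M -> strictly_inside V Omega ->
  d = dist_set V (boundary Omega) -> forall x y, V x -> V y -> linked V d x y ->
  enorm (rep f x - rep f y) <= L * (enorm (x - y) `^ a).
Proof.
have [[rho Vr]|nV] := pselect (exists rho, forall x, V x -> `|x| <= rho); last first.
  exists 0 => Omega f _ _ [cV _]; exfalso; apply: nV.
  have [B [_ HB]] := compact_bounded cV; exists (`|B| + 1) => x Vx; apply: (HB (`|B| + 1)).
    by apply: (le_lt_trans (ler_norm B)); rewrite ltrDl.
  exact: subset_closure.
have [d0|d0] := ltP 0%E d; last first.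
  exists 0 => Omega f oO _ sV dE; exfalso.
  by have := dist_boundary_gt0 oO sV; rewrite -dE ltNge d0.
have [s [s0 sd]] : exists s : R, 0 < s /\ (s%:E <= d)%E.
  case: d d0 => [r| |] // d0; last by exists 1; split; rewrite ?leey.
  by exists r; rewrite -lte_fin.
have s4 : 0 < s / 4 by rewrite divr_gt0.
have [m [H [m0 H0 HH]]] := rep_uniform M s4.
have [N HN] := @separated_finite R n rho m m0.
have ma : 0 < m `^ a by rewrite powR_gt0.
pose w := H * m `^ a; have w0 : 0 <= w by rewrite mulr_ge0// ltW.
exists (H + N%:R * w / m `^ a) => Omega f oO fM sV dE x y Vx Vy lxy.
(* Half the distance to the boundary: the points of a segment shorter than [d]
   are within this distance of one of its ends. *)
pose U p := exists2 z, V z & ((2 * enorm (p - z))%:E < d)%E.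
have VO z : V z -> Omega z by move=> Vz; apply: sV.2; exact: subset_closure.
have UO p : U p -> [set q | enorm (q - p) <= s / 4] `<=` Omega.
  move=> [z Vz pz] q /= qp; apply: (dist_boundary_ball oO (VO z Vz) Vz); rewrite -dE.
  exact: ereal_half_lt s0 pz sd (le_trans (enormB_le q p z) (lerD qp (lexx _))).
have VU z : V z -> U z by move=> Vz; exists z => //; rewrite subrr enorm0 mulr0.
have p0 := powR_ge0 (enorm (x - y)) a.
have q0 : 0 <= N%:R * w / m `^ a by rewrite divr_ge0 ?mulr_ge0// ltW.
rewrite mulrDl; have [xy|xy] := leP (enorm (x - y)) m.
  have [ho _ _] := HH _ _ fM x (UO x (VU x Vx)).
  by apply: (le_trans (ho y xy)); rewrite lerDl mulr_ge0.
have [C [cC CU Cr Cx Cy]] : exists C : set 'rV[R]_n,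
    [/\ connected C, C `<=` U, forall p, C p -> `|p| <= rho, C x & C y].
  case: lxy => [cxy|xyd].
    exists (connected_component V x); split.
    - exact: component_connected.
    - by move=> p /(@connected_component_sub _ V x) /VU.
    - by move=> p /(@connected_component_sub _ V x) /Vr.
    - exact: connected_component_refl.
    - exact: cxy.
  exists (seg x y); split; [exact: seg_connected| | |exact: seg_l|exact: seg_r].
    move=> p [t t01 <-]; move: t01; rewrite /= in_itv /= => /andP[t0 t1].
    have xye := enorm_ge0 (x - y).
    have [t2|t2] := leP t 2^-1.
      exists x => //; rewrite addrAC subrr add0r enormZ ger0_norm// enormBC.
      apply: le_lt_trans xyd; rewrite lee_fin mulrA ler_piMl//.
      by rewrite mulrC -ler_pdivlMr// mul1r.
    exists y => //; rewrite (_ : x + t *: (y - x) - y = (1 - t) *: (x - y)); last first.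
      by apply/rowP => j; rewrite !mxE; ring.
    rewrite enormZ ger0_norm ?subr_ge0//; apply: le_lt_trans xyd; rewrite lee_fin mulrA ler_piMl//.
    by rewrite mulrC -ler_pdivlMr// mul1r; lra.
  move=> p [t t01 <-]; move: t01; rewrite /= in_itv /= => /andP[t0 t1].
  rewrite (_ : x + t *: (y - x) = (1 - t) *: x + t *: y); last first.
    by apply/rowP => j; rewrite !mxE; ring.
  apply: (le_trans (ler_normD _ _)); rewrite !normrZ (ger0_norm t0) ger0_norm ?subr_ge0//.
  have t1' : 0 <= 1 - t by rewrite subr_ge0.
  have := ler_wpM2l t0 (Vr y Vy); have := ler_wpM2l t1' (Vr x Vx); lra.
apply: (@le_trans _ _ (N%:R * w)).
  apply: (connected_oscillation HN cC _ Cr _ Cx Cy) => [p /CU/UO/(HH _ _ fM)[]//|p q Cp Cq pq].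
  have [ho _ _] := HH _ _ fM p (UO p (CU p Cp)).
  apply: (le_trans (ho q pq)); rewrite /w ler_wpM2l//.
  by have /andP[a0 _] := a01; apply: (ge0_ler_powR (ltW a0)); rewrite ?nnegrE ?enorm_ge0// ltW.
have Nw0 : 0 <= N%:R * w := mulr_ge0 (ler0n _ _) w0.
rewrite -[leLHS]add0r; apply: lerD; first exact: mulr_ge0.
rewrite [leRHS]mulrAC ler_pdivlMr//; apply: (ler_wpM2l Nw0).
exact: powR_enorm_mono (ltW m0) (ltW xy).
Qed.

End holder_estimates.

Theorem theorem1p1 (R : realType) (n : nat) (K1 K2 alpha : R) :
  (2 <= n)%N -> 0 < K1 -> 0 <= K2 -> holder_exponent K1 K2 alpha ->
  exists L : set 'rV[R]_n -> \bar R -> R -> R,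
  forall (Omega : set 'rV[R]_n) (f : 'rV[R]_n -> 'rV[R]_n) (M : R),
    open Omega -> quasiregular K1 K2 Omega f ->
    (\int[lebm R n]_(x in Omega) (opnorm (weakD Omega f x) ^+ n)%:E = M%:E)%E ->
  exists g : 'rV[R]_n -> 'rV[R]_n,
    [/\ forall x, Omega x -> {for x, continuous g},
        ae_on Omega (fun x => g x = f x),
        locally_holder Omega alpha g &
        forall V, strictly_inside V Omega ->
          holder_on V alpha g /\
          forall x y, V x -> V y -> linked V (dist_set V (boundary Omega)) x y ->
            enorm (g x - g y) <=
              L V (dist_set V (boundary Omega)) M * enorm (x - y) `^ alpha].
Proof.
move=> n2 K10 K20 aH; have Q := rep_quantitative n2 K10 K20 aH.
exists (fun V d M => sval (cid (Q V d M))) => Omega f M oO qf fM; exists (rep f).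
have qM : qr_energy K1 K2 Omega f M by [].
have lH := rep_compact_holder n2 K10 K20 aH oO qM.
split.
- move=> x Ox; have [e e0 eO] := open_closed_eball oO Ox.
  have [m [H [_ _ HH]]] := rep_uniform n2 K10 K20 aH M e0.
  by have [_ cx _] := HH _ _ qM x eO.
- exact: (@rep_ae R n K1 K2 alpha n2 K10 K20 aH Omega f M oO qM).
- exact: lH.
move=> V sV; split.
  have [B B0 HB] := lH (closure V) sV.1 sV.2; exists B => // x y Vx Vy.
  by apply: HB; exact: subset_closure.
exact: (svalP (cid (Q V _ M)) Omega f oO qM sV erefl).
Qed.
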